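(* Let $X\colon[0,T]\times\Omega\to\mathbb R^d$ be a stochastic process satisfying Conditions (i)–(iii) of the context, with $p<2$ and polyradius $R$, and let $f=(f_1,\ldots,f_d)\colon\mathbb R^d\to\mathbb R^d$ be such that each $f_k$ extends to an entire function with $|f_k(z)|\le C\exp(r\cdot|z|)$ for all $z\in\mathbb C^d$, for some $C>0$ and $r<R$. Then for all $0\le s<t\le T$ the limit defining the Wick integral $$\int_s^tf_j(X_u)\diamond dX^j_u=\lim_{m\to\infty}\sum_{[u,v]\in\pi_m}f_j(X_u)\diamond X^j_{u,v}$$ exists a.s. (along an arbitrary sequence of partitions $\pi_m$ of $[s,t]$ with vanishing mesh), and $$\int_s^tf_j(X_u)\diamond dX^j_u=\int_s^tf_j(X_u)\,dX^j_u-\sum_{I\ne\varnothing}\frac1{I!}\int_s^t\partial_If_j(X_u)\,\kappa^{I,j}(u,\ldots,u,du),$$ where the first integral on the right is a Young integral, the integrals in the series are Riemann–Stieltjes integrals, and the series is absolutely summable in $L^1$. Moreover, if $e^{\sigma\cdot\|X\|_\infty}\in L^1$ for some $\sigma>r$ and if $\|X\|_{p\text{-var}}$ has moments of all orders, then the Wick integral exists as a limit in $L^1$. If additionally $\mathbb EX_t=0$ for all $t$, then $$\mathbb E\int_s^tf_j(X)\diamond dX^j=0,\qquad \mathbb E\int_s^tf_j(X)\,dX^j=\sum_{I\ne\varnothing}\frac1{I!}\int_s^t\mathbb E[\partial_If_j(X_u)]\,\kappa^{I,j}(u,\ldots,u,du).$$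
   Context: Repeated up–down indices ($j$) are summed from $1$ to $d$. $X_{u,v}=X_v-X_u$. Inequalities of vectors are entrywise, $|z|=(|z_1|,\ldots,|z_d|)$ in expressions like $r\cdot|z|$, $\|X\|_\infty=(\sup_t|X^1_t|,\ldots,\sup_t|X^d_t|)$, and $\|X\|_{p\text{-var}}$ is the $p$-variation seminorm on $[0,T]$. For $R\in(0,\infty]^d$, $D_R=\{\theta\in\mathbb C^d:|\theta_i|<R_i\ \forall i\}$. Conditions on $X$: (i) $X$ is a.s. continuous and of bounded $p$-variation for some $p<2$. (ii) Let $\mathcal M_{s,t}(z,w)=\mathbb Ee^{z\cdot X_s+w\cdot X_t}$ and $\mathcal K_{s,t}=\log\mathcal M_{s,t}$. There is a polyradius $R>0$ such that $\mathcal K_{s,t}$ is holomorphic on $D_R\times D_R$ (i.e. $\mathcal M_{s,t}$ is defined, with all the required exponential moments finite, and non-vanishing there), $\partial_t\mathcal K_{s,t}(z,w)$ exists for all $t\in[0,T]$, is continuous in the four variables $(s,t,z,w)$, and $\sup_{s,t\in[0,T],\,z,w\in D_R}|\partial_t\mathcal K_{s,t}(z,w)|<\infty$. (iii) For any $t\in(0,T]$ there is an open $U\subset\mathbb R^d$ with $\mathbb P[X_t\in U]>0$ such that $X_t$ has a density on $U$. Wick products: for a random vector $(Z,Y)$ in $\mathbb R^d\times\mathbb R$, with moment-generating function $\mathcal M$ holomorphic and non-zero near $0$, the Appell polynomials $(x,y)^{\diamond(I,k)}$ ($I\in\mathbb N_0^d$, $k\in\mathbb N_0$) are defined by $e^{\xi\cdot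 x+\eta y}/\mathcal M(\xi,\eta)=\sum_{I,k}(x,y)^{\diamond(I,k)}\frac{\xi^I\eta^k}{I!k!}$. For an entire function $h$ on $\mathbb C^d$ with $|h(z)|\le C\exp(r\cdot|z|)$ for all $z\in\mathbb C^d$, for some $C>0$ and $r<R$ ($R$ being the polyradius in (ii)), with $a_I=\mathbb E[\partial_Ih(Z)]$ one has $h(x)=\sum_Ia_I(x,y)^{\diamond(I,0)}/I!$, and the Wick product is $h(x)\diamond y=\sum_I\frac{a_I}{I!}\bigl((x,y)^{\diamond(I,1)}+\mathbb E[Y]\,(x,y)^{\diamond(I,0)}\bigr)$, an absolutely convergent series; $h(Z)\diamond Y$ is its evaluation at $(x,y)=(Z,Y)$. In the Riemann sums this is used with $(Z,Y)=(X_u,X^j_{u,v})$. Cumulants: $I$ ranges over multiindices in $\mathbb N_0^d$, identified with finite multisets $\{i_1,\ldots,i_n\}$ of elements of $\{1,\ldots,d\}$ ($\varnothing$ is the zero multiindex), $I!=I_1!\cdots I_d!$, $\partial_I=\partial_1^{I_1}\cdots\partial_d^{I_d}$, and $\kappa^{I,j}(u,\ldots,u,du):=\partial_v\,\kappa[X^{i_1}_u,\ldots,X^{i_n}_u,X^j_v]\big|_{v=u}\,du$, where $\kappa[\cdots]$ denotes joint cumulants. *)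

(* Defs.v *)
From HB Require Import structures.
From mathcomp Require Import all_boot all_order all_algebra finmap.
From mathcomp Require Import complex.
From mathcomp Require Import all_classical all_reals all_analysis.
From mathcomp Require Import analysis.showcase.summability.

Set Implicit Arguments.
Unset Strict Implicit.
Unset Printing Implicit Defensive.

Import Order.TTheory GRing.Theory Num.Theory.
Import numFieldNormedType.Exports.
Import ComplexField.Normc.

Local Open Scope classical_set_scope.
Local Open Scope ring_scope.
Local Open Scope complex_scope.

(* The topology and norm of the field of complex numbers. *)
HB.instance Definition _ (R : realType) := NormedModule.copy R[i] R[i]^o.

(** * Multi-indices and unordered series *)

Notation multi d := {ffun 'I_d -> nat}.

Definition mfact (d : nat) (I : multi d) : nat := (\prod_i (I i)`!)%N.

Definition mpow (K : comPzRingType) (d : nat) (z : 'rV[K]_d) (I : multi d) : K :=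
  \prod_i z 0 i ^+ I i.

(* The multiset {i_1, ..., i_n} identified with I. *)
Definition mset (d : nat) (I : multi d) : seq 'I_d :=
  flatten [seq nseq (I i) i | i <- enum 'I_d].

(* Convergence of the net of finite partial sums, which for real or complex
   terms is the same as absolute convergence. *)
Definition is_sum (J : choiceType) (K : numDomainType) (V : normedModType K)
    (a : J -> V) (v : V) : Prop :=
  partial_sum a A @[A --> totally] --> v.

(** * Partitions, p-variation and Riemann-Stieltjes integrals *)

(* As in [itv_partition a b s], a partition a = x_0 < ... < x_n = b is given by
   s = [:: x_1; ...; x_n]. *)
Definition ppoint (R : realType) (a b : R) (s : seq R) (i : nat) : R :=
  nth b (a :: s) i.

Definition mesh (R : realType) (a b : R) (s : seq R) : R :=
  \big[Num.max/0]_(i < size s) (ppoint a b s i.+1 - ppoint a b s i).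

Definition vanishing_partitions (R : realType) (a b : R) (pi : nat -> seq R) :=
  (forall m, itv_partition a b (pi m)) /\ mesh a b (pi m) @[m --> \oo] --> 0.

Definition pvar (R : realType) (d : nat) (p a b : R) (x : R -> 'rV[R]_d) : \bar R :=
  ((ereal_sup
     [set (\sum_(i < size s)
             `|x (ppoint a b s i.+1) - x (ppoint a b s i)| `^ p)%:E
     | s in itv_partition a b]) `^ p^-1)%E.

Definition rs_sum (R : realType) (g h : R -> R) (a b : R) (s : seq R)
    (tag : nat -> R) : R :=
  \sum_(i < size s) g (tag i) * (h (ppoint a b s i.+1) - h (ppoint a b s i)).

(* Limit, as the mesh vanishes, of the sums with arbitrary tags.  For paths of
   complementary variation regularity this is the Young integral. *)
Definition is_rs_integral (R : realType) (g h : R -> R) (a b v : R) : Prop :=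
  forall eps : R, 0 < eps -> exists2 delta : R, 0 < delta &
    forall (s : seq R) (tag : nat -> R),
      itv_partition a b s -> mesh a b s < delta ->
      (forall i, (i < size s)%N ->
         ppoint a b s i <= tag i <= ppoint a b s i.+1) ->
      `|rs_sum g h a b s tag - v| < eps.

Definition rs_integrable (R : realType) (g h : R -> R) (a b : R) : Prop :=
  exists v, is_rs_integral g h a b v.

Definition rs_integral (R : realType) (g h : R -> R) (a b : R) : R :=
  xget 0 [set v | is_rs_integral g h a b v].

(** * Derivatives *)

Definition partial (R : realType) (n : nat) (i : 'I_n) (g : 'rV[R]_n -> R) :
    'rV[R]_n -> R :=
  'D_(delta_mx 0 i) g.

Definition mpartial (R : realType) (d : nat) (I : multi d) (g : 'rV[R]_d -> R) :
    'rV[R]_d -> R :=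
  foldr (fun i => iter (I i) (partial i)) g (enum 'I_d).

(* One-sided at the end points of [0, T], since processes live on [0, T]. *)
Definition deriv_in (R : realType) (T : R) (g : R -> R) (u : R) : R :=
  lim ((g v - g u) / (v - u) @[v --> within `[0, T] u^']).

(** * Several complex variables *)

Definition cexp (R : realType) (z : R[i]) : R[i] :=
  (expR (complex.Re z) * cos (complex.Im z))
    +i* (expR (complex.Re z) * sin (complex.Im z)).

Definition holomorphic_on (R : realType) (V : normedModType R[i])
    (D : set V) (F : V -> R[i]) : Prop :=
  forall z, D z -> differentiable F z.

Definition polydisc (R : realType) (d : nat) (Rad : 'I_d -> \bar R) :
    set 'rV[R[i]]_d :=
  [set z | forall i, ((normc (z 0 i))%:E < Rad i)%E].

Definition cdot (R : realType) (d : nat) (z : 'rV[R[i]]_d) (x : 'rV[R]_d) : R[i] :=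
  \sum_i z 0 i * (x 0 i)%:C.

(* g on R^d extends to an entire function bounded by C exp(r.|z|). *)
Definition extends_exp_type (R : realType) (d : nat) (C : R) (r : 'I_d -> R)
    (g : 'rV[R]_d -> R) : Prop :=
  exists F : 'rV[R[i]]_d -> R[i],
    [/\ holomorphic_on setT F,
        forall x : 'rV[R]_d, F (\row_i (x 0 i)%:C) = (g x)%:C &
        forall z, normc (F z) <= C * expR (\sum_i r i * normc (z 0 i))].

(** * Moments and cumulants *)

Definition cexpectation (R : realType) (disp : measure_display)
    (Omega : measurableType disp) (P : probability Omega R)
    (Z : Omega -> R[i]) : R[i] :=
  (fine ('E_P[fun w => complex.Re (Z w)])%E)
    +i* (fine ('E_P[fun w => complex.Im (Z w)])%E).

(* kappa[Y_1, ..., Y_n], the mixed derivative at 0 of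
   log E exp(l_1 Y_1 + ... + l_n Y_n), once in each variable. *)
Definition joint_cumulant (R : realType) (disp : measure_display)
    (Omega : measurableType disp) (P : probability Omega R)
    (Y : seq (Omega -> R)) : R :=
  foldr (@partial R (size Y))
    (fun l : 'rV[R]_(size Y) =>
       ln (fine ('E_P[fun w => expR (\sum_(k < size Y)
                                       l 0 k * nth (fun=> 0) Y k w)])%E))
    (enum 'I_(size Y)) 0.

(* The density of kappa^{I,j}(u, ..., u, du) with respect to du. *)
Definition kappa (R : realType) (disp : measure_display)
    (Omega : measurableType disp) (P : probability Omega R) (d : nat) (T : R)
    (X : R -> Omega -> 'rV[R]_d) (I : multi d) (j : 'I_d) (u : R) : R :=
  deriv_in T
    (fun v => joint_cumulant P
                (rcons [seq (fun w => X u w 0 i) | i <- mset I]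
                       (fun w => X v w 0 j)))
    u.

(* Almost sure equality with an element of L^1: suprema over [0, T] need not be
   measurable when paths are irregular on a null set. *)
Definition in_L1 (R : realType) (disp : measure_display)
    (Omega : measurableType disp) (P : probability Omega R)
    (Y : Omega -> R) : Prop :=
  exists2 Z : Omega -> R, P.-integrable setT (EFin \o Z) &
    {ae P, forall w, Y w = Z w}.

(** * Wick products *)

(* The family (x, y)^{<>(I,k)} of coefficients of the expansion of
   exp(xi.x + eta y) / M(xi, eta) around 0, M being the moment-generating
   function of (Z, Y). *)
Definition is_appell (R : realType) (disp : measure_display)
    (Omega : measurableType disp) (P : probability Omega R) (d : nat)
    (Z : Omega -> 'rV[R]_d) (Y : Omega -> R) (x : 'rV[R]_d) (y : R)
    (A : multi d * nat -> R) : Prop :=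
  exists2 rho : R, 0 < rho &
    forall (xi : 'rV[R[i]]_d) (eta : R[i]),
      (forall i, normc (xi 0 i) < rho) -> normc eta < rho ->
      is_sum (V := R[i])
        (fun Ik : multi d * nat =>
           (A Ik)%:C * (mpow xi Ik.1 * eta ^+ Ik.2)
             / ((mfact Ik.1 * Ik.2`!)%N)%:R)
        (cexp (cdot xi x + eta * y%:C)
           / cexpectation P (fun w => cexp (cdot xi (Z w) + eta * (Y w)%:C))).

Definition appell (R : realType) (disp : measure_display)
    (Omega : measurableType disp) (P : probability Omega R) (d : nat)
    (Z : Omega -> 'rV[R]_d) (Y : Omega -> R) (x : 'rV[R]_d) (y : R)
    (I : multi d) (k : nat) : R :=
  xget (fun=> 0) [set A | is_appell P Z Y x y A] (I, k).

(* The random variable h(Z) <> Y. *)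
Definition wick_product (R : realType) (disp : measure_display)
    (Omega : measurableType disp) (P : probability Omega R) (d : nat)
    (h : 'rV[R]_d -> R) (Z : Omega -> 'rV[R]_d) (Y : Omega -> R)
    (w : Omega) : R :=
  summability.sum (R := R^o) (fun I : multi d =>
    fine ('E_P[fun w' => mpartial I h (Z w')])%E / (mfact I)%:R
    * (appell P Z Y (Z w) (Y w) I 1
       + fine ('E_P[Y])%E * appell P Z Y (Z w) (Y w) I 0)).

(* The sum over [u,v] in the partition of f_j(X_u) <> X^j_{u,v}. *)
Definition wick_sum (R : realType) (disp : measure_display)
    (Omega : measurableType disp) (P : probability Omega R) (d : nat)
    (f : 'rV[R]_d -> 'rV[R]_d) (X : R -> Omega -> 'rV[R]_d) (s t : R)
    (pi : seq R) (w : Omega) : R :=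
  \sum_(i < size pi) \sum_(j < d)
    let u := ppoint s t pi i in
    let v := ppoint s t pi i.+1 in
    wick_product P (fun x => f x 0 j) (X u) (fun w' => X v w' 0 j - X u w' 0 j) w.

(** * Conditions on the process *)

Definition process (R : realType) (disp : measure_display)
    (Omega : measurableType disp) (d : nat) (T : R)
    (X : R -> Omega -> 'rV[R]_d) : Prop :=
  forall t, 0 <= t <= T ->
    forall i, measurable_fun setT (fun w => X t w 0 i).

Definition regular_paths (R : realType) (disp : measure_display)
    (Omega : measurableType disp) (P : probability Omega R) (d : nat) (T p : R)
    (X : R -> Omega -> 'rV[R]_d) : Prop :=
  {ae P, forall w,
     {within `[0, T], continuous (fun t => X t w)} /\
     (pvar p 0 T (fun t => X t w) < +oo)%E}.

(* K s t is the branch of log M_{s,t}, with M_{s,t}(z,w) = E exp(z.X_s + w.X_t),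
   on the simply connected set D_R x D_R that vanishes at the origin; dK is its
   derivative in t. *)
Definition cumulant_condition (R : realType) (disp : measure_display)
    (Omega : measurableType disp) (P : probability Omega R) (d : nat) (T : R)
    (Rad : 'I_d -> \bar R) (X : R -> Omega -> 'rV[R]_d) : Prop :=
  let D := polydisc Rad in
  let e (s t : R) (z w : 'rV[R[i]]_d) (om : Omega) :=
    cexp (cdot z (X s om) + cdot w (X t om)) in
  exists K dK : R -> R -> 'rV[R[i]]_d -> 'rV[R[i]]_d -> R[i],
    (forall s t, 0 <= s <= T -> 0 <= t <= T ->
       [/\ forall z w, D z -> D w ->
             P.-integrable setT (EFin \o (fun om => normc (e s t z w om))),
           holomorphic_on (D `*` D) (fun zw => K s t zw.1 zw.2),
           forall z w, D z -> D w -> cexp (K s t z w) = cexpectation P (e s t z w),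
           K s t 0 0 = 0 &
           forall z w, D z -> D w ->
             (K s t' z w - K s t z w) / (t' - t)%:C
               @[t' --> within `[0, T] t^'] --> dK s t z w]) /\
    {within (((`[0, T] `*` `[0, T]) `*` D) `*` D), continuous
       (fun q : R * R * 'rV[R[i]]_d * 'rV[R[i]]_d =>
          dK q.1.1.1 q.1.1.2 q.1.2 q.2)} /\
    (exists B : R, forall s t z w, 0 <= s <= T -> 0 <= t <= T ->
       D z -> D w -> normc (dK s t z w) <= B).

(* Lebesgue integral over R^n of a nonnegative Borel function, as an iterated
   integral. *)
Fixpoint lebesgue_int (R : realType) (n : nat) :
    ('rV[R]_n -> \bar R) -> \bar R :=
  match n return ('rV[R]_n -> \bar R) -> \bar R with
  | 0 => fun g => g 0
  | m.+1 => fun g =>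
      (\int[@lebesgue_measure R]_x
         lebesgue_int (fun v : 'rV[R]_m => g (row_mx (x%:M : 'rV[R]_1) v)))%E
  end.

Definition borel (V : topologicalType) : set (set V) := <<s @open V >>.

Definition has_density_on (R : realType) (disp : measure_display)
    (Omega : measurableType disp) (P : probability Omega R) (d : nat)
    (Z : Omega -> 'rV[R]_d) (U : set 'rV[R]_d) : Prop :=
  exists g : 'rV[R]_d -> R,
    [/\ forall x, 0 <= g x,
        forall B : set R, measurable B -> @borel 'rV[R]_d (g @^-1` B) &
        forall A : set 'rV[R]_d, borel A -> A `<=` U ->
          P (Z @^-1` A) = lebesgue_int (fun x => (g x * \1_A x)%:E)].

Definition density_condition (R : realType) (disp : measure_display)
    (Omega : measurableType disp) (P : probability Omega R) (d : nat) (T : R)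
    (X : R -> Omega -> 'rV[R]_d) : Prop :=
  forall t, 0 < t <= T ->
    exists U : set 'rV[R]_d,
      [/\ open U, (0 < P (X t @^-1` U))%E & has_density_on P (X t) U].

(* exp(sigma . ||X||_oo) *)
Definition exp_sup_norm (R : realType) (Omega : Type) (d : nat) (T : R)
    (X : R -> Omega -> 'rV[R]_d) (sigma : 'I_d -> R) (w : Omega) : R :=
  expR (\sum_i sigma i * sup [set `|X t w 0 i| | t in `[0, T]]).

(* Main.v *)
Require Import Defs.
From HB Require Import structures.
From mathcomp Require Import all_boot all_order all_algebra finmap.
From mathcomp Require Import complex.
From mathcomp Require Import all_classical all_reals all_analysis.
From mathcomp Require Import analysis.measurable_realfun.
From mathcomp Require Import analysis.showcase.summability.
From mathcomp Require Import ring lra.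

(** The theorem follows from a pathwise identity on each interval of a partition, which is then
    summed. Write Y = X^j_v - X^j_u, and K_{u,v}(z, w) for the logarithm of E exp(z.X_u + w.X_v).
    The generating function of the Appell polynomials of (X_u, Y) is the exponential of
      xi.x + eta y - K_{u,v}(xi - eta e_j, eta e_j).
    In its eta-derivative at 0 the first-variable derivative of K_{u,v} at (xi, 0) may be replaced
    by the second-variable derivative of K_{u,u}, since both are derivatives of the same function
    log E exp(xi.X_u) ([diag_deriv]). So this derivative is y - k(xi), where k(xi) is the
    eta-derivative at 0 of the increment K_{u,v}(xi, eta e_j) - K_{u,u}(xi, eta e_j), with power
    series coefficients k_J, called [cum_incr] below. Hence the Appell polynomials of first order
    in y are those of order 0 times y, minus a convolution with k. On the other hand the
    polynomials of order 0, weighted by the expectations of the derivatives of h, resum to h and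
    to its derivatives. Together ([wick_formula])
      h(X_u) Y - h(X_u) <> Y = sum over J <> 0 of k_J(u, v) d_J h(X_u).

    Summed over a partition, the first term on the left is a left Riemann sum. It converges to the
    Young integral because p < 2: the products of increments are bounded by a superadditive control
    to a power larger than 1, and bisecting a partition at the interval which carries half of the
    control bounds its Riemann sum by a geometric series ([sewing_bound], [young_exists]).

    On the right, Cauchy's estimates on a polydisc of radius rho turn the bound on the t-derivative
    of K into |k_J(u, v)| <= B |v - u| / rho^J, up to a constant, while d_J h(X_u) is of order r^J
    because h has exponential type r. As r < rho, the terms are dominated by a geometric series,
    uniformly in the partition. By compactness the t-derivative of K is uniformly continuous, so
    that k_J(u, v) = q_J(u) (v - u) up to an error small relative to |v - u| / rho^J. Hence every
    term converges to the integral of d_J h(X_u) q_J(u), and the sum over J follows by dominated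
    convergence for series ([correction_cvg]). Finally J! q_J(u) is the density of the cumulant
    kappa^{J,j} ([kappaE]), because, up to factorials, the joint cumulants
    are the Taylor coefficients of K.

    The L^1 summability of the series comes from exponential moments of X_u bounded in u
    ([exp_moment_bound]). For the convergence in L^1, all Riemann sums are dominated by a multiple
    of exp(a.|X|_infty) (1 + |X|_{p-var})^2 with r < a < sigma, which is integrable when
    exp(sigma.|X|_infty) is and the variation has all moments ([dominating_rv]). Expectations factorize,
    E[h(X_u) <> Y] = E[h(X_u)] E[Y] ([Ex_wick]), which gives zero when the process is centred. The
    expectation of the identity above is of the same form, with the derivatives of h replaced by
    their means, and the same convergence argument gives the last expansion ([centered_means]).

    The analytic input in one variable is Goursat's theorem and the power series with Cauchy's
    estimates which it yields on a disc ([goursat], [cauchy_disc]). A function of several variables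
    is expanded one coordinate at a time ([cauchy_polydisc]). *)

Set Implicit Arguments.
Unset Strict Implicit.
Unset Printing Implicit Defensive.

Import Order.TTheory GRing.Theory Num.Theory.
Import numFieldNormedType.Exports.
Import ComplexField.Normc.

Local Open Scope classical_set_scope.
Local Open Scope ring_scope.
Local Open Scope complex_scope.

(** * Unordered sums *)

Section UnorderedSums.
Context {R : realType}.
Implicit Types (J K : choiceType).

(** Convergence of the net of finite partial sums, unfolded to inequalities. *)
Definition hsum J (a : J -> R) (v : R) : Prop :=
  forall e : R, 0 < e -> exists A0 : {fset J}, forall A : {fset J},
    (A0 `<=` A)%fset -> `|\sum_(i <- A) a i - v| < e.

(** The bound is part of the predicate, since the estimates that follow have to be uniform in
    parameters on which the family depends. *)
Definition absb J (a : J -> R) (M : R) : Prop :=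
  forall A : {fset J}, \sum_(i <- A) `|a i| <= M.

Lemma hsum_le J (a : J -> R) v w e :
  hsum a v -> (exists A0 : {fset J}, forall A : {fset J}, (A0 `<=` A)%fset ->
    `|\sum_(i <- A) a i - w| <= e) -> `|v - w| <= e.
Proof.
move=> av [A0 hA0]; apply/ler_addgt0Pr => /= d d0.
have [A1 hA1] := av _ d0.
have := hA1 _ (fsubsetUr A0 A1); have := hA0 _ (fsubsetUl A0 A1).
set S := \sum_(i <- _) _ => h1 h2.
have -> : v - w = (S - w) - (S - v) by ring.
by rewrite (le_trans (ler_normB _ _))// lerD// ltW.
Qed.

Lemma hsum_uniq J (a : J -> R) v w : hsum a v -> hsum a w -> v = w.
Proof.
move=> av aw; apply/eqP; rewrite -subr_eq0 -normr_le0; apply/ler_addgt0Pr => e e0.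
rewrite add0r; apply: (hsum_le av); have [A0 h] := aw _ e0.
by exists A0 => A /h /ltW.
Qed.

Lemma hsum_ext J (a b : J -> R) v : a =1 b -> hsum a v -> hsum b v.
Proof. by move=> /funext->. Qed.

Lemma hsum0 J : hsum (fun _ : J => 0) 0.
Proof. by move=> e e0; exists fset0 => A _; rewrite big1// subrr normr0. Qed.

Lemma hsumD J (a b : J -> R) v w :
  hsum a v -> hsum b w -> hsum (fun j => a j + b j) (v + w).
Proof.
move=> av bw e e0; have e2 : 0 < e / 2 by rewrite divr_gt0.
have [A1 h1] := av _ e2; have [A2 h2] := bw _ e2.
exists (A1 `|` A2)%fset => A sA; rewrite big_split /= opprD addrACA.
rewrite (le_lt_trans (ler_normD _ _))// [ltRHS]splitr ltrD//.
  by apply: h1; apply: fsubset_trans sA; exact: fsubsetUl.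
by apply: h2; apply: fsubset_trans sA; exact: fsubsetUr.
Qed.

Lemma hsumZ J (a : J -> R) v c : hsum a v -> hsum (fun j => c * a j) (c * v).
Proof.
move=> av; have [->|c0] := eqVneq c 0.
  by rewrite mul0r; apply: (hsum_ext (a := fun=> 0)) (@hsum0 J) => j; rewrite mul0r.
move=> e e0; have nc : 0 < `|c| by rewrite normr_gt0.
have [A0 h] := av (e / `|c|) (divr_gt0 e0 nc).
exists A0 => A sA; rewrite -mulr_sumr -mulrBr normrM mulrC -ltr_pdivlMr//.
exact: h.
Qed.

Lemma hsumN J (a : J -> R) v : hsum a v -> hsum (fun j => - a j) (- v).
Proof.
by move=> /(@hsumZ _ _ _ (-1)); rewrite mulN1r; apply: hsum_ext => j; rewrite mulN1r.
Qed.

Lemma hsumB J (a b : J -> R) v w :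
  hsum a v -> hsum b w -> hsum (fun j => a j - b j) (v - w).
Proof. by move=> av /hsumN; exact: hsumD. Qed.

Lemma hsum_sum J (I : Type) (s : seq I) (a : I -> J -> R) (v : I -> R) :
  (forall i, hsum (a i) (v i)) ->
  hsum (fun j => \sum_(i <- s) a i j) (\sum_(i <- s) v i).
Proof.
move=> av; elim: s => [|i s IH].
  by rewrite big_nil; apply: hsum_ext (@hsum0 J) => j; rewrite big_nil.
rewrite big_cons; apply: hsum_ext (hsumD (av i) IH) => j; by rewrite big_cons.
Qed.

Lemma hsum1 J (j0 : J) (x : R) : hsum (fun j => if j == j0 then x else 0) x.
Proof.
move=> e e0; exists [fset j0]%fset => A; rewrite fsub1set => j0A.
rewrite (big_fsetD1 _ j0A) /= eqxx big_seq big1 ?addr0 ?subrr ?normr0// => j.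
by rewrite !inE => /andP[/negbTE->].
Qed.

Lemma sum_fset_sub J (a : J -> R) (A B : {fset J}) : (A `<=` B)%fset ->
  (forall j, 0 <= a j) -> \sum_(i <- A) a i <= \sum_(i <- B) a i.
Proof.
move=> sAB a0.
rewrite [leRHS](big_fsetID _ (mem A)) /=.
suff <- : A = [fset x | x in B & x \in A]%fset :> {fset J}.
  by rewrite lerDl sumr_ge0.
apply/fsetP => x; rewrite !inE /= andbC; case xA: (x \in A) => //=.
by rewrite (fsubsetP sAB).
Qed.

Lemma absb_ge0 J (a : J -> R) M : absb a M -> 0 <= M.
Proof. by move=> /(_ fset0); rewrite big_seq_fset0. Qed.

Lemma absb_le1 J (a : J -> R) M j : absb a M -> `|a j| <= M.
Proof. by move=> /(_ [fset j]%fset); rewrite big_seq_fset1. Qed.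

Lemma absb_le J (a b : J -> R) M : (forall j, `|a j| <= `|b j|) -> absb b M -> absb a M.
Proof. by move=> ab bM A; apply: le_trans (bM A); exact: ler_sum. Qed.

Lemma absb_weak J (a : J -> R) M M' : M <= M' -> absb a M -> absb a M'.
Proof. by move=> MM aM A; exact: le_trans (aM A) MM. Qed.

Lemma absbZ J (a : J -> R) M c : absb a M -> absb (fun j => c * a j) (`|c| * M).
Proof.
move=> aM A; under eq_bigr do rewrite normrM.
by rewrite -mulr_sumr ler_wpM2l.
Qed.

Lemma absb_finite J (a : J -> R) (A : {fset J}) :
  (forall j, j \notin A -> a j = 0) -> absb a (\sum_(i <- A) `|a i|).
Proof.
move=> a0 B; rewrite (big_fsetID _ (mem A)) /=.
rewrite [X in _ + X]big_seq [X in _ + X]big1 ?addr0; last first.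
  by move=> j; rewrite !inE /= => /andP[_ /a0->]; rewrite normr0.
apply: sum_fset_sub => //; apply/fsubsetP => x; rewrite !inE /=.
by case/andP.
Qed.

Lemma hsum_norm_le J (a : J -> R) M v : absb a M -> hsum a v -> `|v| <= M.
Proof.
move=> aM av; rewrite -[v]subr0; apply: (hsum_le av); exists fset0 => A _.
by rewrite subr0; apply: le_trans (aM A); exact: ler_norm_sum.
Qed.

Lemma hsum_absb J (a : J -> R) v : (forall j, 0 <= a j) -> hsum a v -> absb a v.
Proof.
move=> a0 av A; apply/ler_addgt0Pr => e e0.
have [A0 h] := av _ e0; have /= := h _ (fsubsetUr A A0).
move=> /(le_lt_trans (ler_norm _)) /ltW; rewrite lerBlDr addrC => H.
apply: le_trans H; under eq_bigr do rewrite ger0_norm//.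
by apply: sum_fset_sub => //; exact: fsubsetUl.
Qed.

Lemma absb_hsum_pos J (a : J -> R) M : (forall j, 0 <= a j) -> absb a M ->
  exists v, hsum a v.
Proof.
move=> a0 aM.
pose E := [set \sum_(i <- A) a i | A in [set: {fset J}]].
have hE : has_sup E.
  split; first by exists (\sum_(i <- fset0) a i); exists fset0.
  exists M => _ [A _ <-]; apply: le_trans (aM A).
  by apply: ler_sum => i _; exact: ler_norm.
exists (sup E) => e e0.
have [_ [A0 _ <-] hA0] := sup_adherent e0 hE.
exists A0 => A sA; rewrite ltr_norml; apply/andP; split.
  rewrite ltrBrDl (lt_le_trans hA0)//; exact: sum_fset_sub.
rewrite ltrBlDr (@le_lt_trans _ _ (sup E))// ?ltrDr//.
by apply: ub_le_sup; [exact: hE.2|exists A].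
Qed.

(** The positive and the negative part are bounded families of nonnegative terms, which converge to
    the suprema of their finite sums. *)
Lemma absb_hsum J (a : J -> R) M : absb a M -> exists v, hsum a v.
Proof.
move=> aM.
have [p hp] : exists v, hsum (fun j => Num.max (a j) 0) v.
  apply: (@absb_hsum_pos _ _ M) => [j|]; first by rewrite le_max lexx orbT.
  apply: absb_le aM => j; rewrite maxEle; case: ifP => _ //; by rewrite normr0.
have [q hq] : exists v, hsum (fun j => Num.max (- a j) 0) v.
  apply: (@absb_hsum_pos _ _ M) => [j|]; first by rewrite le_max lexx orbT.
  apply: absb_le aM => j; rewrite maxEle; case: ifP => _; by rewrite ?normr0// normrN.
exists (p - q); apply: hsum_ext (hsumB hp hq) => j.
rewrite !maxEle oppr_le0; have [h|h|->] := ltgtP (a j) 0; lra.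
Qed.

(** Finite sums over sets away from some A0 are bounded by Cauchy's criterion. Testing this on the
    indices where the terms are nonnegative and on those where they are negative bounds the sum of
    the absolute values. *)
Lemma hsum_abs J (a : J -> R) v : hsum a v -> exists M, absb a M.
Proof.
move=> av; have [A0 h] := av 1 ltr01.
have bnd (A : {fset J}) : [disjoint A & A0]%fset -> `|\sum_(i <- A) a i| <= 2.
  move=> dA; have h1 := h A0 (fsubset_refl _).
  have := h _ (fsubsetUr A A0).
  have -> : \sum_(i <- (A `|` A0)%fset) a i = \sum_(i <- A) a i + \sum_(i <- A0) a i.
    rewrite -big_cat /=; apply: perm_big; apply: uniq_perm.
    - exact: fset_uniq.
    - rewrite cat_uniq !fset_uniq /= andbT; apply/hasPn => x xA0.
      by apply/negP => xA; move/fdisjointP : dA => /(_ _ xA); rewrite xA0.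
    - by move=> x; rewrite mem_cat in_fsetU.
  set s := \sum_(i <- A) a i; set t := \sum_(i <- A0) a i in h1 *.
  move=> h2; have -> : s = (s + t - v) - (t - v) by ring.
  by rewrite (le_trans (ler_normB _ _))// -[2]/(1 + 1)%:R natrD lerD// ltW.
exists (4 + \sum_(i <- A0) `|a i|) => A.
have key (B : {fset J}) : [disjoint B & A0]%fset -> \sum_(i <- B) `|a i| <= 4.
  move=> dB; rewrite (big_fsetID _ (fun i => 0 <= a i)) /=.
  set B1 := [fset _ | _ in _ & _]%fset; set B2 := [fset _ | _ in _ & _]%fset.
  have d1 : [disjoint B1 & A0]%fset.
    apply/fdisjointP => x; rewrite !inE /= => /andP[xB _].
    by move/fdisjointP : dB; exact.
  have d2 : [disjoint B2 & A0]%fset.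
    apply/fdisjointP => x; rewrite !inE /= => /andP[xB _].
    by move/fdisjointP : dB; exact.
  have -> : \sum_(i <- B1) `|a i| = \sum_(i <- B1) a i.
    rewrite big_seq [RHS]big_seq; apply: eq_bigr => i; rewrite !inE /=.
    by case/andP => _ /ger0_norm.
  have -> : \sum_(i <- B2) `|a i| = - \sum_(i <- B2) a i.
    rewrite big_seq [in RHS]big_seq -sumrN; apply: eq_bigr => i; rewrite !inE /=.
    by case/andP => _; rewrite -ltNge => /ltr0_norm.
  have := bnd _ d1; have := bnd _ d2; rewrite !ler_norml; lra.
rewrite (big_fsetID _ (mem A0)) /= addrC lerD//.
  apply: key; apply/fdisjointP => x; rewrite !inE /=; by case/andP.
apply: sum_fset_sub => //; apply/fsubsetP => x; rewrite !inE /=; by case/andP.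
Qed.

(** Sequences of finite sets absorbing every finite set, such as boxes of multi-indices, turn
    unordered sums into limits of sequences, to which measure theory applies. *)
Lemma hsum_exhaust J (a : J -> R) v (E : nat -> {fset J}) :
  (forall A : {fset J}, exists n0, forall n, (n0 <= n)%N -> (A `<=` E n)%fset) ->
  hsum a v -> \sum_(i <- E n) a i @[n --> \oo] --> v.
Proof.
move=> hE av; apply/cvgrPdist_lt => e e0.
have [A0 h] := av _ e0; have [n0 hn] := hE A0.
exists n0 => // n /= nn; rewrite distrC; apply: h; exact: hn.
Qed.

Lemma exhaust_hsum J (a : J -> R) M v (E : nat -> {fset J}) :
  (forall A : {fset J}, exists n0, forall n, (n0 <= n)%N -> (A `<=` E n)%fset) ->
  absb a M -> \sum_(i <- E n) a i @[n --> \oo] --> v -> hsum a v.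
Proof.
move=> hE aM cv; have [w hw] := absb_hsum aM.
have cw := hsum_exhaust hE hw.
by rewrite (cvg_unique _ cv cw).
Qed.

Lemma absb_exhaust J (a : J -> R) M (E : nat -> {fset J}) :
  (forall A : {fset J}, exists n0, forall n, (n0 <= n)%N -> (A `<=` E n)%fset) ->
  (forall n, \sum_(i <- E n) `|a i| <= M) -> absb a M.
Proof.
move=> hE aM A; have [n0 /(_ n0 (leqnn _)) h] := hE A.
by apply: le_trans (aM n0); exact: sum_fset_sub.
Qed.

Lemma big_fsetM_pair J K (B : {fset J}) (C : {fset K}) (a : J * K -> R) :
  \sum_(p <- (B `*` C)%fset) a p = \sum_(i <- B) \sum_(k <- C) a (i, k).
Proof.
rewrite -(@big_allpairs_dep _ _ _ _ (fun=> K) _ (fun i k => (i, k)) _ (fun=> enum_fset C)).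
apply: perm_big.
apply: uniq_perm; first exact: fset_uniq.
  apply: allpairs_uniq; rewrite ?fset_uniq//.
  by move=> [? ?] [? ?].
move=> [i k]; rewrite in_fsetM /=; apply/andP/allpairsP => [[iB kC]|[[i' k'] /= [? ? [-> ->]]]//].
by exists (i, k).
Qed.

Lemma fset_sub_prod J K (A : {fset J * K}) (B : {fset J}) (C : {fset K}) :
  ([fset p.1 | p in A] `<=` B)%fset -> ([fset p.2 | p in A] `<=` C)%fset ->
  (A `<=` B `*` C)%fset.
Proof.
move=> /fsubsetP sB /fsubsetP sC; apply/fsubsetP => p pA.
by rewrite in_fsetM sB ?sC// in_imfset.
Qed.

Lemma hsum_pair J K (a : J * K -> R) v (s : J -> R) :
  hsum a v -> (forall j, hsum (fun k => a (j, k)) (s j)) -> hsum s v.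
Proof.
move=> av rs e e0; have [A0 h] := av (e / 2) ltac:(lra).
exists [fset p.1 | p in A0]%fset => B sB.
apply: (@le_lt_trans _ _ (e / 2)); last by lra.
apply: (hsum_le (hsum_sum B rs)).
exists [fset p.2 | p in A0]%fset => C sC.
rewrite exchange_big /= -big_fsetM_pair; apply/ltW/h.
exact: fset_sub_prod.
Qed.

Lemma absb_row J K (a : J * K -> R) M j : absb a M -> absb (fun k => a (j, k)) M.
Proof.
move=> aM C; apply: le_trans (aM ([fset j] `*` C)%fset).
by rewrite (big_fsetM_pair [fset j]%fset C (fun p => `|a p|)) big_seq_fset1.
Qed.

Lemma absb_pair J K (a : J * K -> R) (m : J -> R) M :
  (forall j, absb (fun k => a (j, k)) (m j)) -> absb m M -> absb a M.
Proof.
move=> am mM A.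
apply: (@le_trans _ _ (\sum_(p <- ([fset p.1 | p in A] `*` [fset p.2 | p in A])%fset) `|a p|)).
  by apply: sum_fset_sub => //; exact: fset_sub_prod.
rewrite (big_fsetM_pair _ _ (fun p => `|a p|)).
apply: le_trans (mM [fset p.1 | p in A]%fset); apply: ler_sum => i _.
by apply: le_trans (ler_norm _); exact: am.
Qed.

Lemma hsum_swap J K (a : J * K -> R) v :
  hsum a v -> hsum (fun p : K * J => a (p.2, p.1)) v.
Proof.
move=> av e e0; have [A0 h] := av _ e0.
exists [fset (p.2, p.1) | p in A0]%fset => A sA.
pose sw := [fset (p.2, p.1) | p in A]%fset.
have -> : \sum_(i <- A) a (i.2, i.1) = \sum_(i <- sw) a i.
  by rewrite big_imfset //= => -[? ?] [? ?] _ _ [-> ->].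
apply: h; apply/fsubsetP => -[x y] xy.
apply/imfsetP; exists (y, x) => //=; apply: (fsubsetP sA).
by apply/imfsetP; exists (x, y).
Qed.

Lemma absb_swap J K (a : J * K -> R) M :
  absb a M -> absb (fun p : K * J => a (p.2, p.1)) M.
Proof.
move=> aM A; pose sw := [fset (p.2, p.1) | p in A]%fset.
suff -> : \sum_(i <- A) `|a (i.2, i.1)| = \sum_(i <- sw) `|a i| by exact: aM.
by rewrite big_imfset //= => -[? ?] [? ?] _ _ [-> ->].
Qed.

(** The family converges over the product, and both iterated sums are equal to that sum. *)
Lemma hsum_fubini J K (a : J * K -> R) M (s : J -> R) (t : K -> R) v :
  absb a M ->
  (forall j, hsum (fun k => a (j, k)) (s j)) ->
  (forall k, hsum (fun j => a (j, k)) (t k)) ->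
  hsum s v -> hsum t v.
Proof.
move=> aM hs ht sv; have [w aw] := absb_hsum aM.
rewrite (hsum_uniq sv (hsum_pair aw hs)).
exact: (hsum_pair (hsum_swap aw) ht).
Qed.

Lemma absb1 K (k0 : K) (x : R) : absb (fun k => if k == k0 then x else 0) `|x|.
Proof.
move=> A; apply: (le_trans (absb_finite (A := [fset k0]%fset) _ A)).
  by move=> j; rewrite inE => /negbTE->.
by rewrite big_seq_fset1 eqxx.
Qed.

(** Summation by packets, the packets being the fibres of phi. *)
Lemma hsum_fiber J K (phi : J -> K) (a : J -> R) M (s : K -> R) v :
  absb a M -> hsum a v ->
  (forall k, hsum (fun j => if phi j == k then a j else 0) (s k)) -> hsum s v.
Proof.
move=> aM av hs.
apply: (@hsum_fubini J K (fun p => if p.2 == phi p.1 then a p.1 else 0) M a s v _ _ _ av).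
- apply: (@absb_pair _ _ _ (fun j => `|a j|)) => [j|]; first by apply: (@absb1 _ (phi j) (a j)).
  by move=> A; under eq_bigr do rewrite normr_id.
- by move=> j; apply: (hsum1 (phi j) (a j)).
- by move=> k; apply: hsum_ext (hs k) => j; rewrite eq_sym.
Qed.

Lemma hsum_inj J K (g : K -> J) (a : J -> R) M v :
  injective g -> (forall j, (forall k, g k != j) -> a j = 0) ->
  absb a M -> hsum a v <-> hsum (a \o g) v.
Proof.
move=> gi a0 aM.
pose c (p : J * K) := if p.1 == g p.2 then a p.1 else 0.
have row j : hsum (fun k => c (j, k)) (a j).
  rewrite /c /=; have [[k kj]|nk] := pselect (exists k, g k = j).
    apply: hsum_ext (hsum1 k (a j)) => k'; rewrite -kj (inj_eq gi).
    by rewrite eq_sym.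
  have h k : g k != j by apply/eqP => e; apply: nk; exists k.
  rewrite a0//; under eq_fun do rewrite if_same; exact: hsum0.
have col k : hsum (fun j => c (j, k)) (a (g k)).
  by rewrite /c /=; apply: hsum_ext (hsum1 (g k) (a (g k))) => j /=; case: eqP => // ->.
have cM : absb c M.
  apply: (@absb_pair _ _ _ (fun j => `|a j|)) => [j|]; last first.
    by move=> A; under eq_bigr do rewrite normr_id.
  rewrite /c /=; have [[k kj]|nk] := pselect (exists k, g k = j).
    apply: absb_le (absb1 k (a j)) => k'; rewrite -kj (inj_eq gi) eq_sym.
    by [].
  have h k : g k != j by apply/eqP => e; apply: nk; exists k.
  apply: (@absb_le _ _ (fun=> 0)) => [k|A].
    by rewrite eq_sym (negbTE (h k)).
  by rewrite big1 ?normr0// => ? _; rewrite normr0.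
split => [av|av].
  exact: hsum_fubini cM row col av.
exact: (hsum_fubini (absb_swap cM) col row av).
Qed.

(** Dominated convergence for series: outside a finite set all the sums are small uniformly in n,
    and on this set the limit may be taken term by term. *)
Lemma hsum_tannery J (a : nat -> J -> R) (b m : J -> R) M (s : nat -> R) v :
  absb m M -> (forall n j, `|a n j| <= m j) ->
  (forall j, a n j @[n --> \oo] --> b j) ->
  (forall n, hsum (a n) (s n)) -> hsum b v -> s @ \oo --> v.
Proof.
move=> mM am ab hs hb.
have m0 j : 0 <= m j by exact: le_trans (am 0 j).
have bm j : `|b j| <= m j.
  have h1 : (`|a n j| : R^o) @[n --> \oo] --> `|b j| by apply: cvg_norm; exact: ab.
  by apply: (ler_cvg_to h1 (cvg_cst (m j))); near=> n; exact: am.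
have [w hw] := absb_hsum mM.
apply/cvgrPdist_le => /= e e0.
have e4 : 0 < e / 8 by lra.
have [A0 h] := hw _ e4.
(* outside A0 every family dominated by m has sum at most e / 4, twice the e / 8 allowed for m *)
have tail (c : J -> R) t : (forall j, `|c j| <= m j) -> hsum c t ->
    `|t - \sum_(i <- A0) c i| <= e / 4.
  move=> cm ct; apply: (hsum_le ct); exists A0 => A sA.
  have -> : \sum_(i <- A) c i - \sum_(i <- A0) c i
     = \sum_(i <- A | i \notin A0) c i.
    rewrite [X in X - _](bigID (mem A0)) /= [X in X + _ - _](_ : _ = \sum_(i <- A0) c i).
      by rewrite addrAC subrr add0r.
    rewrite -big_filter; apply: perm_big; apply: uniq_perm.
    - by rewrite filter_uniq// fset_uniq.
    - exact: fset_uniq.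
    - move=> x; rewrite mem_filter /=; case xA0: (x \in A0) => //=.
      exact: (fsubsetP sA).
  have mA : \sum_(i <- A) m i = \sum_(i <- A0) m i + \sum_(i <- A | i \notin A0) m i.
    rewrite (bigID (mem A0)) /=; congr (_ + _).
    rewrite -big_filter; apply: perm_big; apply: uniq_perm.
    - by rewrite filter_uniq// fset_uniq.
    - exact: fset_uniq.
    - move=> x; rewrite mem_filter /=; case xA0: (x \in A0) => //=.
      exact: (fsubsetP sA).
  apply: (@le_trans _ _ (\sum_(i <- A | i \notin A0) m i)).
    by apply: le_trans (ler_norm_sum _ _ _) _; exact: ler_sum.
  have := h _ sA; have := h _ (fsubset_refl A0); rewrite mA.
  rewrite !ltr_norml; lra.
have cA : \sum_(i <- A0) a n i @[n --> \oo] --> \sum_(i <- A0) b i.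
  by elim: (enum_fset A0) => [|i r IH]; [rewrite big_nil; under eq_fun do rewrite big_nil; exact: cvg_cst|rewrite big_cons; under eq_fun do rewrite big_cons; apply: cvgD].
near=> n.
have h3 : `|\sum_(i <- A0) b i - \sum_(i <- A0) a n i| < e / 4.
  by near: n; move/cvgrPdist_lt : cA; apply; lra.
have h1 := tail _ _ bm hb; have h2 := tail _ _ (am n) (hs n).
move: h1 h2 h3; rewrite ltr_norml !ler_norml; lra.
Unshelve. all: by end_near. Qed.

End UnorderedSums.

(** * Multi-indices and product families *)

Section Multi.
Context {R : realType} {d : nat}.
Implicit Types (I J : multi d).

Definition mono (K : comPzRingType) (x : 'I_d -> K) I : K := \prod_i x i ^+ I i.

Lemma mpowE (K : comPzRingType) (z : 'rV[K]_d) I : mpow z I = mono (z 0) I.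
Proof. by []. Qed.

Lemma monoD (K : comPzRingType) (x : 'I_d -> K) I J : mono x (I + J) = mono x I * mono x J.
Proof. by rewrite /mono -big_split; apply: eq_bigr => i _; rewrite ffunE exprD. Qed.

Lemma mono0 (K : comPzRingType) (x : 'I_d -> K) : mono x 0 = 1.
Proof. by rewrite /mono big1 // => i _; rewrite ffunE expr0. Qed.

Lemma monoM (K : comPzRingType) (x y : 'I_d -> K) I : mono (fun i => x i * y i) I = mono x I * mono y I.
Proof. by rewrite /mono -big_split; apply: eq_bigr => i _; rewrite exprMn. Qed.

Lemma mono_norm (x : 'I_d -> R) I : `|mono x I| = mono (fun i => `|x i|) I.
Proof. by rewrite /mono normr_prod; apply: eq_bigr => i _; rewrite normrX. Qed.

Lemma mono_ge0 (x : 'I_d -> R) I : (forall i, 0 <= x i) -> 0 <= mono x I.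
Proof. by move=> x0; apply: prodr_ge0 => i _; exact: exprn_ge0. Qed.

Lemma mono_gt0 (x : 'I_d -> R) I : (forall i, 0 < x i) -> 0 < mono x I.
Proof. by move=> x0; apply: prodr_gt0 => i _; exact: exprn_gt0. Qed.

Lemma mono_le (x y : 'I_d -> R) I : (forall i, 0 <= x i <= y i) -> mono x I <= mono y I.
Proof.
move=> xy; apply: ler_prod => i _; have /andP[x0 h] := xy i.
by rewrite exprn_ge0//= lerXn2r// nnegrE// (le_trans x0).
Qed.

Lemma monoV (x : 'I_d -> R) I : mono (fun i => (x i)^-1) I = (mono x I)^-1.
Proof. by rewrite /mono -prodfV; apply: eq_bigr => i _; rewrite exprVn. Qed.

(** Boxes exhaust the multi-indices, and a sum of products over a box is a product of sums. *)
Definition box (n : nat) : {fset multi d} :=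
  [fset I in [seq ([ffun i => val (g i)] : multi d) | g : {ffun 'I_d -> 'I_n}]]%fset.

Lemma in_box n I : (I \in box n) = [forall i, (I i < n)%N].
Proof.
rewrite !inE; apply/mapP/forallP => [[g _ ->] i|h].
  by rewrite ffunE; exact: ltn_ord.
exists [ffun i => Ordinal (h i)]; first by rewrite mem_enum.
by apply/ffunP => i; rewrite !ffunE.
Qed.

Lemma big_box (n : nat) (F : multi d -> R) :
  \sum_(I <- box n) F I = \sum_(g : {ffun 'I_d -> 'I_n}) F [ffun i => val (g i)].
Proof.
rewrite -big_enum -(big_map (fun g : {ffun 'I_d -> 'I_n} => [ffun i => val (g i)]) xpredT F) /=.
apply: perm_big; apply: uniq_perm; first exact: fset_uniq.
  rewrite map_inj_uniq ?enum_uniq// => g h /ffunP e.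
  by apply/ffunP => i; apply: val_inj; have := e i; rewrite !ffunE.
by move=> I; rewrite !inE.
Qed.

Lemma box_exhaust (A : {fset multi d}) :
  exists n0, forall n, (n0 <= n)%N -> (A `<=` box n)%fset.
Proof.
exists (\max_(I <- A) \max_i (I i).+1)%N => n h.
apply/fsubsetP => I IA; rewrite in_box; apply/forallP => i.
apply: leq_trans h; apply: leq_trans (leq_bigmax_seq _ IA _) => //.
exact: (@leq_bigmax _ (fun i => (I i).+1) i).
Qed.

Lemma sum_box_prod n (a : 'I_d -> nat -> R) :
  \sum_(I <- box n) \prod_i a i (I i) = \prod_i \sum_(k < n) a i k.
Proof.
rewrite big_box bigA_distr_bigA /=; apply: eq_bigr => g _.
by apply: eq_bigr => i _; rewrite ffunE.
Qed.

(** Sums over boxes factor over the coordinates, so that bounds on the partial sums in each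
    coordinate suffice. *)
Lemma absb_prod (a : 'I_d -> nat -> R) (M : 'I_d -> R) :
  (forall i n, \sum_(k < n) `|a i k| <= M i) ->
  absb (fun I => \prod_i a i (I i)) (\prod_i M i).
Proof.
move=> aM; apply: (absb_exhaust box_exhaust) => n.
rewrite (eq_bigr (fun I : multi d => \prod_i `|a i (I i)|)); last by move=> I _; rewrite normr_prod.
rewrite (sum_box_prod n (fun i k => `|a i k|)).
by apply: ler_prod => i _; rewrite aM sumr_ge0.
Qed.

Lemma cvg_fprod (a : 'I_d -> nat -> R) (s : 'I_d -> R) :
  (forall i, a i n @[n --> \oo] --> s i) ->
  \prod_i a i n @[n --> \oo] --> \prod_i s i.
Proof.
move=> h; elim: (index_enum _) => [|i r IH].
  by rewrite big_nil; under eq_fun do rewrite big_nil; exact: cvg_cst.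
by rewrite big_cons; under eq_fun do rewrite big_cons; apply: cvgM.
Qed.

Lemma hsum_prod (a : 'I_d -> nat -> R) (M s : 'I_d -> R) :
  (forall i n, \sum_(k < n) `|a i k| <= M i) ->
  (forall i, \sum_(k < n) a i k @[n --> \oo] --> s i) ->
  hsum (fun I => \prod_i a i (I i)) (\prod_i s i).
Proof.
move=> aM as_; apply: (exhaust_hsum box_exhaust (absb_prod aM)).
under eq_fun do rewrite sum_box_prod.
exact: cvg_fprod.
Qed.

Lemma absb_geom (q : 'I_d -> R) : (forall i, 0 <= q i < 1) ->
  absb (mono q) (\prod_i (1 - q i)^-1).
Proof.
move=> q01; apply: (absb_prod (a := fun i k => q i ^+ k)) => i n.
have /andP[q0 q1] := q01 i.
under eq_bigr do rewrite ger0_norm ?exprn_ge0//.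
have := subrX1 (q i) n => e.
have -> : \sum_(k < n) q i ^+ k = (1 - q i ^+ n) / (1 - q i).
  rewrite -[q i ^+ n - 1]opprB -[q i - 1]opprB mulNr in e.
  by move/oppr_inj : e => ->; rewrite mulrC mulKf// subr_eq0 gt_eqF.
by rewrite ler_pdivrMr ?subr_gt0// mulVf ?subr_eq0 ?gt_eqF// gerBl exprn_ge0.
Qed.

Lemma mfact_gt0 I : (0 < mfact I)%N.
Proof. by rewrite prodn_gt0// => i; exact: fact_gt0. Qed.

Lemma mfactE I : (mfact I)%:R = \prod_i ((I i)`!)%:R :> R.
Proof. by rewrite /mfact natr_prod. Qed.

Lemma mfact0 : mfact (0 : multi d) = 1%N.
Proof. by rewrite /mfact big1// => i _; rewrite ffunE. Qed.

Lemma expR_partial (x : R) : \sum_(k < n) (x ^+ k / (k`!)%:R) @[n --> \oo] --> expR x.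
Proof.
have := is_cvg_series_exp_coeff x; rewrite /expR => /cvg_ex[l hl].
have -> : limn (series (exp_coeff x)) = l by exact: cvg_lim.
apply: cvg_trans hl; apply: near_eq_cvg; near=> n.
by rewrite /series /= big_mkord.
Unshelve. all: by end_near. Qed.

Lemma expR_partial_le (x : R) n : \sum_(k < n) `|x ^+ k / (k`!)%:R| <= expR `|x|.
Proof.
have h := @expR_partial `|x|.
apply: (ler_cvg_to (cvg_cst (\sum_(k < n) `|x ^+ k / (k`!)%:R|)) h).
near=> m; have nm : (n <= m)%N by near: m; exact: nbhs_infty_ge.
rewrite -(subnK nm) addnC big_split_ord /=.
under eq_bigr do rewrite normrM normrX (@ger0_norm _ (_^-1))//.
by rewrite lerDl sumr_ge0// => i _; rewrite divr_ge0// exprn_ge0.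
Unshelve. all: by end_near. Qed.

(** Together with [hsum_mexp], the exponential series of a sum of d variables as a series over
    multi-indices. *)
Lemma absb_mexp (x : 'I_d -> R) :
  absb (fun I => mono x I / (mfact I)%:R) (expR (\sum_i `|x i|)).
Proof.
rewrite expR_sum; apply: (@absb_le _ _ _ (fun I => \prod_i (x i ^+ I i / ((I i)`!)%:R))) => [I|].
  by rewrite /mono mfactE -prodfV -big_split.
by apply: (@absb_prod (fun i k => x i ^+ k / (k`!)%:R)) => i n; exact: expR_partial_le.
Qed.

Lemma hsum_mexp (x : 'I_d -> R) :
  hsum (fun I => mono x I / (mfact I)%:R) (expR (\sum_i x i)).
Proof.
rewrite expR_sum; apply: (@hsum_ext _ _ (fun I => \prod_i (x i ^+ I i / ((I i)`!)%:R))) => [I|].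
  by rewrite /mono mfactE -prodfV -big_split.
apply: (@hsum_prod (fun i k => x i ^+ k / (k`!)%:R) (fun i => expR `|x i|)) => i.
  by move=> n; exact: expR_partial_le.
exact: expR_partial.
Qed.

End Multi.

(** * Uniqueness of power series coefficients *)

Section Uniqueness.
Context {R : realType} {d : nat}.

(** If all coefficients before the n-th vanish, then a_n t^n is minus the sum of the later terms,
    which is O(t^(n+1)). *)
Lemma pseries_uniq1 (a : nat -> R) (rho : R) : 0 < rho ->
  (forall t, 0 < t < rho -> hsum (fun n => a n * t ^+ n) 0) -> forall n, a n = 0.
Proof.
move=> rho0 h n; elim/ltn_ind : n => n IH.
have [t0 ht0] : exists t0, 0 < t0 < rho by exists (rho / 2); lra.
have /andP[t00 _] := ht0.
have [M hM] := hsum_abs (h _ ht0).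
have M0 := absb_ge0 hM.
have key t : 0 < t < t0 -> `|a n| <= t * (M / t0 ^+ n.+1).
  move=> /andP[tp tt0].
  have ht : 0 < t < rho by rewrite tp (lt_trans tt0)//; case/andP: ht0.
  have H := hsumB (h _ ht) (hsum1 n (a n * t ^+ n)).
  have B : absb (fun m => a m * t ^+ m - (if m == n then a n * t ^+ n else 0))
      (`|(t / t0) ^+ n.+1| * M).
    apply: absb_le (absbZ ((t / t0) ^+ n.+1) hM) => m.
    have [->|mn] := eqVneq m n; first by rewrite subrr normr0.
    rewrite subr0; have [ltmn|] := ltnP m n; first by rewrite IH// !mul0r mulr0 normr0.
    rewrite leq_eqVlt eq_sym (negbTE mn)/= => ltnm.
    rewrite !normrM mulrCA ler_wpM2l// !ger0_norm ?exprn_ge0 ?divr_ge0 ?(ltW tp) ?(ltW t00)//.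
    have -> : t ^+ m = (t / t0) ^+ m * t0 ^+ m.
      by rewrite -exprMn divfK// gt_eqF.
    rewrite ler_wpM2r ?exprn_ge0 ?(ltW t00)//.
    apply: ler_wiXn2l => //; first by rewrite divr_ge0 ?ltW.
    by rewrite ler_pdivrMr// mul1r ltW.
  have := hsum_norm_le B H.
  rewrite sub0r normrN normrM (@ger0_norm _ (t ^+ n)) ?exprn_ge0 ?(ltW tp)//.
  rewrite (@ger0_norm _ ((t / t0) ^+ _)) ?exprn_ge0 ?divr_ge0 ?(ltW tp) ?(ltW t00)//.
  rewrite exprMn exprVn exprSr -!mulrA mulrA [X in _ <= X]mulrC mulrA.
  rewrite -[X in _ <= X]mulrA [X in _ <= X]mulrC => HH.
  rewrite -(ler_pM2r (exprn_gt0 n tp)); apply: le_trans HH _.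
  by rewrite le_eqVlt; apply/orP; left; apply/eqP; ring.
apply/eqP; rewrite -normr_eq0; apply/eqP/le_anti; rewrite normr_ge0 andbT.
have C0 : 0 <= M / t0 ^+ n.+1 by rewrite divr_ge0// exprn_ge0// ltW.
apply/ler_addgt0Pr => e e0; rewrite add0r.
set C := M / _ in C0 key.
have C1 : 0 < C + 1 by lra.
pose t := Num.min (t0 / 2) (e / (C + 1)).
have tp : 0 < t by rewrite lt_min divr_gt0// divr_gt0.
have tt : t < t0 by rewrite gt_min; apply/orP; left; lra.
apply: le_trans (key t _) _; first by rewrite tp.
have : t <= e / (C + 1) by rewrite ge_min lexx orbT.
rewrite ler_pdivlMr//; lra.
Qed.

(** Induction on the set of coordinates which still occur as variables. A coordinate i is removed
    by collecting the powers of x_i and using the uniqueness in one variable; only the multi-indices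
    with exponent N i remain. When no coordinate is left, c N is the only term. *)
Lemma mseries_uniq (c : multi d -> R) (rho : R) : 0 < rho ->
  (forall x : 'I_d -> R, (forall i, 0 < x i < rho) ->
     hsum (fun I => c I * mono x I) 0) -> forall N, c N = 0.
Proof.
move=> rho0 h N.
(* the variables outside l have been frozen: only the multi-indices equal to N there are kept *)
pose fam (l : seq 'I_d) (x : 'I_d -> R) (I : multi d) : R :=
  if [forall i, (i \in l) || (I i == N i)] then c I * \prod_(i <- l) x i ^+ I i else 0.
suff key l : uniq l -> (forall x : 'I_d -> R, (forall i, 0 < x i < rho) -> hsum (fam l x) 0) ->
    c N = 0.
  apply: (key (enum 'I_d)); first exact: enum_uniq.
  move=> x xr; apply: hsum_ext (h x xr) => I; rewrite /fam.
  rewrite ifT; last by apply/forallP => i; rewrite mem_enum.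
  by rewrite /mono big_enum.
elim: l => [_ H|i l IH /= /andP[il ul] H].
  have r2 : forall i : 'I_d, 0 < (fun=> rho / 2) i < rho by move=> _; lra.
  have := H (fun=> rho / 2) r2.
  move=> hh; rewrite -(hsum_uniq hh (_ : hsum _ (c N)))//.
  apply: hsum_ext (hsum1 N (c N)) => I; rewrite /fam big_nil mulr1.
  have [->|IN] := eqVneq I N; first by rewrite ifT//; apply/forallP => i; rewrite eqxx orbT.
  rewrite ifF//; apply/negbTE/forallPn; move/eqP: IN => IN.
  have [//|nh] := pselect (exists x, ~~ ((x \in [::]) || (I x == N x))).
  exfalso; apply: IN; apply/ffunP => i; apply/eqP; rewrite -[_ == _]negbK; apply/negP => ni.
  by apply: nh; exists i.
apply: IH => // x xr.
pose x' (t : R) k := if k == i then t else x k.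
have x'r t : 0 < t < rho -> forall k, 0 < x' t k < rho.
  by move=> tr k; rewrite /x'; case: ifP.
pose t1 := rho / 2; have t1r : 0 < t1 < rho by rewrite /t1; lra.
have famE (t : R) (n : nat) (I : multi d) : (if I i == n then fam (i :: l) (x' t) I else 0) =
    t ^+ n * (if I i == n then (if [forall k, (k \in i :: l) || (I k == N k)]
             then c I * \prod_(k <- l) x k ^+ I k else 0) else 0).
  case: eqP => [In|_]; last by rewrite mulr0.
  rewrite /fam; case: ifP => _; last by rewrite mulr0.
  rewrite big_cons /x' eqxx In mulrCA; congr (_ * (_ * _)).
  apply: eq_big_seq => k kl; case: eqP => // ki.
  by rewrite -ki kl in il.
pose g (n : nat) (I : multi d) := if I i == n then (if [forall k, (k \in i :: l) || (I k == N k)]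
             then c I * \prod_(k <- l) x k ^+ I k else 0) else 0.
have gsum n : exists v, hsum (g n) v.
  have [M hM] := hsum_abs (H _ (x'r _ t1r)).
  apply: (@absb_hsum _ _ _ (`|(t1 ^+ n)^-1| * M)).
  apply: absb_le (absbZ (t1 ^+ n)^-1 hM) => I.
  have := famE t1 n I; rewrite -/(g n I) /g.
  case: eqP => [In ->|_ _]; last by rewrite normr0.
  by rewrite mulKf// expf_neq0// gt_eqF//; case/andP: t1r.
pose s n := projT1 (cid (gsum n)).
have hs n : hsum (g n) (s n) by exact: (projT2 (cid (gsum n))).
have s0 := @pseries_uniq1 s rho rho0 _ (N i).
rewrite -{}s0.
  apply: hsum_ext (hs (N i)) => I; rewrite /g /fam.
  case: eqP => IN.
    congr (if _ then _ else _); apply: eq_forallb => k; rewrite inE.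
    by have [->|_] := eqVneq k i => //=; rewrite IN eqxx orbT.
  rewrite ifF//; apply/negbTE/forallPn; exists i; rewrite (negbTE il) /=.
  exact/eqP.
move=> t tr; have [M hM] := hsum_abs (H _ (x'r _ tr)).
apply: (hsum_fiber (phi := fun I : multi d => I i) hM (H _ (x'r _ tr))) => n.
rewrite mulrC; by apply: hsum_ext (hsumZ (t ^+ n) (hs n)) => I; rewrite famE.
Qed.

End Uniqueness.

(** * Complex derivatives, exponentials and integrals *)

Section ComplexBasics.
Context {R : realType}.
Local Notation C := R[i].
Implicit Types (z w h : C).

Lemma normcE z : `|z| = (normc z)%:C. Proof. by case: z. Qed.

Lemma normc_ge0 z : 0 <= normc z. Proof. by case: z => a b /=; exact: sqrtr_ge0. Qed.

Lemma normcD z w : normc (z + w) <= normc z + normc w.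
Proof. exact: (@le_normcD R z w). Qed.

Lemma normcB z w : normc (z - w) <= normc z + normc w.
Proof. by rewrite -(normcN w); exact: normcD. Qed.

Lemma normc_distC z w : normc (z - w) = normc (w - z).
Proof. by rewrite -opprB; exact: (normcN (w - z)). Qed.

Lemma normcX z n : normc (z ^+ n) = normc z ^+ n.
Proof. by elim: n => [|n IH]; rewrite ?expr0 ?normc1// !exprS normcM IH. Qed.

Lemma normc_real (x : R) : normc x%:C = `|x|.
Proof. by rewrite /= expr0n addr0 sqrtr_sqr. Qed.

Lemma normc_eq0 z : (normc z == 0) = (z == 0).
Proof. by apply/eqP/eqP => [/eq0_normc//|->]; exact: normc0. Qed.

Lemma normc_gt0 z : (0 < normc z) = (z != 0).
Proof. by rewrite lt_def normc_ge0 andbT normc_eq0. Qed.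

Lemma ler_Re z : `|complex.Re z| <= normc z.
Proof.
case: z => a b /=; rewrite -[leLHS]sqrtr_sqr ler_wsqrtr//.
by rewrite lerDl sqr_ge0.
Qed.

Lemma ler_Im z : `|complex.Im z| <= normc z.
Proof.
case: z => a b /=; rewrite -[leLHS]sqrtr_sqr ler_wsqrtr//.
by rewrite lerDr sqr_ge0.
Qed.

Lemma normc_le_ReIm z : normc z <= `|complex.Re z| + `|complex.Im z|.
Proof.
case: z => a b /=.
have -> : `|a| + `|b| = Num.sqrt ((`|a| + `|b|) ^+ 2).
  by rewrite sqrtr_sqr [RHS]ger0_norm ?addr_ge0.
apply: ler_wsqrtr; rewrite sqrrD !real_normK ?num_real// lerD2r lerDl.
by rewrite mulrn_wge0// mulr_ge0.
Qed.

Lemma normc_sum (I : Type) (s : seq I) (P : pred I) (F : I -> C) :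
  normc (\sum_(i <- s | P i) F i) <= \sum_(i <- s | P i) normc (F i).
Proof.
elim/big_rec2 : _ => [|i y x _ h]; first by rewrite normc0.
by apply: le_trans (normcD _ _) _; rewrite lerD2l.
Qed.

Lemma normc_prod (I : Type) (s : seq I) (P : pred I) (F : I -> C) :
  normc (\prod_(i <- s | P i) F i) = \prod_(i <- s | P i) normc (F i).
Proof.
elim/big_rec2 : _ => [|i y x _ h]; first by rewrite normc1.
by rewrite normcM h.
Qed.

Lemma ltc_real (e : C) : 0 < e -> exists2 r : R, 0 < r & e = r%:C.
Proof. by case: e => a b; rewrite ltcE /= => /andP[/eqP-> a0]; exists a. Qed.

Lemma ltcR (a b : R) : (a%:C < b%:C) = (a < b).
Proof. by rewrite ltcR. Qed.

Lemma lecR (a b : R) : (a%:C <= b%:C) = (a <= b).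
Proof. by rewrite lecR. Qed.

(** The norm of the complex field takes values in that field, so neighbourhoods come with complex
    radii. Real radii are used throughout. *)
Lemma nbhs_normc z (A : set C) : nbhs z A <->
  exists2 r : R, 0 < r & forall w, normc (w - z) < r -> A w.
Proof.
split => [/nbhs_ballP[e /= e0 h]|[r r0 h]].
  have [r r0 er] := ltc_real e0; exists r => // w wz; apply: h.
  by rewrite -ball_normE /= er normcE ltcR normc_distC.
apply/nbhs_ballP; exists r%:C => /=; first by rewrite ltcR.
by move=> w; rewrite -ball_normE /= normcE ltcR normc_distC; exact: h.
Qed.

(** Complex differentiability at z with derivative l, in terms of real moduli. *)
Definition cdiff (f : C -> C) z l : Prop := forall e : R, 0 < e ->
  exists2 dl : R, 0 < dl & forall h, normc h < dl ->
    normc (f (z + h) - f z - l * h) <= e * normc h.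

Lemma cdiffP (f : C -> C) z : differentiable f z <-> exists l, cdiff f z l.
Proof.
split.
  move/derivable1_diffP => df; exists ('D_1 f z) => e e0.
  have /cvgrPdist_le /(_ e%:C) : h^-1 *: ((f \o shift z) (h *: 1) - f z) @[h --> 0^'] --> 'D_1 f z by exact: df.
  rewrite ltcR => /(_ e0) /nbhs_normc[dl dl0 hd]; exists dl => // h hdl.
  have [->|h0] := eqVneq h 0.
    by rewrite addr0 subrr mulr0 subrr normc0 mulr0.
  have := hd h; rewrite subr0 => /(_ hdl h0).
  rewrite normcE lecR /= normc_distC => H.
  have -> : f (z + h) - f z - 'D_1 f z * h = h * (h^-1 *: (f (h *: 1 + z) - f z) - 'D_1 f z).
    rewrite mulrBr -[h^-1 *: _]/(h^-1 * _) mulVKf// -[h *: 1]/(h * 1) mulr1 (addrC h).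
    by rewrite (mulrC h).
  by rewrite normcM mulrC ler_wpM2r// normc_ge0.
move=> [l hl]; apply/derivable1_diffP; apply/cvg_ex; exists l.
apply/cvgrPdist_le => e0 /ltc_real[e ep ->].
have [dl dl0 hd] := hl _ ep.
apply/nbhs_normc; exists dl => // h; rewrite subr0 => hdl h0.
rewrite normcE lecR normc_distC.
have hn : 0 < normc h by rewrite normc_gt0.
have := hd _ hdl.
have -> : f (z + h) - f z - l * h = h * (h^-1 *: ((f \o shift z) (h *: 1) - f z) - l).
  rewrite mulrBr -[h^-1 *: _]/(h^-1 * _) mulVKf// /= -[h *: 1]/(h * 1) mulr1 (addrC h).
  by rewrite (mulrC h).
by rewrite normcM mulrC ler_pM2r.
Qed.

Lemma cdiff_unique (f : C -> C) z l l' : cdiff f z l -> cdiff f z l' -> l = l'.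
Proof.
move=> hl hl'; apply/eqP; rewrite -subr_eq0 -normc_eq0 eq_le normc_ge0 andbT.
apply/ler_addgt0Pr => e e0; rewrite add0r.
have e2 : 0 < e / 2 by lra.
have [d1 d10 h1] := hl _ e2; have [d2 d20 h2] := hl' _ e2.
pose r := Num.min d1 d2 / 2.
have r0 : 0 < r by rewrite divr_gt0// lt_min d10.
have rm : r < Num.min d1 d2.
  have : 0 < Num.min d1 d2 by rewrite lt_min d10.
  rewrite /r; lra.
have nr : normc r%:C = r by rewrite normc_real gtr0_norm.
have := h1 r%:C; have := h2 r%:C; rewrite nr.
move: rm; rewrite lt_min => /andP[-> ->] /(_ isT) H2 /(_ isT) H1.
have : normc ((l - l') * r%:C) <= e * r.
  have -> : (l - l') * r%:C = (f (z + r%:C) - f z - l' * r%:C) - (f (z + r%:C) - f z - l * r%:C) by ring.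
  apply: le_trans (normcB _ _) _; lra.
by rewrite normcM nr ler_pM2r.
Qed.

Definition ccont (f : C -> C) z := forall e : R, 0 < e ->
  exists2 dl : R, 0 < dl & forall w, normc (w - z) < dl -> normc (f w - f z) < e.

Lemma ccontP (f : C -> C) z : {for z, continuous f} <-> ccont f z.
Proof.
split => [/cvgrPdist_lt h e e0|h].
  have /nbhs_normc[dl dl0 H] := h e%:C ltac:(by rewrite ltcR).
  by exists dl => // w /H /=; rewrite normcE ltcR normc_distC.
apply/(@cvgrPdist_lt _ _ _ (nbhs z)) => e' /ltc_real[e e0 ->].
have [dl dl0 H] := h _ e0.
by apply/nbhs_normc; exists dl => // w /H; rewrite normcE ltcR normc_distC.
Qed.

Lemma diff_ccont (f : C -> C) z : differentiable f z -> ccont f z.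
Proof. by move/differentiable_continuous/ccontP. Qed.

End ComplexBasics.

Arguments normc : simpl never.

Section Cexp.
Context {R : realType}.
Local Notation C := R[i].
Implicit Types (z w h : C).

Lemma cexpD z w : cexp (z + w) = cexp z * cexp w.
Proof.
case: z => a b; case: w => c e; rewrite /cexp /= expRD cosD sinD.
by apply/eqP; rewrite eq_complex /=; apply/andP; split; apply/eqP; ring.
Qed.

Lemma cexp0 : cexp 0 = 1 :> C.
Proof. by rewrite /cexp /= expR0 cos0 sin0 mulr1 mulr0. Qed.

Lemma cexp_neq0 z : cexp z != 0.
Proof.
apply/eqP => e; have := cexpD z (- z); rewrite subrr e mul0r cexp0 => /eqP.
by rewrite oner_eq0.
Qed.

Lemma cexpN z : cexp (- z) = (cexp z)^-1.
Proof.
apply: (mulfI (cexp_neq0 z)); rewrite -cexpD subrr cexp0 mulfV//.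
exact: cexp_neq0.
Qed.

Lemma cexp_real (x : R) : cexp x%:C = (expR x)%:C.
Proof. by rewrite /cexp /= cos0 sin0 mulr1 mulr0. Qed.

Lemma normc_cexp z : normc (cexp z) = expR (complex.Re z).
Proof.
rewrite /cexp /normc /= !exprMn -mulrDr cos2Dsin2 mulr1 sqrtr_sqr ger0_norm// expR_ge0.
Qed.

Lemma cexp_2pi (x y : R) : cexp (x +i* (y + pi *+ 2)) = cexp (x +i* y).
Proof. by rewrite /cexp /= cosD2pi sinD2pi. Qed.

Lemma normc_polar (r t : R) : 0 <= r -> normc (r%:C * cexp (0 +i* t)) = r.
Proof. by move=> r0; rewrite normcM normc_cexp [complex.Re _]/= expR0 mulr1 normc_real ger0_norm. Qed.

Lemma real_diff0 (f : R -> R) l : is_derive (0 : R) 1 f l -> forall e : R, 0 < e ->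
  exists2 dl : R, 0 < dl & forall h : R, `|h| < dl -> `|f h - f 0 - l * h| <= e * `|h|.
Proof.
move=> df e e0.
have [dv dE] := df.
have /cvgrPdist_le /(_ e e0) : h^-1 *: ((f \o shift 0) (h *: 1) - f 0) @[h --> 0^'] --> l.
  by rewrite -dE; exact: dv.
move=> /nbhs_ballP[dl /= dl0 hd]; exists dl => // h hdl.
have [->|h0] := eqVneq h 0; first by rewrite subrr mulr0 subrr normr0 mulr0.
have := hd h; rewrite /ball /= sub0r normrN => /(_ hdl h0).
rewrite distrC => H.
have -> : f h - f 0 - l * h = h * (h^-1 *: (f (h *: 1 + 0) - f 0) - l).
  rewrite mulrBr -[h^-1 *: _]/(h^-1 * _) mulVKf// -[h *: 1]/(h * 1) mulr1 addr0.
  by rewrite (mulrC h).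
by rewrite normrM mulrC ler_wpM2r.
Qed.

(** The real and the imaginary parts of cexp h - 1 - h are combinations of the first-order
    remainders of exp, cos and sin at 0. *)
Lemma cexp_diff0 : cdiff (@cexp R) (0 : C) 1.
Proof.
move=> e e0.
have e8 : 0 < e / 8 by lra.
have dexp : is_derive (0 : R) 1 expR 1 by have := @is_derive_expR R 0; rewrite expR0.
have dcos : is_derive (0 : R) 1 cos 0 by have := @is_derive_cos R 0; rewrite sin0 oppr0.
have dsin : is_derive (0 : R) 1 sin 1 by have := @is_derive_sin R 0; rewrite cos0.
have [d1 d10 h1] := real_diff0 dexp e8.
have [d2 d20 h2] := real_diff0 dcos e8.
have [d3 d30 h3] := real_diff0 dsin e8.
pose dl := Num.min (Num.min d1 d2) (Num.min d3 (Num.min 1 (e / 8))).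
exists dl; first by rewrite !lt_min d10 d20 d30 ltr01.
case=> a b hab.
have ha := le_lt_trans (ler_Re _) hab; have hb := le_lt_trans (ler_Im _) hab.
rewrite /= /dl !lt_min in ha hb.
have [[a1 _] [_ [a4 a5]]] : (`|a| < d1 /\ `|a| < d2) /\ (`|a| < d3 /\ (`|a| < 1 /\ `|a| < e / 8)).
  by move: ha => /andP[/andP[-> ->] /andP[-> /andP[-> ->]]].
have [[_ b2] [b3 [b4 b5]]] : (`|b| < d1 /\ `|b| < d2) /\ (`|b| < d3 /\ (`|b| < 1 /\ `|b| < e / 8)).
  by move: hb => /andP[/andP[-> ->] /andP[-> /andP[-> ->]]].
have := h1 _ a1; have := h2 _ b2; have := h3 _ b3.
rewrite expR0 cos0 sin0 !mul1r mul0r !subr0.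
have na := ler_Re (a +i* b); have nb := ler_Im (a +i* b); simpl complex.Re in na; simpl complex.Im in nb.
have hn := normc_ge0 (a +i* b).
rewrite [0 + _]add0r cexp0.
set N := normc _ in na nb hn *.
move=> hS hC hE; apply: le_trans (normc_le_ReIm _) _; move: hS hC hE.
rewrite /cexp [complex.Re _]/= [complex.Im _]/=.
set E := expR a; set Cc := cos b; set S := sin b => hS hC hE.
have ea : e / 8 * `|a| <= e / 8 * N by rewrite ler_wpM2l// ltW.
have eb : e / 8 * `|b| <= e / 8 * N by rewrite ler_wpM2l// ltW.
have a0 := normr_ge0 a; have b0 := normr_ge0 b.
have C1 : `|Cc| <= 1 by rewrite ler_norml cos_geN1 cos_le1.
have S1 : `|S| <= 1 by rewrite ler_norml sin_geN1 sin_le1.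
have -> : E * Cc - 1 - a = (E - 1 - a) * Cc + (Cc - 1) * (1 + a) by ring.
have -> : E * S - 0 - b = (E - 1 - a) * S + (S - b) * (1 + a) + b * a by ring.
have t1 : `|(E - 1 - a) * Cc| <= e / 8 * N.
  by rewrite normrM (le_trans (ler_piMr _ C1))// (le_trans hE).
have t2 : `|(E - 1 - a) * S| <= e / 8 * N.
  by rewrite normrM (le_trans (ler_piMr _ S1))// (le_trans hE).
have a2 : `|1 + a| <= 2.
  by rewrite (le_trans (ler_normD _ _))// normr1 -[2]/(1 + 1)%:R natrD lerD2l ltW.
have t3 : `|(Cc - 1) * (1 + a)| <= e / 8 * N * 2.
  by rewrite normrM ler_pM// (le_trans hC).
have t4 : `|(S - b) * (1 + a)| <= e / 8 * N * 2.
  by rewrite normrM ler_pM// (le_trans hS).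
have t5 : `|b * a| <= N * (e / 8) by rewrite normrM; apply: ler_pM => //; exact: ltW.
apply: (@le_trans _ _ (e / 8 * N + e / 8 * N * 2 + (e / 8 * N + e / 8 * N * 2 + N * (e / 8)))).
  apply: lerD; first by rewrite (le_trans (ler_normD _ _))// lerD.
  rewrite (le_trans (ler_normD _ _))// lerD//.
  by rewrite (le_trans (ler_normD _ _))// lerD.
have q0 : 0 <= e / 8 * N by rewrite mulr_ge0// ltW.
have -> : e * N = e / 8 * N * 8 by field.
rewrite [N * (e / 8)]mulrC; move: q0; set q := e / 8 * N; clear; lra.
Qed.

Lemma cexp_diff z : cdiff (@cexp R) z (cexp z).
Proof.
move=> e e0; have nz : 0 < normc (cexp z) by rewrite normc_gt0 cexp_neq0.
have [dl dl0 hd] := cexp_diff0 (divr_gt0 e0 nz).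
exists dl => // h /hd; rewrite add0r cexp0 mul1r cexpD => H.
have -> : cexp z * cexp h - cexp z - cexp z * h = cexp z * (cexp h - 1 - h) by ring.
by rewrite normcM mulrC -ler_pdivlMr// mulrAC.
Qed.

Lemma differentiable_cexp z : differentiable (@cexp R) z.
Proof. by apply/cdiffP; exists (cexp z); exact: cexp_diff. Qed.

End Cexp.

Section Cint.
Context {R : realType}.
Local Notation C := R[i].
Local Notation mu := (@lebesgue_measure R).

Definition cint (a b : R) (g : R -> C) : C :=
  (\int[mu]_(x in `[a, b]) complex.Re (g x))%R +i* (\int[mu]_(x in `[a, b]) complex.Im (g x))%R.

(** Continuity is asked of g on a neighbourhood of every point of [a, b], including points outside
    of the interval. *)
Definition rcont (a b : R) (g : R -> C) := forall x : R, a <= x <= b ->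
  forall e : R, 0 < e -> exists2 dl : R, 0 < dl & forall y : R, `|y - x| < dl -> normc (g y - g x) < e.

Lemma rcont_integrable a b g : rcont a b g ->
  mu.-integrable `[a, b] (EFin \o (fun x => complex.Re (g x))) /\
  mu.-integrable `[a, b] (EFin \o (fun x => complex.Im (g x))).
Proof.
move=> cg; split; apply: continuous_compact_integrable; try exact: segment_compact.
- apply: continuous_in_subspaceT => x /set_mem /=; rewrite in_itv /= => xab.
  apply/(@cvgrPdist_lt _ _ _ (nbhs x)) => e e0; have [dl dl0 h] := cg _ xab _ e0.
  apply/nbhs_ballP; exists dl => //= y; rewrite /ball /= distrC => /h H.
  apply: le_lt_trans H; rewrite distrC; apply: le_trans (ler_Re _).
  by case: (g y) => ? ?; case: (g x).
- apply: continuous_in_subspaceT => x /set_mem /=; rewrite in_itv /= => xab.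
  apply/(@cvgrPdist_lt _ _ _ (nbhs x)) => e e0; have [dl dl0 h] := cg _ xab _ e0.
  apply/nbhs_ballP; exists dl => //= y; rewrite /ball /= distrC => /h H.
  apply: le_lt_trans H; rewrite distrC; apply: le_trans (ler_Im _).
  by case: (g y) => ? ?; case: (g x).
Qed.

Lemma rcont_cst a b (c : C) : rcont a b (fun=> c).
Proof. by move=> x _ e e0; exists 1 => // y _; rewrite subrr normc0. Qed.

Lemma rcontD a b g h : rcont a b g -> rcont a b h -> rcont a b (fun x => g x + h x).
Proof.
move=> cg ch x xab e e0; have e2 : 0 < e / 2 by lra.
have [d1 d10 h1] := cg _ xab _ e2; have [d2 d20 h2] := ch _ xab _ e2.
exists (Num.min d1 d2); first by rewrite lt_min d10.
move=> y; rewrite lt_min => /andP[/h1 H1 /h2 H2].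
rewrite opprD addrACA; apply: le_lt_trans (normcD _ _) _; lra.
Qed.

Lemma rcontZ a b c g : rcont a b g -> rcont a b (fun x => c * g x).
Proof.
move=> cg x xab e e0; have [->|c0] := eqVneq c 0.
  by exists 1 => // y _; rewrite !mul0r subrr normc0.
have nc : 0 < normc c by rewrite normc_gt0.
have [dl dl0 h] := cg _ xab (e / normc c) (divr_gt0 e0 nc).
by exists dl => // y /h H; rewrite -mulrBr normcM mulrC -ltr_pdivlMr.
Qed.

Lemma cintD a b g h : rcont a b g -> rcont a b h ->
  cint a b (fun x => g x + h x) = cint a b g + cint a b h.
Proof.
move=> /rcont_integrable[g1 g2] /rcont_integrable[h1 h2]; rewrite /cint.
under eq_Rintegral => x _. 
  have -> : complex.Re (g x + h x) = complex.Re (g x) + complex.Re (h x) by case: (g x) => ? ?; case: (h x).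
  over.
rewrite RintegralD//.
rewrite [X in _ +i* X](_ : _ = \int[mu]_(x in `[a, b]) (complex.Im (g x) + complex.Im (h x))); last first.
  by apply: eq_Rintegral => x _; case: (g x) => ? ?; case: (h x).
by rewrite RintegralD.
Qed.

Lemma cintZ a b c g : rcont a b g -> cint a b (fun x => c * g x) = c * cint a b g.
Proof.
move=> /rcont_integrable[g1 g2]; rewrite /cint; case: c => c1 c2.
rewrite [X in X +i* _](_ : _ = \int[mu]_(x in `[a, b]) (c1 * complex.Re (g x) - c2 * complex.Im (g x))); last first.
  by apply: eq_Rintegral => x _; case: (g x) => ? ?.
rewrite [X in _ +i* X](_ : _ = \int[mu]_(x in `[a, b]) (c1 * complex.Im (g x) + c2 * complex.Re (g x))); last first.
  by apply: eq_Rintegral => x _; case: (g x) => ? ?.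
have i1 c f : mu.-integrable `[a, b] (EFin \o f) -> mu.-integrable `[a, b] (EFin \o (fun x => c * f x)).
  by move=> fi; apply: eq_integrable (integrableZl _ c fi).
rewrite RintegralB ?RintegralD//; try exact: i1.
by rewrite !RintegralZl.
Qed.

Lemma cint_cst a b c : a <= b -> cint a b (fun=> c) = c * (b - a)%:C.
Proof.
move=> ab; rewrite /cint !Rintegral_cst//= lebesgue_measure_itv/= lte_fin.
case: c => c1 c2 /=; move: ab; rewrite le_eqVlt => /orP[/eqP->|ab].
  by rewrite ltxx subrr /= !mulr0.
by rewrite ab /=; apply/eqP; rewrite eq_complex /= !mulr0 subr0 add0r !eqxx.
Qed.

Lemma cint_split a c b g : a <= c <= b -> rcont a b g ->
  cint a b g = cint a c g + cint c b g.
Proof.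
move=> /andP[ac cb] cg; have [g1 g2] := rcont_integrable cg; rewrite /cint.
have S f : mu.-integrable `[a, b] (EFin \o f) ->
    \int[mu]_(x in `[a, b]) f x = \int[mu]_(x in `[a, c]) f x + \int[mu]_(x in `[c, b]) f x.
  move=> fi; have := @Rintegral_itvB _ f (BLeft a) (BRight b) c fi.
  rewrite !bnd_simp => /(_ ac cb) h.
  rewrite -(Rintegral_itv_obnd_cbnd (r := c)); last first.
    apply: integrableS fi => //; apply: subset_itvr.
    by rewrite bnd_simp.
  rewrite -h; ring.
by rewrite !S.
Qed.

Lemma cint_eq a b g h : (forall x, a <= x <= b -> g x = h x) -> cint a b g = cint a b h.
Proof.
by move=> gh; rewrite /cint; congr (_ +i* _); apply: eq_Rintegral => x /set_mem /=;
   rewrite in_itv /= => /gh ->.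
Qed.

(** After a rotation which makes the integral a nonnegative real number, the estimate is the one for
    the real part of the integrand. *)
Lemma cint_bound a b g M : a <= b -> rcont a b g -> (forall x, a <= x <= b -> normc (g x) <= M) ->
  normc (cint a b g) <= M * (b - a).
Proof.
move=> ab cg gM.
have M0 : 0 <= M by apply: le_trans (gM a _); rewrite ?normc_ge0 ?lexx.
set J := cint a b g.
have [->|J0] := eqVneq J 0; first by rewrite normc0 mulr_ge0// subr_ge0.
have nJ : 0 < normc J by rewrite normc_gt0.
pose u : C := (normc J)%:C / J.
have nu : normc u = 1 by rewrite normcM normcV normc_real ger0_norm ?normc_ge0// mulfV// gt_eqF.
have eu : cint a b (fun x => u * g x) = (normc J)%:C by rewrite cintZ// /u divfK.
have -> : normc J = complex.Re (cint a b (fun x => u * g x)) by rewrite eu.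
rewrite /cint /=.
have [i1 i2] := rcont_integrable (rcontZ u cg).
have -> : M * (b - a) = \int[mu]_(x in `[a, b]) M.
  rewrite Rintegral_cst//= lebesgue_measure_itv/= lte_fin.
  by move: ab; rewrite le_eqVlt => /orP[/eqP->|ab]; rewrite ?ltxx ?subrr//= ab.
apply: le_Rintegral => //.
  by have [] := rcont_integrable (@rcont_cst a b M%:C).
move=> x /=; rewrite in_itv /= => xab.
apply: le_trans (ler_norm _) _; apply: le_trans (ler_Re _) _.
by rewrite normcM nu mul1r gM.
Qed.

End Cint.

(** * Goursat's theorem on rectangles *)

Section Goursat.
Context {R : realType}.
Local Notation C := R[i].

(** The integral along the boundary of [x, x + w] x [y, y + k], counterclockwise. *)
Definition contour (h : C -> C) (x y w k : R) : C :=
  cint x (x + w) (fun t => h (t +i* y)) - cint x (x + w) (fun t => h (t +i* (y + k)))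
  + 'i%C * (cint y (y + k) (fun t => h ((x + w) +i* t)) - cint y (y + k) (fun t => h (x +i* t))).

Lemma rcontH (h : C -> C) a b y : (forall x, a <= x <= b -> ccont h (x +i* y)) ->
  rcont a b (fun t => h (t +i* y)).
Proof.
move=> ch x xab e e0; have [dl dl0 H] := ch _ xab _ e0.
exists dl => // t tx; apply: H; apply: le_lt_trans tx.
by rewrite /normc /= subrr expr0n /= addr0 sqrtr_sqr.
Qed.

Lemma rcontV (h : C -> C) a b x : (forall y, a <= y <= b -> ccont h (x +i* y)) ->
  rcont a b (fun t => h (x +i* t)).
Proof.
move=> ch y yab e e0; have [dl dl0 H] := ch _ yab _ e0.
exists dl => // t tx; apply: H; apply: le_lt_trans tx.
by rewrite /normc /= subrr expr0n /= add0r sqrtr_sqr.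
Qed.

Lemma contourD (h1 h2 : C -> C) x y w k : 0 <= w -> 0 <= k ->
  (forall a b, x <= a <= x + w -> y <= b <= y + k -> ccont h1 (a +i* b)) ->
  (forall a b, x <= a <= x + w -> y <= b <= y + k -> ccont h2 (a +i* b)) ->
  contour (fun z => h1 z + h2 z) x y w k = contour h1 x y w k + contour h2 x y w k.
Proof.
move=> w0 k0 c1 c2; rewrite /contour !cintD; first ring;
  try (apply: rcontH => t ht; solve [apply: c1; lra|apply: c2; lra]);
  try (apply: rcontV => t ht; solve [apply: c1; lra|apply: c2; lra]).
Qed.

Lemma differentiable_affine (c l z : C) : differentiable (fun z => c + l * z) z.
Proof.
apply/cdiffP; exists l => e e0; exists 1 => // h _.
have -> : c + l * (z + h) - (c + l * z) - l * h = 0 by ring.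
by rewrite normc0 mulr_ge0 ?normc_ge0// ltW.
Qed.

(** On opposite sides the values of an affine function differ by a constant, l w or i l k. *)
Lemma contour_affine (c l : C) x y w k : 0 <= w -> 0 <= k ->
  contour (fun z => c + l * z) x y w k = 0.
Proof.
move=> w0 k0; rewrite /contour.
have cH (b : R) : rcont x (x + w) (fun t : R => c + l * (t +i* b)).
  by apply: (rcontH (h := fun z => c + l * z)) => t _; apply: diff_ccont; exact: differentiable_affine.
have cV (a : R) : rcont y (y + k) (fun t : R => c + l * (a +i* t)).
  by apply: (rcontV (h := fun z => c + l * z)) => t _; apply: diff_ccont; exact: differentiable_affine.
rewrite (@cint_eq _ x (x + w) (fun t => c + l * (t +i* (y + k))) (fun t => (c + l * (t +i* y)) + l * ('i%C * k%:C))); last first.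
  move=> t _; rewrite -addrA -mulrDr; congr (_ + _ * _).
  by apply/eqP; rewrite eq_complex /=; apply/andP; split; apply/eqP; ring.
rewrite (@cint_eq _ y (y + k) (fun t => c + l * ((x + w) +i* t)) (fun t => (c + l * (x +i* t)) + l * w%:C)); last first.
  move=> t _; rewrite -addrA -mulrDr; congr (_ + _ * _).
  by apply/eqP; rewrite eq_complex /=; apply/andP; split; apply/eqP; ring.
rewrite (cintD (cH y) (@rcont_cst _ _ _ _)) (cintD (cV x) (@rcont_cst _ _ _ _)).
rewrite !cint_cst; [|lra|lra].
have -> : x + w - x = w by ring.
have -> : y + k - y = k by ring.
ring.
Qed.

Arguments contour : simpl never.

Variable g : C -> C.
Variables (X Y W K : R).
Hypothesis (W0 : 0 <= W) (K0 : 0 <= K).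
Hypothesis dg : forall x y, X <= x <= X + W -> Y <= y <= Y + K -> differentiable g (x +i* y).

Definition inrect x y w k := [/\ X <= x, x + w <= X + W, Y <= y, y + k <= Y + K & (0 <= w) && (0 <= k)].

Lemma contour4 x y w k : inrect x y (w *+ 2) (k *+ 2) ->
  contour g x y (w *+ 2) (k *+ 2) = contour g x y w k + contour g (x + w) y w k
    + (contour g x (y + k) w k + contour g (x + w) (y + k) w k).
Proof.
move=> [xX xW yY yK /andP[w0 k0]]; move: w0 k0; rewrite !pmulrn_lge0// => w0 k0.
have cc a b : X <= a <= X + W -> Y <= b <= Y + K -> ccont g (a +i* b).
  by move=> ha hb; apply: diff_ccont; exact: dg.
have e1 : x + w *+ 2 = x + w + w by rewrite mulr2n addrA.
have e2 : y + k *+ 2 = y + k + k by rewrite mulr2n addrA.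
have cH b : Y <= b <= Y + K -> rcont x (x + w + w) (fun t => g (t +i* b)).
  move=> hb; apply: rcontH => t ht; apply: cc => //; rewrite -e1 in ht; lra.
have cV a : X <= a <= X + W -> rcont y (y + k + k) (fun t => g (a +i* t)).
  move=> hb; apply: rcontV => t ht; apply: cc => //; rewrite -e2 in ht; lra.
rewrite /contour e1 e2.
rewrite !(@cint_split _ x (x + w) (x + w + w)); [|lra|apply: cH; lra|lra|apply: cH; lra].
rewrite !(@cint_split _ y (y + k) (y + k + k)); [|lra|apply: cV; lra|lra|apply: cV; lra].
ring.
Qed.

(** Up to an affine function, whose contour integral vanishes, g is at most e (w + k) / 2 on the
    rectangle, and the perimeter is 2 (w + k). *)
Lemma contour_small (z0 : C) : differentiable g z0 -> forall e : R, 0 < e ->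
  exists2 dl : R, 0 < dl & forall x y w k, inrect x y w k ->
    x <= complex.Re z0 <= x + w -> y <= complex.Im z0 <= y + k -> w + k < dl ->
    normc (contour g x y w k) <= e * (w + k) ^+ 2.
Proof.
move=> /cdiffP[l hl] e e0; have e2 : 0 < e / 2 by lra.
have [dl dl0 hd] := hl _ e2; exists dl => // x y w k [xX xW yY yK /andP[w0 k0]] hx hy hwk.
pose r (z : C) := g z - g z0 - l * (z - z0).
have zz (a b : R) : x <= a <= x + w -> y <= b <= y + k -> normc ((a +i* b) - z0) <= w + k.
  move=> ha hb; case: z0 hx hy {hl hd r} => p q /= hx hy.
  apply: le_trans (normc_le_ReIm ((a - p) +i* (b - q))) _ => /=.
  apply: lerD; rewrite ler_norml; lra.
have rb a b : x <= a <= x + w -> y <= b <= y + k -> normc (r (a +i* b)) <= e / 2 * (w + k).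
  move=> ha hb; have h1 := zz _ _ ha hb.
  have := hd ((a +i* b) - z0) (le_lt_trans h1 hwk).
  rewrite [z0 + _]addrC subrK => H; apply: le_trans H _.
  by rewrite ler_wpM2l// ltW.
have dr a b : x <= a <= x + w -> y <= b <= y + k -> ccont r (a +i* b).
  move=> ha hb; apply: diff_ccont; rewrite /r.
  apply: differentiableB; last first.
    apply: differentiableM; first exact: differentiable_cst.
    by apply: differentiableB; [exact: ex_diff|exact: differentiable_cst].
  by apply: differentiableB; [apply: dg; lra|exact: differentiable_cst].
have -> : contour g x y w k = contour r x y w k.
  have gE : g = fun z => r z + ((g z0 - l * z0) + l * z).
    by apply/funext => z; rewrite /r; ring.
  rewrite [in LHS]gE contourD//; first by rewrite contour_affine// addr0.
  by move=> a b ha hb; apply: diff_ccont; exact: differentiable_affine.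
rewrite /contour.
have rH (b : R) : y <= b <= y + k -> rcont x (x + w) (fun t : R => r (t +i* b)).
  by move=> hb; apply: rcontH => t ht; exact: dr.
have rV (a : R) : x <= a <= x + w -> rcont y (y + k) (fun t : R => r (a +i* t)).
  by move=> hb; apply: rcontV => t ht; exact: dr.
have bH (b : R) : y <= b <= y + k -> normc (cint x (x + w) (fun t => r (t +i* b))) <= e / 2 * (w + k) * w.
  move=> hb; have -> : e / 2 * (w + k) * w = e / 2 * (w + k) * (x + w - x) by ring.
  by apply: cint_bound; [lra|exact: rH|move=> t ht; exact: rb].
have bV (a : R) : x <= a <= x + w -> normc (cint y (y + k) (fun t => r (a +i* t))) <= e / 2 * (w + k) * k.
  move=> hb; have -> : e / 2 * (w + k) * k = e / 2 * (w + k) * (y + k - y) by ring.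
  by apply: cint_bound; [lra|exact: rV|move=> t ht; exact: rb].
apply: le_trans (normcD _ _) _; rewrite normcM.
have -> : normc 'i%C = 1 :> R by rewrite /normc expr0n expr1n add0r sqrtr1.
rewrite mul1r; apply: le_trans (lerD (normcB _ _) (normcB _ _)) _.
have -> : e * (w + k) ^+ 2 = (e / 2 * (w + k) * w + e / 2 * (w + k) * w) + (e / 2 * (w + k) * k + e / 2 * (w + k) * k).
  by rewrite expr2; field.
by apply: lerD; apply: lerD; [apply: bH|apply: bH|apply: bV|apply: bV]; lra.
Qed.

Definition bad_rect (e : R) (n : nat) (p : R * R) :=
  let w := W / 2 ^+ n in let k := K / 2 ^+ n in
  inrect p.1 p.2 w k /\ e * (w + k) ^+ 2 < normc (contour g p.1 p.2 w k).

(** The contour integral is the sum of those over the four quarters, and the bound is divided by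
    four when the sides are halved; one of the quarters exceeds it. *)
Lemma bad_rect_child e n p : bad_rect e n p -> exists q, bad_rect e n.+1 q /\
   (p.1 <= q.1 /\ q.1 + W / 2 ^+ n.+1 <= p.1 + W / 2 ^+ n) /\
   (p.2 <= q.2 /\ q.2 + K / 2 ^+ n.+1 <= p.2 + K / 2 ^+ n).
Proof.
case: p => x y [ir hb]; rewrite [_.1]/= [_.2]/= in ir hb *.
set w := W / 2 ^+ n.+1; set k := K / 2 ^+ n.+1.
have w0 : 0 <= w by rewrite divr_ge0// exprn_ge0.
have k0 : 0 <= k by rewrite divr_ge0// exprn_ge0.
have ew : W / 2 ^+ n = w *+ 2.
  by rewrite /w exprS; field; rewrite expf_neq0.
have ek : K / 2 ^+ n = k *+ 2.
  by rewrite /k exprS; field; rewrite expf_neq0.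
rewrite ew ek in ir hb *.
have [xX xW yY yK _] := ir.
have [//|nb] := pselect (exists q, bad_rect e n.+1 q /\
   (x <= q.1 /\ q.1 + w <= x + w *+ 2) /\ (y <= q.2 /\ q.2 + k <= y + k *+ 2)).
exfalso; move: hb; apply/negP; rewrite -leNgt contour4//.
have ok q : x <= q.1 -> q.1 <= x + w -> y <= q.2 -> q.2 <= y + k ->
    normc (contour g q.1 q.2 w k) <= e * (w + k) ^+ 2.
  move=> h1 h2 h3 h4; rewrite leNgt; apply/negP => hq; apply: nb; exists q.
  split; last by split; split => //; lra.
  by split => //; split; rewrite -/w -/k ?w0 ?k0//; lra.
have := ok (x, y); have := ok (x + w, y); have := ok (x, y + k); have := ok (x + w, y + k).
rewrite /= !lexx !lerDl => /(_ w0 isT k0 isT) o1 /(_ isT w0 k0 isT) o2 /(_ w0 isT isT k0) o3 /(_ isT w0 isT k0) o4.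
apply: le_trans (normcD _ _) _.
apply: le_trans (lerD (normcD _ _) (normcD _ _)) _.
have -> : e * (w *+ 2 + k *+ 2) ^+ 2 = e * (w + k) ^+ 2 *+ 4 by ring.
set E := e * _ in o1 o2 o3 o4 *.
have -> : E *+ 4 = (E + E) + (E + E) by ring.
by apply: lerD; apply: lerD.
Qed.

(** If the integral did not vanish, repeated bisection would give nested rectangles with integrals
    exceeding e (w + k)^2. They shrink to a point, where [contour_small] contradicts this. *)
Theorem goursat : contour g X Y W K = 0.
Proof.
apply/eqP; rewrite -normc_eq0 eq_le normc_ge0 andbT leNgt; apply/negP => c0.
(* small enough for the whole rectangle to be bad; the summand 1 keeps the denominator positive *)
pose e := normc (contour g X Y W K) / (2 * ((W + K) ^+ 2 + 1)).
have sq0 : 0 <= (W + K) ^+ 2 by rewrite sqr_ge0.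
have e0 : 0 < e by rewrite divr_gt0// mulr_gt0//; lra.
have b0 : bad_rect e 0 (X, Y).
  split => /=; rewrite expr0 !divr1; first by split; rewrite ?lexx ?W0.
  rewrite /e mulrAC -mulrA gtr_pMr// ltr_pdivrMr; lra.
pose nxt n p := match pselect (bad_rect e n p) with left b => projT1 (cid (bad_rect_child b)) | right _ => p end.
pose q := fix q n := match n with 0 => (X, Y) | m.+1 => nxt m (q m) end.
have bq n : bad_rect e n (q n).
  elim: n => [|n IH]; first exact: b0.
  rewrite -[q n.+1]/(nxt n (q n)) /nxt; case: pselect => // b.
  by have [] := projT2 (cid (bad_rect_child b)).
have step n : ((q n).1 <= (q n.+1).1 /\ (q n.+1).1 + W / 2 ^+ n.+1 <= (q n).1 + W / 2 ^+ n) /\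
   ((q n).2 <= (q n.+1).2 /\ (q n.+1).2 + K / 2 ^+ n.+1 <= (q n).2 + K / 2 ^+ n).
  rewrite -[q n.+1]/(nxt n (q n)) /nxt; case: pselect => // b.
  by have [] := projT2 (cid (bad_rect_child b)).
have lim1 (u : nat -> R) (V : R) : 0 <= V ->
    (forall n, u n <= u n.+1 /\ u n.+1 + V / 2 ^+ n.+1 <= u n + V / 2 ^+ n) ->
    exists a, forall n, u n <= a <= u n + V / 2 ^+ n.
  move=> V0 hu.
  have up n m : u n <= u (m + n)%N.
    by elim: m => [//|m IH]; rewrite addSn (le_trans IH)//; have [] := hu (m + n)%N.
  have dn n m : u (m + n)%N + V / 2 ^+ (m + n) <= u n + V / 2 ^+ n.
    elim: m => [//|m IH]; rewrite addSn; apply: le_trans IH.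
    by have [] := hu (m + n)%N.
  have vn n : 0 <= V / 2 ^+ n by rewrite divr_ge0// exprn_ge0.
  have ub n m : u m <= u n + V / 2 ^+ n.
    have [h|/ltnW h] := leqP n m.
      by have := dn n (m - n)%N; rewrite subnK//; have := vn m; lra.
    by have := up m (n - m)%N; rewrite subnK//; have := vn n; lra.
  exists (sup (range u)) => n; apply/andP; split.
    apply: ub_le_sup; last by exists n.
    by exists (u 0%N + V / 2 ^+ 0) => _ [m _ <-].
  apply: ge_sup; first by exists (u 0%N); exists 0%N.
  by move=> _ [m _ <-].
have [a ha] := lim1 (fun n => (q n).1) W W0 (fun n => (step n).1).
have [b hb] := lim1 (fun n => (q n).2) K K0 (fun n => (step n).2).
have dz : differentiable g (a +i* b).
  apply: dg; first by have := ha 0%N; rewrite expr0 divr1.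
  by have := hb 0%N; rewrite expr0 divr1.
have [dl dl0 hdl] := contour_small dz e0.
have [n hn] : exists n, (W + K) / 2 ^+ n < dl.
  have h2 : (2^-1 : R) ^+ n @[n --> \oo] --> 0 by apply: cvg_expr; rewrite ger0_norm//; lra.
  have WK : 0 < W + K + 1 by rewrite ltr_wpDl// addr_ge0.
  have [n _ /(_ n (leqnn n))] := (@cvgrPdist_lt _ _ _ _ _ _ _).1 h2 _ (divr_gt0 dl0 WK).
  rewrite sub0r normrN ger0_norm ?exprn_ge0// => hn; exists n.
  have p0 : 0 < (2^-1 : R) ^+ n by rewrite exprn_gt0.
  rewrite ltr_pdivlMr// in hn; rewrite -exprVn; apply: le_lt_trans hn.
  by rewrite mulrC ler_wpM2l ?(ltW p0)// lerDl.
have [ir] := bq n.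
apply/negP; rewrite -leNgt; apply: hdl => //=.
by rewrite -mulrDl.
Qed.

End Goursat.

(** * Unordered sums of complex numbers *)

Section ComplexSums.
Context {R : realType}.
Local Notation C := R[i].
Implicit Types (J K : choiceType).

Definition chsum J (a : J -> C) (v : C) : Prop :=
  hsum (fun j => complex.Re (a j)) (complex.Re v) /\
  hsum (fun j => complex.Im (a j)) (complex.Im v).

Definition cabsb J (a : J -> C) (M : R) : Prop := absb (fun j => normc (a j)) M.

Lemma complex_ext (z w : C) : complex.Re z = complex.Re w -> complex.Im z = complex.Im w -> z = w.
Proof. by case: z => ? ?; case: w => ? ? /= -> ->. Qed.

Lemma ReD (z w : C) : complex.Re (z + w) = complex.Re z + complex.Re w.
Proof. by case: z => ? ?; case: w. Qed.
Lemma ImD (z w : C) : complex.Im (z + w) = complex.Im z + complex.Im w.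
Proof. by case: z => ? ?; case: w. Qed.
Lemma ReN (z : C) : complex.Re (- z) = - complex.Re z. Proof. by case: z. Qed.
Lemma ImN (z : C) : complex.Im (- z) = - complex.Im z. Proof. by case: z. Qed.
Lemma ReM (z w : C) : complex.Re (z * w) = complex.Re z * complex.Re w - complex.Im z * complex.Im w.
Proof. by case: z => ? ?; case: w. Qed.
Lemma ImM (z w : C) : complex.Im (z * w) = complex.Re z * complex.Im w + complex.Im z * complex.Re w.
Proof. by case: z => ? ?; case: w. Qed.
Lemma Re_sum (I : Type) (s : seq I) (P : pred I) (F : I -> C) :
  complex.Re (\sum_(i <- s | P i) F i) = \sum_(i <- s | P i) complex.Re (F i).
Proof. by elim/big_rec2 : _ => // i y x _ <-; rewrite ReD. Qed.
Lemma Im_sum (I : Type) (s : seq I) (P : pred I) (F : I -> C) :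
  complex.Im (\sum_(i <- s | P i) F i) = \sum_(i <- s | P i) complex.Im (F i).
Proof. by elim/big_rec2 : _ => // i y x _ <-; rewrite ImD. Qed.
Lemma ReZ (x : R) (z : C) : complex.Re (x%:C * z) = x * complex.Re z.
Proof. by rewrite ReM /= mul0r subr0. Qed.
Lemma ImZ (x : R) (z : C) : complex.Im (x%:C * z) = x * complex.Im z.
Proof. by rewrite ImM /= mul0r addr0. Qed.

Lemma chsum_ext J (a b : J -> C) v : a =1 b -> chsum a v -> chsum b v.
Proof. by move=> /funext->. Qed.

Lemma chsum_uniq J (a : J -> C) v w : chsum a v -> chsum a w -> v = w.
Proof. by move=> [h1 h2] [h3 h4]; apply: complex_ext; [exact: hsum_uniq h1 h3|exact: hsum_uniq h2 h4]. Qed.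

Lemma chsumD J (a b : J -> C) v w : chsum a v -> chsum b w -> chsum (fun j => a j + b j) (v + w).
Proof.
move=> [h1 h2] [h3 h4]; split; rewrite ?ReD ?ImD.
  by apply: hsum_ext (hsumD h1 h3) => j; rewrite ReD.
by apply: hsum_ext (hsumD h2 h4) => j; rewrite ImD.
Qed.

Lemma chsumZ J (a : J -> C) v c : chsum a v -> chsum (fun j => c * a j) (c * v).
Proof.
move=> [h1 h2]; split; rewrite ?ReM ?ImM.
  by apply: hsum_ext (hsumB (hsumZ _ h1) (hsumZ _ h2)) => j; rewrite ReM.
by apply: hsum_ext (hsumD (hsumZ _ h2) (hsumZ _ h1)) => j; rewrite ImM.
Qed.

Lemma chsumB J (a b : J -> C) v w : chsum a v -> chsum b w -> chsum (fun j => a j - b j) (v - w).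
Proof.
move=> ha /(chsumZ (-1)) hb; have := chsumD ha hb; rewrite mulN1r; apply: chsum_ext => j.
by rewrite mulN1r.
Qed.

Lemma cabsb_Re J (a : J -> C) M : cabsb a M -> absb (fun j => complex.Re (a j)) M.
Proof. by apply: absb_le => j; rewrite [leRHS]ger0_norm ?normc_ge0// ler_Re. Qed.

Lemma cabsb_Im J (a : J -> C) M : cabsb a M -> absb (fun j => complex.Im (a j)) M.
Proof. by apply: absb_le => j; rewrite [leRHS]ger0_norm ?normc_ge0// ler_Im. Qed.

Lemma cabsb_le J (a : J -> C) (b : J -> R) M : (forall j, normc (a j) <= b j) -> absb b M -> cabsb a M.
Proof.
by move=> ab; apply: absb_le => j; rewrite ger0_norm ?normc_ge0// (le_trans (ab j))// ler_norm.
Qed.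

Lemma cabsb_chsum J (a : J -> C) M : cabsb a M -> exists v, chsum a v.
Proof.
move=> aM; have [x hx] := absb_hsum (cabsb_Re aM); have [y hy] := absb_hsum (cabsb_Im aM).
by exists (x +i* y).
Qed.

(** Multiplication by u reduces norm estimates for complex numbers to estimates for real parts. *)
Lemma unit_rot (v : C) : exists u : C, normc u <= 1 /\ u * v = (normc v)%:C.
Proof.
have [->|v0] := eqVneq v 0; first by exists 0; rewrite normc0 mul0r.
exists ((normc v)%:C / v); rewrite divfK//; split => //.
by rewrite normcM normcV normc_real ger0_norm ?normc_ge0// mulfV// normc_eq0.
Qed.

Lemma chsum_norm_le J (a : J -> C) M v : cabsb a M -> chsum a v -> normc v <= M.
Proof.
move=> aM av; have [u [u1 uv]] := unit_rot v.
have [h _] := chsumZ u av; rewrite uv /= in h.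
apply: le_trans (ler_norm _) _; apply: hsum_norm_le h.
apply: absb_le aM => j; rewrite [leRHS]ger0_norm ?normc_ge0//.
apply: le_trans (ler_Re _) _; by rewrite normcM ler_piMl// normc_ge0.
Qed.

Lemma chsum_fiber J K (phi : J -> K) (a : J -> C) M (s : K -> C) v :
  cabsb a M -> chsum a v ->
  (forall k, chsum (fun j => if phi j == k then a j else 0) (s k)) -> chsum s v.
Proof.
move=> aM [h1 h2] hs; split.
  apply: (hsum_fiber (cabsb_Re aM) h1 (phi := phi)) => k.
  by apply: hsum_ext (hs k).1 => j; case: ifP.
apply: (hsum_fiber (cabsb_Im aM) h2 (phi := phi)) => k.
by apply: hsum_ext (hs k).2 => j; case: ifP.
Qed.

Lemma chsum_inj J K (g : K -> J) (a : J -> C) M v :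
  injective g -> (forall j, (forall k, g k != j) -> a j = 0) ->
  cabsb a M -> chsum a v <-> chsum (a \o g) v.
Proof.
move=> gi a0 aM; rewrite /chsum.
rewrite (@hsum_inj _ _ _ g (fun j => complex.Re (a j)) M (complex.Re v) gi); last 2 first.
- by move=> j /a0->.
- exact: cabsb_Re.
rewrite (@hsum_inj _ _ _ g (fun j => complex.Im (a j)) M (complex.Im v) gi)//.
- by move=> j /a0->.
- exact: cabsb_Im.
Qed.

Lemma nat_exhaust (A : {fset nat}) : exists n0, forall n, (n0 <= n)%N ->
  (A `<=` [fset k in iota 0 n])%fset.
Proof.
exists (\max_(k <- A) k.+1)%N => n h; apply/fsubsetP => k kA.
rewrite !inE mem_iota add0n /=; apply: leq_trans h.
exact: (@leq_bigmax_seq _ (enum_fset A) xpredT (fun k => k.+1) k kA isT).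
Qed.

Lemma big_fset_iota (a : nat -> R) n : \sum_(k <- [fset k in iota 0 n]%fset) a k = \sum_(k < n) a k.
Proof.
rewrite -(big_mkord xpredT) /= /index_iota subn0; apply: perm_big; apply: uniq_perm.
- exact: fset_uniq.
- exact: iota_uniq.
- by move=> x; rewrite !inE.
Qed.

Lemma nat_absb (a : nat -> R) M : (forall n, \sum_(k < n) `|a k| <= M) -> absb a M.
Proof. by move=> h; apply: (absb_exhaust nat_exhaust) => n; rewrite big_fset_iota. Qed.

Lemma nat_hsum (a : nat -> R) M v : absb a M -> \sum_(k < n) a k @[n --> \oo] --> v -> hsum a v.
Proof.
move=> aM h; apply: (exhaust_hsum nat_exhaust aM).
by under eq_fun do rewrite big_fset_iota.
Qed.

Lemma nat_geom_absb (q : R) : 0 <= q < 1 -> absb (fun n => q ^+ n) (1 - q)^-1.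
Proof.
move=> /andP[q0 q1]; apply: nat_absb => n.
under eq_bigr do rewrite ger0_norm ?exprn_ge0//.
have e : q ^+ n - 1 = (q - 1) * \sum_(k < n) q ^+ k by exact: subrX1.
have -> : \sum_(k < n) q ^+ k = (1 - q ^+ n) / (1 - q).
  by rewrite -[1 - q ^+ n]opprB e -mulNr opprB mulrAC mulfV ?mul1r// subr_eq0 gt_eqF.
by rewrite ler_pdivrMr ?subr_gt0// mulVf ?subr_eq0 ?gt_eqF// gerBl exprn_ge0.
Qed.

Lemma cpseries_uniq (c : nat -> C) (rho : R) : 0 < rho ->
  (forall t : R, 0 < t < rho -> chsum (fun n => c n * t%:C ^+ n) 0) -> forall n, c n = 0.
Proof.
move=> rho0 h n; apply: complex_ext.
  apply: (@pseries_uniq1 _ (fun n => complex.Re (c n)) rho rho0) => t /h [h1 _].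
  by apply: hsum_ext h1 => k; rewrite -rmorphXn mulrC ReZ mulrC.
apply: (@pseries_uniq1 _ (fun n => complex.Im (c n)) rho rho0) => t /h [_ h1].
by apply: hsum_ext h1 => k; rewrite -rmorphXn mulrC ImZ mulrC.
Qed.

End ComplexSums.

(** * Power series and Cauchy's estimates on a disc *)

Section Cauchy1.
Context {R : realType}.
Local Notation C := R[i].
Local Notation ipi := ((pi : R) *+ 2).

(** The integral of h along the circle of radius r with respect to the angle. With respect to dz
    this is the integral of h(z) / z, up to the factor i. *)
Definition circ (h : C -> C) (r : R) : C :=
  cint 0 ipi (fun t => h (r%:C * cexp (0 +i* t))).

Lemma pi2_gt0 : 0 < ipi. Proof. by rewrite pmulrn_lgt0// pi_gt0. Qed.

Lemma rcont_circ (h : C -> C) (r : R) a b : 0 <= r -> (forall z, normc z = r -> ccont h z) ->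
  rcont a b (fun t => h (r%:C * cexp (0 +i* t))).
Proof.
move=> r0 ch; apply: (rcontV (h := fun z => h (r%:C * cexp z))) => y _.
apply/ccontP; apply: (@continuous_comp _ _ _ (fun z : C => r%:C * cexp z) h); last first.
  by apply/ccontP; apply: ch; exact: normc_polar.
apply: differentiable_continuous; apply: differentiableM; first exact: differentiable_cst.
exact: differentiable_cexp.
Qed.

(** In logarithmic coordinates the annulus becomes a rectangle of height 2 pi. The function h o exp
    takes the same values on its horizontal sides, so Goursat's theorem equates the vertical ones. *)
Lemma circ_const (h : C -> C) (r1 r2 : R) : 0 < r1 -> r1 <= r2 ->
  (forall z, r1 <= normc z <= r2 -> differentiable h z) -> circ h r1 = circ h r2.
Proof.
move=> r10 r12 dh; have r20 := lt_le_trans r10 r12.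
pose g (z : C) := h (cexp z).
have polar (r t : R) : 0 < r -> cexp (ln r +i* t) = r%:C * cexp (0 +i* t).
  move=> r0; rewrite -[r in r%:C]lnK ?posrE// -cexp_real -cexpD; congr cexp.
  by apply/eqP; rewrite eq_complex /= addr0 add0r !eqxx.
have W0 : 0 <= ln r2 - ln r1 by rewrite subr_ge0 ler_ln ?posrE.
have := @goursat _ g (ln r1) 0 (ln r2 - ln r1) ipi W0 (ltW pi2_gt0).
have dg x y : ln r1 <= x <= ln r1 + (ln r2 - ln r1) -> 0 <= y <= 0 + ipi ->
   differentiable g (x +i* y).
  rewrite addrC subrK => /andP[h1 h2] _.
  apply: differentiable_comp; first exact: differentiable_cexp.
  by apply: dh; rewrite normc_cexp /= -[r1]lnK ?posrE// -[r2]lnK ?posrE// !ler_expR h1.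
move=> /(_ dg); rewrite /contour add0r [ln r1 + _]addrC subrK.
rewrite (@cint_eq _ (ln r1) (ln r2) (fun t => g (t +i* ipi)) (fun t => g (t +i* 0))); last first.
  by move=> x _; rewrite /g -[X in x +i* X]add0r cexp_2pi.
rewrite subrr add0r => /eqP; rewrite mulf_eq0 => /orP[|].
  by rewrite eq_complex /= oner_eq0 andbF.
rewrite subr_eq0 => /eqP e; rewrite /circ.
rewrite (@cint_eq _ 0 ipi _ (fun t => g (ln r1 +i* t))); last by move=> t _; rewrite /g polar.
by rewrite -e; apply: cint_eq => t _; rewrite /g polar.
Qed.

Lemma circZ c (h : C -> C) r : 0 <= r -> (forall z, normc z = r -> ccont h z) ->
  circ (fun z => c * h z) r = c * circ h r.
Proof. by move=> r0 ch; rewrite /circ cintZ//; exact: rcont_circ. Qed.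

Lemma circD (h1 h2 : C -> C) r : 0 <= r -> (forall z, normc z = r -> ccont h1 z) ->
  (forall z, normc z = r -> ccont h2 z) ->
  circ (fun z => h1 z + h2 z) r = circ h1 r + circ h2 r.
Proof. by move=> r0 c1 c2; rewrite /circ cintD//; exact: rcont_circ. Qed.

Lemma circ_eq (h1 h2 : C -> C) r : 0 <= r -> (forall z, normc z = r -> h1 z = h2 z) ->
  circ h1 r = circ h2 r.
Proof. by move=> r0 e; apply: cint_eq => t _; apply: e; exact: normc_polar. Qed.

Lemma circ_bound (h : C -> C) r M : 0 <= r -> (forall z, normc z = r -> ccont h z) ->
  (forall z, normc z = r -> normc (h z) <= M) -> normc (circ h r) <= M * ipi.
Proof.
move=> r0 ch hM; have := @cint_bound _ 0 ipi (fun t => h (r%:C * cexp (0 +i* t))) M (ltW pi2_gt0).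
rewrite subr0; apply; first exact: rcont_circ.
by move=> t _; apply: hM; exact: normc_polar.
Qed.

Lemma circ_sum (n : nat) (F : nat -> C -> C) r : 0 <= r ->
  (forall k (z : C), normc z = r -> ccont (F k) z) ->
  circ (fun z => \sum_(k < n) F k z) r = \sum_(k < n) circ (F k) r.
Proof.
move=> r0 cF; elim: n => [|n IH].
  rewrite big_ord0 /circ (@cint_eq _ _ _ _ (fun=> 0)); last by move=> t _; rewrite big_ord0.
  by rewrite cint_cst ?mul0r// ltW// pi2_gt0.
rewrite big_ord_recr /= -IH -circD//; last exact: cF.
  by apply: circ_eq => // z _; rewrite big_ord_recr.
move=> z zr; elim: n {IH} => [|n IH].
  move=> e e0; exists 1 => // w _; by rewrite !big_ord0 subrr normc0.
apply/ccontP; rewrite (_ : (fun z => _) = (fun z => \sum_(k < n) F k z) \+ F n); last first.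
  by apply/funext => w; rewrite big_ord_recr.
by apply: continuousD; apply/ccontP; [exact: IH|exact: cF].
Qed.

Lemma circ1 r : circ (fun=> 1) r = ipi%:C.
Proof. by rewrite /circ cint_cst ?subr0 ?mul1r// ltW// pi2_gt0. Qed.

Lemma diff_invX n (z : C) : z != 0 -> differentiable (fun z : C => (z ^+ n)^-1) z.
Proof.
move=> z0; apply: (@differentiable_comp _ _ _ _ (fun z : C => z ^+ n) (fun z : C => z^-1)).
  elim: n => [|n IH]; first by under eq_fun do rewrite expr0; exact: differentiable_cst.
  under eq_fun do rewrite exprS; by apply: differentiableM; [exact: ex_diff|exact: IH].
by apply/derivable1_diffP; apply: derivableV; rewrite ?expf_neq0//; apply/derivable1_diffP; exact: ex_diff.
Qed.

Lemma circE (h : C -> C) r : circ h r = cint 0 ipi (fun t => h (r%:C * cexp (0 +i* t))).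
Proof. by []. Qed.

#[local] Opaque circ.

(** Passing from the radius 1 to the radius 2 divides the mean by 2^n, although the mean does not
    depend on the radius. *)
Lemma circ_invX n r : 0 < r -> (0 < n)%N -> circ (fun z => (z ^+ n)^-1) r = 0.
Proof.
move=> r0 n0; have [k kE] : exists k, circ (fun z => (z ^+ n)^-1) 1 = k by eexists.
have nz0 (z : C) (q : R) : 0 < q -> normc z = q -> z != 0.
  by move=> rr e; rewrite -normc_gt0 e.
have scal r' : 0 < r' -> circ (fun z => (z ^+ n)^-1) r' = (r'%:C ^+ n)^-1 * k.
  move=> r'0; rewrite -kE -circZ//; last first.
    by move=> z z1; apply: diff_ccont; apply: diff_invX; apply: nz0 z1.
  by rewrite !circE; apply: cint_eq => t _; rewrite mul1r exprMn invfM.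
have k0 : k = 0.
  have h := @circ_const (fun z => (z ^+ n)^-1) 1 2 ltr01.
  have h12 : (1 : R) <= 2 by lra.
  have d12 (z : C) : 1 <= normc z <= 2 -> differentiable (fun z : C => (z ^+ n)^-1) z.
    by move=> /andP[z1 _]; apply: diff_invX; rewrite -normc_gt0 (lt_le_trans ltr01).
  have e : k = (2%:C ^+ n)^-1 * k := etrans (esym kE) (etrans (h h12 d12) (scal 2 ltac:(lra))).
  move/eqP: e; rewrite -subr_eq0 -{1}[k]mul1r -mulrBl mulf_eq0.
  move=> /orP[|/eqP//]; rewrite subr_eq0 => /eqP e.
  exfalso; have : normc (2%:C ^+ n : C) = 1.
    by rewrite -[LHS]invrK -normcV -e normc1 invr1.
  rewrite normcX normc_real (ger0_norm (ler0n R 2)) => e2.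
  move: e2; clear - n0 => e2.
  have : 1 < (2 : R) ^+ n by rewrite exprn_egt1 ?ltr1n// -lt0n.
  by rewrite e2 ltxx.
by rewrite scal// k0 mulr0.
Qed.

(** The continuity of the integrand in the radius is uniform in the angle, by compactness. *)
Lemma circ_cont (h : C -> C) (rho r0 : R) : 0 <= r0 < rho ->
  (forall z, normc z < rho -> ccont h z) -> forall e : R, 0 < e ->
  exists2 dl : R, 0 < dl & forall r : R, 0 <= r -> `|r - r0| < dl ->
    normc (circ h r - circ h r0) <= e.
Proof.
move=> /andP[r00 r0r] ch e e0.
have ep : 0 < e / ipi by rewrite divr_gt0// pi2_gt0.
pose P (r t : R) : Prop := 0 <= r -> r < rho /\
  normc (h (r%:C * cexp (0 +i* t)) - h (r0%:C * cexp (0 +i* t))) < e / ipi.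
have nc (t : R) : normc (cexp (0 +i* t)) = 1 by rewrite normc_cexp /= expR0.
have : \forall r \near nbhs r0, (`[0, ipi]%classic : set R) `<=` P r.
  apply: (compact_near_coveringP _).1; first exact: segment_compact.
  move=> t0 _.
  have z0 : normc (r0%:C * cexp (0 +i* t0)) < rho by rewrite normc_polar.
  have [d1 d10 h1] := ch _ z0 (e / ipi / 2) ltac:(by rewrite divr_gt0).
  pose d2 := d1 / (2 * (r0 + 1)).
  have r1 : 0 < r0 + 1 by lra.
  have d20 : 0 < d2 by rewrite divr_gt0// mulr_gt0.
  have : ccont (@cexp R) (0 +i* t0) by apply: diff_ccont; exact: differentiable_cexp.
  move=> /(_ d2 d20)[d3 d30 h3].
  have hz (r t : R) : 0 <= r -> `|r - r0| < d1 / 2 -> `|t - t0| < d3 ->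
      normc (r%:C * cexp (0 +i* t) - r0%:C * cexp (0 +i* t0)) < d1.
    move=> r_0 hr ht.
    have -> : r%:C * cexp (0 +i* t) - r0%:C * cexp (0 +i* t0) =
      (r - r0)%:C * cexp (0 +i* t) + r0%:C * (cexp (0 +i* t) - cexp (0 +i* t0)).
      by rewrite rmorphB /=; ring.
    apply: le_lt_trans (normcD _ _) _; rewrite !normcM nc mulr1 !normc_real (ger0_norm r00).
    rewrite [d1]splitr; apply: ltr_leD => //.
    apply: (@le_trans _ _ ((r0 + 1) * d2)); last first.
      by rewrite /d2 le_eqVlt; apply/orP; left; apply/eqP; field; rewrite gt_eqF.
    apply: ler_pM => //; rewrite ?normc_ge0 ?lerDl//.
    apply/ltW/h3; apply: le_lt_trans ht.
    rewrite (_ : (0 +i* t) - (0 +i* t0) = 'i%C * (t - t0)%:C); last first.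
      by apply/eqP; rewrite eq_complex /=; apply/andP; split; apply/eqP; ring.
    rewrite normcM normc_real; have -> : normc 'i%C = 1 :> R.
      by rewrite /normc expr0n expr1n add0r sqrtr1.
    by rewrite mul1r.
  have rr : 0 < Num.min (d1 / 2) (rho - r0) by rewrite lt_min subr_gt0 r0r andbT divr_gt0.
  exists (ball t0 d3, ball r0 (Num.min (d1 / 2) (rho - r0))) => /=.
    by split; apply: nbhsx_ballx.
  move=> [t r] /= []; rewrite /ball /= distrC => ht; rewrite distrC lt_min => /andP[hr1 hr2] r_0.
  split.
    by move: hr2; rewrite ltr_norml => /andP[_]; rewrite ltrD2r.
  have a1 := h1 _ (hz _ _ r_0 hr1 ht).
  have a2 := h1 _ (hz _ _ r00 _ ht); rewrite subrr normr0 in a2.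
  have {}a2 := a2 ltac:(by rewrite divr_gt0).
  set A := h (r%:C * _) in a1 *; set B := h _ in a1 a2 *; set D := h _ in a2 *.
  have -> : A - D = (A - B) - (D - B) by ring.
  apply: le_lt_trans (normcB _ _) _; rewrite [e / ipi]splitr; exact: ltrD.
move=> /nbhs_ballP[dl /= dl0 hd]; exists dl => // r r_0 hr.
have hP t : 0 <= t <= ipi -> P r t.
  by move=> ht; apply: hd; rewrite /ball /= 1?distrC//= in_itv.
have rrho : r < rho by have [] := hP 0 ltac:(by rewrite lexx ltW// pi2_gt0) r_0.
have c1 q : 0 <= q -> q < rho -> rcont 0 ipi (fun t => h (q%:C * cexp (0 +i* t))).
  by move=> q0 qr; apply: rcont_circ => // z zq; apply: ch; rewrite zq.
have -> : circ h r - circ h r0 = cint 0 ipi (fun t => h (r%:C * cexp (0 +i* t)) + -1 * h (r0%:C * cexp (0 +i* t))).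
  by rewrite !circE cintD; [rewrite cintZ ?mulN1r//; exact: c1|exact: c1|by apply: rcontZ; exact: c1].
have -> : e = e / ipi * (ipi - 0) by rewrite subr0 divfK// gt_eqF// pi2_gt0.
apply: cint_bound; first by rewrite ltW// pi2_gt0.
  by apply: rcontD; [exact: c1|by apply: rcontZ; exact: c1].
by move=> t ht; rewrite mulN1r ltW//; have [] := hP _ ht r_0.
Qed.

(** The integrand has a removable singularity at a, at which its extension is continuous. The
    circular integral vanishes at radius 0, is constant as long as the radius does not meet |a|,
    and is continuous in the radius, so it stays 0 when the radius passes |a|. *)
Lemma circ_quotient (f : C -> C) (rho : R) (a : C) r :
  (forall z, normc z < rho -> differentiable f z) -> normc a < r -> r < rho ->
  circ (fun z => z * ((f z - f a) / (z - a))) r = 0.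
Proof.
move=> df ar rrho.
have a0 : 0 <= normc a by exact: normc_ge0.
have arho := lt_trans ar rrho.
have [l hl] := (cdiffP f a).1 (df _ arho).
(* the quotient with its removable singularity filled by the derivative l *)
pose g z := if z == a then l else (f z - f a) / (z - a).
pose G z := z * g z.
have dg z : normc z < rho -> z != a -> differentiable G z.
  move=> zr za; apply: differentiableM; first exact: ex_diff.
  apply/cdiffP.
  have : differentiable (fun z => (f z - f a) / (z - a)) z.
    apply: differentiableM; first by apply: differentiableB; [exact: df|exact: differentiable_cst].
    apply: (@differentiable_comp _ _ _ _ (fun z : C => z - a) (fun z : C => z^-1)).
      by apply: differentiableB; [exact: ex_diff|exact: differentiable_cst].
    by apply/derivable1_diffP; apply: derivableV; rewrite ?subr_eq0//; apply/derivable1_diffP; exact: ex_diff.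
  move/cdiffP => [m hm]; exists m => e e0; have [dl dl0 hd] := hm _ e0.
  have za0 : 0 < normc (z - a) by rewrite normc_gt0 subr_eq0.
  exists (Num.min dl (normc (z - a))); first by rewrite lt_min dl0.
  move=> h; rewrite lt_min => /andP[h1 h2]; rewrite /g (negbTE za) ifF; first exact: hd.
  apply/negP => /eqP e1; move: h2; rewrite -e1 opprD addrA subrr sub0r.
  by rewrite (normcN h) ltxx.
have cG z : normc z < rho -> ccont G z.
  move=> zr; have [->|za] := eqVneq z a; last by apply: diff_ccont; exact: dg.
  apply/ccontP; apply: (@continuousM _ _ (fun z : C => z) g); first exact: cvg_id.
  apply/ccontP => e e0; have e2 : 0 < e / 2 by rewrite divr_gt0.
  have [dl dl0 hd] := hl _ e2; exists dl => // w wa.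
  rewrite /g eqxx; case: eqVneq => [_|wa0]; first by rewrite subrr normc0.
  have := hd _ wa; rewrite [a + _]addrC subrK => H.
  have wa1 : 0 < normc (w - a) by rewrite normc_gt0 subr_eq0.
  have -> : (f w - f a) / (w - a) - l = (f w - f a - l * (w - a)) / (w - a).
    by field; rewrite subr_eq0.
  rewrite normcM normcV ltr_pdivrMr//; apply: le_lt_trans H _.
  by rewrite ltr_pM2r//; lra.
have A0 : circ G 0 = 0.
  rewrite circE (@cint_eq _ _ _ _ (fun=> 0)) ?cint_cst ?mul0r//; first by rewrite ltW// pi2_gt0.
  by move=> t _; rewrite /G !mul0r.
(* once the integral vanishes at radius s0, it vanishes further out until the circle meets a *)
have climb s0 s : 0 <= s0 -> s0 < s -> s < rho -> circ G s0 = 0 ->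
    (forall z, s0 < normc z <= s -> z != a) -> circ G s = 0.
  move=> s00 s0s srho cs0 hz; apply/eqP; rewrite -normc_eq0 eq_le normc_ge0 andbT.
  apply/ler_addgt0Pr => e e0; rewrite add0r.
  have s0r : 0 <= s0 < rho by rewrite s00 (lt_trans s0s).
  have [dl dl0 hd] := circ_cont s0r cG e0.
  pose q := Num.min (s0 + dl / 2) s.
  have q0 : s0 < q by rewrite lt_min s0s andbT ltrDl divr_gt0.
  have qs : q <= s by rewrite ge_min lexx orbT.
  have qd : q < s0 + dl by rewrite gt_min ltrD2l; apply/orP; left; lra.
  have qp := le_lt_trans s00 q0.
  have <- : circ G q = circ G s.
    apply: (circ_const qp qs) => z /andP[qz zs]; apply: dg; first exact: le_lt_trans zs srho.
    by apply: hz; rewrite zs andbT (lt_le_trans q0).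
  have := hd q (ltW qp); rewrite cs0 subr0; apply.
  by rewrite gtr0_norm ?subr_gt0// ltrBlDl.
have below s : 0 < s -> s < normc a -> circ G s = 0.
  move=> s0 sa; apply: (climb 0 s) => //; first exact: lt_trans sa arho.
  by move=> z /andP[_ zs]; apply: contraTneq zs => ->; rewrite -ltNge.
have at_a : circ G (normc a) = 0.
  have [->//|na] := eqVneq (normc a) 0.
  have pa : 0 < normc a by rewrite lt_def na.
  apply/eqP; rewrite -normc_eq0 eq_le normc_ge0 andbT.
  apply/ler_addgt0Pr => e e0; rewrite add0r.
  have sr : 0 <= normc a < rho by rewrite a0.
  have [dl dl0 hd] := circ_cont sr cG e0.
  pose q := Num.max (normc a - dl / 2) (normc a / 2).
  have q0 : 0 < q by rewrite lt_max; apply/orP; right; lra.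
  have qa : q < normc a by rewrite gt_max; apply/andP; split; lra.
  have qd : normc a - dl < q by rewrite lt_max; apply/orP; left; lra.
  have := hd q (ltW q0); rewrite (below q)// sub0r (normcN (circ G (normc a))); apply.
  by rewrite ltr0_norm ?subr_lt0// opprB ltrBlDl -ltrBlDr.
have r0 : 0 <= r by rewrite (le_trans a0)// ltW.
rewrite -[RHS](climb (normc a) r)//; last first.
  by move=> z /andP[az _]; apply: contraTneq az => ->; rewrite ltxx.
apply: circ_eq => // z zr; rewrite /G /g ifF//; apply/negbTE.
by apply: contraTneq ar => <-; rewrite -zr ltxx.
Qed.

(** The coefficients are the circular means of f(z) / z^n, which do not depend on the radius; this
    gives Cauchy's estimate. By [circ_quotient] the means of z f(z) / (z - a) and f(a) z / (z - a)
    agree; expanding z / (z - a) into a finite geometric series gives the Taylor polynomial up to a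
    remainder of order (|a| / r)^N. *)
Theorem cauchy_disc (f : C -> C) (rho M : R) : 0 < rho ->
  (forall z, normc z < rho -> differentiable f z) ->
  (forall z, normc z < rho -> normc (f z) <= M) ->
  exists c : nat -> C, (forall n, normc (c n) <= M / rho ^+ n) /\
    (forall a, normc a < rho -> chsum (fun n => c n * a ^+ n) (f a)).
Proof.
move=> rho0 df fM.
have pp : 0 < ipi by exact: pi2_gt0.
have M0 : 0 <= M by apply: le_trans (fM 0 _); rewrite ?normc_ge0 ?normc0.
pose F n (z : C) := f z * (z ^+ n)^-1.
have dF n z : 0 < normc z < rho -> differentiable (F n) z.
  move=> /andP[z0 zr]; apply: differentiableM; first exact: df.
  by apply: diff_invX; rewrite -normc_gt0.
have cF n r z : 0 < r < rho -> normc z = r -> ccont (F n) z.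
  by move=> hr zr; apply: diff_ccont; apply: dF; rewrite zr.
pose c n := circ (F n) (rho / 2) / ipi%:C.
have r2 : 0 < rho / 2 < rho by lra.
have ipi0 : ipi%:C != 0 :> C by rewrite eq_complex /= eqxx andbT gt_eqF.
have cE n r : 0 < r < rho -> c n * ipi%:C = circ (F n) r.
  move=> /andP[r0 rr]; rewrite /c (divfK ipi0).
  have [h|/ltW h] := leP r (rho / 2); last first.
    have r20 : 0 < rho / 2 by case/andP: r2.
    apply: (circ_const r20 h).
    by move=> z /andP[h1 h2]; apply: dF; rewrite (le_lt_trans h2)// (lt_le_trans _ h1)//; case/andP: r2.
  apply/esym; apply: (circ_const r0 h).
  move=> z /andP[h1 h2]; apply: dF; rewrite (lt_le_trans r0 h1) (le_lt_trans h2)//.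
  by case/andP: r2.
have cb n r : 0 < r < rho -> normc (c n) * r ^+ n <= M.
  move=> hr; have /andP[r0 rr] := hr.
  rewrite -(ler_pM2r pp); have <- : normc ipi%:C = ipi by rewrite normc_real gtr0_norm.
  rewrite mulrAC -normcM (cE n r)// -ler_pdivlMr ?exprn_gt0// normc_real gtr0_norm// mulrAC.
  apply: circ_bound; first exact: ltW.
    by move=> z; exact: cF.
  move=> z zr; rewrite normcM normcV normcX zr ler_pM2r ?invr_gt0 ?exprn_gt0//.
  by apply: fM; rewrite zr.
have cM n : normc (c n) <= M / rho ^+ n.
  rewrite ler_pdivlMr ?exprn_gt0//.
  have h : (normc (c n) * x ^+ n : R) @[x --> rho^'-] --> normc (c n) * rho ^+ n.
    apply: cvgMr; apply: cvg_at_left_filter; exact: exprn_continuous.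
  apply: (ler_cvg_to h (cvg_cst M)); near=> x; apply: cb; apply/andP; split.
    by near: x; exact: nbhs_left_gt.
  by near: x; exact: nbhs_left_lt.
exists c; split => // a ar.
pose q := normc a / rho.
have q01 : 0 <= q < 1 by rewrite divr_ge0 ?normc_ge0 ?(ltW rho0)//= ltr_pdivrMr// mul1r.
have ab : cabsb (fun n => c n * a ^+ n) (`|M| * (1 - q)^-1).
  apply: (@cabsb_le _ _ _ (fun n => M * q ^+ n)) => [n|]; last exact: absbZ (nat_geom_absb q01).
  rewrite normcM normcX /q exprMn exprVn mulrA mulrAC ler_wpM2r// ?exprn_ge0 ?normc_ge0//.
pose r := (normc a + rho) / 2.
have ar' : normc a < r by rewrite /r; lra.
have rr : r < rho by rewrite /r; lra.
have rp : 0 < r by rewrite (le_lt_trans _ ar')// normc_ge0.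
pose Q z := z * ((f z - f a) / (z - a)).
have Q0 : circ Q r = 0 by exact: (@circ_quotient f rho).
have cQ z : normc z = r -> ccont Q z.
  move=> zr; apply: diff_ccont; apply: differentiableM; first exact: ex_diff.
  have za : z - a != 0 by rewrite subr_eq0; apply: contraTneq ar' => <-; rewrite zr ltxx.
  apply: differentiableM; first by apply: differentiableB; [by apply: df; rewrite zr|exact: differentiable_cst].
  apply: (@differentiable_comp _ _ _ _ (fun z : C => z - a) (fun z : C => z^-1)).
    by apply: differentiableB; [exact: ex_diff|exact: differentiable_cst].
  by apply/derivable1_diffP; apply: derivableV => //; apply/derivable1_diffP; exact: ex_diff.
have Qb z : normc z = r -> normc (Q z) <= r * (2 * M / (r - normc a)).
  move=> zr; rewrite /Q !normcM normcV zr ler_wpM2l ?(ltW rp)//.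
  have h1 : r - normc a <= normc (z - a).
    by rewrite lerBlDr -zr; have := normcD (z - a) a; rewrite subrK.
  apply: ler_pM; rewrite ?normc_ge0 ?invr_ge0 ?normc_ge0//.
    apply: le_trans (normcB _ _) _; have := fM z; have := fM a ar; rewrite zr => h2 /(_ rr); lra.
  by rewrite lef_pV2 ?posrE// ?subr_gt0// (lt_le_trans _ h1)// subr_gt0.
pose B := r * (2 * M / (r - normc a)).
(* for N = 0 the sum lacks the mean of the constant function 1, which is where f a comes from *)
have key N : normc (\sum_(n < N) c n * a ^+ n - (if N is 0 then 0 else f a)) <= (normc a / r) ^+ N * B.
  have z0 z : normc z = r -> z != 0 by move=> zr; rewrite -normc_gt0 zr.
  have geo z : normc z = r -> Q z = \sum_(n < N) (a ^+ n * F n z + (- (f a * a ^+ n)) * (z ^+ n)^-1)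
     + a ^+ N * ((z ^+ N)^-1 * Q z).
    move=> zr; have zn := z0 z zr.
    have za : z - a != 0 by rewrite subr_eq0; apply: contraTneq ar' => <-; rewrite zr ltxx.
    elim: N => [|N IH]; first by rewrite big_ord0 add0r !expr0 invr1 !mul1r.
    rewrite {1}IH big_ord_recr /= -addrA; congr (_ + _); rewrite /F /Q !exprS.
    by field; rewrite ?zn ?za ?expf_neq0.
  have cI n z : normc z = r -> ccont (fun z : C => (z ^+ n)^-1) z.
    by move=> zr; apply: diff_ccont; apply: diff_invX; exact: z0.
  have r0 := ltW rp.
  have hr : 0 < r < rho by rewrite rp.
  have ccZ (u : C) (h : C -> C) z : ccont h z -> ccont (fun z => u * h z) z.
    by move=> ch; apply/ccontP; apply: (@continuousM _ _ (fun=> u) h); [exact: (@cst_continuous _ _ u z)|apply/ccontP].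
  have ccD (h1 h2 : C -> C) z : ccont h1 z -> ccont h2 z -> ccont (fun z => h1 z + h2 z) z.
    by move=> c1 c2; apply/ccontP; apply: (@continuousD _ _ _ h1 h2); apply/ccontP.
  have ccM (h1 h2 : C -> C) z : ccont h1 z -> ccont h2 z -> ccont (fun z => h1 z * h2 z) z.
    by move=> c1 c2; apply/ccontP; apply: (@continuousM _ _ h1 h2); apply/ccontP.
  have ccS (n : nat) z : normc z = r -> ccont (fun z => \sum_(k < n) (a ^+ k * F k z + - (f a * a ^+ k) * (z ^+ k)^-1)) z.
    move=> zr; elim: n => [|n IH].
      by move=> e e0; exists 1 => // w _; rewrite !big_ord0 subrr normc0.
    under eq_fun do rewrite big_ord_recr /=.
    apply: (ccD _ _ _ IH); apply: (ccD (fun z => a ^+ n * F n z)); apply: ccZ; first exact: (cF _ _ _ hr zr).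
    exact: cI.
  have cR z : normc z = r -> ccont (fun z => (z ^+ N)^-1 * Q z) z.
    by move=> zr; apply: ccM; [exact: cI|exact: cQ].
  have e1 : circ Q r = \sum_(n < N) (a ^+ n * circ (F n) r + - (f a * a ^+ n) * circ (fun z => (z ^+ n)^-1) r)
      + a ^+ N * circ (fun z => (z ^+ N)^-1 * Q z) r.
    rewrite (circ_eq r0 geo) (circD r0 (fun z zr => ccS N z zr) (fun z zr => ccZ _ _ _ (cR z zr))).
    rewrite circZ// (@circ_sum N (fun n z => a ^+ n * F n z + - (f a * a ^+ n) * (z ^+ n)^-1))//; last first.
      move=> k z zr; apply: (ccD (fun z => a ^+ k * F k z)); apply: ccZ; first exact: (cF _ _ _ hr zr).
      exact: cI.
    congr (_ + _); apply: eq_bigr => k _; rewrite circD//; last 2 first.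
    - by move=> z zr; apply: ccZ; exact: (cF _ _ _ hr zr).
    - by move=> z zr; apply: ccZ; exact: cI.
    by rewrite !circZ//; move=> z zr; solve [exact: cI|exact: (cF _ _ _ hr zr)].
  have e2 : \sum_(n < N) (a ^+ n * circ (F n) r + - (f a * a ^+ n) * circ (fun z => (z ^+ n)^-1) r)
     = ipi%:C * (\sum_(n < N) c n * a ^+ n - (if N is 0 then 0 else f a)).
    case: N {geo cR e1} => [|N]; first by rewrite !big_ord0 subr0 mulr0.
    rewrite big_split /= mulrBr; congr (_ + _).
      by rewrite mulr_sumr; apply: eq_bigr => k _; rewrite -(cE _ _ hr); ring.
    rewrite big_ord_recl /= big1 ?addr0; last first.
      by move=> k _; rewrite circ_invX// mulr0.
    have -> : circ (fun z => (z ^+ 0)^-1) r = circ (fun=> 1) r.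
      by apply: circ_eq => // z _; rewrite expr0 invr1.
    by rewrite expr0 mulr1 circ1 mulNr mulrC.
  rewrite e2 in e1.
  have : normc (ipi%:C * (\sum_(n < N) c n * a ^+ n - (if N is 0 then 0 else f a))) <= (normc a / r) ^+ N * B * ipi.
    have -> : ipi%:C * (\sum_(n < N) c n * a ^+ n - (if N is 0 then 0 else f a)) = - (a ^+ N * circ (fun z => (z ^+ N)^-1 * Q z) r).
      by apply/eqP; rewrite -addr_eq0 -e1 Q0.
    have -> : (normc a / r) ^+ N * B * ipi = normc a ^+ N * ((r^-1) ^+ N * B * ipi).
      by rewrite exprMn -!mulrA.
    rewrite (normcN (a ^+ N * _)) normcM normcX ler_wpM2l ?exprn_ge0 ?normc_ge0//.
    apply: (circ_bound r0 cR) => z zr.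
    by rewrite normcM normcV normcX zr exprVn ler_wpM2l ?invr_ge0 ?exprn_ge0// Qb.
  by rewrite normcM normc_real gtr0_norm// mulrC ler_pM2r.
have B0 : 0 <= B.
  rewrite /B mulr_ge0//; first exact: ltW.
  by rewrite divr_ge0 ?subr_ge0 ?(ltW ar')// mulr_ge0.
have lim0 : ((normc a / r) ^+ n * B : R) @[n --> \oo] --> 0.
  rewrite -[0](mul0r B); apply: cvgMl; apply: cvg_expr.
  have q0 : 0 <= normc a / r by rewrite divr_ge0 ?normc_ge0// ltW.
  by rewrite (ger0_norm q0) ltr_pdivrMr// mul1r.
have cv (x : nat -> R) (y : R) : (forall n, `|x n.+1 - y| <= (normc a / r) ^+ n.+1 * B) -> x @ \oo --> y.
  move=> h; apply/cvgrPdist_le => e e0.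
  have [n0 _ hn] := (@cvgrPdist_le _ _ _ _ _ _ _).1 lim0 e e0.
  exists n0.+1 => // -[//|n] /= nn; rewrite distrC; apply: le_trans (h n) _.
  by have := hn n.+1 (leqW nn); rewrite sub0r normrN; exact: le_trans (ler_norm _).
split.
  apply: (nat_hsum (cabsb_Re ab)); apply: cv => n.
  apply: le_trans (key n.+1); apply: le_trans (ler_Re _).
  by rewrite ReD ReN Re_sum.
apply: (nat_hsum (cabsb_Im ab)); apply: cv => n.
apply: le_trans (key n.+1); apply: le_trans (ler_Im _).
by rewrite ImD ImN Im_sum.
Unshelve. all: by end_near. Qed.

End Cauchy1.

(** * Power series and Cauchy's estimates on a polydisc *)

Section CauchyMulti.
Context {R : realType}.
Local Notation C := R[i].

(** Cauchy's criterion at 0 with an explicit rate. For real values the limit is the supremum of the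
    lower bounds p(h) - K |h|. *)
Lemma uniform_limit0 (phi : C -> C) (dl K : R) : 0 < dl ->
  (forall h h', 0 < normc h <= dl -> 0 < normc h' <= dl ->
     normc (phi h - phi h') <= K * (normc h + normc h')) ->
  exists l, forall h, 0 < normc h <= dl -> normc (phi h - l) <= 2 * K * normc h.
Proof.
move=> dl0 hphi.
have real_case (p : C -> R) :
    (forall h h', 0 < normc h <= dl -> 0 < normc h' <= dl -> `|p h - p h'| <= K * (normc h + normc h')) ->
    exists l, forall h, 0 < normc h <= dl -> `|p h - l| <= K * normc h.
  move=> hp; pose E := [set p h - K * normc h | h in [set h | 0 < normc h <= dl]].
  have E0 : E !=set0.
    exists (p dl%:C - K * normc dl%:C); exists dl%:C => //=.
    by rewrite normc_real gtr0_norm// dl0 lexx.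
  have ub h : 0 < normc h <= dl -> ubound E (p h + K * normc h).
    move=> hh _ [h' hh' <-]; have := hp _ _ hh hh'; rewrite ler_norml; lra.
  exists (sup E) => h hh; rewrite ler_norml; apply/andP; split.
    have : sup E <= p h + K * normc h by apply: ge_sup => //; exact: ub.
    lra.
  have : p h - K * normc h <= sup E.
    by apply: ub_le_sup; [exists (p h + K * normc h); exact: ub|exists h].
  lra.
have [a ha] := real_case (fun h => complex.Re (phi h)) ltac:(
  move=> h h' H H'; apply: le_trans (hphi _ _ H H'); apply: le_trans (ler_Re _); by rewrite ReD ReN).
have [b hb] := real_case (fun h => complex.Im (phi h)) ltac:(
  move=> h h' H H'; apply: le_trans (hphi _ _ H H'); apply: le_trans (ler_Im _); by rewrite ImD ImN).
exists (a +i* b) => h hh; apply: le_trans (normc_le_ReIm _) _.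
rewrite ReD ReN ImD ImN /=; have := ha _ hh; have := hb _ hh; lra.
Qed.

Lemma taylor1 (f : C -> C) (rho M : R) : 0 < rho ->
  (forall z, normc z < rho -> differentiable f z) ->
  (forall z, normc z < rho -> normc (f z) <= M) ->
  exists a1, forall h, normc h <= rho / 2 ->
    normc (f h - f 0 - a1 * h) <= 8 * M / rho ^+ 2 * normc h ^+ 2.
Proof.
move=> rho0 df fM; have [c [cM cs]] := cauchy_disc rho0 df fM.
have M0 : 0 <= M by apply: le_trans (fM 0 _); rewrite ?normc_ge0 ?normc0.
have c0 : c 0%N = f 0.
  have H := cs 0 ltac:(by rewrite normc0).
  apply: (@chsum_uniq _ _ (fun n => c n * 0 ^+ n)) H.
  split.
    apply: hsum_ext (hsum1 0%N (complex.Re (c 0%N))) => n.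
    by case: n => [|n]; rewrite ?expr0 ?mulr1// expr0n mulr0.
  apply: hsum_ext (hsum1 0%N (complex.Im (c 0%N))) => n.
  by case: n => [|n]; rewrite ?expr0 ?mulr1// expr0n mulr0.
exists (c 1%N) => h hh.
have hr : normc h < rho by apply: le_lt_trans hh _; lra.
have S1 (n : nat) (x : C) : chsum (fun k => if k == n then x else 0) x.
  split.
    by apply: hsum_ext (hsum1 n (complex.Re x)) => k; case: ifP.
  by apply: hsum_ext (hsum1 n (complex.Im x)) => k; case: ifP.
have H := chsumB (chsumB (cs h hr) (S1 0%N (f 0))) (S1 1%N (c 1%N * h)).
apply: (chsum_norm_le _ H).
have q2 : 0 <= (2^-1 : R) < 1 by lra.
have B := absbZ (4 * M / rho ^+ 2 * normc h ^+ 2) (nat_geom_absb q2).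
have C0 : 0 <= 4 * M / rho ^+ 2 * normc h ^+ 2.
  by rewrite mulr_ge0 ?exprn_ge0 ?normc_ge0// divr_ge0 ?exprn_ge0 ?(ltW rho0)// mulr_ge0.
apply: (@absb_weak _ _ _ _ _ _ (cabsb_le _ B)).
  rewrite (ger0_norm C0); set X := normc h ^+ 2; set Y := M / rho ^+ 2.
  have -> : 1 - (2^-1 : R) = 2^-1 by lra.
  by rewrite invrK /Y; lra.
move=> [|[|k]] /=.
- by rewrite expr0 mulr1 c0 subrr subr0 normc0 expr0 mulr1.
- by rewrite expr1 subr0 subrr normc0 mulr_ge0.
rewrite !subr0 normcM normcX.
apply: (@le_trans _ _ (M / rho ^+ k.+2 * normc h ^+ k.+2)).
  by rewrite ler_wpM2r ?exprn_ge0 ?normc_ge0.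
have -> : M / rho ^+ k.+2 * normc h ^+ k.+2 = M / rho ^+ 2 * normc h ^+ 2 * (normc h / rho) ^+ k.
  rewrite !exprS expr0 exprMn exprVn.
  by field; rewrite expf_neq0 gt_eqF.
have -> : 4 * M / rho ^+ 2 * normc h ^+ 2 * (2^-1) ^+ k.+2 = M / rho ^+ 2 * normc h ^+ 2 * (2^-1) ^+ k.
  by rewrite !exprS expr0; field; rewrite ?expf_neq0 ?gt_eqF.
apply: ler_wpM2l; first by rewrite mulr_ge0 ?exprn_ge0 ?normc_ge0// divr_ge0 ?exprn_ge0 ?(ltW rho0).
apply: lerXn2r; rewrite ?nnegrE ?divr_ge0 ?normc_ge0 ?(ltW rho0)//.
by rewrite ler_pdivrMr// mulrC.
Qed.

Lemma differentiable_shift (f : C -> C) w z : differentiable f (w + z) ->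
  differentiable (fun h => f (w + h)) z.
Proof.
move=> /cdiffP[l hl]; apply/cdiffP; exists l => e e0.
by have [dl dl0 hd] := hl _ e0; exists dl => // h /hd; rewrite addrA.
Qed.

(** By uniqueness, the n-th coefficient of a difference quotient of G in w is the difference quotient
    of c n. Differences of such quotients are bounded uniformly in z by [taylor1], so Cauchy's
    estimates make the quotients of c n a Cauchy family. *)
Lemma coef_differentiable (G : C -> C -> C) (rho sigma M : R) (c : nat -> C -> C) :
  0 < rho ->
  (forall z w, normc z < rho -> normc w < sigma -> differentiable (G ^~ w) z) ->
  (forall z w, normc z < rho -> normc w < sigma -> differentiable (G z) w) ->
  (forall z w, normc z < rho -> normc w < sigma -> normc (G z w) <= M) ->
  (forall z w, normc z < rho -> normc w < sigma -> chsum (fun n => c n w * z ^+ n) (G z w)) ->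
  forall n w, normc w < sigma -> differentiable (c n) w.
Proof.
move=> rho0 d1 d2 GM cs n w0 w0s.
pose dl := sigma - normc w0; have dl0 : 0 < dl by rewrite subr_gt0.
have inw h : normc h < dl -> normc (w0 + h) < sigma.
  by move=> hd; apply: le_lt_trans (normcD _ _) _; rewrite /dl in hd; lra.
have T z : normc z < rho -> exists a1, forall h, normc h <= dl / 2 ->
    normc (G z (w0 + h) - G z (w0 + 0) - a1 * h) <= 8 * M / dl ^+ 2 * normc h ^+ 2.
  move=> zr; apply: (@taylor1 (fun h => G z (w0 + h)) dl M dl0).
    by move=> h hd; apply: differentiable_shift; apply: d2 => //; exact: inw.
  by move=> h hd; apply: GM => //; exact: inw.
set K := 8 * M / dl ^+ 2 in T.
(* difference quotients in w of G and of its n-th coefficient *)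
pose q h z := (G z (w0 + h) - G z w0) / h.
pose phi h := (c n (w0 + h) - c n w0) / h.
have hd2 h : normc h <= dl / 2 -> normc h < dl by move=> H; lra.
have hphi h h' : 0 < normc h <= dl / 2 -> 0 < normc h' <= dl / 2 ->
    normc (phi h - phi h') <= K / rho ^+ n * (normc h + normc h').
  move=> /andP[h0 hd] /andP[h0' hd'].
  have dq k : 0 < normc k <= dl / 2 -> forall z, normc z < rho -> differentiable (q k) z.
    move=> /andP[k0 kd] z zr.
    rewrite (_ : q k = fun z => k^-1 * (G z (w0 + k) - G z w0)); last by apply/funext => ?; rewrite mulrC.
    apply: differentiableM; first exact: differentiable_cst.
    by apply: differentiableB; apply: d1 => //; apply: inw; exact: hd2.
  have qb k a1 z : 0 < normc k <= dl / 2 ->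
     normc (G z (w0 + k) - G z (w0 + 0) - a1 * k) <= K * normc k ^+ 2 -> normc (q k z - a1) <= K * normc k.
    move=> /andP[k0 kd] H.
    have kn0 : k != 0 by rewrite -normc_gt0.
    have -> : q k z - a1 = (G z (w0 + k) - G z (w0 + 0) - a1 * k) / k by rewrite /q addr0; field.
    by rewrite normcM normcV ler_pdivrMr// -mulrA -expr2.
  have dqq z : normc z < rho -> differentiable (fun z => q h z - q h' z) z.
    by move=> zr; apply: differentiableB; apply: dq => //; apply/andP.
  have qqb z : normc z < rho -> normc (q h z - q h' z) <= K * (normc h + normc h').
    move=> zr; have [a1 ha] := T z zr.
    have -> : q h z - q h' z = (q h z - a1) - (q h' z - a1) by ring.
    apply: le_trans (normcB _ _) _; rewrite mulrDr; apply: lerD.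
      by apply: qb; [rewrite h0|exact: ha].
    by apply: qb; [rewrite h0'|exact: ha].
  have [e [eM es]] := cauchy_disc rho0 dqq qqb.
  suff -> : phi h - phi h' = e n by apply: le_trans (eM n) _; rewrite mulrAC.
  apply/eqP; rewrite -subr_eq0; apply/eqP.
  apply: (@cpseries_uniq _ (fun n => (c n (w0 + h) - c n w0) / h - (c n (w0 + h') - c n w0) / h' - e n) rho rho0).
  move=> t /andP[t0 tr]; have tr' : normc t%:C < rho by rewrite normc_real gtr0_norm.
  have s1 := chsumZ h^-1 (chsumB (cs _ _ tr' (inw _ (hd2 _ hd))) (cs _ _ tr' w0s)).
  have s2 := chsumZ h'^-1 (chsumB (cs _ _ tr' (inw _ (hd2 _ hd'))) (cs _ _ tr' w0s)).
  have := chsumB (chsumB s1 s2) (es _ tr').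
  have -> : h^-1 * (G t%:C (w0 + h) - G t%:C w0) - h'^-1 * (G t%:C (w0 + h') - G t%:C w0)
      - (q h t%:C - q h' t%:C) = 0 by rewrite /q; ring.
  by apply: chsum_ext => k; ring.
have [l hl] := uniform_limit0 (divr_gt0 dl0 (ltr0n R 2)) hphi.
apply/cdiffP; exists l => e e0.
set K' := 2 * _ in hl.
have hlK h : 0 < normc h <= dl / 2 -> normc (c n (w0 + h) - c n w0 - l * h) <= K' * normc h * normc h.
  move=> /andP[h0 hd]; have hn0 : h != 0 by rewrite -normc_gt0.
  have -> : c n (w0 + h) - c n w0 - l * h = (phi h - l) * h by rewrite /phi; field.
  by rewrite normcM ler_pM2r// hl// h0.
have K0 : 0 <= K'.
  have dC : 0 < normc (dl / 2)%:C <= dl / 2 by rewrite normc_real gtr0_norm ?divr_gt0// lexx.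
  have := hl _ dC; move/(le_trans (normc_ge0 _)); rewrite pmulr_lge0//.
  by case/andP: dC.
exists (Num.min (dl / 2) (e / (K' + 1))).
  by rewrite lt_min !divr_gt0//; lra.
move=> h; rewrite lt_min => /andP[h1 h2].
have [->|hn0] := eqVneq h 0; first by rewrite addr0 subrr mulr0 subrr normc0 mulr0.
have h0 : 0 < normc h by rewrite normc_gt0.
apply: le_trans (hlK h _) _; first by rewrite h0 ltW.
rewrite ler_pM2r//; apply: (@le_trans _ _ ((K' + 1) * normc h)).
  by rewrite ler_pM2r//; lra.
by rewrite mulrC -ler_pdivlMr ?ltW//; lra.
Qed.

Variable d : nat.
Implicit Types (z : 'I_d -> C) (rho : 'I_d -> R).

Definition in_polydisc rho z := forall i, normc (z i) < rho i.

Definition upd (z : 'I_d -> C) (i : 'I_d) (t : C) : 'I_d -> C := fun k => if k == i then t else z k.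

(** Separate holomorphy in each coordinate is what the induction over the coordinates needs, and it
    passes to the coefficients by [coef_differentiable]. *)
Definition sepholo rho (F : ('I_d -> C) -> C) :=
  forall z, in_polydisc rho z -> forall i, differentiable (fun t => F (upd z i t)) (z i).

Lemma upd_upd z i t u : upd (upd z i t) i u = upd z i u.
Proof. by apply/funext => k; rewrite /upd; case: eqP. Qed.

Lemma upd_id z i : upd z i (z i) = z.
Proof. by apply/funext => k; rewrite /upd; case: eqP => // ->. Qed.

Lemma upd_comm z i j t u : i != j -> upd (upd z i t) j u = upd (upd z j u) i t.
Proof.
move=> ij; apply/funext => k; rewrite /upd.
by case: (eqVneq k j) => // ->; rewrite eq_sym (negbTE ij).
Qed.

Lemma in_polydisc_upd rho z i t : in_polydisc rho z -> normc t < rho i -> in_polydisc rho (upd z i t).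
Proof. by move=> zD tr k; rewrite /upd; case: eqP => // ->. Qed.

Lemma upd_same z i t : upd z i t i = t. Proof. by rewrite /upd eqxx. Qed.

Lemma sepholo_at rho F z i a : sepholo rho F -> in_polydisc rho z -> normc a < rho i ->
  differentiable (fun t => F (upd z i t)) a.
Proof.
move=> dF zD ar; have := dF _ (in_polydisc_upd zD ar) i; rewrite upd_same.
rewrite (_ : (fun t => F (upd (upd z i a) i t)) = fun t => F (upd z i t))//.
by apply/funext => t; rewrite upd_upd.
Qed.

(** The coefficients do not depend on the i-th coordinate, being those of the series through the point
    whose i-th coordinate is 0. They inherit separate holomorphy by [coef_differentiable]. *)
Lemma expand_coordinate rho F M i : (forall i, 0 < rho i) -> sepholo rho F ->
  (forall z, in_polydisc rho z -> normc (F z) <= M) ->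
  exists c : nat -> ('I_d -> C) -> C,
    [/\ forall n z t, c n (upd z i t) = c n z,
        forall n z, in_polydisc rho z -> normc (c n z) <= M / rho i ^+ n,
        forall n, sepholo rho (c n) &
        forall z, in_polydisc rho z -> chsum (fun n => c n z * z i ^+ n) (F z)].
Proof.
move=> rho0 dF FM.
have ex z : in_polydisc rho z -> exists c : nat -> C, (forall n, normc (c n) <= M / rho i ^+ n) /\
    (forall a, normc a < rho i -> chsum (fun n => c n * a ^+ n) (F (upd z i a))).
  move=> zD; apply: (@cauchy_disc _ (fun a => F (upd z i a)) (rho i) M (rho0 i)).
    by move=> a ar; exact: (sepholo_at dF zD ar).
  by move=> a ar; apply: FM; exact: in_polydisc_upd.
pose c n z := match pselect (in_polydisc rho (upd z i 0)) with
  | left h => projT1 (cid (ex _ h)) n | right _ => 0 end.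
have z0 z : in_polydisc rho z -> in_polydisc rho (upd z i 0).
  by move=> zD; apply: in_polydisc_upd => //; rewrite normc0.
have cM n z : in_polydisc rho z -> normc (c n z) <= M / rho i ^+ n.
  move=> zD; rewrite /c; case: pselect => [h|]; last by move/(_ (z0 _ zD)).
  by case: (projT2 (cid (ex _ h))).
have cs z a : in_polydisc rho z -> normc a < rho i -> chsum (fun n => c n z * a ^+ n) (F (upd z i a)).
  move=> zD ar; rewrite /c; case: pselect => [h|]; last by move/(_ (z0 _ zD)).
  case: (projT2 (cid (ex _ h))) => _ /(_ a ar).
  by rewrite upd_upd.
have ci n z t : c n (upd z i t) = c n z by rewrite /c upd_upd.
exists c; split => //.
  move=> n z zD k; have [->|ki] := eqVneq k i.
    by under eq_fun do rewrite ci; exact: differentiable_cst.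
  apply: (@coef_differentiable (fun t w => F (upd (upd z k w) i t)) (rho i) (rho k) M
     (fun n w => c n (upd z k w)) (rho0 i)) => //.
  - by move=> t w tr wr; exact: (sepholo_at dF (in_polydisc_upd zD wr) tr).
  - move=> t w tr wr; rewrite (_ : (fun w => _) = fun w => F (upd (upd z i t) k w)).
      by exact: (sepholo_at dF (in_polydisc_upd zD tr) wr).
    by apply/funext => u; rewrite upd_comm.
  - by move=> t w tr wr; apply: FM; apply: in_polydisc_upd => //; exact: in_polydisc_upd.
  - by move=> t w tr wr; apply: cs => //; exact: in_polydisc_upd.
by move=> z zD; have := cs z (z i) zD (zD i); rewrite upd_id.
Qed.

Definition mclear (i : 'I_d) (I : multi d) : multi d := [ffun k => if k == i then 0%N else I k].
Definition mset1 (i : 'I_d) (I : multi d) (n : nat) : multi d := [ffun k => if k == i then n else I k].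

Lemma mono_split (K : comPzRingType) (x : 'I_d -> K) i I :
  mono x I = mono x (mclear i I) * x i ^+ I i.
Proof.
rewrite /mono [LHS](bigD1 i)//= [in RHS](bigD1 i)//= ffunE eqxx expr0 mul1r mulrC.
by congr (_ * _); apply: eq_bigr => k ki; rewrite ffunE (negbTE ki).
Qed.

Lemma mclear_mset1 i (I : multi d) n : I i = 0%N -> mclear i (mset1 i I n) = I.
Proof. by move=> I0; apply/ffunP => k; rewrite !ffunE; case: eqP => // ->. Qed.

Lemma normc_mono (x : 'I_d -> C) I : normc (mono x I) = mono (fun i => normc (x i)) I.
Proof. by rewrite /mono normc_prod; apply: eq_bigr => i _; rewrite normcX. Qed.

Lemma cabsb_mono rho (c : multi d -> C) M z : (forall i, 0 < rho i) -> 0 <= M ->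
  (forall I, normc (c I) <= M / mono rho I) -> in_polydisc rho z ->
  cabsb (fun I => c I * mono z I) (M * \prod_i (1 - normc (z i) / rho i)^-1).
Proof.
move=> rho0 M0 cM zD; rewrite -[M in M * _]ger0_norm//.
apply: (@cabsb_le _ _ _ (fun I => M * mono (fun i => normc (z i) / rho i) I)); last first.
  apply: absbZ; apply: absb_geom => i.
  by rewrite divr_ge0 ?normc_ge0 ?(ltW (rho0 i))//= ltr_pdivrMr// mul1r.
move=> I; rewrite normcM normc_mono monoM monoV mulrCA mulrC ler_wpM2l//.
by rewrite mono_ge0// => i; exact: normc_ge0.
Qed.

Definition msupp (l : seq 'I_d) (I : multi d) : bool := [forall i, (i \in l) || (I i == 0%N)].

(** The variables in l are expanded one after another. The coefficients are still functions of the
    remaining coordinates, separately holomorphic and with the estimates needed to go on. *)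
Lemma expand_coordinates rho F M (l : seq 'I_d) : (forall i, 0 < rho i) -> uniq l ->
  sepholo rho F -> (forall z, in_polydisc rho z -> normc (F z) <= M) ->
  exists c : multi d -> ('I_d -> C) -> C,
    [/\ forall I z, ~~ msupp l I -> c I z = 0,
        forall I z, in_polydisc rho z -> normc (c I z) <= M / mono rho I,
        forall I, sepholo rho (c I),
        forall I z z', in_polydisc rho z -> in_polydisc rho z' ->
          (forall i, i \notin l -> z i = z' i) -> c I z = c I z' &
        forall z, in_polydisc rho z -> chsum (fun I => c I z * mono z I) (F z)].
Proof.
move=> rho0 + dF FM.
have D0 : in_polydisc rho (fun=> 0) by move=> i; rewrite normc0.
have M0 : 0 <= M := le_trans (normc_ge0 _) (FM _ D0).
elim: l => [_|i l IH /= /andP[il ul]].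
  exists (fun I z => if I == 0 then F z else 0); split.
  - move=> I z; case: eqP => // ->; rewrite /msupp => /negP[].
    by apply/forallP => i; rewrite ffunE.
  - move=> I z zD; case: eqP => [->|_]; first by rewrite mono0 divr1; exact: FM.
    by rewrite normc0 divr_ge0//; apply/ltW/mono_gt0.
  - move=> I z zD i; have [_|_] := eqVneq I 0; first exact: (dF z zD i).
    exact: (@differentiable_cst _ C C 0 (z i)).
  - by move=> I z z' _ _ zz'; case: (I == 0) => //; congr F; apply/funext => k; exact: zz'.
  - move=> z zD; split.
      apply: hsum_ext (hsum1 (0 : multi d) (complex.Re (F z))) => I.
      by case: eqP => [->|_]; rewrite ?mono0 ?mulr1 ?mul0r.
    apply: hsum_ext (hsum1 (0 : multi d) (complex.Im (F z))) => I.
    by case: eqP => [->|_]; rewrite ?mono0 ?mulr1 ?mul0r.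
have [c' [c'0 c'M c'h c'i c's]] := IH ul.
have ex I := expand_coordinate i rho0 (c'h I) (c'M I).
pose e I := projT1 (cid (ex I)).
have eP I := projT2 (cid (ex I)).
pose c I z := if msupp (i :: l) I then e (mclear i I) (I i) z else 0.
have cM I z : in_polydisc rho z -> normc (c I z) <= M / mono rho I.
  move=> zD; rewrite /c; case: ifP => _; last by rewrite normc0 divr_ge0//; apply/ltW/mono_gt0.
  have [_ h _ _] := eP (mclear i I); apply: le_trans (h (I i) z zD) _.
  by rewrite (mono_split rho i I) invfM mulrA.
exists c; split => //.
- by move=> I z /negbTE h; rewrite /c h.
- move=> I; rewrite /c; case: (msupp _ _); last by move=> z zD k; exact: differentiable_cst.
  by have [_ _ h _] := eP (mclear i I); exact: h.
- move=> I z z' zD zD' zz'; rewrite /c; case: ifP => // _.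
  have [ei _ _ es] := eP (mclear i I).
  rewrite /e; set e0 := projT1 _ in ei es *.
  rewrite -(ei _ z (z' i)); apply/eqP; rewrite -subr_eq0; apply/eqP.
  have zD2 : in_polydisc rho (upd z i (z' i)) by exact: in_polydisc_upd.
  apply: (@cpseries_uniq _ (fun n => e0 n (upd z i (z' i)) - e0 n z') (rho i) (rho0 i)).
  move=> t /andP[t0 tr]; have tr' : normc t%:C < rho i by rewrite normc_real gtr0_norm.
  have := chsumB (es _ (in_polydisc_upd zD2 tr')) (es _ (in_polydisc_upd zD' tr')).
  rewrite (c'i _ (upd (upd z i (z' i)) i t%:C) (upd z' i t%:C)) ?subrr; last 3 first.
  - exact: in_polydisc_upd.
  - exact: in_polydisc_upd.
  - move=> k kl; rewrite /upd; case: eqP => // /eqP ki; apply: zz'.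
    by rewrite inE negb_or ki.
  by apply: chsum_ext => n; rewrite !ei !upd_same mulrBl.
move=> z zD.
have aM := cabsb_mono rho0 M0 (fun I => cM I z zD) zD.
have [v hv] := cabsb_chsum aM.
suff -> : F z = v by [].
apply: (chsum_uniq (c's z zD)).
apply: (chsum_fiber (phi := mclear i) aM hv) => I.
have [sI|sI] := boolP (msupp l I); last first.
  rewrite c'0// mul0r; apply: chsum_ext (_ : chsum (fun=> 0) 0); last by split; exact: hsum0.
  move=> N; case: eqP => // NI; rewrite /c ifF ?mul0r//.
  apply: contraNF sI => /forallP h; apply/forallP => k.
  have := h k; rewrite inE -NI /mclear ffunE; case: eqP => [->|_]//=.
  by rewrite eqxx orbT.
have Ii : I i = 0%N by move/forallP : sI => /(_ i); rewrite (negbTE il) => /eqP.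
(* the fibre of mclear i over I is parametrized by the exponent of the variable i *)
have gi : injective (mset1 i I).
  by move=> n m /ffunP /(_ i); rewrite !ffunE eqxx.
have aM' : cabsb (fun N => if mclear i N == I then c N z * mono z N else 0) (M * \prod_i (1 - normc (z i) / rho i)^-1).
  apply: cabsb_le aM => N; case: eqP => // _; rewrite normc0; exact: normc_ge0.
have a0 N : (forall n, mset1 i I n != N) -> (if mclear i N == I then c N z * mono z N else 0) = 0.
  move=> h; case: eqP => // NI; exfalso; have := h (N i); rewrite -NI => /eqP; apply.
  by apply/ffunP => k; rewrite !ffunE; case: eqP => // ->.
apply: ((chsum_inj (c' I z * mono z I) gi a0 aM').2).
have [_ _ _ /(_ z zD) es] := eP I.
rewrite [c' I z * _]mulrC; apply: chsum_ext (chsumZ (mono z I) es) => n /=.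
rewrite mclear_mset1// eqxx /c ifT; last first.
  apply/forallP => k; rewrite inE ffunE; have := forallP sI k.
  by case: (k == i).
rewrite mclear_mset1// (mono_split z i (mset1 i I n)) mclear_mset1// ffunE eqxx.
exact: mulrCA.
Qed.

Theorem cauchy_polydisc rho F M : (forall i, 0 < rho i) -> sepholo rho F ->
  (forall z, in_polydisc rho z -> normc (F z) <= M) ->
  exists c : multi d -> C, (forall I, normc (c I) <= M / mono rho I) /\
    (forall z, in_polydisc rho z -> chsum (fun I => c I * mono z I) (F z)).
Proof.
move=> rho0 dF FM.
have [c [_ cM _ ci cs]] := expand_coordinates rho0 (enum_uniq 'I_d) dF FM.
have D0 : in_polydisc rho (fun=> 0) by move=> i; rewrite normc0.
have cE I z : in_polydisc rho z -> c I z = c I (fun=> 0).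
  by move=> zD; apply: ci => // i; rewrite mem_enum.
exists (fun I => c I (fun=> 0)); split.
  by move=> I; apply: cM.
by move=> z zD; apply: chsum_ext (cs z zD) => I; rewrite (cE _ _ zD).
Qed.

Lemma cmseries_uniq (c : multi d -> C) (rho : R) : 0 < rho ->
  (forall x : 'I_d -> R, (forall i, 0 < x i < rho) ->
     chsum (fun I => c I * mono (fun i => (x i)%:C) I) 0) -> forall N, c N = 0.
Proof.
move=> rho0 h N.
have mR (x : 'I_d -> R) I : mono (fun i => (x i)%:C) I = (mono x I)%:C.
  by rewrite /mono rmorph_prod; apply: eq_bigr => i _; rewrite rmorphXn.
apply: complex_ext.
  apply: (@mseries_uniq _ _ (fun I => complex.Re (c I)) rho rho0) => x /h [h1 _].
  by apply: hsum_ext h1 => I; rewrite mR mulrC ReZ mulrC.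
apply: (@mseries_uniq _ _ (fun I => complex.Im (c I)) rho rho0) => x /h [_ h1].
by apply: hsum_ext h1 => I; rewrite mR mulrC ImZ mulrC.
Qed.

Lemma expand_parameter (H : C -> ('I_d -> C) -> C) (sigma : R) rho M : 0 < sigma ->
  (forall i, 0 < rho i) ->
  (forall t z, normc t < sigma -> in_polydisc rho z -> differentiable (H ^~ z) t) ->
  (forall t, normc t < sigma -> sepholo rho (H t)) ->
  (forall t z, normc t < sigma -> in_polydisc rho z -> normc (H t z) <= M) ->
  exists c : nat -> ('I_d -> C) -> C,
    [/\ forall n z, in_polydisc rho z -> normc (c n z) <= M / sigma ^+ n,
        forall n, sepholo rho (c n) &
        forall t z, normc t < sigma -> in_polydisc rho z -> chsum (fun n => c n z * t ^+ n) (H t z)].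
Proof.
move=> s0 rho0 d1 d2 HM.
have ex z : in_polydisc rho z -> exists c : nat -> C, (forall n, normc (c n) <= M / sigma ^+ n) /\
    (forall a, normc a < sigma -> chsum (fun n => c n * a ^+ n) (H a z)).
  by move=> zD; apply: (@cauchy_disc _ (H ^~ z) sigma M s0) => t ts; [exact: d1|exact: HM].
pose c n z := match pselect (in_polydisc rho z) with
  | left h => projT1 (cid (ex _ h)) n | right _ => 0 end.
have cM n z : in_polydisc rho z -> normc (c n z) <= M / sigma ^+ n.
  by move=> zD; rewrite /c; case: pselect => // h; case: (projT2 (cid (ex _ h))).
have cs t z : normc t < sigma -> in_polydisc rho z -> chsum (fun n => c n z * t ^+ n) (H t z).
  by move=> ts zD; rewrite /c; case: pselect => // h; case: (projT2 (cid (ex _ h))) => _; apply.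
exists c; split => //.
move=> n z zD i.
apply: (@coef_differentiable (fun t w => H t (upd z i w)) sigma (rho i) M (fun n w => c n (upd z i w)) s0) => //.
- by move=> t w ts wr; apply: d1 => //; exact: in_polydisc_upd.
- by move=> t w ts wr; exact: (sepholo_at (d2 t ts) zD wr).
- by move=> t w ts wr; apply: HM => //; exact: in_polydisc_upd.
- by move=> t w ts wr; apply: cs => //; exact: in_polydisc_upd.
Qed.

End CauchyMulti.

#[local] Existing Instance summability.totally_filter.

(** * Sums as limits of the net of finite partial sums *)

Section SumBridge.
Context {R : realType}.

Lemma totallyP (J : choiceType) (P : set {fset J}) : totally P <->
  exists A0 : {fset J}, forall A : {fset J}, (A0 `<=` A)%fset -> P A.
Proof.
split => [[A0 _ h]|[A0 h]]; first by exists A0.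
by exists A0.
Qed.

Lemma partial_sumE (J : choiceType) (V : zmodType) (a : J -> V) (A : {fset J}) :
  partial_sum a A = \sum_(i <- A) a i.
Proof. by rewrite /partial_sum big_seq_fsetE. Qed.

Lemma hsum_is_sum (J : choiceType) (a : J -> R) v : is_sum (V := R^o) a v <-> hsum a v.
Proof.
split => [h e e0|h].
  have [A0 h0] := (totallyP (fun A => `|v - partial_sum a A| < e)).1 ((@cvgrPdist_lt _ _ _ _ _ _ _).1 h e e0).
  by exists A0 => A /h0; rewrite distrC partial_sumE.
apply/(@cvgrPdist_lt _ R^o) => e e0; apply/totallyP; have [A0 h0] := h e e0.
by exists A0 => A /h0; rewrite distrC partial_sumE.
Qed.

Lemma chsum_is_sum (J : choiceType) (a : J -> R[i]) v : is_sum (V := R[i]) a v <-> chsum a v.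
Proof.
split => [h|[h1 h2]].
  have H e : 0 < e -> exists A0 : {fset J}, forall A : {fset J}, (A0 `<=` A)%fset ->
      normc (\sum_(i <- A) a i - v) < e.
    move=> e0; have e0' : 0 < e%:C by rewrite ltcR.
    have [A0 h0] := (totallyP (fun A => `|v - partial_sum a A| < e%:C)).1 ((@cvgrPdist_lt _ _ _ _ _ _ _).1 h e%:C e0').
    by exists A0 => A /h0; rewrite partial_sumE normcE ltcR normc_distC.
  split => e /H[A0 hA0]; exists A0 => A /hA0; apply: le_lt_trans.
    by apply: le_trans (ler_Re _); rewrite ReD ReN Re_sum.
  by apply: le_trans (ler_Im _); rewrite ImD ImN Im_sum.
apply/(@cvgrPdist_lt _ R[i]) => e' /ltc_real[e e0 ->]; apply/totallyP.
have e2 : 0 < e / 2 by lra.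
have [A1 hA1] := h1 _ e2; have [A2 hA2] := h2 _ e2.
exists (A1 `|` A2)%fset => A sA; rewrite partial_sumE normcE ltcR normc_distC.
apply: le_lt_trans (normc_le_ReIm _) _; rewrite [e]splitr ReD ImD ReN ImN Re_sum Im_sum ltrD//.
  by apply: hA1; apply: fsubset_trans sA; exact: fsubsetUl.
by apply: hA2; apply: fsubset_trans sA; exact: fsubsetUr.
Qed.

Lemma summability_sumE (J : choiceType) (a : J -> R) v : hsum a v ->
  summability.sum (R := R^o) a = v.
Proof.
move=> /hsum_is_sum h; rewrite /summability.sum; apply: (@cvg_lim R^o _ _ _ _ _ _ h).
exact: norm_hausdorff.
Qed.

(** The sum is chosen once and for all so that power series become functions of the point. *)
Definition usum (J : choiceType) (a : J -> R) : R := xget 0 [set v | hsum a v].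

Lemma usumE (J : choiceType) (a : J -> R) v : hsum a v -> usum a = v.
Proof.
by move=> h; apply: xget_unique => // w hw; exact: hsum_uniq hw h.
Qed.

Lemma usumP (J : choiceType) (a : J -> R) M : absb a M -> hsum a (usum a).
Proof. by move=> /absb_hsum[v hv]; rewrite (usumE hv). Qed.

End SumBridge.

(** * Real power series in several variables *)

Section PowerSeries.
Context {R : realType} {d : nat}.
Implicit Types (c : multi d -> R) (x y : 'I_d -> R).

Definition munit (i : 'I_d) : multi d := [ffun k => (k == i) : nat].

Definition updr x (i : 'I_d) (t : R) : 'I_d -> R := fun k => if k == i then t else x k.

(** The coefficients of the i-th partial derivative of the power series with coefficients c. *)
Definition deriv_coef c (i : 'I_d) : multi d -> R := fun I => (I i).+1%:R * c (I + munit i).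

Definition psum c x : R := usum (fun I => c I * mono x I).

(** Absolute convergence at y gives absolute convergence on the closed polydisc of radius y. *)
Definition abs_conv_at c y := exists M, absb (fun I => c I * mono y I) M.

Lemma bernoulli_le (a e : R) n : 0 <= a -> 0 <= e ->
  a ^+ n + n%:R * a ^+ n.-1 * e <= (a + e) ^+ n.
Proof.
move=> a0 e0; elim: n => [|n IH]; first by rewrite !expr0 !mul0r addr0.
rewrite [leRHS]exprSr; apply: le_trans (ler_wpM2r (addr_ge0 a0 e0) IH).
case: n {IH} => [|n]; first by rewrite !expr0 expr1 !mul0r addr0 !mul1r.
rewrite /= -subr_ge0.
have -> : (a ^+ n.+1 + n.+1%:R * a ^+ n * e) * (a + e) - (a ^+ n.+2 + n.+2%:R * a ^+ n.+1 * e) =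
  n.+1%:R * a ^+ n * e ^+ 2 by rewrite !exprS -!natr1; ring.
by rewrite !mulr_ge0 ?exprn_ge0.
Qed.

Lemma taylor_pow1 (a h : R) n :
  `|(a + h) ^+ n - a ^+ n - n%:R * h * a ^+ n.-1| <= h ^+ 2 * (`|a| + `|h| + 1) ^+ n.
Proof.
elim: n => [|n IH].
  by rewrite !expr0 subrr !mul0r subrr normr0 mulr1 sqr_ge0.
set D := (a + h) ^+ n - a ^+ n - n%:R * h * a ^+ n.-1 in IH.
have -> : (a + h) ^+ n.+1 - a ^+ n.+1 - n.+1%:R * h * a ^+ n.+1.-1 =
    (a + h) * D + n%:R * h ^+ 2 * a ^+ n.-1.
  rewrite /D; case: n {IH D} => [|n]; rewrite /= ?expr0 ?expr1 ?mulr1; first ring.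
  by rewrite !exprS -!natr1; ring.
have [Y YE] : exists Y : R, Y = `|a| + `|h| + 1 by eexists.
rewrite -YE in IH *.
have E : h ^+ 2 * Y ^+ n.+1 = (`|a| + `|h|) * (h ^+ 2 * Y ^+ n) + h ^+ 2 * Y ^+ n.
  by rewrite (exprS Y) mulrCA {1}YE mulrDl mul1r.
apply: le_trans (ler_normD _ _) _; rewrite E.
apply: lerD; first by rewrite normrM ler_pM// ler_normD.
rewrite -mulrA [_ * (_ * _)]mulrCA normrM (ger0_norm (sqr_ge0 h)) ler_wpM2l ?sqr_ge0//.
rewrite normrM normrX ger0_norm//.
apply: (@le_trans _ _ ((`|a| + 1) ^+ n)).
  by apply: le_trans (bernoulli_le n (normr_ge0 a) ler01); rewrite mulr1 lerDr exprn_ge0.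
rewrite YE; apply: lerXn2r; rewrite ?nnegrE ?addr_ge0// lerD2r lerDl//.
Qed.

(** The bound in [taylor_pow1] carries the factor (|a| + |h| + 1)^n; rescaling by eta replaces 1 by
    an eta so small that the point |a| + |h| + eta stays inside a disc of convergence. *)
Lemma taylor_pow (a h eta : R) n : 0 < eta ->
  `|(a + h) ^+ n - a ^+ n - n%:R * h * a ^+ n.-1| <= (h / eta) ^+ 2 * (`|a| + `|h| + eta) ^+ n.
Proof.
move=> e0; have en0 : eta != 0 by rewrite gt_eqF.
have := taylor_pow1 (a / eta) (h / eta) n.
have -> : `|a / eta| + `|h / eta| + 1 = (`|a| + `|h| + eta) / eta.
  by rewrite !normrM normfV (gtr0_norm e0); field.
rewrite -[X in (X ^+ n - _ - _)]mulrDl !exprMn => H.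
have E : n%:R * (h / eta) * (a ^+ n.-1 * eta^-1 ^+ n.-1) = n%:R * h * a ^+ n.-1 * eta^-1 ^+ n.
  by case: n {H} => [|n]; rewrite ?mul0r// /= exprS; ring.
have q0 : 0 <= eta^-1 ^+ n by rewrite exprn_ge0// invr_ge0 ltW.
rewrite E -!mulrBl normrM (ger0_norm q0) in H.
rewrite -(ler_pM2r (_ : 0 < eta^-1 ^+ n)) ?exprn_gt0 ?invr_gt0//.
by rewrite -[leRHS]mulrA.
Qed.

Lemma mono_upd x i t I : mono (updr x i t) I = mono x (mclear i I) * t ^+ I i.
Proof.
rewrite (mono_split _ i) /updr eqxx; congr (_ * _); apply: eq_bigr => k _.
by rewrite ffunE; case: eqP => // _; rewrite !expr0.
Qed.

Lemma abs_conv_at_le c x y : (forall i, `|x i| <= y i) -> abs_conv_at c y -> abs_conv_at c x.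
Proof.
move=> xy [M hM]; exists M; apply: absb_le hM => I.
rewrite !normrM ler_wpM2l// mono_norm ger0_norm ?mono_ge0//; last first.
  by move=> i; exact: le_trans (xy i).
by apply: mono_le => i; rewrite normr_ge0 xy.
Qed.

Lemma psum_hsum c x y : (forall i, `|x i| <= y i) -> abs_conv_at c y ->
  hsum (fun I => c I * mono x I) (psum c x).
Proof. by move=> xy /(abs_conv_at_le xy)[M hM]; exact: usumP hM. Qed.

Lemma munit_addK i (I : multi d) : (0 < I i)%N -> [ffun k => (I k - (k == i))%N] + munit i = I.
Proof.
move=> Ii; apply/ffunP => k; rewrite !ffunE /=.
by case: eqP => [->|_]; rewrite -[LHS]/(_ + _)%N ?subnK// subn0 addn0.
Qed.

Lemma munit_inj i : injective (fun I : multi d => I + munit i).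
Proof. move=> I J /ffunP e; apply/ffunP => k; have := e k; rewrite !ffunE.
exact: addIn. Qed.

(** Convergence at a larger point absorbs the factor I i, by Bernoulli's inequality. *)
Lemma deriv_absb c i x y : abs_conv_at c y -> (forall k, `|x k| < y k) ->
  exists M, absb (fun I : multi d => (I i)%:R * c I * (mono (updr x i 1) I * x i ^+ (I i).-1)) M.
Proof.
move=> [M hM] xy.
have y0 k : 0 < y k by exact: le_lt_trans (xy k).
pose eta := y i - `|x i|; have e0 : 0 < eta by rewrite subr_gt0.
exists (`|eta^-1| * M); apply: absb_le (absbZ eta^-1 hM) => I.
rewrite mono_upd expr1n mulr1 (mono_split y i).
have -> : (I i)%:R * c I * (mono x (mclear i I) * x i ^+ (I i).-1) =
   c I * (mono x (mclear i I) * ((I i)%:R * x i ^+ (I i).-1)) by ring.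
have -> : eta^-1 * (c I * (mono y (mclear i I) * y i ^+ I i)) =
   c I * (mono y (mclear i I) * (eta^-1 * y i ^+ I i)) by ring.
rewrite [leLHS]normrM [leRHS]normrM ler_wpM2l// [leLHS]normrM [leRHS]normrM.
apply: ler_pM => //.
  rewrite mono_norm [leRHS]ger0_norm ?mono_ge0// => [|k]; last exact: ltW.
  by apply: mono_le => k; rewrite normr_ge0 ltW.
rewrite [leRHS]ger0_norm; last by rewrite mulr_ge0 ?invr_ge0 ?exprn_ge0// ltW.
rewrite normrM normr_nat normrX [leRHS]mulrC ler_pdivlMr//.
have h1 : (`|x i| + eta) ^+ I i = y i ^+ I i by rewrite /eta addrC subrK.
rewrite -h1; apply: le_trans (bernoulli_le (I i) (normr_ge0 (x i)) (ltW e0)).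
by rewrite lerDr exprn_ge0.
Qed.

Lemma deriv_coef_hsum c i x y v : abs_conv_at c y -> (forall k, `|x k| < y k) ->
  hsum (fun I : multi d => (I i)%:R * c I * (mono (updr x i 1) I * x i ^+ (I i).-1)) v <->
  hsum (fun I => deriv_coef c i I * mono x I) v.
Proof.
move=> cy xy; have [M B] := deriv_absb i cy xy.
rewrite (hsum_inj v (@munit_inj i) _ B); last first.
  move=> I hI; case Ii : (I i) => [|n]; first by rewrite !mul0r.
  exfalso; have := hI [ffun k => (I k - (k == i))%N].
  by rewrite munit_addK ?Ii// eqxx.
have E (I : multi d) : (fun I : multi d => (I i)%:R * c I * (mono (updr x i 1) I * x i ^+ (I i).-1)) (I + munit i) =
    deriv_coef c i I * mono x I.
  have Ei : (I + munit i) i = (I i).+1.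
    by rewrite !ffunE eqxx -[LHS]/(_ + _)%N addn1.
  rewrite Ei /deriv_coef mono_upd expr1n mulr1 /= (mono_split x i I).
  congr (_ * (_ * _)); congr mono; apply/ffunP => k; rewrite !ffunE.
  by case: (k == i) => //; rewrite -[LHS]/(I k + 0)%N addn0.
by split; apply: hsum_ext => I; rewrite /comp E.
Qed.

Lemma deriv_coef_conv c i x y : abs_conv_at c y -> (forall k, 0 <= x k < y k) -> abs_conv_at (deriv_coef c i) x.
Proof.
move=> [M hM] xy; pose c' (I : multi d) := `|c I|.
have cy' : abs_conv_at c' y.
  by exists M; apply: absb_le hM => I; rewrite !normrM normr_id.
have x1 k : `|x k| < y k by have /andP[h1 h2] := xy k; rewrite ger0_norm.
have x0 k : 0 <= x k by case/andP: (xy k).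
have [M' B] := deriv_absb i cy' x1.
have [v hv] := absb_hsum B.
exists v; apply: (@absb_le _ _ _ (fun I => deriv_coef c' i I * mono x I)).
  by move=> I; rewrite /deriv_coef !normrM normr_id.
apply: hsum_absb; last exact/(deriv_coef_hsum i v cy' x1).
move=> I; rewrite /deriv_coef; apply: mulr_ge0; last exact: mono_ge0.
by apply: mulr_ge0 => //; exact: normr_ge0.
Qed.

(** The remainders of the monomials are quadratic in h with constants which are the terms of the
    series at y, up to a factor 1 / eta^2. *)
Lemma psum_deriv c i x y : abs_conv_at c y -> (forall k, `|x k| < y k) ->
  exists K dl : R, 0 < dl /\ forall h : R, `|h| < dl ->
    `|psum c (updr x i (x i + h)) - psum c x - h * psum (deriv_coef c i) x| <= K * h ^+ 2.
Proof.
move=> cy xy.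
have y0 k : 0 < y k by exact: le_lt_trans (xy k).
pose eta := (y i - `|x i|) / 2; have e0 : 0 < eta by rewrite divr_gt0// subr_gt0.
have [M hM] := cy.
exists (M / eta ^+ 2), eta; split => // h hh.
have xi : updr x i (x i) = x by apply/funext => k; rewrite /updr; case: eqP => // ->.
have s1 : hsum (fun I => c I * mono (updr x i (x i + h)) I) (psum c (updr x i (x i + h))).
  apply: (psum_hsum _ cy) => k; rewrite /updr; case: eqP => [->|_]; last exact: ltW.
  apply: le_trans (ler_normD _ _) _; have := xy i; rewrite /eta in hh; lra.
have s2 : hsum (fun I => c I * mono x I) (psum c x) by apply: (psum_hsum _ cy) => k; exact: ltW.
have [M' B] := deriv_absb i cy xy.
have [v hv] := absb_hsum B.
have dv := (deriv_coef_hsum i v cy xy).1 hv.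
rewrite (usumE dv : psum (deriv_coef c i) x = v).
have H := hsumB (hsumB s1 s2) (hsumZ h hv).
apply: le_trans (hsum_norm_le _ H) (lexx _).
have := absbZ (h ^+ 2 / eta ^+ 2) hM.
have n0 : 0 <= h ^+ 2 / eta ^+ 2 by rewrite divr_ge0 ?sqr_ge0.
rewrite (ger0_norm n0) => hM'.
have -> : M / eta ^+ 2 * h ^+ 2 = h ^+ 2 / eta ^+ 2 * M by ring.
apply: absb_le hM' => I.
rewrite (mono_split x i) !mono_upd expr1n mulr1 (mono_split y i).
have -> : c I * (mono x (mclear i I) * (x i + h) ^+ I i) - c I * (mono x (mclear i I) * x i ^+ I i)
  - h * ((I i)%:R * c I * (mono x (mclear i I) * x i ^+ (I i).-1)) =
  c I * (mono x (mclear i I) * ((x i + h) ^+ I i - x i ^+ I i - (I i)%:R * h * x i ^+ (I i).-1)) by ring.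
have -> : h ^+ 2 / eta ^+ 2 * (c I * (mono y (mclear i I) * y i ^+ I i)) =
  c I * (mono y (mclear i I) * (h ^+ 2 / eta ^+ 2 * y i ^+ I i)) by ring.
rewrite [leLHS]normrM [leRHS]normrM ler_wpM2l// [leLHS]normrM [leRHS]normrM.
apply: ler_pM => //.
  rewrite mono_norm [leRHS]ger0_norm ?mono_ge0// => [|k]; last exact: ltW.
  by apply: mono_le => k; rewrite normr_ge0 ltW.
apply: le_trans (taylor_pow _ _ _ e0) _; rewrite exprMn exprVn.
apply: le_trans (ler_norm _); rewrite ler_wpM2l//.
apply: lerXn2r; rewrite ?nnegrE ?addr_ge0 ?(ltW e0) ?(ltW (y0 i))//.
by have := xy i; rewrite /eta in hh *; lra.
Qed.

End PowerSeries.

(** * Entire functions of exponential type *)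

Section ExpType.
Context {R : realType}.

Lemma fact_bound (n : nat) : (n`!)%:R * expR n%:R <= (n.+1%:R ^+ n.+1 : R).
Proof.
elim: n => [|n IH]; first by rewrite fact0 expR0 mulr1 expr1.
rewrite factS natrM -[in expR _]natr1 expRD mulrACA.
apply: (@le_trans _ _ (n.+1%:R ^+ n.+1 * (n.+1%:R * expR 1))).
  have -> : n.+1%:R * expR n%:R * ((n`!)%:R * expR 1) = ((n`!)%:R * expR n%:R) * (n.+1%:R * expR 1) :> R.
    by rewrite mulrACA [in RHS]mulrACA [_ * n.+1%:R]mulrC.
  by rewrite ler_wpM2r// mulr_ge0 ?expR_ge0.
rewrite mulrA -exprSr -[X in X * _]mulr1.
have n0 : 0 < (n.+2%:R : R) by [].
have e1 : expR (- (n.+2%:R)^-1) >= n.+1%:R / n.+2%:R :> R.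
  have nE : n.+1%:R = n.+2%:R - 1 :> R by rewrite -[n.+2%:R]natr1 addrK.
  apply: le_trans (expR_ge1Dx _).
  by rewrite nE mulrBl mulfV ?mul1r ?gt_eqF.
have := lerXn2r n.+2 (x := n.+1%:R / n.+2%:R : R) (y := expR (- (n.+2%:R)^-1)).
rewrite !nnegrE divr_ge0// expR_ge0 => /(_ isT isT e1).
rewrite -expRM_natr mulNr mulVf ?gt_eqF// expRN exprMn exprVn ler_pdivrMr ?exprn_gt0//.
by move=> H; rewrite mulr1 -ler_pdivlMr ?expR_gt0// mulrC.
Qed.

(** Cauchy's estimate at the radius rho = (n + 1) / r', close to the minimizer n / r' of
    e^(r' rho) / rho^n. Combined with n! e^n <= (n + 1)^(n + 1), it shows that the n-th derivative at 0
    grows like r'^n. *)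
Lemma exp_type_coef (n : nat) (r r' : R) : r < r' -> 0 < r' ->
  exists2 rho : R, 0 < rho & (n`!)%:R * expR (r * rho) / rho ^+ n <= (expR 1 / (1 - r / r')) * r' ^+ n.
Proof.
move=> rr r'0; exists (n.+1%:R / r'); first by rewrite divr_gt0.
set th := r / r'; have th1 : 0 < 1 - th by rewrite subr_gt0 ltr_pdivrMr// mul1r.
have -> : r * (n.+1%:R / r') = th * n.+1%:R by rewrite /th; ring.
have F := fact_bound n.
have n0 : 0 < (n.+1%:R : R) by [].
have E1 : (n`!)%:R <= n.+1%:R ^+ n.+1 * expR (- n%:R) :> R.
  by rewrite expRN ler_pdivlMr ?expR_gt0.
rewrite exprMn exprVn invfM invrK mulrA ler_wpM2r ?exprn_ge0 ?(ltW r'0)//.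
rewrite ler_pdivrMr ?exprn_gt0//.
apply: (@le_trans _ _ (n.+1%:R ^+ n.+1 * expR (- n%:R) * expR (th * n.+1%:R))).
  by rewrite ler_wpM2r ?expR_ge0.
rewrite -mulrA -expRD exprSr -mulrA [leRHS]mulrC ler_wpM2l ?exprn_ge0//.
rewrite ler_pdivlMr// mulrAC.
have -> : - n%:R + th * n.+1%:R = 1 - (1 - th) * n.+1%:R :> R by rewrite -natr1; ring.
rewrite expRD mulrCA ler_piMr ?expR_ge0// expRN ler_pdivrMr ?expR_gt0// mul1r mulrC.
by apply: le_trans (expR_ge1Dx _); rewrite lerDr.
Qed.

Lemma derive_quad n (f : 'rV[R]_n -> R) x v l (K dl : R) : 0 < dl ->
  (forall h : R, `|h| < dl -> `|f (h *: v + x) - f x - h * l| <= K * h ^+ 2) ->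
  'D_v f x = l.
Proof.
move=> dl0 hf; apply: cvg_lim; first exact: norm_hausdorff.
apply/cvgrPdist_le => e e0.
have K1 : 0 < `|K| + 1 by rewrite ltr_wpDl.
apply/nbhs_ballP; exists (Num.min dl (e / (`|K| + 1))) => /=.
  by rewrite lt_min dl0 divr_gt0.
move=> h; rewrite /ball /= sub0r normrN lt_min => /andP[h1 h2] h0.
have hn : 0 < `|h| by rewrite normr_gt0.
have := hf h h1 => H.
have -> : l - h^-1 *: (f (h *: v + x) - f x) = - (h^-1 * (f (h *: v + x) - f x - h * l)).
  by rewrite -[h^-1 *: _]/(h^-1 * _); field.
rewrite normrN normrM normfV ler_pdivrMl//; apply: le_trans H _.
apply: (@le_trans _ _ ((`|K| + 1) * h ^+ 2)).
  by rewrite ler_wpM2r ?sqr_ge0// (le_trans (ler_norm K))// lerDl.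
have hh : h ^+ 2 = `|h| * `|h| by rewrite -expr2 real_normK ?num_real.
rewrite hh mulrA [leRHS]mulrC ler_wpM2r// mulrC -ler_pdivlMr//.
exact: ltW.
Qed.

Variable d : nat.
Implicit Types (c b : multi d -> R).

Definition entire c := forall y : 'I_d -> R, (forall k, 0 <= y k) -> abs_conv_at c y.

Lemma entire_deriv_coef c i : entire c -> entire (deriv_coef c i).
Proof.
move=> ec y y0; apply: (@deriv_coef_conv _ _ _ _ _ (fun k => y k + 1)).
  by apply: ec => k; rewrite addr_ge0.
by move=> k; rewrite y0 ltrDl ltr01.
Qed.

Lemma row_upd (x : 'rV[R]_d) i h : (h *: delta_mx 0 i + x : 'rV[R]_d) 0 = updr (x 0) i (x 0 i + h).
Proof.
apply/funext => k; rewrite !mxE /updr eqxx /= addrC.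
by case: eqP => [->|_]; rewrite ?mulr1// mulr0 addr0.
Qed.

Lemma partial_psum c i : entire c ->
  partial i (fun x : 'rV[R]_d => psum c (x 0)) = (fun x => psum (deriv_coef c i) (x 0)).
Proof.
move=> ec; apply/funext => x; rewrite /partial.
have [K [dl [dl0 H]]] := @psum_deriv _ _ c i (x 0) (fun k => `|x 0 k| + 1) (ec _ (fun k => addr_ge0 (normr_ge0 _) ler01)) (fun k => ltr_pwDr ltr01 (lexx _)).
apply: (derive_quad (K := K) dl0) => h hh; rewrite row_upd; exact: H.
Qed.

(** The power series with derivatives b at 0. *)
Definition egf b : multi d -> R := fun I => b I / (mfact I)%:R.

Lemma mfact_munit i (I : multi d) : mfact (I + munit i) = ((I i).+1 * mfact I)%N.
Proof.
rewrite /mfact (bigD1 i)//= [in RHS](bigD1 i)//= mulnA.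
have -> : (I + munit i) i = (I i).+1 by rewrite !ffunE eqxx -[LHS]/(_ + _)%N addn1.
rewrite factS; congr (_ * _)%N; apply: eq_bigr => k ki.
by rewrite !ffunE (negbTE ki) -[X in X`!]/(_ + _)%N addn0.
Qed.

Lemma deriv_coef_egf b i : deriv_coef (egf b) i = egf (fun I => b (I + munit i)).
Proof.
apply/funext => I; rewrite /deriv_coef /egf mfact_munit natrM.
have f0 : (mfact I)%:R != 0 :> R by rewrite pnatr_eq0 -lt0n mfact_gt0.
have n0 : (I i).+1%:R != 0 :> R by rewrite pnatr_eq0.
by rewrite invfM mulrCA [in RHS]mulrC mulVKf// mulrC.
Qed.

Lemma sum_munit (J : multi d) : \sum_(i <- enum 'I_d) munit i *+ J i = J.
Proof.
apply/ffunP => k; rewrite sum_ffunE big_enum /= (bigD1 k)//= big1 => [|i ik].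
  rewrite addr0 ffunMnE ffunE eqxx; by elim: (J k) => // n IH; rewrite mulrS IH.
by rewrite ffunMnE ffunE eq_sym (negbTE ik) mul0rn.
Qed.

(** Differentiating an exponential generating function shifts its coefficients. *)
Lemma mpartial_psum b (J : multi d) : entire (egf b) ->
  mpartial J (fun x => psum (egf b) (x 0)) = (fun x => psum (egf (fun I => b (I + J))) (x 0)) /\
  entire (egf (fun I => b (I + J))).
Proof.
move=> eb; rewrite /mpartial -{2 3}(sum_munit J).
have key i n b' : entire (egf b') ->
    iter n (partial i) (fun x : 'rV[R]_d => psum (egf b') (x 0)) = (fun x => psum (egf (fun I => b' (I + munit i *+ n))) (x 0))
    /\ entire (egf (fun I => b' (I + munit i *+ n))).
  move=> eb'; elim: n => [|n [IH1 IH2]].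
    have E0 : (fun I => b' (I + munit i *+ 0)) = b' by apply/funext => I; rewrite mulr0n addr0.
    by rewrite E0.
  have E : egf (fun I => b' (I + munit i *+ n.+1)) = deriv_coef (egf (fun I => b' (I + munit i *+ n))) i.
    by rewrite deriv_coef_egf; congr egf; apply/funext => I; rewrite mulrS addrA.
  by rewrite E iterS IH1 partial_psum//; split => //; exact: entire_deriv_coef.
elim: (enum _) => [|i s [IH1 IH2]] /=.
  have E0 : (fun I : multi d => b (I + \sum_(j <- [::]) munit j *+ J j)) = b.
    by apply/funext => I; rewrite big_nil addr0.
  by rewrite E0.
rewrite IH1; have [-> e2] := key i (J i) _ IH2.
have E : (fun I => b (I + munit i *+ J i + \sum_(j <- s) munit j *+ J j)) =
    (fun I => b (I + \sum_(j <- i :: s) munit j *+ J j)).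
  by apply/funext => I; rewrite big_cons addrA.
by split; [rewrite E|rewrite -E].
Qed.

End ExpType.

Section Extension.
Context {R : realType}.
Local Notation C := R[i].

Lemma diff_line (V : normedModType C) (F : V -> C) (x v : V) (t : C) :
  differentiable F (x + t *: v) -> differentiable (fun t : C => F (x + t *: v)) t.
Proof.
move=> dF; apply: (@differentiable_comp _ _ _ _ (fun t : C => x + t *: v) F) => //.
Qed.

(** Liouville's theorem. By Cauchy's estimates f(a) - f(0) is at most 2 M |a| / rho. *)
Lemma bounded_entire_const (f : C -> C) (M : R) : (forall z, differentiable f z) ->
  (forall z, normc (f z) <= M) -> forall a, f a = f 0.
Proof.
move=> df bf a; apply/eqP; rewrite -subr_eq0 -normc_eq0 -normr_le0 -[X in `|X|]/(normc _).
rewrite ger0_norm ?normc_ge0//; apply/ler_addgt0Pr => e e0; rewrite add0r.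
have M0 : 0 <= M by apply: le_trans (bf 0); exact: normc_ge0.
(* large enough for |a| / rho <= 1 / 2 and 2 M |a| / rho <= e *)
pose rho := 2 * normc a + 1 + 2 * normc a * M / e.
have na := normc_ge0 a.
have t0 : 0 <= 2 * normc a * M / e by rewrite !mulr_ge0// invr_ge0 ltW.
have rho0 : 0 < rho by rewrite /rho; lra.
have [c [cb hc]] := cauchy_disc rho0 (fun z _ => df z) (fun z _ => bf z).
have ha : normc a < rho by rewrite /rho; lra.
have hz : normc (0 : C) < rho by rewrite (normc_real (0:R)) normr0.
have q0 : 0 <= normc a / rho by rewrite divr_ge0// ltW.
have q1 : normc a / rho <= 1 / 2 by rewrite ler_pdivrMr// /rho; lra.
have S := chsumB (hc a ha) (hc 0 hz).
have B : cabsb (fun n => c n * a ^+ n - c n * 0 ^+ n) (2 * M * (normc a / rho)).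
  apply: (@cabsb_le _ _ _ (fun n => if n is n'.+1 then M * (normc a / rho) ^+ n else 0)).
    case=> [|n]; first by rewrite !expr0 subrr (normc_real (0:R)) normr0.
    rewrite expr0n mulr0 subr0 normcM normcX exprMn exprVn.
    have := cb n.+1; rewrite ler_pdivlMr ?exprn_gt0// => h.
    rewrite mulrA -[leRHS]/(_ / _) ler_pdivlMr ?exprn_gt0// mulrAC ler_wpM2r// exprn_ge0//.
  apply: nat_absb => n; apply: (@le_trans _ _ (M * (normc a / rho) * \sum_(k < n) (normc a / rho) ^+ k)).
    case: n => [|n]; first by rewrite !big_ord0 mulr0.
    rewrite big_ord_recl normr0 add0r mulr_sumr big_ord_recr /=.
    rewrite -[leLHS]addr0 lerD//; last by rewrite mulr_ge0 ?exprn_ge0// mulr_ge0.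
    apply: ler_sum => k _; rewrite ger0_norm; last by rewrite !mulr_ge0// exprn_ge0.
    by rewrite exprS mulrA.
  rewrite mulrAC ler_wpM2r// [leRHS]mulrC ler_wpM2l//.
  have q01 : 0 <= normc a / rho < 1 by apply/andP; split=> //; apply: le_lt_trans q1 _; lra.
  have := nat_geom_absb q01 [fset k in iota 0 n]%fset; rewrite (big_fset_iota (fun k => `|(normc a / rho) ^+ k|)) => h.
  apply: (@le_trans _ _ (1 - normc a / rho)^-1); last by rewrite invf_ple ?posrE; lra.
  by apply: le_trans h; apply: ler_sum => k _; exact: ler_norm.
apply: le_trans (chsum_norm_le B S) _.
rewrite mulrA ler_pdivrMr// /rho.
have : e * (2 * normc a * M / e) = 2 * normc a * M by field; rewrite gt_eqF.
have : 0 <= e * (2 * normc a + 1) by rewrite mulr_ge0 ?(ltW e0)//; lra.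
by rewrite !mulrDr; lra.
Qed.

Variable d : nat.
Implicit Types (r : 'I_d -> R) (g : 'rV[R]_d -> R).

Lemma row_upd_line (z : 'I_d -> C) i t :
  \row_k upd z i t k = \row_k upd z i 0 k + t *: delta_mx 0 i :> 'rV[C]_d.
Proof.
apply/rowP => k; rewrite !mxE /upd eqxx /=; case: eqP => _; rewrite ?mulr1 ?add0r//.
by rewrite mulr0 addr0.
Qed.

Lemma sepholo_row (rho : 'I_d -> R) (F : 'rV[C]_d -> C) :
  (forall z, in_polydisc rho z -> differentiable F (\row_k z k)) ->
  sepholo rho (fun z => F (\row_k z k)).
Proof.
move=> dF z hz i.
have -> : (fun t => F (\row_k upd z i t k)) = (fun t => F (\row_k upd z i 0 k + t *: delta_mx 0 i)).
  by apply/funext => t; rewrite row_upd_line.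
by apply: diff_line; rewrite -row_upd_line upd_id; exact: dF.
Qed.

Lemma mono_real (x : 'I_d -> R) I : mono (fun i => (x i)%:C) I = (mono x I)%:C.
Proof. by rewrite /mono rmorph_prod; apply: eq_bigr => i _; rewrite rmorphXn. Qed.

(** With a negative rate in one coordinate, the function is bounded in this coordinate, hence
    constant in it by Liouville's theorem, and it tends to 0 there. *)
Lemma exp_type_neg (Cst : R) r (F : 'rV[C]_d -> C) i : r i < 0 ->
  holomorphic_on setT F ->
  (forall z, normc (F z) <= Cst * expR (\sum_i r i * normc (z 0 i))) ->
  forall z, F z = 0.
Proof.
move=> ri dF bF z.
have C0 : 0 <= Cst.
  have := le_trans (normc_ge0 _) (bF 0); rewrite pmulr_lge0//; exact: expR_gt0.
pose z' : 'I_d -> C := z 0.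
have zE : z = \row_k z' k by apply/rowP => k; rewrite mxE.
pose f t := F (\row_k upd z' i t k).
pose A := Cst * expR (\sum_(k | k != i) r k * normc (z 0 k)).
have A0 : 0 <= A by rewrite mulr_ge0 ?expR_ge0.
have bf t : normc (f t) <= A * expR (r i * normc t).
  apply: le_trans (bF _) _; rewrite (bigD1 i)//= mxE /upd eqxx addrC expRD mulrA.
  rewrite ler_wpM2r ?expR_ge0// ler_wpM2l// ler_expR; apply: ler_sum => k ki.
  by rewrite mxE (negbTE ki).
have cf := @bounded_entire_const f A.
have {}cf a : f a = f 0.
  apply: cf => [t|t].
    have -> : f = (fun t => F (\row_k upd z' i 0 k + t *: delta_mx 0 i)).
      by apply/funext => u; rewrite /f row_upd_line.
    by apply: diff_line; exact: dF.
  apply: le_trans (bf t) _; rewrite -[leRHS]mulr1 ler_wpM2l// -expR0 ler_expR.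
  by rewrite nmulr_rle0// normc_ge0.
have -> : F z = f (z' i) by rewrite /f upd_id -zE.
apply/eqP; rewrite -normc_eq0 eq_le normc_ge0 andbT; apply/ler_addgt0Pr => e e0; rewrite add0r.
(* a point of the real axis where the bound A exp(r_i s) is at most e, since exp x >= x *)
pose s := A / e / (- r i).
have s0 : 0 <= s by rewrite !divr_ge0 ?(ltW e0)// oppr_ge0 ltW.
have -> : f (z' i) = f s%:C by rewrite !cf.
apply: le_trans (bf _) _; rewrite normc_real ger0_norm//.
have -> : r i * s = - (A / e) by rewrite /s; field; rewrite (lt_eqF ri) gt_eqF.
rewrite expRN ler_pdivrMr ?expR_gt0// [leRHS]mulrC -ler_pdivrMr//.
by apply: le_trans (expR_ge1Dx _); rewrite lerDr.
Qed.

(** All derivatives of g are series in the derivatives b of g at 0, which grow at most like r'^I.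
    The coefficients on polydiscs of different radii agree by uniqueness, so that for each I the
    radius can be chosen according to [exp_type_coef]. A negative rate makes the function vanish. *)
Lemma exp_type_expansion (Cst : R) r r' g : extends_exp_type Cst r g ->
  (forall i, r i < r' i) -> (forall i, 0 < r' i) ->
  exists b : multi d -> R, exists C' : R,
    [/\ 0 <= C', forall I, `|b I| <= C' * mono r' I,
        forall (J : multi d) (x : 'rV[R]_d), hsum (fun I : multi d => b (I + J) * (mono (x 0) I / (mfact I)%:R)) (mpartial J g x) &
        (exists i, r i < 0) -> C' = 0].
Proof.
move=> [F [dF Fg bF]] rr r'0.
have C0 : 0 <= Cst.
  have := le_trans (normc_ge0 _) (bF 0); rewrite pmulr_lge0//; exact: expR_gt0.
pose F' z := F (\row_k z k).
(* on a polydisc a negative rate contributes at most a factor 1 *)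
pose rp i := Num.max 0 (r i).
have rp0 i : 0 <= rp i by rewrite /rp le_max lexx.
pose M (rho : 'I_d -> R) := Cst * expR (\sum_i rp i * rho i).
have sF rho : sepholo rho F' by apply: sepholo_row => z _; exact: dF.
have bF' rho z : in_polydisc rho z -> normc (F' z) <= M rho.
  move=> hz; apply: le_trans (bF _) _; rewrite ler_wpM2l// ler_expR.
  apply: ler_sum => i _; rewrite mxE; apply: (@le_trans _ _ (rp i * normc (z i))).
    by rewrite ler_wpM2r ?normc_ge0// /rp le_max lexx orbT.
  by rewrite ler_wpM2l// ltW.
have P rho (h : forall i, 0 < rho i) := cauchy_polydisc h (sF rho) (bF' rho).
have o0 : forall i : 'I_d, 0 < (1 : R) by [].
have [c [_ hc]] := P _ o0.
have cb rho : (forall i, 0 < rho i) -> forall I, normc (c I) <= M rho / mono rho I.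
  move=> rho0 I; have [c' [cb' hc']] := P _ rho0.
  suff -> : c I = c' I by [].
  have [m m0 mr] : exists2 m : R, 0 < m & m <= 1 /\ forall i, m <= rho i.
    exists (\big[Num.min/1]_i rho i).
      by elim/big_ind: _ => // a b a0 b0; rewrite lt_min a0.
    split; first by rewrite -big_enum /=; elim: (enum _) => [|i s IH]; rewrite ?big_nil// big_cons ge_min IH orbT.
    by move=> i; rewrite (bigD1 i)//= ge_min lexx.
  apply/eqP; rewrite -subr_eq0; apply/eqP.
  apply: (@cmseries_uniq _ _ (fun I => c I - c' I) m m0 _ I) => x hx.
  have xb k : in_polydisc (fun=> 1) (fun i => (x i)%:C) /\ in_polydisc rho (fun i => (x i)%:C) \/ k = 0%N.
    left; split=> i; rewrite normc_real gtr0_norm; have /andP[h1 h2] := hx i => //.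
      by case: mr => m1 _; exact: lt_le_trans h2 m1.
    by case: mr => _ m1; exact: lt_le_trans h2 (m1 i).
  case: (xb 1%N) => // -[x1 x2].
  have := chsumB (hc _ x1) (hc' _ x2); rewrite subrr; apply: chsum_ext => J.
  by rewrite mulrBl.
pose cst := \prod_(i < d) (expR 1 / (1 - rp i / r' i)).
have rpr i : rp i < r' i by rewrite /rp gt_max r'0 rr.
have cst0 : 0 <= cst.
  apply: prodr_ge0 => i _; rewrite divr_ge0 ?expR_ge0// subr_ge0 ler_pdivrMr// mul1r.
  exact: ltW.
(* the radius is optimized for each multi-index *)
have cI I : (mfact I)%:R * normc (c I) <= Cst * cst * mono r' I.
  have /(_ _)/cid2 -/all_sig2[rho rho0 hrho] := fun i : 'I_d => exp_type_coef (I i) (rpr i) (r'0 i).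
  have := cb rho rho0 I.
  rewrite -(ler_pM2l (_ : 0 < (mfact I)%:R :> R)) ?ltr0n ?mfact_gt0// => h.
  apply: le_trans h _; rewrite /M -!mulrA mulrCA ler_wpM2l//.
  rewrite mfactE expR_sum /mono -prodfV -!big_split /=.
  apply: ler_prod => i _; rewrite mulrA hrho andbT.
  by rewrite !mulr_ge0 ?expR_ge0// invr_ge0 exprn_ge0// ltW.
pose C' := if `[< exists i, r i < 0 >] then 0 else Cst * cst.
pose b I := (mfact I)%:R * complex.Re (c I).
have f0 (I : multi d) : (mfact I)%:R != 0 :> R by rewrite pnatr_eq0 -lt0n mfact_gt0.
have bE : egf b = (fun I => complex.Re (c I)).
  by apply/funext => I; rewrite /egf /b mulrAC mulfV// mul1r.
have bI I : `|b I| <= Cst * cst * mono r' I.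
  apply: le_trans (cI I); rewrite /b normrM ger0_norm// ler_wpM2l//; exact: ler_Re.
have eb : entire (egf b).
  move=> y y0; have := absbZ (Cst * cst) (absb_mexp (fun i => r' i * y i)) => h.
  eexists; apply: absb_le h => I; rewrite [leRHS]ger0_norm; last first.
    rewrite !mulr_ge0 ?invr_ge0//; apply: mono_ge0 => i.
    by rewrite mulr_ge0 ?(ltW (r'0 _)).
  have m0 : 0 <= (mfact I)%:R^-1 :> R by rewrite invr_ge0.
  have y0' : 0 <= mono y I by exact: mono_ge0.
  rewrite /egf 2!normrM (ger0_norm m0) (ger0_norm y0') monoM.
  have -> : Cst * cst * (mono r' I * mono y I * (mfact I)%:R^-1) =
    Cst * cst * mono r' I * (mfact I)%:R^-1 * mono y I by ring.
  by rewrite !ler_wpM2r// bI.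
have gE : g = (fun x => psum (egf b) (x 0)).
  apply/funext => x; apply/esym/usumE.
  pose rho i := `|x 0 i| + 1.
  have rho0 i : 0 < rho i by rewrite /rho ltr_wpDl.
  have hx : in_polydisc rho (fun i => (x 0 i)%:C).
    by move=> i; rewrite normc_real /rho ltrDl.
  have B := cabsb_mono rho0 (le_trans (normc_ge0 _) (bF' _ _ hx)) (cb rho rho0) hx.
  have [v hv] := cabsb_chsum B.
  have [c' [cb' hc']] := P _ rho0.
  have cc : c = c'.
    apply/funext => I; apply/eqP; rewrite -subr_eq0; apply/eqP.
    apply: (@cmseries_uniq _ _ (fun I => c I - c' I) 1 ltr01 _ I) => y hy.
    have y1 : in_polydisc (fun=> 1) (fun i => (y i)%:C).
      by move=> i; have /andP[h1 h2] := hy i; rewrite normc_real gtr0_norm.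
    have y2 : in_polydisc rho (fun i => (y i)%:C).
      move=> i; have /andP[h1 h2] := hy i; rewrite normc_real gtr0_norm// /rho.
      by apply: lt_le_trans h2 _; rewrite lerDr.
    have := chsumB (hc _ y1) (hc' _ y2); rewrite subrr; apply: chsum_ext => J.
    by rewrite mulrBl.
  have := (hc' _ hx).1; rewrite -cc /F' Fg /=; apply: hsum_ext => I.
  by rewrite bE mono_real mulrC ReZ mulrC.
have mb J := mpartial_psum J eb.
exists b, C'; split.
- by rewrite /C'; case: asboolP => // _; rewrite mulr_ge0.
- move=> I; rewrite /C'; case: asboolP => // -[i ri].
  have F0 := exp_type_neg ri dF bF.
  have c0 : c I = 0.
    apply: (@cmseries_uniq _ _ c 1 ltr01 _ I) => y hy.
    have y1 : in_polydisc (fun=> 1) (fun i => (y i)%:C).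
      by move=> k; have /andP[h1 h2] := hy k; rewrite normc_real gtr0_norm.
    by have := hc _ y1; rewrite /F' F0.
  by rewrite /b c0 mulr0 normr0 mul0r.
- move=> J x; rewrite gE (mb J).1.
  have := psum_hsum (fun i => lexx `|x 0 i|) ((mb J).2 _ (fun i => normr_ge0 _)).
  by apply: hsum_ext => I; rewrite /egf mulrA [in RHS]mulrAC.
- by move=> h; rewrite /C'; case: asboolP.
Qed.

End Extension.

(** * Partitions and Riemann-Stieltjes sums *)

Section Partitions.
Context {R : realType}.
Implicit Types (g h : R -> R) (a b u v w x : R) (s : seq R).

(** Left Riemann-Stieltjes sums, by recursion on the partition, which suits induction and
    concatenation. *)
Fixpoint lsum g h a s : R := if s is x :: s' then g a * (h x - h a) + lsum g h x s' else 0.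

Lemma rs_sum_cons g h a b x s tag : rs_sum g h a b (x :: s) tag =
  g (tag 0%N) * (h x - h a) + rs_sum g h x b s (fun i => tag i.+1).
Proof. by rewrite /rs_sum big_ord_recl. Qed.

Lemma lsumE g h a b s : rs_sum g h a b s (ppoint a b s) = lsum g h a s.
Proof.
elim: s a => [|x s IH] a; first by rewrite /rs_sum big_ord0.
by rewrite rs_sum_cons /= -IH.
Qed.

Lemma lsum_cat g h a s1 s2 : lsum g h a (s1 ++ s2) = lsum g h a s1 + lsum g h (last a s1) s2.
Proof. by elim: s1 a => [|x s IH] a /=; rewrite ?add0r// IH addrA. Qed.

(** As a relation on consecutive points, a mesh bound is a property of paths. *)
Definition finer (dl : R) x y := (x < y) && (y - x < dl).

Lemma mesh_cons a b x s : mesh a b (x :: s) = Num.max (x - a) (mesh x b s).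
Proof. by rewrite /mesh big_ord_recl. Qed.

Lemma mesh_ge0 a b s : 0 <= mesh a b s.
Proof. by elim: s a => [|x s IH] a; rewrite ?mesh_cons ?le_max ?IH ?orbT// /mesh big_ord0. Qed.

Lemma mesh_finer a b s dl : path <%R a s -> mesh a b s < dl -> path (finer dl) a s.
Proof.
elim: s a => //= x s IH a /andP[ax ps]; rewrite mesh_cons gt_max => /andP[h1 h2].
by rewrite /finer ax h1 IH.
Qed.

Lemma finer_mesh a b s dl : 0 < dl -> path (finer dl) a s -> mesh a b s < dl.
Proof.
move=> dl0; elim: s a => [|x s IH] a /=; first by rewrite /mesh big_ord0.
by case/andP => /andP[_ h1] /IH h2; rewrite mesh_cons gt_max h1.
Qed.

Lemma finer_lt dl a s : path (finer dl) a s -> path <%R a s.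
Proof. by apply: sub_path => x y /andP[]. Qed.

Lemma path_le_last a s : path <%R a s -> a <= last a s.
Proof.
by elim: s a => //= x s IH a /andP[/ltW ax /IH]; exact: le_trans.
Qed.

Definition upoint a b (n i : nat) : R := a + (b - a) * (i%:R / n.+1%:R).
Definition upart a b (n : nat) : seq R := [seq upoint a b n i.+1 | i <- iota 0 n.+1].

Lemma upart_path a b n : a < b -> path (finer (2 * (b - a) / n.+1%:R)) a (upart a b n).
Proof.
move=> ab; have n0 : 0 < n.+1%:R :> R by [].
have H m k : path (finer (2 * (b - a) / n.+1%:R)) (upoint a b n k) [seq upoint a b n i.+1 | i <- iota k m].
  elim: m k => //= m IH k; rewrite IH andbT.
  have E : upoint a b n k.+1 - upoint a b n k = (b - a) / n.+1%:R.
    rewrite /upoint -[k.+1%:R]natr1.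
    have n1 : n.+1%:R != 0 :> R by rewrite pnatr_eq0.
    by move: (n.+1%:R) n1 => m0 n1; field.
  have p : 0 < (b - a) / n.+1%:R by rewrite divr_gt0 ?subr_gt0.
  by rewrite /finer -subr_gt0 E p /= -mulrA mulr_natl mulr2n ltrDl.
by have := H n.+1 0%N; rewrite {1}/upoint !mul0r mulr0 addr0.
Qed.

Lemma upart_last a b n : last a (upart a b n) = b.
Proof.
rewrite /upart -[n.+1]addn1 iotaD map_cat last_cat /= add0n /upoint divff ?pnatr_eq0//.
by rewrite mulr1 addrC subrK.
Qed.

Lemma upart_itv a b n : a < b -> itv_partition a b (upart a b n).
Proof. by move=> ab; split; [exact: finer_lt (upart_path n ab)|rewrite upart_last]. Qed.

Lemma upart_fine a b dl : a < b -> 0 < dl -> exists N, forall n, (N <= n)%N ->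
  path (finer dl) a (upart a b n).
Proof.
move=> ab dl0; have [N hN] : exists N : nat, 2 * (b - a) / dl < N%:R.
  by eexists; apply: archi_boundP; rewrite divr_ge0 ?mulr_ge0 ?subr_ge0 ?ltW.
exists N => n Nn; apply: sub_path (upart_path n ab) => x y /andP[xy h].
rewrite /finer xy /=; apply: lt_trans h _; rewrite ltr_pdivrMr//; rewrite ltr_pdivrMr// in hN.
by apply: lt_le_trans hN _; rewrite mulrC ler_wpM2l ?(ltW dl0)// ler_nat leqW.
Qed.

Lemma upart_vanishing a b : a < b -> vanishing_partitions a b (upart a b).
Proof.
move=> ab; split => [n|]; first exact: upart_itv.
apply/cvgrPdist_lt => e e0; have [N hN] := upart_fine ab e0.
exists N => // n /= Nn; rewrite sub0r normrN ger0_norm ?mesh_ge0//.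
exact: finer_mesh e0 (hN n Nn).
Qed.

Lemma upart_small a b dl : a < b -> 0 < dl -> exists2 s, itv_partition a b s & mesh a b s < dl.
Proof.
move=> ab dl0; have [N hN] := upart_fine ab dl0; exists (upart a b N); first exact: upart_itv.
exact: finer_mesh dl0 (hN N (leqnn _)).
Qed.

(** Some partition has a mesh small enough for both values. *)
Lemma rs_integral_uniq g h a b v w : a < b -> is_rs_integral g h a b v ->
  is_rs_integral g h a b w -> v = w.
Proof.
move=> ab hv hw; apply/eqP; rewrite -subr_eq0 -normr_le0; apply/ler_addgt0Pr => e e0.
rewrite add0r; have e2 : 0 < e / 2 by lra.
have [d1 d10 h1] := hv _ e2; have [d2 d20 h2] := hw _ e2.
have m0 : 0 < Num.min d1 d2 by rewrite lt_min d10.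
have [s [ps ls]] := upart_small ab m0; rewrite lt_min => /andP[m1 m2].
have tg i : (i < size s)%N -> ppoint a b s i <= ppoint a b s i <= ppoint a b s i.+1.
  move=> hi; rewrite lexx /=; apply: ltW; rewrite /ppoint.
  have := pathP b ps i hi; by [].
have {}h1 := h1 s (ppoint a b s) (conj ps ls) m1 tg.
have {}h2 := h2 s (ppoint a b s) (conj ps ls) m2 tg.
set S := rs_sum _ _ _ _ _ _ in h1 h2.
have -> : v - w = (S - w) - (S - v) by ring.
by apply: le_trans (ler_normB _ _) _; rewrite [e]splitr addrC lerD// ltW.
Qed.

Lemma rs_integralE g h a b v : a < b -> is_rs_integral g h a b v -> rs_integral g h a b = v.
Proof. by move=> ab hv; apply: xget_unique => // w hw; exact: rs_integral_uniq hw hv. Qed.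

Lemma rs_integral_cvg g h a b v pi : is_rs_integral g h a b v -> vanishing_partitions a b pi ->
  lsum g h a (pi n) @[n --> \oo] --> v.
Proof.
move=> hv [p1 p2]; apply/cvgrPdist_lt => e e0; have [dl dl0 H] := hv e e0.
have [N _ hN] := (@cvgrPdist_lt _ _ _ _ _ _ _).1 p2 dl dl0.
exists N => // n Nn; have := hN n Nn; rewrite /= sub0r normrN ger0_norm ?mesh_ge0// => hm.
rewrite distrC -(lsumE _ _ _ b); apply: H => // i hi.
rewrite lexx /=; apply: ltW; case: (p1 n) => ps _; exact: (pathP b ps i hi).
Qed.

Lemma join_partition a b s1 s2 : itv_partition a b s1 -> itv_partition a b s2 -> a < b ->
  exists2 s, itv_partition a b s & {subset s1 <= s} /\ {subset s2 <= s}.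
Proof.
move=> [p1 /eqP l1] [p2 /eqP l2] ab.
pose s := sort <=%R (undup (s1 ++ s2)).
have ms x : (x \in s) = (x \in s1) || (x \in s2) by rewrite mem_sort mem_undup mem_cat.
have so : sorted <%R s by rewrite lt_sorted_uniq_le sort_uniq undup_uniq sort_le_sorted.
have al c t : path <%R c t -> forall x, x \in t -> c < x.
  by move=> pt x xt; move: (order_path_min lt_trans pt) => /allP; exact.
have be c t : path <%R c t -> forall x, x \in t -> x <= last c t.
  elim: t c => //= y t IH c /andP[_ pt] x; rewrite inE => /orP[/eqP->|xt]; first exact: path_le_last.
  exact: IH pt _ xt.
have bs : b \in s.
  rewrite ms -l1; case: (s1) l1 => [/= e|y t _]; last by rewrite /= mem_last.
  by rewrite e ltxx in ab.
have ps : path <%R a s.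
  rewrite path_min_sorted//; apply/allP => x; rewrite ms => /orP[]; exact: al.
exists s; last by split => x; rewrite ms => ->; rewrite ?orbT.
split => //; rewrite eq_le be// andbT.
have : last a s \in s by case: (s) bs => // y t _; rewrite /= mem_last.
by rewrite ms => /orP[] h; [have := be _ _ p1 _ h; rewrite l1|have := be _ _ p2 _ h; rewrite l2].
Qed.

End Partitions.

(** * Superadditive controls and the sewing estimate *)

Section Sewing.
Context {R : realType}.
Implicit Types (g h : R -> R).
Variables (a0 b0 : R) (om : R -> R -> R).
Hypothesis om_ge0 : forall u v, a0 <= u -> u <= v -> v <= b0 -> 0 <= om u v.
Hypothesis om_super : forall u w v, a0 <= u -> u <= w -> w <= v -> v <= b0 ->
  om u w + om w v <= om u v.

Lemma om_diag u : a0 <= u <= b0 -> om u u = 0.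
Proof.
move=> /andP[h1 h2]; apply/eqP; rewrite eq_le om_ge0// andbT.
by have := om_super h1 (lexx u) (lexx u) h2; lra.
Qed.

(** The point w is the first one where the control from a exceeds half of the total, or the last point
    if there is none. By superadditivity the part after w carries at most the other half. *)
Lemma split_half a b s : a0 <= a -> b <= b0 -> path <%R a s -> last a s = b -> s != [::] ->
  exists s1 w s2, [/\ s = s1 ++ w :: s2, om a (last a s1) <= om a b / 2 & om w b <= om a b / 2].
Proof.
move=> ha hb ps ls sn0; set c := om a b / 2.
have ab : a <= b by rewrite -ls path_le_last.
have om0 : 0 <= om a b by exact: om_ge0.
have c0 : 0 <= c by rewrite /c; lra.
pose P y := c < om a y.
have aux t : ~~ has P t -> om a (last a t) <= c.
  case: t => [_|y t]; first by rewrite /= om_diag// ha (le_trans ab).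
  by rewrite -all_predC => /allP/(_ _ (mem_last y t)); rewrite /= /P -leNgt.
case hP : (has P s); last first.
  case/lastP: s sn0 ps ls hP => // s1 w _ ps; rewrite last_rcons => wb.
  rewrite has_rcons => /negbT; rewrite negb_or => /andP[_ /aux h1].
  exists s1, w, [::]; split => //; first by rewrite cats1.
  by rewrite wb om_diag// hb andbT (le_trans ha).
move: ps ls; case/split_find: hP => w s1 s2 Pw /aux h1.
rewrite cat_rcons => ps ls; exists s1, w, s2; split => //.
move: ps ls; rewrite cat_path last_cat /= => /and3P[p1 p2 p3] lw.
have := path_le_last p1; have := path_le_last p3; rewrite lw => wb al.
have aw : a <= w by rewrite (le_trans al)// ltW.
have := om_super ha aw wb hb; rewrite /P /c in Pw *; lra.
Qed.

(** Induction on the number of points, splitting at the interval [u, w] of [split_half]. Each of the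
    two outer parts contributes a factor 2^(-th), and joining the parts costs two products of
    increments. The constant B is the solution of B = B 2^(1 - th) + 2. *)
Lemma sewing_bound g h th e dl a b s : 1 < th -> 0 <= e ->
  (forall u w v, a0 <= u -> u <= w -> w <= v -> v <= b0 -> v - u < dl ->
     `|(g w - g u) * (h v - h w)| <= e * om u v `^ th) ->
  a0 <= a -> b <= b0 -> b - a < dl -> path <%R a s -> last a s = b ->
  `|lsum g h a s - g a * (h b - h a)| <= (2 / (1 - 2 `^ (1 - th))) * e * om a b `^ th.
Proof.
move=> th1 e0 H; set B := 2 / _.
have t1 : 2 `^ (1 - th) < 1 :> R.
  have l2 : 0 < ln 2 :> R by rewrite ln_gt0// ltr1n.
  by rewrite /powR gt_eqF// -[ltRHS]expR0 ltr_expR pmulr_llt0// subr_lt0.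
have B0 : 0 <= B by rewrite divr_ge0// subr_ge0 ltW.
(* the fixed point equation which closes the induction *)
have BE : B * 2 `^ (1 - th) + 2 = B.
  by rewrite /B; field; rewrite subr_eq0 eq_sym lt_eqF.
elim: {s}(size s) {-2}s (leqnn (size s)) a b => [|n IH] s.
  rewrite leqn0 => /nilP-> a b ha hb hab _ /= <-; rewrite subrr mulr0 subrr normr0.
  by rewrite mulr_ge0 ?powR_ge0// mulr_ge0.

move=> sn a b ha hb hab ps ls.
case: (altP (s =P [::])) => [s0|sn0].
  rewrite s0 /= in ls *; rewrite -ls subrr mulr0 subrr normr0.
  by rewrite mulr_ge0 ?powR_ge0// mulr_ge0.
have [s1 [w [s2 [E h1 h2]]]] := split_half ha hb ps ls sn0.
move: ps ls sn; rewrite E cat_path last_cat size_cat /= addnS ltnS => /and3P[p1 p2 p3] lw sn.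
set u := last a s1 in h1 p2.
have au : a <= u by exact: path_le_last.
have uw : u <= w by exact: ltW.
have wb : w <= b by rewrite -lw path_le_last.
have n1 : (size s1 <= n)%N by rewrite (leq_trans _ sn)// leq_addr.
have n2 : (size s2 <= n)%N by rewrite (leq_trans _ sn)// leq_addl.
have ub : u <= b by exact: le_trans wb.
have I1 : `|lsum g h a s1 - g a * (h u - h a)| <= B * e * om a u `^ th.
  by apply: IH => //; [exact: le_trans hb|lra].
have I2 : `|lsum g h w s2 - g w * (h b - h w)| <= B * e * om w b `^ th.
  by apply: IH => //; [exact: le_trans ha (le_trans au uw)|lra].
have ab : a <= b by exact: le_trans ub.
(* the two products of increments created by joining the three parts *)
have D1 := H a u b ha au ub hb hab.
have D2 : `|(g w - g u) * (h b - h w)| <= e * om a b `^ th.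
  apply: le_trans (H u w b (le_trans ha au) uw wb hb _) _; first lra.
  rewrite ler_wpM2l// ge0_ler_powR ?nnegrE ?om_ge0//; [lra|exact: le_trans ha au|].
  have := om_super ha au ub hb; have := om_ge0 ha au (le_trans ub hb); lra.
rewrite lsum_cat /= -/u.
have -> : lsum g h a s1 + (g u * (h w - h u) + lsum g h w s2) - g a * (h b - h a) =
  (lsum g h a s1 - g a * (h u - h a)) + (lsum g h w s2 - g w * (h b - h w)) +
  ((g u - g a) * (h b - h u) + (g w - g u) * (h b - h w)) by ring.
have half x y : a0 <= x -> x <= y -> y <= b0 -> om x y <= om a b / 2 ->
    om x y `^ th <= 2 `^ (- th) * om a b `^ th.
  move=> x1 x2 x3 x4.
  have -> : 2 `^ (- th) * om a b `^ th = (om a b / 2) `^ th.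
    rewrite powRM ?invr_ge0 ?om_ge0//; rewrite mulrC; congr (_ * _).
    by rewrite -[2^-1]powR_inv1// -powRrM mulN1r.
  by rewrite ge0_ler_powR ?nnegrE ?om_ge0//; [lra|have := om_ge0 ha ab hb; lra].
have J1 := half a u ha au (le_trans ub hb) h1.
have J2 := half w b (le_trans ha (le_trans au uw)) wb hb h2.
have Be : 0 <= B * e by rewrite mulr_ge0.
apply: le_trans (ler_normD _ _) _.
have -> : B * e * om a b `^ th = (B * e * (2 `^ (- th) * om a b `^ th) + B * e * (2 `^ (- th) * om a b `^ th)) + (e * om a b `^ th + e * om a b `^ th).
  have -> : 2 `^ (- th) = 2 `^ (1 - th) / 2 :> R.
    by rewrite powRD ?pnatr_eq0 ?implybT// powRr1// mulrAC divff// mul1r.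
  by rewrite -{1}BE; field.
apply: lerD; apply: le_trans (ler_normD _ _) _; apply: lerD => //.
  by apply: le_trans I1 _; rewrite ler_wpM2l.
by apply: le_trans I2 _; rewrite ler_wpM2l.
Qed.

(** The control is superadditive, so the errors on the intervals of the coarser partition add up to at
    most e om(a, b). *)
Lemma refine_bound g h e dl :
  (forall u v s, a0 <= u -> v <= b0 -> v - u < dl -> path <%R u s -> last u s = v ->
     `|lsum g h u s - g u * (h v - h u)| <= e * om u v) -> 0 <= e ->
  forall s s' a b, a0 <= a -> b <= b0 -> path (finer dl) a s -> last a s = b ->
    path <%R a s' -> last a s' = b -> {subset s <= s'} ->
    `|lsum g h a s' - lsum g h a s| <= e * om a b.
Proof.
move=> H e0; elim=> [|x s IH] s' a b ha hb /=.
  move=> _ ab ps' ls' _; case: s' ps' ls' => [|y s'] /=.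
    by rewrite subrr normr0 ab om_diag ?mulr0// -ab ha (le_trans _ hb)// ab.
  move=> /andP[ay /path_le_last] h1 h2; rewrite h2 -ab in h1.
  by have := lt_le_trans ay h1; rewrite ltxx.
move=> /andP[/andP[ax xd] ps] ls ps' ls' sub.
have /sub xs' : x \in x :: s by rewrite mem_head.
move: ps' ls' sub; case/splitPr: xs' => s1 s2.
rewrite -cat_rcons cat_path last_cat last_rcons => /andP[p1 p2] ls2 sub.
have E : last a (rcons s1 x) = x by rewrite last_rcons.
have xb : x <= b by rewrite -ls; exact: path_le_last (finer_lt ps).
rewrite lsum_cat E.
have -> : lsum g h a (rcons s1 x) + lsum g h x s2 - (g a * (h x - h a) + lsum g h x s) =
  (lsum g h a (rcons s1 x) - g a * (h x - h a)) + (lsum g h x s2 - lsum g h x s) by ring.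
apply: le_trans (ler_normD _ _) _.
apply: (@le_trans _ _ (e * om a x + e * om x b)).
  apply: lerD; first by apply: H => //; exact: le_trans hb.
  apply: IH => //; first by apply: le_trans ha _; exact: ltW.
  move=> y ys; have : y \in rcons s1 x ++ s2 by apply: (sub y); rewrite inE ys orbT.
  have xy : x < y.
    by have /allP := order_path_min lt_trans (finer_lt ps); exact.
  rewrite mem_cat => /orP[ys1|//]; exfalso.
  suff : y <= x by rewrite leNgt xy.
  move: ys1 p1; elim: (s1) (a) => [|z t IHt] c /=; first by rewrite inE => /eqP->.
  rewrite inE => /orP[/eqP->|yt]; case/andP => _ pt; last exact: IHt yt pt.
  by have := path_le_last pt; rewrite last_rcons.
by rewrite -mulrDr ler_wpM2l//; apply: om_super => //; exact: ltW.
Qed.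

(** Two fine partitions are compared with a common refinement. The second condition accounts for
    arbitrary tags. *)
Lemma sewing g h : a0 < b0 ->
  (forall e, 0 < e -> exists2 dl, 0 < dl & 
     (forall u v s, a0 <= u -> v <= b0 -> v - u < dl -> path <%R u s -> last u s = v ->
     `|lsum g h u s - g u * (h v - h u)| <= e * om u v) /\
     (forall u w v, a0 <= u -> u <= w -> w <= v -> v <= b0 -> v - u < dl ->
        `|(g w - g u) * (h v - h u)| <= e * om u v)) ->
  exists v, is_rs_integral g h a0 b0 v.
Proof.
move=> ab H.
pose M := om a0 b0 + 1.
have om0 : 0 <= om a0 b0 by rewrite om_ge0// ltW.
have M0 : 0 < M by rewrite /M; lra.
have H' e : 0 < e -> exists2 dl, 0 < dl & 
   (forall s1 s2, itv_partition a0 b0 s1 -> itv_partition a0 b0 s2 -> path (finer dl) a0 s1 -> path (finer dl) a0 s2 ->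
     `|lsum g h a0 s1 - lsum g h a0 s2| <= e) /\
   (forall s tag, itv_partition a0 b0 s -> path (finer dl) a0 s -> (forall i, (i < size s)%N ->
         ppoint a0 b0 s i <= tag i <= ppoint a0 b0 s i.+1) -> `|rs_sum g h a0 b0 s tag - lsum g h a0 s| <= e).
  move=> e0; have e1 : 0 < e / (2 * M) by rewrite divr_gt0// mulr_gt0.
  have [dl dl0 [H1 H2]] := H _ e1; exists dl => //.
  have eM : 2 * (e / (2 * M) * om a0 b0) <= e.
    have -> : 2 * (e / (2 * M) * om a0 b0) = e * om a0 b0 / M by field; rewrite gt_eqF.
    by rewrite ler_pdivrMr// ler_wpM2l ?(ltW e0)// /M; lra.
  split=> [s1 s2 i1 i2 f1 f2|s tag [_ /eqP ls] fs tg].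
    have [s [ps /eqP ls] [sb1 sb2]] := join_partition i1 i2 ab.
    case: i1 => _ /eqP l1; case: i2 => _ /eqP l2.
    have R1 := refine_bound H1 (ltW e1) (lexx a0) (lexx b0) f1 l1 ps ls sb1.
    have R2 := refine_bound H1 (ltW e1) (lexx a0) (lexx b0) f2 l2 ps ls sb2.
    have -> : lsum g h a0 s1 - lsum g h a0 s2 = (lsum g h a0 s - lsum g h a0 s2) - (lsum g h a0 s - lsum g h a0 s1) by ring.
    by apply: le_trans (ler_normB _ _) _; apply: le_trans eM; rewrite mulr_natl mulr2n lerD.
  apply: (@le_trans _ _ (e / (2 * M) * om a0 b0)); last first.
    apply: le_trans eM; rewrite [leRHS]mulr_natl mulr2n lerDl mulr_ge0//; exact: ltW.
  suff key : forall s tag a, a0 <= a -> path (finer dl) a s -> last a s = b0 ->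
      (forall i, (i < size s)%N -> ppoint a b0 s i <= tag i <= ppoint a b0 s i.+1) ->
      `|rs_sum g h a b0 s tag - lsum g h a s| <= e / (2 * M) * om a b0 by exact: key.
  elim=> [|x t IH] tg' a aa /=.
    move=> _ ab0 _; rewrite /rs_sum big_ord0 subrr normr0; apply: mulr_ge0; first exact: ltW.
    by rewrite om_ge0// ab0.
  case/andP => /andP[ax xd] ps ls' tgs.
  have xb : x <= b0 by rewrite -ls'; exact: path_le_last (finer_lt ps).
  rewrite rs_sum_cons.
  have -> : g (tg' 0%N) * (h x - h a) + rs_sum g h x b0 t (fun i => tg' i.+1) - (g a * (h x - h a) + lsum g h x t) =
    (g (tg' 0%N) - g a) * (h x - h a) + (rs_sum g h x b0 t (fun i => tg' i.+1) - lsum g h x t) by ring.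
  apply: le_trans (ler_normD _ _) _.
  apply: (@le_trans _ _ (e / (2 * M) * om a x + e / (2 * M) * om x b0)).
    apply: lerD.
      have /andP[t1 t2] := tgs 0%N isT.
      exact: H2.
    by apply: IH => // [|i hi]; [exact: le_trans aa (ltW ax)|exact: (tgs i.+1)].
  by rewrite -mulrDr ler_wpM2l ?(ltW e1)//; apply: om_super => //; exact: ltW.
have cc : cvgn (fun n => lsum g h a0 (upart a0 b0 n)).
  apply/cauchy_cvgP/cauchy_exP => e e0.
  have e2 : 0 < e / 2 by lra.
  have [dl dl0 [H1 _]] := H' _ e2.
  have [N hN] := upart_fine ab dl0; exists (lsum g h a0 (upart a0 b0 N)); exists N => // n /= Nn.
  rewrite /ball; apply: (@le_lt_trans _ _ (e / 2)); last lra.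
  exact: (H1 _ _ (upart_itv N ab) (upart_itv n ab) (hN N (leqnn N)) (hN n Nn)).
exists (limn (fun n => lsum g h a0 (upart a0 b0 n))) => e e0.
have e4 : 0 < e / 4 by lra.
have [dl dl0 [H1 H2]] := H' _ e4; exists dl => // s tag ips ms tg.
have fs : path (finer dl) a0 s by case: ips => ps _; exact: mesh_finer ms.
have [N hN] := upart_fine ab dl0.
have [N' _ hN'] := (@cvgrPdist_lt _ _ _ _ _ _ _).1 cc _ e4.
pose n := maxn N N'.
have K1 : `|limn (fun n => lsum g h a0 (upart a0 b0 n)) - lsum g h a0 (upart a0 b0 n)| < e / 4 := hN' n (leq_maxr _ _).
have K2 := H1 _ _ (upart_itv n ab) ips (hN n (leq_maxl _ _)) fs.
have K3 := H2 s tag ips fs tg.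
move: K1 K2 K3; move: (limn _) (rs_sum _ _ _ _ _ _) (lsum _ _ _ (upart _ _ _)) (lsum _ _ _ s) => l S S1 S2 K1 K2 K3.
have -> : S - l = (S - S2) - ((l - S1) + (S1 - S2)) by ring.
apply: le_lt_trans (ler_normB _ _) _.
have := ler_normD (l - S1) (S1 - S2); lra.
Qed.

End Sewing.

(** * The control given by the p-variation *)

Section PVariation.
Context {R : realType} {d : nat}.
Implicit Types (x : R -> 'rV[R]_d) (p : R).

Fixpoint vsum p x (a : R) (s : seq R) : R :=
  if s is y :: s' then `|x y - x a| `^ p + vsum p x y s' else 0.

Lemma vsumE p x a b s : \sum_(i < size s)
   `|x (ppoint a b s i.+1) - x (ppoint a b s i)| `^ p = vsum p x a s.
Proof. by elim: s a => [|y s IH] a /=; rewrite ?big_ord0// big_ord_recl /= -IH. Qed.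

Lemma vsum_cat p x a s1 s2 : vsum p x a (s1 ++ s2) = vsum p x a s1 + vsum p x (last a s1) s2.
Proof. by elim: s1 a => [|y s IH] a /=; rewrite ?add0r// IH addrA. Qed.

Lemma vsum_ge0 p x a s : 0 <= vsum p x a s.
Proof. by elim: s a => //= y s IH a; rewrite addr_ge0// powR_ge0. Qed.

Variables (p T : R) (x : R -> 'rV[R]_d).
Hypothesis (p0 : 0 < p) (T0 : 0 < T) (fin : (pvar p 0 T x < +oo)%E).

Definition varset (u v : R) : set R := [set vsum p x u s | s in itv_partition u v].
Definition vcontrol (u v : R) : R := sup (varset u v).

Lemma varset_le_pvar y : varset 0 T y -> y <= fine (pvar p 0 T x) `^ p.
Proof.
move=> [s ps <-].
set E := ereal_sup [set (\sum_(i < size s) `|x (ppoint 0 T s i.+1) - x (ppoint 0 T s i)| `^ p)%:E | s in itv_partition 0 T].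
have pE : pvar p 0 T x = (E `^ p^-1)%E by [].
have Ele : ((vsum p x 0 s)%:E <= E)%E.
  by apply: ereal_sup_ubound; exists s => //; rewrite vsumE.
have E0 : (0 <= E)%E by apply: le_trans Ele; rewrite lee_fin vsum_ge0.
have Efin : (E < +oo)%E.
  by apply: (@lty_poweRy _ _ p^-1); [rewrite invr_eq0 gt_eqF|rewrite -pE].
have Ef : E \is a fin_num by rewrite ge0_fin_numE.
rewrite pE fine_poweR -powRrM mulVf ?gt_eqF// powRr1 ?fine_ge0//.
by rewrite -lee_fin fineK.
Qed.

Lemma varset_cat u w v y z : varset u w y -> varset w v z -> varset u v (y + z).
Proof.
move=> [s1 [p1 /eqP l1] <-] [s2 [p2 /eqP l2] <-]; exists (s1 ++ s2).
  by split; rewrite ?cat_path ?last_cat l1 ?p1// l2.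
by rewrite vsum_cat l1.
Qed.

Lemma varset_nonempty u v : u <= v -> varset u v !=set0.
Proof.
rewrite le_eqVlt => /orP[/eqP->|uv]; first by exists 0, [::].
by exists (vsum p x u [:: v]), [:: v] => //; split => //=; rewrite uv.
Qed.

Lemma varset_ge0 u v y : varset u v y -> 0 <= y.
Proof. by move=> [s _ <-]; exact: vsum_ge0. Qed.

Lemma varset_bound u v y : 0 <= u -> u <= v -> v <= T -> varset u v y ->
  y <= fine (pvar p 0 T x) `^ p.
Proof.
move=> u0 uv vT hy.
have [y1 h1] := varset_nonempty u0; have [y2 h2] := varset_nonempty vT.
have := varset_le_pvar (varset_cat (varset_cat h1 hy) h2).
by have := varset_ge0 h1; have := varset_ge0 h2; lra.
Qed.

Lemma varset_sup u v : 0 <= u -> u <= v -> v <= T -> has_sup (varset u v).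
Proof.
move=> u0 uv vT; split; first exact: varset_nonempty.
by exists (fine (pvar p 0 T x) `^ p) => y; exact: varset_bound.
Qed.

Lemma vcontrol_ub u v y : 0 <= u -> u <= v -> v <= T -> varset u v y -> y <= vcontrol u v.
Proof. by move=> u0 uv vT hy; apply: ub_le_sup => //; case: (varset_sup u0 uv vT). Qed.

Lemma vcontrol_ge0 u v : 0 <= u -> u <= v -> v <= T -> 0 <= vcontrol u v.
Proof.
move=> u0 uv vT; have [y hy] := varset_nonempty uv.
exact: le_trans (varset_ge0 hy) (vcontrol_ub u0 uv vT hy).
Qed.

(** Partitions of [u, w] and of [w, v] join to a partition of [u, v]. *)
Lemma vcontrol_super u w v : 0 <= u -> u <= w -> w <= v -> v <= T ->
  vcontrol u w + vcontrol w v <= vcontrol u v.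
Proof.
move=> u0 uw wv vT; have w0 := le_trans u0 uw; have wT := le_trans wv vT.
rewrite -lerBrDr; apply: ge_sup => [|y hy]; first exact: varset_nonempty.
rewrite lerBrDr addrC -lerBrDr; apply: ge_sup => [|z hz]; first exact: varset_nonempty.
by rewrite lerBrDr addrC; apply: vcontrol_ub (varset_cat hy hz) => //; exact: le_trans wv.
Qed.

Lemma vcontrol_le u v : 0 <= u -> u <= v -> v <= T -> vcontrol u v <= fine (pvar p 0 T x) `^ p.
Proof.
move=> u0 uv vT; apply: ge_sup => [|y]; first exact: varset_nonempty.
exact: varset_bound.
Qed.

Lemma vcontrol_incr u w z v : 0 <= u -> u <= w -> w <= z -> z <= v -> v <= T ->
  `|x z - x w| <= vcontrol u v `^ p^-1.
Proof.
move=> u0 uw wz zv vT.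
have w0 := le_trans u0 uw; have z0 := le_trans w0 wz; have zT := le_trans zv vT.
have h : `|x z - x w| `^ p <= vcontrol u v.
  have [y1 h1] := varset_nonempty uw; have [y2 h2] := varset_nonempty zv.
  have h3 : varset w z (`|x z - x w| `^ p).
    move: wz; rewrite le_eqVlt => /orP[/eqP->|wz].
      by exists [::] => //; rewrite subrr normr0 powR0// gt_eqF.
    by exists [:: z] => //=; [split => //=; rewrite wz|rewrite addr0].
  have := vcontrol_ub u0 (le_trans uw (le_trans wz zv)) vT (varset_cat (varset_cat h1 h3) h2).
  by have := varset_ge0 h1; have := varset_ge0 h2; lra.
have -> : `|x z - x w| = (`|x z - x w| `^ p) `^ p^-1.
  by rewrite -powRrM mulfV ?gt_eqF// powRr1.
apply: ge0_ler_powR => //; rewrite ?nnegrE ?powR_ge0 ?invr_ge0 ?(ltW p0)//.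
by apply: le_trans h; exact: powR_ge0.
Qed.

End PVariation.

(** * Uniformity on compact sets *)

Section CompactUniform.
Context {R : realType}.

(** Local choices of a threshold dl can be made uniform over a compact set. *)
Lemma compact_uniform (X : topologicalType) (K : set X) (P : R -> X -> Prop) : compact K ->
  (forall x, K x -> exists2 r : R, 0 < r & exists2 U : set X, nbhs x U &
     forall y, U y -> K y -> forall dl, 0 < dl < r -> P dl y) ->
  exists2 dl, 0 < dl & forall y, K y -> P dl y.
Proof.
move=> /compact_near_coveringP/near_covering_withinP cK H.
have := cK R (0 : R)^'+ P _; case.
  move=> x Kx; have [r r0 [U nU HU]] := H x Kx.
  exists (U, [set dl | 0 < dl < r]).
    split => //=; near=> dl; apply/andP; split; near: dl; [exact: nbhs_right_gt|exact: nbhs_right_lt].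
  by move=> [y dl] /= [Uy hdl] Ky; exact: HU.
move=> e /= e0 he; exists (e / 2); first by rewrite divr_gt0.
apply: he; rewrite /= ?divr_gt0// sub0r normrN ger0_norm ?divr_ge0 ?(ltW e0)//.
by rewrite ltr_pdivrMr// mulr_natr mulr2n ltrDl.
Unshelve. all: by end_near. Qed.

Lemma path_unif (V : normedModType R) (x : R -> V) a b e : {within `[a, b], continuous x} ->
  0 < e -> exists2 dl, 0 < dl & forall u v, a <= u <= b -> a <= v <= b -> `|v - u| < dl ->
  `|x v - x u| < e.
Proof.
move=> /subspace_continuousP cx e0.
have [|dl dl0 H] := @compact_uniform R^o `[a, b]%classic (fun dl u => forall v, a <= v <= b -> `|v - u| < dl -> `|x v - x u| < e) (@segment_compact _ a b).
  move=> u uab; have e2 : 0 < e / 2 by lra.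
  move/cvgrPdist_lt: (cx u uab) => /(_ _ e2)/nbhs_ballP[r /= r0 hr].
  exists (r / 2); first by lra.
  exists (ball u (r / 2)); first by apply: nbhsx_ballx; lra.
  move=> y uy yab dl /andP[dl0 dlr] v vab vy.
  have b1 : `|x u - x y| < e / 2.
    apply: hr; last by [].
    by apply: le_ball uy; lra.
  have b2 : `|x u - x v| < e / 2.
    apply: hr; last by rewrite /= in_itv.
    rewrite /ball /= in uy *; have -> : u - v = (u - y) - (v - y) by ring.
    by apply: le_lt_trans (ler_normB _ _) _; lra.
  have -> : x v - x y = (x u - x y) - (x u - x v) by rewrite opprB [RHS]addrC addrA subrK.
  by apply: le_lt_trans (ler_normB _ _) _; lra.
by exists dl => // u v uab vab; apply: H => //=; rewrite in_itv.
Qed.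

End CompactUniform.

(** * Young integrals *)

Section Young.
Context {R : realType} {d : nat}.
Variables (p T s t : R) (x : R -> 'rV[R]_d).
Hypothesis (p02 : 0 < p < 2) (fin : (pvar p 0 T x < +oo)%E).
Hypothesis (cont : {within `[0, T], continuous x}).
Hypothesis (s0 : 0 <= s) (st : s < t) (tT : t <= T).

(** An increment of x is at most the control to the power 1 / p, so the product of two increments is at
    most the control to the power 2 / p > 1. *)
Lemma young_bound g h L : 0 <= L ->
  (forall u v, s <= u -> u <= v -> v <= t -> `|g v - g u| <= L * `|x v - x u|) ->
  (forall u v, s <= u -> u <= v -> v <= t -> `|h v - h u| <= `|x v - x u|) ->
  forall pi, itv_partition s t pi ->
  `|lsum g h s pi - g s * (h t - h s)| <= 2 / (1 - 2 `^ (1 - 2 / p)) * L * fine (pvar p 0 T x) ^+ 2.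
Proof.
move=> L0 hg hh pi [ps /eqP ls]; have /andP[p0 p2] := p02.
have T0 : 0 < T by apply: lt_le_trans tT; apply: le_lt_trans st.
set om := vcontrol p x.
have th1 : 1 < 2 / p by rewrite ltr_pdivlMr// mul1r.
have om0 u v : s <= u -> u <= v -> v <= t -> 0 <= om u v.
  by move=> *; apply: (@vcontrol_ge0 _ _ p T) => //; [exact: le_trans s0 _|exact: le_trans tT].
have omS u w v : s <= u -> u <= w -> w <= v -> v <= t -> om u w + om w v <= om u v.
  by move=> *; apply: (@vcontrol_super _ _ p T) => //; [exact: le_trans s0 _|exact: le_trans tT].
have H u w v : s <= u -> u <= w -> w <= v -> v <= t -> v - u < (t - s + 1) ->
     `|(g w - g u) * (h v - h w)| <= L * om u v `^ (2 / p).
  move=> su uw wv vt _; rewrite normrM.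
  have u0 := le_trans s0 su; have vT := le_trans vt tT.
  have i1 : `|x w - x u| <= om u v `^ p^-1 by exact: (@vcontrol_incr _ _ p T).
  have i2 : `|x v - x w| <= om u v `^ p^-1 by exact: (@vcontrol_incr _ _ p T).
  have -> : om u v `^ (2 / p) = om u v `^ p^-1 * om u v `^ p^-1.
    by rewrite mulrC powRrM powR_mulrn ?powR_ge0.
  rewrite mulrA; apply: ler_pM => //.
    by apply: le_trans (hg u w su uw (le_trans wv vt)) _; rewrite ler_wpM2l.
  exact: le_trans (hh w v (le_trans su uw) wv vt) i2.
have := @sewing_bound _ s t om om0 omS g h (2 / p) L (t - s + 1) s t pi th1 L0 H (lexx _) (lexx _) _ ps ls.
move=> /(_ _)/le_trans-> //; first by rewrite ltrDl.
rewrite ler_wpM2l//.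
  rewrite mulr_ge0// divr_ge0// subr_ge0.
  have l2 : 0 < ln 2 :> R by rewrite ln_gt0// ltr1n.
  by rewrite /powR gt_eqF// -[leRHS]expR0 ler_expR pmulr_lle0// subr_le0 ltW.
have -> : fine (pvar p 0 T x) ^+ 2 = (fine (pvar p 0 T x) `^ p) `^ (2 / p).
  rewrite -powRrM mulrC -mulrA mulVf ?gt_eqF// mulr1 powR_mulrn//.
  by rewrite fine_ge0// poweR_ge0.
apply: ge0_ler_powR; rewrite ?nnegrE ?powR_ge0 ?om0 ?(ltW st)//; first by rewrite divr_ge0// ltW.
by apply: (@vcontrol_le _ _ p T) => //; exact: ltW.
Qed.

(** Part of the exponent 2 / p is traded for the small oscillation o; the exponent (2 + p) / (2 p)
    which remains is still larger than 1 when p < 2. *)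
Lemma prod_bound (a b o m : R) : 0 <= a -> 0 <= b -> a <= o -> b <= o -> 0 <= m ->
  a <= m `^ p^-1 -> b <= m `^ p^-1 ->
  a * b <= o `^ ((2 - p) / 2) * m `^ ((2 + p) / (2 * p)).
Proof.
have /andP[p0 p2] := p02 => a0 b0 ao bo m0 am bm.
have key c : 0 <= c -> c <= o -> c <= m `^ p^-1 ->
    c <= o `^ ((2 - p) / 4) * (m `^ p^-1) `^ ((2 + p) / 4).
  move=> c0 co cm; have -> : c = c `^ ((2 - p) / 4) * c `^ ((2 + p) / 4).
    have E : (2 - p) / 4 + (2 + p) / 4 = 1 by field.
    by rewrite -powRD E ?oner_eq0// powRr1.
  have q1 : 0 <= (2 - p) / 4 by lra.
  have q2 : 0 <= (2 + p) / 4 by lra.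
  have oo := le_trans c0 co.
  by apply: ler_pM; rewrite ?powR_ge0//; apply: ge0_ler_powR; rewrite ?nnegrE ?powR_ge0.
have -> : o `^ ((2 - p) / 2) * m `^ ((2 + p) / (2 * p)) =
  (o `^ ((2 - p) / 4) * (m `^ p^-1) `^ ((2 + p) / 4)) * (o `^ ((2 - p) / 4) * (m `^ p^-1) `^ ((2 + p) / 4)).
  rewrite mulrACA -powRD; last by apply/implyP; lra.
  rewrite -powRD; last by apply/implyP; lra.
  rewrite -powRrM; congr (_ `^ _ * _ `^ _); first by field.
  by field; rewrite gt_eqF.
by apply: ler_pM => //; exact: key.
Qed.

(** Sums over short intervals are within a small multiple of the control, not just within a
    multiple of it, thanks to the small factor in [prod_bound]. *)
Lemma young_exists g h L : 0 <= L ->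
  (forall u v, s <= u -> u <= v -> v <= t -> `|g v - g u| <= L * `|x v - x u|) ->
  (forall u v, s <= u -> u <= v -> v <= t -> `|h v - h u| <= `|x v - x u|) ->
  exists v, is_rs_integral g h s t v.
Proof.
move=> L0 hg hh; have /andP[p0 p2] := p02.
have T0 : 0 < T by apply: lt_le_trans tT; apply: le_lt_trans st.
set om := vcontrol p x; pose th := (2 + p) / (2 * p); pose ka := (2 - p) / 2.
have th1 : 1 < th by rewrite /th ltr_pdivlMr ?mulr_gt0//; lra.
have ka0 : 0 < ka by rewrite /ka; lra.
have om0 u v : s <= u -> u <= v -> v <= t -> 0 <= om u v.
  by move=> *; apply: (@vcontrol_ge0 _ _ p T) => //; [exact: le_trans s0 _|exact: le_trans tT].
have omS u w v : s <= u -> u <= w -> w <= v -> v <= t -> om u w + om w v <= om u v.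
  by move=> *; apply: (@vcontrol_super _ _ p T) => //; [exact: le_trans s0 _|exact: le_trans tT].
apply: (sewing om0 omS) => // e e0.
pose W := om s t `^ (th - 1).
have W0 : 0 <= W by exact: powR_ge0.
pose B := 2 / (1 - 2 `^ (1 - th)).
have B0 : 0 <= B.
  have l2 : 0 < ln 2 :> R by rewrite ln_gt0// ltr1n.
  rewrite /B divr_ge0// subr_ge0 /powR gt_eqF// -[leRHS]expR0 ler_expR pmulr_lle0//.
  by rewrite subr_le0 ltW.
(* the small factor is chosen after the constants that multiply it *)
pose eta := e / ((B + 1) * (L * W) + 1).
have D0 : 0 < (B + 1) * (L * W) + 1.
  by rewrite ltr_wpDl// mulr_ge0 ?mulr_ge0// addr_ge0.
have eta0 : 0 < eta by rewrite divr_gt0.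
have omW u v : s <= u -> u <= v -> v <= t -> om u v `^ th <= om u v * W.
  move=> su uv vt; rewrite -mulr_powRB1 ?om0//; last lra.
  rewrite ler_wpM2l ?om0//; apply: ge0_ler_powR; rewrite ?nnegrE ?om0 ?(ltW st)//; first lra.
  have h1 := omS s u t (lexx s) su (le_trans uv vt) (lexx t).
  have h2 := omS u v t su uv vt (lexx t).
  have h3 := om0 s u (lexx s) su (le_trans uv vt).
  have h4 := om0 v t (le_trans su uv) vt (lexx t).
  lra.
have o0 : 0 < eta `^ ka^-1 by rewrite powR_gt0.
have oE : (eta `^ ka^-1) `^ ka = eta.
  by rewrite -powRrM mulVf ?gt_eqF// powRr1// ltW.
have [dl dl0 hdl] := path_unif cont o0.
have etaB c : 0 <= c -> c <= B + 1 -> c * (L * eta) * W <= e.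
  move=> c0 cB; have -> : c * (L * eta) * W = c * (L * W) * eta by ring.
  rewrite /eta mulrA ler_pdivrMr// mulrC ler_wpM2l ?(ltW e0)//.
  by rewrite ler_wpDr// ler_wpM2r// mulr_ge0.
(* one estimate for both conditions of the sewing lemma: the two increments lie inside [u, v'] *)
have P u w w' v v' : s <= u -> u <= w -> w <= w' -> u <= v -> v <= v' -> w' <= t -> v' <= t ->
   w' <= v' -> v' - u < dl -> `|(g w' - g w) * (h v' - h v)| <= L * eta * om u v' `^ th.
  move=> su uw ww uv vv wt vt wv dd.
  have u0 := le_trans s0 su; have vT := le_trans vt tT; have wT := le_trans wt tT.
  rewrite normrM; apply: (@le_trans _ _ (L * (`|x w' - x w| * `|x v' - x v|))).
    rewrite mulrA; apply: ler_pM => //; first exact: hg (le_trans su uw) ww wt.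
    exact: hh (le_trans su uv) vv vt.
  rewrite -[leRHS]mulrA ler_wpM2l// -oE.
  have osc a b : u <= a -> a <= b -> b <= v' -> `|x b - x a| <= eta `^ ka^-1.
    move=> ua ab bv; apply: ltW; apply: hdl.
    - by rewrite (le_trans u0 ua)/= (le_trans ab)// (le_trans bv).
    - by rewrite (le_trans u0 (le_trans ua ab))/= (le_trans bv).
    - by rewrite ger0_norm ?subr_ge0//; lra.
  have uv' := le_trans uv vv.
  have i1 : `|x w' - x w| <= om u v' `^ p^-1 by exact: (@vcontrol_incr _ _ p T).
  have i2 : `|x v' - x v| <= om u v' `^ p^-1 by exact: (@vcontrol_incr _ _ p T).
  exact: (prod_bound (normr_ge0 _) (normr_ge0 _) (osc _ _ uw ww wv) (osc _ _ uv vv (lexx _)) (om0 _ _ su uv' vt) i1 i2).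
exists dl => //; split=> [u v pi su vt vu ps ls|u w v su uw wv vt vu].
  have uv : u <= v by rewrite -ls path_le_last.
  have Le0 : 0 <= L * eta by rewrite mulr_ge0// ltW.
  have H u' w v' : s <= u' -> u' <= w -> w <= v' -> v' <= t -> v' - u' < dl ->
      `|(g w - g u') * (h v' - h w)| <= L * eta * om u' v' `^ th.
    by move=> h1 h2 h3 h4 h5; apply: P => //; exact: le_trans h4.
  apply: le_trans (sewing_bound om0 omS th1 Le0 H su vt vu ps ls) _.
  apply: (@le_trans _ _ (B * (L * eta) * (om u v * W))).
    by rewrite ler_wpM2l ?omW// mulr_ge0.
  have -> : B * (L * eta) * (om u v * W) = B * (L * eta) * W * om u v by ring.
  by rewrite ler_wpM2r ?om0// etaB// lerDl.
apply: le_trans (P u u w u v su (lexx u) uw (lexx u) (le_trans uw wv) (le_trans wv vt) vt wv vu) _.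
apply: (@le_trans _ _ (1 * (L * eta) * (om u v * W))).
  by rewrite mul1r ler_wpM2l ?omW ?(le_trans uw)// mulr_ge0// ltW.
have -> : 1 * (L * eta) * (om u v * W) = 1 * (L * eta) * W * om u v by ring.
by rewrite ler_wpM2r ?om0 ?(le_trans uw)// etaB// lerDr.
Qed.

End Young.

(** * Riemann integrals of continuous functions *)

Section Riemann.
Context {R : realType}.
Variables (s t : R).
Hypothesis (st : s < t).

Lemma lsum_id_const (g : R -> R) c e a pi : (forall u, a <= u <= last a pi -> `|g u - c| <= e) ->
  path <%R a pi -> `|lsum g id a pi - c * (last a pi - a)| <= e * (last a pi - a).
Proof.
elim: pi a => [|y pi IH] a H /=; first by rewrite subrr !mulr0 subrr normr0.
case/andP => ay ps; have yl := path_le_last ps.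
have -> : g a * (y - a) + lsum g id y pi - c * (last y pi - a) =
  (g a - c) * (y - a) + (lsum g id y pi - c * (last y pi - y)) by ring.
apply: le_trans (ler_normD _ _) _.
have -> : e * (last y pi - a) = e * (y - a) + e * (last y pi - y) by ring.
apply: lerD.
  rewrite normrM [ `|y - a|]ger0_norm ?subr_ge0 ?(ltW ay)// ler_wpM2r ?subr_ge0 ?(ltW ay)//.
  by apply: H; rewrite lexx /= (le_trans (ltW ay)).
by apply: IH => // u /andP[h1 h2]; apply: H; rewrite /= h2 (le_trans (ltW ay)).
Qed.

Lemma riemann_exists (g : R -> R) : {within `[s, t], continuous g} ->
  exists v, is_rs_integral g id s t v.
Proof.
move=> cg.
have om0 u v : s <= u -> u <= v -> v <= t -> 0 <= v - u by rewrite subr_ge0.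
have omS u w v : s <= u -> u <= w -> w <= v -> v <= t -> (w - u) + (v - w) <= v - u by move=> *; lra.
apply: (sewing (om := fun u v => v - u) om0 omS) => // e e0.
have [dl dl0 H] := path_unif cg e0; exists dl => //; split.
  move=> u v pi su vt vu ps ls; rewrite -ls; apply: lsum_id_const => // w; rewrite ls => /andP[uw wv].
  apply: ltW; apply: H; first by rewrite su/= (le_trans uw)// (le_trans wv).
    by rewrite (le_trans su)//= (le_trans wv).
  by rewrite ger0_norm; lra.
move=> u w v su uw wv vt vu; rewrite normrM /= [ `|v - u|]ger0_norm ?subr_ge0 ?(le_trans uw)//.
rewrite ler_wpM2r ?subr_ge0 ?(le_trans uw)//; apply: ltW; apply: H.
- by rewrite su/= (le_trans uw)// (le_trans wv).
- by rewrite (le_trans su)//= (le_trans wv).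
- by rewrite ger0_norm; lra.
Qed.

End Riemann.

(** * Power series of a derivative in a parameter *)

Section Coef1.
Context {R : realType}.
Local Notation C := R[i].

Lemma cdiffD (f g : C -> C) z l m : cdiff f z l -> cdiff g z m ->
  cdiff (fun t => f t + g t) z (l + m).
Proof.
move=> hf hg e e0; have e2 : 0 < e / 2 by lra.
have [d1 d10 h1] := hf _ e2; have [d2 d20 h2] := hg _ e2.
exists (Num.min d1 d2) => [|h]; first by rewrite lt_min d10.
rewrite lt_min => /andP[/h1 a1 /h2 a2].
have -> : f (z + h) + g (z + h) - (f z + g z) - (l + m) * h =
  (f (z + h) - f z - l * h) + (g (z + h) - g z - m * h) by ring.
apply: le_trans (normcD _ _) _; rewrite [e]splitr mulrDl; exact: lerD.
Qed.

Lemma cdiffZ (f : C -> C) z l c : cdiff f z l -> cdiff (fun t => c * f t) z (c * l).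
Proof.
move=> hf e e0; have c1 : 0 < normc c + 1 by rewrite ltr_wpDl ?normc_ge0.
have [d1 d10 h1] := hf (e / (normc c + 1)) (divr_gt0 e0 c1).
exists d1 => // h /h1 a1.
have -> : c * f (z + h) - c * f z - c * l * h = c * (f (z + h) - f z - l * h) by ring.
rewrite normcM; apply: le_trans (ler_wpM2l (normc_ge0 _) a1) _.
rewrite mulrA; apply: ler_wpM2r; first exact: normc_ge0.
rewrite mulrA ler_pdivrMr// mulrC ler_wpM2l ?(ltW e0)//; lra.
Qed.

Lemma cdiff_comp (f g : C -> C) z l m : cdiff f z l -> cdiff g (f z) m ->
  cdiff (g \o f) z (m * l).
Proof.
move=> hf hg e e0.
pose L := normc l + 1; have L0 : 0 < L by rewrite ltr_wpDl ?normc_ge0.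
pose N := normc m + 1; have N0 : 0 < N by rewrite ltr_wpDl ?normc_ge0.
have e1 : 0 < e / (2 * L) by rewrite divr_gt0// mulr_gt0.
have e2 : 0 < Num.min 1 (e / (2 * N)) by rewrite lt_min ltr01 divr_gt0// mulr_gt0.
have [d1 d10 h1] := hg _ e1; have [d2 d20 h2] := hf _ e2.
exists (Num.min d2 (d1 / L)) => [|h]; first by rewrite lt_min d20 divr_gt0.
rewrite lt_min => /andP[/h2 a2]; rewrite ltr_pdivlMr// => hd.
have n0 := normc_ge0 h.
have b1 : normc (f (z + h) - f z) <= L * normc h.
  have -> : f (z + h) - f z = (f (z + h) - f z - l * h) + l * h by ring.
  apply: le_trans (normcD _ _) _; rewrite normcM /L mulrDl addrC lerD2l.
  by apply: le_trans a2 _; rewrite ler_wpM2r// ge_min lexx.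
have := h1 (f (z + h) - f z); rewrite [f z + _]addrC subrK => a1.
rewrite /comp.
have -> : g (f (z + h)) - g (f z) - m * l * h =
   (g (f (z + h)) - g (f z) - m * (f (z + h) - f z)) + m * (f (z + h) - f z - l * h) by ring.
apply: le_trans (normcD _ _) _; rewrite [e]splitr mulrDl; apply: lerD.
  apply: le_trans (a1 _) _; first by apply: le_lt_trans b1 _; rewrite mulrC.
  apply: le_trans (ler_wpM2l (ltW e1) b1) _.
  by have -> // : e / (2 * L) * (L * normc h) = e / 2 * normc h; field; rewrite gt_eqF.
rewrite normcM; apply: le_trans (ler_wpM2l (normc_ge0 _) a2) _.
rewrite mulrA ler_wpM2r//; apply: (@le_trans _ _ (N * (e / (2 * N)))).
  apply: ler_pM; rewrite ?normc_ge0 ?(ltW e2)//; first by rewrite /N lerDl.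
  by rewrite ge_min lexx orbT.
by have -> : N * (e / (2 * N)) = e / 2; [field; rewrite gt_eqF|].
Qed.

Lemma cdiff_ext (f g : C -> C) z l (r : R) : 0 < r -> (forall h, normc h < r -> f (z + h) = g (z + h)) ->
  cdiff f z l -> cdiff g z l.
Proof.
move=> r0 E hf e e0; have [d1 d10 h1] := hf e e0.
exists (Num.min r d1) => [|h]; first by rewrite lt_min r0.
rewrite lt_min => /andP[hr /h1]; rewrite !E//.
have -> // : f z = g z by have := E 0; rewrite addr0 (normc_real (0 : R)) normr0; exact.
Qed.

(** The remainder of a power series after its linear term is quadratic. *)
Lemma cdiff_series (c : nat -> C) (f : C -> C) (sigma M : R) : 0 < sigma ->
  (forall n, normc (c n) <= M / sigma ^+ n) ->
  (forall a, normc a < sigma -> chsum (fun n => c n * a ^+ n) (f a)) -> cdiff f 0 (c 1%N).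
Proof.
move=> s0 cb hf e e0.
have M0 : 0 <= M by have := le_trans (normc_ge0 _) (cb 0%N); rewrite expr0 divr1.
pose A := 8 * M / sigma ^+ 2.
have A0 : 0 <= A by rewrite divr_ge0 ?mulr_ge0 ?exprn_ge0// ltW.
exists (Num.min (sigma / 2) (e / (A + 1))) => [|h].
  by rewrite lt_min !divr_gt0// ltr_wpDl.
rewrite lt_min => /andP[hs he]; rewrite add0r.
have n0 := normc_ge0 h.
have z0 : normc (0 : C) = 0 by rewrite (normc_real (0 : R)) normr0.
have S1 := hf h (lt_trans hs _); have {}S1 := S1 ltac:(lra).
have S0 := hf 0; rewrite z0 in S0; have {}S0 := S0 s0.
have S2 : chsum (fun n => if n == 1%N then c 1%N * h else 0) (c 1%N * h).
  by split; [have := hsum1 1%N (complex.Re (c 1%N * h))|have := hsum1 1%N (complex.Im (c 1%N * h))];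
    apply: hsum_ext => n; case: eqP.
have S := chsumB (chsumB S1 S0) S2.
pose q := normc h / sigma.
have q0 : 0 <= q by rewrite divr_ge0// ltW.
have q2 : q <= 1 / 2 by rewrite /q ler_pdivrMr//; lra.
have B : cabsb (fun n => c n * h ^+ n - c n * 0 ^+ n - (if n == 1%N then c 1%N * h else 0)) (A * normc h ^+ 2).
  have -> : A * normc h ^+ 2 = (4 * M * q ^+ 2) * (1 - 1 / 2)^-1.
    by rewrite /A /q; field; rewrite gt_eqF.
  apply: (@cabsb_le _ _ _ (fun n => 4 * M * q ^+ 2 * (1 / 2) ^+ n)); last first.
    have p0 : 0 <= 4 * M * q ^+ 2 by rewrite mulr_ge0 ?exprn_ge0// mulr_ge0.
    rewrite -[X in absb _ (X / _)](ger0_norm p0).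
    by apply: absbZ; apply: nat_geom_absb; lra.
  have p0 : 0 <= 4 * M * q ^+ 2 by rewrite mulr_ge0 ?exprn_ge0// mulr_ge0.
  case=> [|[|n]].
  - by rewrite !expr0 !mulr1 subrr subr0 z0.
  - by rewrite !expr1 mulr0 subr0 eqxx subrr z0 mulr_ge0//; lra.
  rewrite expr0n mulr0 !subr0 normcM normcX.
  have := cb n.+2; rewrite ler_pdivlMr ?exprn_gt0// => cn.
  apply: (@le_trans _ _ (M * q ^+ n.+2)).
    have -> : M * q ^+ n.+2 = M / sigma ^+ n.+2 * normc h ^+ n.+2.
      by rewrite /q expr_div_n mulrA mulrAC.
    by rewrite ler_wpM2r ?exprn_ge0.
  have -> : 4 * M * q ^+ 2 * (1 / 2) ^+ n.+2 = M * (q ^+ 2 * (1 / 2) ^+ n).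
    by rewrite !exprS; field.
  rewrite ler_wpM2l// -addn2 addnC exprD ler_wpM2l ?exprn_ge0//.
  by apply: lerXn2r; rewrite ?nnegrE//; lra.
apply: le_trans (chsum_norm_le B S) _.
rewrite expr2 mulrA ler_wpM2r//; apply: (@le_trans _ _ ((A + 1) * normc h)).
  by rewrite ler_wpM2r// lerDl.
by rewrite mulrC -ler_pdivlMr ?ltr_wpDl// ltW.
Qed.

Variable d : nat.
Implicit Types (rho : 'I_d -> R) (H : C -> ('I_d -> C) -> C) (c : multi d -> C).

(** Of the expansion of H in t, the first order is the one which enters the Wick product. *)
Definition coef1 rho H c := forall z, in_polydisc rho z ->
  exists2 l, cdiff (H ^~ z) 0 l & chsum (fun I => c I * mono z I) l.

Definition sepholo_param (sigma : R) rho H :=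
  (forall t z, normc t < sigma -> in_polydisc rho z -> differentiable (H ^~ z) t) /\
  (forall t, normc t < sigma -> sepholo rho (H t)).

Lemma coef1_exists sigma rho H M : 0 < sigma -> (forall i, 0 < rho i) -> sepholo_param sigma rho H ->
  (forall t z, normc t < sigma -> in_polydisc rho z -> normc (H t z) <= M) ->
  exists2 c, coef1 rho H c & forall I, normc (c I) <= M / (sigma * mono rho I).
Proof.
move=> s0 r0 [h1 h2] hM; have [c [cb ch cs]] := expand_parameter s0 r0 h1 h2 hM.
have [c1 [b1 s1]] := cauchy_polydisc r0 (ch 1%N) (cb 1%N).
exists c1 => [z hz|I].
  exists (c 1%N z); last exact: s1.
  apply: (cdiff_series (c := c ^~ z) s0) => [n|a ha]; first exact: cb.
  exact: cs.
by have := b1 I; rewrite expr1 -mulrA -invfM.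
Qed.

Lemma coef1_uniq rho H c c' : (forall i, 0 < rho i) -> coef1 rho H c -> coef1 rho H c' -> c =1 c'.
Proof.
move=> r0 hc hc' I; apply/eqP; rewrite -subr_eq0; apply/eqP.
have [m m0 mr] : exists2 m : R, 0 < m & forall i, m <= rho i.
  exists (\big[Num.min/1]_i rho i); last by move=> i; rewrite (bigD1 i)//= ge_min lexx.
  by elim/big_ind: _ => // a b a0 b0; rewrite lt_min a0.
apply: (@cmseries_uniq _ _ (fun I => c I - c' I) m m0 _ I) => x hx.
have hz : in_polydisc rho (fun i => (x i)%:C).
  by move=> i; have /andP[x0 xm] := hx i; rewrite normc_real gtr0_norm// (lt_le_trans xm).
have [l cl sl] := hc _ hz; have [l' cl' sl'] := hc' _ hz.
rewrite (cdiff_unique cl' cl) in sl'.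
by have := chsumB sl sl'; rewrite subrr; apply: chsum_ext => J; rewrite mulrBl.
Qed.

Lemma coef1_lin rho H H' c c' (a b : C) : coef1 rho H c -> coef1 rho H' c' ->
  coef1 rho (fun t z => a * H t z + b * H' t z) (fun I => a * c I + b * c' I).
Proof.
move=> hc hc' z hz; have [l cl sl] := hc _ hz; have [l' cl' sl'] := hc' _ hz.
exists (a * l + b * l'); first exact: cdiffD (cdiffZ a cl) (cdiffZ b cl').
by apply: chsum_ext (chsumD (chsumZ a sl) (chsumZ b sl')) => I; rewrite mulrDl !mulrA.
Qed.

Lemma sepholo_param_lin sigma rho H H' (a b : C) : sepholo_param sigma rho H -> sepholo_param sigma rho H' ->
  sepholo_param sigma rho (fun t z => a * H t z + b * H' t z).
Proof.
move=> [h1 h2] [h1' h2']; split => [t z ht hz|t ht z hz i].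
  by apply: differentiableD; apply: differentiableZ; auto.
by apply: differentiableD; apply: differentiableZ; [exact: h2|exact: h2'].
Qed.

Lemma coef1_bound sigma rho H c M : 0 < sigma -> (forall i, 0 < rho i) -> sepholo_param sigma rho H ->
  coef1 rho H c -> (forall t z, normc t < sigma -> in_polydisc rho z -> normc (H t z) <= M) ->
  forall I, normc (c I) <= M / (sigma * mono rho I).
Proof.
move=> s0 r0 rH hc hM I; have [c' hc' cb] := coef1_exists s0 r0 rH hM.
by rewrite (coef1_uniq r0 hc hc').
Qed.

End Coef1.

(** * A mean value inequality for complex-valued functions *)

Section MeanValue.
Context {R : realType}.
Local Notation C := R[i].

(** A derivative relative to [a, b], one-sided at the end points. *)
Definition tderiv (a b : R) (f : R -> C) (t : R) (l : C) := forall e : R, 0 < e ->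
  exists2 dl : R, 0 < dl & forall t', a <= t' <= b -> `|t' - t| < dl ->
    normc (f t' - f t - l * (t' - t)%:C) <= e * `|t' - t|.

Lemma real_mean_value (a b : R) (f g : R -> R) e : a < b ->
  (forall t, a <= t <= b -> forall e', 0 < e' -> exists2 dl : R, 0 < dl &
     forall t', a <= t' <= b -> `|t' - t| < dl -> `|f t' - f t - g t * (t' - t)| <= e' * `|t' - t|) ->
  (forall t, a <= t <= b -> `|g t| <= e) -> `|f b - f a| <= e * (b - a).
Proof.
move=> ab df ge.
have [||] := @MVT R f g a b ab.
- move=> t; rewrite in_itv /= => /andP[ta tb].
  have tab : a <= t <= b by rewrite !ltW.
  have L : h^-1 *: (f (h *: 1 + t) - f t) @[h --> (0 : R)^'] --> g t.
    apply/cvgrPdist_le => e' e'0; have [dl dl0 H] := df t tab e' e'0.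
    apply/nbhs_ballP; exists (Num.min dl (Num.min (t - a) (b - t))) => /=.
      by rewrite !lt_min dl0 !subr_gt0 ta tb.
    move=> h; rewrite /ball /= sub0r normrN !lt_min => /and3P[h1 h2 h3] h0.
    have ht : a <= h + t <= b by move: h2 h3; rewrite !ltr_norml => /andP[? ?] /andP[? ?]; lra.
    have := H _ ht; rewrite addrK => /(_ h1) K.
    rewrite -[h *: 1]/(h * 1) mulr1 -[_ *: _]/(_ * _).
    have -> : g t - h^-1 * (f (h + t) - f t) = - (h^-1 * (f (h + t) - f t - g t * h)) by field.
    by rewrite normrN normrM normfV ler_pdivrMl ?normr_gt0// [leRHS]mulrC.
  by apply: DeriveDef; [apply/cvg_ex; exists (g t)|apply: cvg_lim].
- apply/subspace_continuousP => u uab; apply/cvgrPdist_lt => e' e'0.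
  have uab' : a <= u <= b by move: uab; rewrite /= in_itv.
  have [dl dl0 H] := df u uab' 1 ltr01.
  have N0 : 0 < `|g u| + 1 by rewrite ltr_wpDl.
  apply/nbhs_ballP; exists (Num.min dl (e' / (`|g u| + 1))) => /=.
    by rewrite lt_min dl0 divr_gt0.
  move=> v; rewrite /ball /= lt_min distrC => /andP[v1 v2]; rewrite in_itv /= => vab.
  have := H v vab v1; rewrite distrC => K.
  rewrite ltr_pdivlMr// in v2; apply: le_lt_trans v2.
  have -> : f u - f v = (g u * (v - u) - (f v - f u)) - g u * (v - u) by ring.
  apply: le_trans (ler_normB _ _) _; rewrite normrM.
  have -> : `|v - u| * (`|g u| + 1) = 1 * `|v - u| + `|g u| * `|v - u| by ring.
  by rewrite lerD2r.
move=> t tab ->; rewrite normrM [ `|b - a|]ger0_norm ?subr_ge0 ?(ltW ab)//.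
rewrite ler_wpM2r ?subr_ge0 ?(ltW ab)//; apply: ge.
by move: tab; rewrite in_itv /= => /andP[/ltW-> /ltW->].
Qed.

(** A rotation reduces the claim to the mean value theorem for a real part. *)
Lemma mean_value (a b : R) (f g : R -> C) (c : C) e : a <= b ->
  (forall t, a <= t <= b -> tderiv a b f t (g t)) ->
  (forall t, a <= t <= b -> normc (g t - c) <= e) ->
  normc (f b - f a - c * (b - a)%:C) <= e * (b - a).
Proof.
rewrite le_eqVlt => /orP[/eqP->|ab] df ge.
  by rewrite !subrr mulr0 subr0 (normc_real (0 : R)) normr0 mulr0.
have [w [w1 wE]] := unit_rot (f b - f a - c * (b - a)%:C).
pose F t := complex.Re (w * (f t - c * t%:C)).
pose G t := complex.Re (w * (g t - c)).
have := @real_mean_value a b F G e ab.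
have -> : `|F b - F a| = normc (f b - f a - c * (b - a)%:C).
  rewrite /F -ReN -ReD.
  have -> : w * (f b - c * b%:C) - w * (f a - c * a%:C) = w * (f b - f a - c * (b - a)%:C).
    by rewrite rmorphB /=; ring.
  by rewrite wE /= ger0_norm ?normc_ge0.
apply.
  move=> t tab e' e'0; have [dl dl0 H] := df t tab e' e'0; exists dl => // t' tab' tt.
  rewrite /F /G.
  have -> : complex.Re (w * (f t' - c * t'%:C)) - complex.Re (w * (f t - c * t%:C)) - complex.Re (w * (g t - c)) * (t' - t)
    = complex.Re (w * (f t' - f t - g t * (t' - t)%:C)).
    rewrite [complex.Re (w * (g t - c)) * _]mulrC -ReZ -!ReN -!ReD; congr complex.Re.
    by rewrite rmorphB /=; ring.
  apply: le_trans (ler_Re _) _; rewrite normcM; apply: le_trans (H t' tab' tt).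
  by rewrite ler_piMl ?normc_ge0.
move=> t tab; rewrite /G; apply: le_trans (ler_Re _) _; rewrite normcM.
by apply: le_trans (ge t tab); rewrite ler_piMl ?normc_ge0.
Qed.

Lemma tderiv_sub a b a' b' f t l : a' <= a -> b <= b' -> tderiv a' b' f t l -> tderiv a b f t l.
Proof.
move=> ha hb H e e0; have [dl dl0 K] := H e e0; exists dl => // t' /andP[h1 h2]; apply: K.
by rewrite (le_trans ha)//= (le_trans h2).
Qed.

Lemma mean_value_sym (a b : R) (f g : R -> C) (c : C) e u v : a <= u <= b -> a <= v <= b ->
  (forall t, a <= t <= b -> tderiv a b f t (g t)) ->
  (forall t, `|t - u| <= `|v - u| -> a <= t <= b -> normc (g t - c) <= e) ->
  normc (f v - f u - c * (v - u)%:C) <= e * `|v - u|.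
Proof.
move=> /andP[au ub] /andP[av vb] df ge; have [uv|/ltW vu] := leP u v.
  rewrite ger0_norm ?subr_ge0//; apply: (mean_value (g := g)) => // t /andP[t1 t2].
    by apply: tderiv_sub (df t _) => //; rewrite (le_trans au)//= (le_trans t2).
  apply: ge; last by rewrite (le_trans au)//= (le_trans t2).
  by rewrite !ger0_norm ?subr_ge0//; lra.
rewrite distrC [ `|u - v|]ger0_norm ?subr_ge0//.
have -> : f v - f u - c * (v - u)%:C = - (f u - f v - c * (u - v)%:C).
  by rewrite !rmorphB /=; ring.
have NE (z : C) : normc (- z) = normc z by rewrite -[- z]sub0r normc_distC subr0.
rewrite NE; apply: (mean_value (g := g)) => // t /andP[t1 t2].
  by apply: tderiv_sub (df t _) => //; rewrite (le_trans av)//= (le_trans t2).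
apply: ge; last by rewrite (le_trans av)//= (le_trans t2).
by rewrite ler0_norm ?subr_le0// ler0_norm ?subr_le0//; lra.
Qed.

End MeanValue.

(** * Increments of the cumulant generating functions *)

Section ComplexCompact.
Context {R : realType}.
Local Notation C := R[i].

Lemma compact_cdisc (r : R) : compact [set z : C | normc z <= r].
Proof.
have cl : closed [set z : C | normc z <= r].
  rewrite -openC openE => z /negP; rewrite -ltNge => rz.
  apply/nbhs_normc; exists (normc z - r); first by rewrite subr_gt0.
  move=> w hw; apply/negP; rewrite -ltNge.
  by have := normcD w (z - w); rewrite [w + _]addrC subrK [normc (z - w)]normc_distC; lra.
pose f (p : R * R) : C := p.1 +i* p.2.
have cf : continuous f.
  move=> p; apply/(@cvgrPdist_lt _ C) => e' /ltc_real[e e0 ->].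
  have e2 : 0 < e / 2 by lra.
  exists (ball p.1 (e / 2), ball p.2 (e / 2)); first by split; exact: nbhsx_ballx.
  move=> q [/= h1 h2].
  rewrite normcE ltcR; apply: le_lt_trans (normc_le_ReIm _) _.
  by rewrite ReD ReN ImD ImN /=; rewrite /ball /= in h1 h2; lra.
have K : compact (`[- r, r]%classic `*` `[- r, r]%classic : set (R * R)).
  by apply: compact_setX; exact: segment_compact.
apply: (subclosed_compact cl (@continuous_compact _ _ f _ _ K)).
  exact: continuous_subspaceT.
move=> z /= hz; exists (complex.Re z, complex.Im z) => /=; last by case: z {hz}.
have := ler_Re z; have := ler_Im z; rewrite !in_itv /= -!ler_norml => h1 h2.
by split; [exact: le_trans hz|exact: le_trans hz].
Qed.

Lemma compact_cpoly d (rho : 'I_d -> R) : compact [set z : 'rV[C]_d | forall i, normc (z 0 i) <= rho i].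
Proof. by apply: (@rV_compact C d (fun i => [set z | normc z <= rho i])) => i; exact: compact_cdisc. Qed.

End ComplexCompact.

Section CumulantProcess.
Context {R : realType} {disp : measure_display} {Omega : measurableType disp}.
Context (P : probability Omega R) {d : nat} (T : R) (X : R -> Omega -> 'rV[R]_d).
Local Notation C := R[i].
Variables (Rad : 'I_d -> \bar R).
Let D := polydisc Rad.
Let ex (s t : R) (z w : 'rV[C]_d) (om : Omega) := cexp (cdot z (X s om) + cdot w (X t om)).

(** The hypothesis on the cumulant generating functions, with the branch K of the logarithm, its
    derivative dK in the second time and the bound B of this derivative made explicit. *)
Definition log_mgf (K dK : R -> R -> 'rV[C]_d -> 'rV[C]_d -> C) (B : R) : Prop :=
    (forall s t, 0 <= s <= T -> 0 <= t <= T ->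
       [/\ forall z w, D z -> D w ->
             P.-integrable setT (EFin \o (fun om => normc (ex s t z w om))),
           holomorphic_on (D `*` D) (fun zw => K s t zw.1 zw.2),
           forall z w, D z -> D w -> cexp (K s t z w) = cexpectation P (ex s t z w),
           K s t 0 0 = 0 &
           forall z w, D z -> D w ->
             (K s t' z w - K s t z w) / (t' - t)%:C
               @[t' --> within `[0, T] t^'] --> dK s t z w]) /\
    {within (((`[0, T] `*` `[0, T]) `*` D) `*` D), continuous
       (fun q : R * R * 'rV[C]_d * 'rV[C]_d =>
          dK q.1.1.1 q.1.1.2 q.1.2 q.2)} /\
    (forall s t z w, 0 <= s <= T -> 0 <= t <= T -> D z -> D w -> normc (dK s t z w) <= B).

Variables (K dK : R -> R -> 'rV[C]_d -> 'rV[C]_d -> C) (B : R).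
Hypothesis HK : log_mgf K dK B.
Hypothesis T0 : 0 < T.
Variable rho : 'I_d -> R.
Hypotheses (rho0 : forall i, 0 < rho i) (rhoR : forall i, ((rho i)%:E < Rad i)%E).

(** Closed polydiscs of radius rho inside the domain of K are compact. *)
Definition cpoly : set 'rV[C]_d := [set z | forall i, normc (z 0 i) <= rho i].

Lemma cpolyD z : cpoly z -> D z.
Proof. by move=> hz i; apply: le_lt_trans (rhoR i); rewrite lee_fin. Qed.

Definition axis (j : 'I_d) (eta : C) : 'rV[C]_d := eta *: delta_mx 0 j.

Lemma cpoly_axis j eta : normc eta <= rho j -> cpoly (axis j eta).
Proof.
move=> h i; rewrite !mxE eqxx /=; case: eqP => [->|_]; first by rewrite mulr1.
by rewrite mulr0 (normc_real (0 : R)) normr0 ltW.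
Qed.

Lemma cpoly_row z : in_polydisc rho z -> cpoly (\row_k z k).
Proof. by move=> h i; rewrite mxE ltW. Qed.

Lemma cpoly0 : cpoly 0.
Proof. by move=> i; rewrite mxE (normc_real (0 : R)) normr0 ltW. Qed.

Definition cgf_axis u v j (eta : C) (xi : 'I_d -> C) := K u v (\row_k xi k) (axis j eta).

Lemma K_diff u v z w : 0 <= u <= T -> 0 <= v <= T -> D z -> D w ->
  differentiable (fun zw : 'rV[C]_d * 'rV[C]_d => K u v zw.1 zw.2) (z, w).
Proof.
by move=> hu hv hz hw; have [_ H _ _ _] := HK.1 u v hu hv; apply: H.
Qed.

Lemma cgf_axis_holo u v j : 0 <= u <= T -> 0 <= v <= T -> sepholo_param (rho j) rho (cgf_axis u v j).
Proof.
move=> hu hv; split => [t z ht hz|t ht z hz i].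
  have -> : cgf_axis u v j ^~ z = (fun t : C => (fun zw : 'rV[C]_d * 'rV[C]_d => K u v zw.1 zw.2) ((\row_k z k, 0) + t *: (0, delta_mx 0 j))).
    by apply/funext => a; rewrite /cgf_axis /= scaler0 addr0 add0r.
  apply: (@diff_line R ('rV[C]_d * 'rV[C]_d)%type (fun zw => K u v zw.1 zw.2) (\row_k z k, 0) (0, delta_mx 0 j) t).
  rewrite -[X in differentiable _ X]/(_ + _ *: _, _ + _ *: _) scaler0 addr0 add0r.
  apply: K_diff => //; apply: cpolyD; first exact: cpoly_row.
  by apply: cpoly_axis; exact: ltW.
have -> : (fun a => cgf_axis u v j t (upd z i a)) = (fun a : C => (fun zw : 'rV[C]_d * 'rV[C]_d => K u v zw.1 zw.2) ((\row_k upd z i 0 k, axis j t) + a *: (delta_mx 0 i, 0))).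
  by apply/funext => a; rewrite /cgf_axis /= scaler0 addr0 row_upd_line.
apply: (@diff_line R ('rV[C]_d * 'rV[C]_d)%type (fun zw => K u v zw.1 zw.2) (\row_k upd z i 0 k, axis j t) (delta_mx 0 i, 0) (z i)).
rewrite -[X in differentiable _ X]/(_ + _ *: _, _ + _ *: _) scaler0 addr0 -row_upd_line upd_id.
apply: K_diff => //; apply: cpolyD; first exact: cpoly_row.
by apply: cpoly_axis; exact: ltW.
Qed.

Lemma K_cexp u v z w : 0 <= u <= T -> 0 <= v <= T -> D z -> D w ->
  cexp (K u v z w) = cexpectation P (fun om => cexp (cdot z (X u om) + cdot w (X v om))).
Proof. by move=> hu hv hz hw; have [_ _ H _ _] := HK.1 u v hu hv; exact: H. Qed.

Lemma K_tderiv u v z w : 0 <= u <= T -> 0 <= v <= T -> D z -> D w ->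
  tderiv 0 T (fun t => K u t z w) v (dK u v z w).
Proof.
move=> hu hv hz hw e e0; have [_ _ _ _ H] := HK.1 u v hu hv.
have e0' : 0 < e%:C :> C by rewrite ltcR.
move/(@cvgrPdist_le _ C): (H z w hz hw) => /(_ _ e0') /nbhs_ballP[r /= r0 hr].
exists r => // t' tT tv; have [->|nvt] := eqVneq t' v.
  by rewrite !subrr mulr0 subr0 (normc_real (0 : R)) normr0 mulr0.
have := hr t'; rewrite /ball /= distrC tv in_itv /= => /(_ isT nvt tT).
rewrite normcE lecR; set q := _ / _ => hq.
have n0 : (t' - v)%:C != 0 :> C by rewrite -normc_eq0 normc_real normr_eq0 subr_eq0.
have -> : K u t' z w - K u v z w - dK u v z w * (t' - v)%:C = - ((dK u v z w - q) * (t' - v)%:C).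
  by rewrite mulrBl /q divfK// opprB.
by rewrite -[X in normc X]sub0r normc_distC subr0 normcM normc_real ler_wpM2r.
Qed.

Lemma K_lip u v z w : 0 <= u <= T -> 0 <= v <= T -> D z -> D w ->
  normc (K u v z w - K u u z w) <= B * `|v - u|.
Proof.
move=> hu hv hz hw.
have := @mean_value_sym _ 0 T (fun t => K u t z w) (fun t => dK u t z w) 0 B u v hu hv.
rewrite mul0r subr0; apply => [t ht|t _ ht]; first exact: K_tderiv.
by rewrite subr0; apply: HK.2.2.
Qed.

(** By compactness of [0, T] times two closed polydiscs. *)
Lemma dK_unif e : 0 < e -> exists2 dl, 0 < dl & forall u u' v z w,
  0 <= u <= T -> 0 <= u' <= T -> 0 <= v <= T -> cpoly z -> cpoly w ->
  `|u' - u| < dl -> `|v - u| < dl -> normc (dK u' v z w - dK u u z w) <= e.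
Proof.
move=> e0.
pose XX := (R * 'rV[C]_d * 'rV[C]_d)%type.
pose A : set XX := (`[0, T]%classic `*` cpoly) `*` cpoly.
have cA : compact A.
  by apply: compact_setX; [apply: compact_setX; [exact: segment_compact|exact: compact_cpoly]|exact: compact_cpoly].
pose Q (dl : R) (y : XX) := forall u' v, 0 <= u' <= T -> 0 <= v <= T -> `|u' - y.1.1| < dl -> `|v - y.1.1| < dl ->
   normc (dK u' v y.1.2 y.2 - dK y.1.1 y.1.1 y.1.2 y.2) <= e.
have [|dl dl0 H] := @compact_uniform R XX A Q cA; last first.
  exists dl => // u u' v z w hu hu' hv hz hw h1 h2.
  by apply: (H ((u, z), w)) => //; split => //; split => //=; rewrite in_itv.
move=> [[u z] w] [[/= hu hz] hw]; rewrite in_itv /= in hu.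
have e2 : 0 < (e / 2)%:C :> C by rewrite ltcR; lra.
have /subspace_continuousP c := HK.2.1.
have {}c := c (((u, u), z), w) (conj (conj (conj (hu : `[0, T]%classic u) hu) (cpolyD hz)) (cpolyD hw)).
move/(@cvgrPdist_lt _ C): c => /(_ _ e2) [[U4 Uw] [[[U3 Uz] [[[U1 U2] [n1 n2] s12] nz] s3] nw] s4].
have /nbhs_ballP[r1 /= r10 h1] : nbhs u U1 by [].
have /nbhs_ballP[r2 /= r20 h2] : nbhs u U2 by [].
pose r := Num.min r1 r2; have r0 : 0 < r by rewrite lt_min r10.
have key u' v z1 w1 : `|u' - u| < r -> `|v - u| < r -> 0 <= u' <= T -> 0 <= v <= T -> Uz z1 -> Uw w1 -> cpoly z1 -> cpoly w1 ->
    normc (dK u u z w - dK u' v z1 w1) < e / 2.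
  rewrite !lt_min => /andP[a1 a2] /andP[b1 b2] hu' hv uz uw hz1 hw1.
  have := s4 (((u', v), z1), w1) _; rewrite /= normcE ltcR; apply.
    split => //=; apply: s3; split => //=; apply: s12; split => /=.
      by apply: h1; rewrite /ball /= distrC.
    by apply: h2; rewrite /ball /= distrC.
  split; [split; [split|]|] => /=; rewrite ?in_itv//; exact: cpolyD.
exists (r / 2); first by lra.
exists ((ball u (r / 2) `*` Uz) `*` Uw).
  exists (ball u (r / 2) `*` Uz, Uw) => //=; split => //.
  exists (ball u (r / 2), Uz) => //=; split => //; apply: nbhsx_ballx; lra.
move=> [[u1 z1] w1] [[/= b1 uz] uw] [[/= hu1 hz1] hw1] dl /andP[dl0 dlr] u' v hu' hv c1 c2.
rewrite in_itv /= in hu1; rewrite /ball /= distrC in b1; simpl in c1, c2.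
have T1 : `|u' - u| < r.
  have -> : u' - u = (u' - u1) + (u1 - u) by ring.
  by apply: le_lt_trans (ler_normD _ _) _; lra.
have T2 : `|v - u| < r.
  have -> : v - u = (v - u1) + (u1 - u) by ring.
  by apply: le_lt_trans (ler_normD _ _) _; lra.
have T3 : `|u1 - u| < r by lra.
have k1 := key _ _ _ _ T1 T2 hu' hv uz uw hz1 hw1.
have k2 := key _ _ _ _ T3 T3 hu1 hu1 uz uw hz1 hw1.
have -> : dK u' v z1 w1 - dK u1 u1 z1 w1 = (dK u u z w - dK u1 u1 z1 w1) - (dK u u z w - dK u' v z1 w1) by ring.
by apply: le_trans (normcB _ _) _; lra.
Qed.

Definition cgf_incr j u v (eta : C) (xi : 'I_d -> C) := 1 * cgf_axis u v j eta xi + (- 1) * cgf_axis u u j eta xi.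

Lemma cgf_incr_holo j u v : 0 <= u <= T -> 0 <= v <= T -> sepholo_param (rho j) rho (cgf_incr j u v).
Proof. by move=> hu hv; apply: sepholo_param_lin; exact: cgf_axis_holo. Qed.

Lemma cgf_incr_bound j u v eta xi : 0 <= u <= T -> 0 <= v <= T -> normc eta < rho j -> in_polydisc rho xi ->
  normc (cgf_incr j u v eta xi) <= B * `|v - u|.
Proof.
move=> hu hv he hx; rewrite /cgf_incr mul1r mulN1r; apply: K_lip => //; apply: cpolyD.
  exact: cpoly_row.
by apply: cpoly_axis; exact: ltW.
Qed.

(** The complex coefficients of which [cum_incr] takes the real parts; they are real by [kcoef_real]. *)
Definition kcoef j u v : multi d -> C := xget (fun=> 0) [set c | coef1 rho (cgf_incr j u v) c].

Lemma kcoefP j u v : 0 <= u <= T -> 0 <= v <= T -> coef1 rho (cgf_incr j u v) (kcoef j u v).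
Proof.
move=> hu hv; have [c hc _] := coef1_exists (rho0 j) rho0 (cgf_incr_holo j hu hv) (fun t z ht hz => cgf_incr_bound hu hv ht hz).
exact: (@xgetI _ _ _ c).
Qed.

Lemma kcoef_bound j u v I : 0 <= u <= T -> 0 <= v <= T ->
  normc (kcoef j u v I) <= B * `|v - u| / (rho j * mono rho I).
Proof.
move=> hu hv; apply: coef1_bound (rho0 j) rho0 (cgf_incr_holo j hu hv) (kcoefP j hu hv) _ _ => t z ht hz.
exact: cgf_incr_bound.
Qed.

(** On the polydisc, the increment of K divided by v - u is close to dK at (u, u), uniformly, by the
    mean value inequality. Cauchy's estimates turn this into closeness of the coefficients, relative
    to rho^I. *)
Lemma kcoef_cauchy j e : 0 < e -> exists2 dl, 0 < dl & forall u v u' v' I,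
  0 <= u <= T -> 0 <= v <= T -> 0 <= u' <= T -> 0 <= v' <= T -> u != v -> u' != v' ->
  `|v - u| < dl -> `|v' - u'| < dl -> `|u' - u| < dl ->
  normc (kcoef j u v I / (v - u)%:C - kcoef j u' v' I / (v' - u')%:C) <= e / mono rho I.
Proof.
(* three errors e', and the factor 1 / rho j of Cauchy's estimate *)
move=> e0; pose e' := e * rho j / 3.
have e'0 : 0 < e' by rewrite !divr_gt0 ?mulr_gt0.
have [dl dl0 H] := dK_unif e'0; exists dl => // u v u' v' I hu hv hu' hv' uv uv' d1 d2 d3.
have appr x y eta xi : 0 <= x <= T -> 0 <= y <= T -> x != y -> `|y - x| < dl -> normc eta < rho j -> in_polydisc rho xi ->
    normc (cgf_incr j x y eta xi / (y - x)%:C - dK x x (\row_k xi k) (axis j eta)) <= e'.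
  move=> hx hy xy dd he hxi.
  have cz : cpoly (\row_k xi k) by exact: cpoly_row.
  have cw : cpoly (axis j eta) by apply: cpoly_axis; exact: ltW.
  have n0 : (y - x)%:C != 0 :> C by rewrite -normc_eq0 normc_real normr_eq0 subr_eq0 eq_sym.
  have := @mean_value_sym _ 0 T (fun t => K x t (\row_k xi k) (axis j eta)) (fun t => dK x t (\row_k xi k) (axis j eta))
     (dK x x (\row_k xi k) (axis j eta)) e' x y hx hy.
  have -> : cgf_incr j x y eta xi / (y - x)%:C - dK x x (\row_k xi k) (axis j eta) =
     (K x y (\row_k xi k) (axis j eta) - K x x (\row_k xi k) (axis j eta) - dK x x (\row_k xi k) (axis j eta) * (y - x)%:C) / (y - x)%:C.
    by rewrite /cgf_incr /cgf_axis mul1r mulN1r [RHS]mulrBl mulfK.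
  rewrite normcM normcV normc_real ler_pdivrMr ?normr_gt0 ?subr_eq0 1?eq_sym//; apply.
    by move=> t ht; apply: K_tderiv => //; exact: cpolyD.
  move=> t tx ht; apply: H => //; first by rewrite subrr normr0.
  exact: le_lt_trans dd.
have hc := coef1_lin (v - u)%:C^-1 (- (v' - u')%:C^-1) (kcoefP j hu hv) (kcoefP j hu' hv').
have hr := sepholo_param_lin (v - u)%:C^-1 (- (v' - u')%:C^-1) (cgf_incr_holo j hu hv) (cgf_incr_holo j hu' hv').
have := coef1_bound (M := 3 * e') (rho0 j) rho0 hr hc _ I.
have -> : (v - u)%:C^-1 * kcoef j u v I + - (v' - u')%:C^-1 * kcoef j u' v' I =
   kcoef j u v I / (v - u)%:C - kcoef j u' v' I / (v' - u')%:C by rewrite mulrC mulNr [_^-1 * kcoef j u' v' I]mulrC.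
have -> : 3 * e' / (rho j * mono rho I) = e / mono rho I.
  by rewrite /e'; field; rewrite !gt_eqF// mono_gt0.
apply=> eta xi he hxi.
have a1 := appr u v eta xi hu hv uv d1 he hxi.
have a2 := appr u' v' eta xi hu' hv' uv' d2 he hxi.
have a3 : normc (dK u' u' (\row_k xi k) (axis j eta) - dK u u (\row_k xi k) (axis j eta)) <= e'.
  by apply: H => //; [exact: cpoly_row|apply: cpoly_axis; exact: ltW].
rewrite mulNr mulrC [_^-1 * cgf_incr j u' v' _ _]mulrC.
move: a1 a2 a3; move: (cgf_incr _ _ _ _ _ / _) (cgf_incr _ _ _ _ _ / _) (dK _ _ _ _) (dK _ _ _ _) => a b x y a1 a2 a3.
have -> : b - a = (b - y) - ((a - x) + (x - y)) by ring.
apply: le_trans (normcB _ _) _.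
have -> : 3 * e' = e' + (e' + e') by ring.
apply: lerD => //; apply: le_trans (normcD _ _) _; exact: lerD.
Qed.

Lemma line_deriv (V : normedModType C) (F : V -> C) (x v : V) :
  differentiable F x -> cdiff (fun t : C => F (x + t *: v)) 0 ('d F x v).
Proof.
move=> dF e e0; rewrite -deriveE//.
have dv : derivable F x v by exact: diff_derivable.
have e0' : 0 < e%:C :> C by rewrite ltcR.
move/(@cvgrPdist_le _ C): (dv : h^-1 *: (F (h *: v + x) - F x) @[h --> (0 : C)^'] --> 'D_v F x) => /(_ _ e0').
case/nbhs_normc => r r0 hr; exists r => // h hh; rewrite add0r scale0r addr0.
have [->|h0] := eqVneq h 0.
  by rewrite scale0r addr0 subrr mulr0 subr0 (normc_real (0 : R)) normr0 mulr0.
have := hr h; rewrite subr0 => /(_ hh h0); rewrite normcE lecR => K1.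
have -> : F (x + h *: v) - F x - 'D_v F x * h = - (('D_v F x - h^-1 *: (F (h *: v + x) - F x)) * h).
  by rewrite mulrBl -[h^-1 *: _]/(h^-1 * _) mulrAC mulVf// mul1r opprB addrC [x + _]addrC addrC.
by rewrite -[X in normc X]sub0r normc_distC subr0 normcM ler_wpM2r ?normc_ge0.
Qed.

Lemma cdotDl (z z' : 'rV[C]_d) (x : 'rV[R]_d) : cdot (z + z') x = cdot z x + cdot z' x.
Proof. by rewrite /cdot -big_split; apply: eq_bigr => i _; rewrite mxE mulrDl. Qed.

Lemma cdot0l (x : 'rV[R]_d) : cdot (0 : 'rV[C]_d) x = 0.
Proof. by rewrite /cdot big1// => i _; rewrite mxE mul0r. Qed.

Lemma cdot_real (z : 'I_d -> R) (x : 'rV[R]_d) : cdot (\row_k (z k)%:C) x = (\sum_i z i * x 0 i)%:C.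
Proof. by rewrite /cdot rmorph_sum; apply: eq_bigr => i _; rewrite mxE -rmorphM. Qed.

Lemma cdot_axis j (eta : C) (x : 'rV[R]_d) : cdot (axis j eta) x = eta * (x 0 j)%:C.
Proof.
rewrite /cdot (bigD1 j)//= !mxE !eqxx mulr1 big1 ?addr0// => i ij.
by rewrite !mxE eqxx (negbTE ij) mulr0 mul0r.
Qed.

Lemma cexpectation_real (Z : Omega -> C) (f : Omega -> R) : (forall om, Z om = (f om)%:C) ->
  cexpectation P Z = (fine 'E_P[f]%E)%:C.
Proof.
move=> E; rewrite /cexpectation.
have -> : (fun w => complex.Re (Z w)) = f by apply/funext => w; rewrite E.
have -> : (fun w => complex.Im (Z w)) = cst 0 by apply/funext => w; rewrite E.
by rewrite expectation_cst.
Qed.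

(** Along the direction (- e_j, e_j) the derivative of K_{u,v} at (xi, 0) is the difference of its
    second and its first partial derivative. Since K_{u,v}(z, 0) and K_{u,u}(0, z) are both
    logarithms of E exp(z.X_u), the latter is also a second-variable derivative of K_{u,u}; thus the
    derivative is that of the increment [cgf_incr]. *)
Lemma diag_deriv j u v xi : 0 <= u <= T -> 0 <= v <= T -> in_polydisc rho xi ->
  exists2 phi, chsum (fun I => kcoef j u v I * mono xi I) phi &
    cdiff (fun eta => K u v (\row_k xi k - axis j eta) (axis j eta)) 0 phi.
Proof.
move=> hu hv hxi; have [l cl sl] := kcoefP j hu hv hxi; exists l => //.
pose VV := ('rV[C]_d * 'rV[C]_d)%type.
pose pt : VV := (\row_k xi k, 0).
pose F t (zw : VV) := K u t zw.1 zw.2.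
have Dpt : D (\row_k xi k) by apply: cpolyD; exact: cpoly_row.
have D0 : D 0 by apply: cpolyD; exact: cpoly0.
have dF : differentiable (F v) pt by exact: K_diff.
have dF' : differentiable (F u) pt by exact: K_diff.
pose ez : VV := (delta_mx 0 j, 0); pose ew : VV := (0, delta_mx 0 j).
have c1 := line_deriv (- ez + ew) dF; have c2 := line_deriv ez dF.
have c3 := line_deriv ew dF; have c4 := line_deriv ew dF'.
have E0 : cexp (F v pt) = cexp (F u pt).
  rewrite /F /= !K_cexp//.
  by congr cexpectation; apply/funext => om; rewrite !cdot0l.
(* the first derivative of K_{u,v} is the second one of K_{u,u}; compared after exponentiating,
   because the two logarithms could differ by a multiple of 2 pi i *)
have zw : 'd (F v) pt ez = 'd (F u) pt ew.
  have m1 := cdiff_comp c2 (cexp_diff _); have m2 := cdiff_comp c4 (cexp_diff _).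
  rewrite !scale0r !addr0 E0 in m1 m2.
  have r0 : 0 < rho j - normc (xi j) by rewrite subr_gt0; exact: hxi.
  suff : cdiff (@cexp R \o (fun t : C => F u (pt + t *: ew))) 0 (cexp (F u pt) * 'd (F v) pt ez).
    by move/(cdiff_unique m2) => E1; apply: (mulfI (cexp_neq0 (F u pt))); rewrite E1.
  apply: cdiff_ext r0 _ m1 => h hh; rewrite add0r /= /F /= !scaler0 !addr0 add0r.
  have Dh : D (\row_k xi k + h *: delta_mx 0 j).
    apply: cpolyD => i; rewrite !mxE eqxx /=; case: eqP => [->|_]; last by rewrite mulr0 addr0 ltW.
    by rewrite mulr1; apply: le_trans (normcD _ _) _; lra.
  have Da : D (axis j h).
    by apply: cpolyD; apply: cpoly_axis; have := normc_ge0 (xi j); lra.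
  rewrite !K_cexp//.
  by congr cexpectation; apply/funext => om; rewrite cdot0l addr0 cdotDl.
have -> : l = 'd (F v) pt (- ez + ew).
  rewrite linearD linearN zw.
  have c5 := cdiffD (cdiffZ 1 c3) (cdiffZ (- 1) c4).
  have c6 : cdiff ((cgf_incr j u v)^~ xi) 0 (1 * 'd (F v) pt ew + -1 * 'd (F u) pt ew).
    apply: cdiff_ext ltr01 _ c5 => h _.
    by rewrite add0r /cgf_incr /cgf_axis /F /axis /= !scaler0 !addr0 !add0r.
  by rewrite (cdiff_unique cl c6) mul1r mulN1r addrC.
apply: cdiff_ext ltr01 _ c1 => h _; rewrite add0r /F /axis /=.
by rewrite !scalerDr !scalerN !scaler0 oppr0 addr0 !add0r.
Qed.

Lemma ex_real u v (x : 'I_d -> R) j (t : R) om :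
  cexp (cdot (\row_k (x k)%:C) (X u om) + cdot (axis j t%:C) (X v om)) =
  (expR (\sum_i x i * X u om 0 i + t * X v om 0 j))%:C.
Proof. by rewrite cdot_real cdot_axis -rmorphM -rmorphD cexp_real. Qed.

Lemma row_diag_real (x : 'I_d -> R) j (t : R) :
  \row_k (x k)%:C - axis j t%:C = \row_k (x k - t *+ (k == j))%:C.
Proof.
apply/rowP => k; rewrite !mxE eqxx /= rmorphB /=; congr (_ - _).
by case: eqP; rewrite ?mulr1 ?mulr0.
Qed.

(** The exponential of K along the diagonal is a real moment-generating function at real arguments,
    so its logarithmic derivative is real, whichever branch K is. *)
Lemma diag_real j u v (x : 'I_d -> R) phi : 0 <= u <= T -> 0 <= v <= T -> in_polydisc rho (fun k => (x k)%:C) ->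
  cdiff (fun eta => K u v (\row_k (x k)%:C - axis j eta) (axis j eta)) 0 phi -> complex.Im phi = 0.
Proof.
move=> hu hv hx cphi.
set h := fun eta => _ in cphi.
have m1 := cdiff_comp cphi (cexp_diff _).
have r0 : 0 < rho j - `|x j| by have := hx j; rewrite normc_real subr_gt0.
have hr (t : R) : `|t| < rho j - `|x j| -> exists r : R, cexp (h t%:C) = r%:C.
  move=> ht.
  rewrite /h K_cexp//; last 2 first.
  - rewrite row_diag_real; apply: cpolyD => i; rewrite mxE normc_real.
    case: eqP => [->|_]; last by rewrite mulr0n subr0; have := hx i; rewrite normc_real => /ltW.
    by rewrite mulr1n; apply: le_trans (ler_normB _ _) _; lra.
  - by apply: cpolyD; apply: cpoly_axis; rewrite normc_real; have := normr_ge0 (x j); lra.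
  rewrite row_diag_real; eexists; apply: cexpectation_real => om.
  exact: ex_real.
have [r rE] : exists r : R, cexp (h 0) = r%:C by apply: (hr 0); rewrite normr0.
have rn0 : r != 0 by apply/eqP => r00; have := cexp_neq0 (h 0); rewrite rE r00 eqxx.
apply/eqP; rewrite -normr_le0; apply/ler_addgt0Pr => e e0; rewrite add0r.
have er : 0 < e * `|r| by rewrite mulr_gt0 ?normr_gt0.
have [dl dl0 H] := m1 _ er.
pose t := Num.min (dl / 2) ((rho j - `|x j|) / 2).
have t0 : 0 < t by rewrite lt_min; apply/andP; split; lra.
have t1 : t < dl.
  have : t <= dl / 2 by rewrite ge_min lexx.
  lra.
have t2 : t < rho j - `|x j|.
  have : t <= (rho j - `|x j|) / 2 by rewrite ge_min lexx orbT.
  lra.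
have := H t%:C; rewrite normc_real (gtr0_norm t0) => /(_ t1).
have [s sE] : exists s : R, cexp (h t%:C) = s%:C by apply: hr; rewrite gtr0_norm.
rewrite add0r /= rE sE => K1.
have := le_trans (ler_Im _) K1.
rewrite !ImD !ImN !ImM /= !(mulr0, mul0r, addr0, subr0, oppr0, add0r) normrN.
rewrite normrM (gtr0_norm t0) ler_pM2r// normrM mulrC ler_pM2r ?normr_gt0//.
Qed.

Lemma small_rho : exists2 m : R, 0 < m & forall i, m <= rho i.
Proof.
exists (\big[Num.min/1]_i rho i); last by move=> i; rewrite (bigD1 i)//= ge_min lexx.
by elim/big_ind: _ => // a b a0 b0; rewrite lt_min a0.
Qed.

Lemma kcoef_real j u v I : 0 <= u <= T -> 0 <= v <= T -> complex.Im (kcoef j u v I) = 0.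
Proof.
move=> hu hv; have [m m0 mr] := small_rho.
apply: (@mseries_uniq _ _ (fun I => complex.Im (kcoef j u v I)) m m0 _ I) => x hx.
have hz : in_polydisc rho (fun i => (x i)%:C).
  by move=> i; have /andP[x0 xm] := hx i; rewrite normc_real gtr0_norm// (lt_le_trans xm).
have [phi s c] := diag_deriv j hu hv hz.
have := s.2; rewrite (diag_real hu hv hz c); apply: hsum_ext => J.
by rewrite mono_real ImM /= mulr0 add0r.
Qed.

Definition cum_incr j u v I : R := complex.Re (kcoef j u v I).

Lemma kcoefE j u v I : 0 <= u <= T -> 0 <= v <= T -> kcoef j u v I = (cum_incr j u v I)%:C.
Proof. by move=> hu hv; apply: complex_ext => //=; exact: kcoef_real. Qed.

Lemma cum_incr_bound j u v I : 0 <= u <= T -> 0 <= v <= T ->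
  `|cum_incr j u v I| <= B * `|v - u| / (rho j * mono rho I).
Proof. by move=> hu hv; rewrite -normc_real -kcoefE//; exact: kcoef_bound. Qed.

Lemma cum_incr_cauchy j e : 0 < e -> exists2 dl, 0 < dl & forall u v u' v' I,
  0 <= u <= T -> 0 <= v <= T -> 0 <= u' <= T -> 0 <= v' <= T -> u != v -> u' != v' ->
  `|v - u| < dl -> `|v' - u'| < dl -> `|u' - u| < dl ->
  `|cum_incr j u v I / (v - u) - cum_incr j u' v' I / (v' - u')| <= e / mono rho I.
Proof.
move=> e0; have [dl dl0 H] := kcoef_cauchy j e0; exists dl => // u v u' v' I hu hv hu' hv' n1 n2 d1 d2 d3.
have := H u v u' v' I hu hv hu' hv' n1 n2 d1 d2 d3.
by rewrite !kcoefE// -!fmorphV -!rmorphM -rmorphB normc_real.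
Qed.

(** A sequence of points of [0, T], all different from u and converging to u. *)
Definition nearby (u : R) (n : nat) : R :=
  if u <= T / 2 then u + T / (2 * n.+1%:R) else u - T / (2 * n.+1%:R).

Lemma nearbyP u n : 0 <= u <= T -> [/\ 0 <= nearby u n <= T, u != nearby u n & `|nearby u n - u| = T / (2 * n.+1%:R)].
Proof.
move=> /andP[u0 uT]; have p : 0 < T / (2 * n.+1%:R) by rewrite divr_gt0 ?mulr_gt0.
have q : T / (2 * n.+1%:R) <= T / 2.
  by rewrite ler_wpM2l ?(ltW T0)// lef_pV2 ?posrE ?mulr_gt0// ler_peMr// ler1n.
rewrite /nearby; set z := T / (2 * n.+1%:R) in p q *; have [h|h] := leP u (T / 2); split.
- lra.
- by rewrite lt_eqF// ltrDl.
- by rewrite addrC addKr gtr0_norm.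
- lra.
- by rewrite gt_eqF// ltrBlDr ltrDl.
- by rewrite addrC addKr normrN gtr0_norm.
Qed.

Lemma nearby_small dl : 0 < dl -> exists N, forall n, (N <= n)%N -> T / (2 * n.+1%:R) < dl.
Proof.
move=> dl0; have [N hN] : exists N : nat, T / dl < N%:R.
  by eexists; apply: archi_boundP; rewrite divr_ge0 ?ltW.
exists N => n Nn; rewrite ltr_pdivrMr ?mulr_gt0//; rewrite ltr_pdivrMr// in hN.
apply: lt_le_trans hN _; rewrite mulrC ler_wpM2l ?(ltW dl0)//.
by rewrite -natrM ler_nat mul2n -addnn (leq_trans (leqW Nn))// leq_addr.
Qed.

Lemma cvg_dist_le (a : nat -> R) (l c b : R) N : a @ \oo --> l ->
  (forall n, (N <= n)%N -> `|a n - c| <= b) -> `|l - c| <= b.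
Proof.
move=> al H; apply/ler_addgt0Pr => e e0; have [N' _ h] := (@cvgrPdist_lt _ _ _ _ _ _ _).1 al _ e0.
have h1 : `|l - a (maxn N N')| < e := h (maxn N N') (leq_maxr _ _).
have h2 := H (maxn N N') (leq_maxl _ _).
have -> : l - c = (a (maxn N N') - c) + (l - a (maxn N N')) by ring.
apply: le_trans (ler_normD _ _) _; apply: lerD => //; exact: ltW.
Qed.

(** The density q_I of the increments k_I(u, v). The Cauchy property [cum_incr_cauchy] makes the limit
    exist and independent of the sequence. *)
Definition cum_deriv j u I : R := limn (fun n => cum_incr j u (nearby u n) I / (nearby u n - u)).

Lemma cum_deriv_cvg j u I : 0 <= u <= T -> cum_incr j u (nearby u n) I / (nearby u n - u) @[n --> \oo] --> cum_deriv j u I.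
Proof.
move=> hu; apply/cauchy_cvgP/cauchy_exP => e e0.
have m0 : 0 < mono rho I by exact: mono_gt0.
have e2 : 0 < e / 2 * mono rho I by rewrite mulr_gt0//; lra.
have [dl dl0 H] := cum_incr_cauchy j e2; have [N hN] := nearby_small dl0.
exists (cum_incr j u (nearby u N) I / (nearby u N - u)); exists N => // n /= Nn.
have [a1 a2 a3] := nearbyP n hu; have [b1 b2 b3] := nearbyP N hu.
rewrite /ball /=; apply: (@le_lt_trans _ _ (e / 2)); last lra.
have := H u (nearby u N) u (nearby u n) I hu b1 hu a1 b2 a2; rewrite a3 b3 subrr normr0 => /(_ (hN _ (leqnn _)) (hN _ Nn) dl0).
by rewrite mulfK// gt_eqF.
Qed.

Lemma cum_incr_diag j u I : 0 <= u <= T -> cum_incr j u u I = 0.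
Proof.
move=> hu; apply/eqP; rewrite -normr_le0; apply: le_trans (cum_incr_bound j I hu hu) _.
by rewrite subrr normr0 mulr0 mul0r.
Qed.

(** The error is small relative to 1 / rho^I, uniformly in I. This uniformity makes the series over I
    converge after summation over a partition. *)
Lemma cum_incr_deriv j e : 0 < e -> exists2 dl, 0 < dl & forall u v I, 0 <= u <= T -> 0 <= v <= T -> `|v - u| < dl ->
  `|cum_incr j u v I - cum_deriv j u I * (v - u)| <= e * `|v - u| / mono rho I.
Proof.
move=> e0; have [dl dl0 H] := cum_incr_cauchy j e0; exists dl => // u v I hu hv dd.
have [->|nuv] := eqVneq v u; first by rewrite cum_incr_diag// !subrr normr0 !(mulr0, mul0r) subr0 normr0.
have [N hN] := nearby_small dl0.
have n0 : v - u != 0 by rewrite subr_eq0.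
have -> : cum_incr j u v I - cum_deriv j u I * (v - u) = - ((cum_deriv j u I - cum_incr j u v I / (v - u)) * (v - u)) by field.
rewrite normrN normrM mulrAC ler_wpM2r//; apply: (cvg_dist_le (N := N) (cum_deriv_cvg (j := j) (I := I) hu)) => n Nn.
have [a1 a2 a3] := nearbyP n hu; rewrite distrC.
by apply: H; rewrite // ?a3 ?subrr ?normr0// 1?eq_sym//; exact: hN.
Qed.

Lemma cum_deriv_unif j e : 0 < e -> exists2 dl, 0 < dl & forall u u' I, 0 <= u <= T -> 0 <= u' <= T -> `|u' - u| < dl ->
  `|cum_deriv j u' I - cum_deriv j u I| <= e / mono rho I.
Proof.
move=> e0; have [dl dl0 H] := cum_incr_cauchy j e0; exists dl => // u u' I hu hu' dd.
have [N hN] := nearby_small dl0.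
apply: (cvg_dist_le (N := N) (cum_deriv_cvg (j := j) (I := I) hu')) => n Nn; rewrite distrC.
apply: (cvg_dist_le (N := N) (cum_deriv_cvg (j := j) (I := I) hu)) => m Nm.
have [a1 a2 a3] := nearbyP n hu'; have [b1 b2 b3] := nearbyP m hu.
by apply: H; rewrite // ?a3 ?b3; exact: hN.
Qed.

Lemma cum_deriv_cont j I : {within `[0, T], continuous (fun u => cum_deriv j u I)}.
Proof.
apply/subspace_continuousP => u; rewrite /= in_itv /= => hu; apply/cvgrPdist_le => e e0.
have m0 : 0 < mono rho I by exact: mono_gt0.
have [dl dl0 H] := cum_deriv_unif j (mulr_gt0 e0 m0).
apply/nbhs_ballP; exists dl => // v; rewrite /ball /= distrC => vu; rewrite in_itv /= => hv.
by have := H u v I hu hv vu; rewrite mulfK ?gt_eqF// distrC.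
Qed.

Lemma cum_deriv_bound j u I : 0 <= u <= T -> `|cum_deriv j u I| <= B / (rho j * mono rho I).
Proof.
move=> hu; rewrite -[cum_deriv j u I]subr0; apply: (cvg_dist_le (N := 0%N) (cum_deriv_cvg (j := j) (I := I) hu)) => n _.
have [a1 a2 a3] := nearbyP n hu; rewrite subr0 normrM normfV ler_pdivrMr ?normr_gt0 ?subr_eq0 1?eq_sym//.
by rewrite mulrAC; exact: cum_incr_bound.
Qed.

End CumulantProcess.

(** * Joint cumulants as power series coefficients *)

Section CumulantDerivative.
Context {R : realType}.
Local Notation C := R[i].

Lemma derive_o n (f : 'rV[R]_n -> R) x v l :
  (forall e : R, 0 < e -> exists2 dl : R, 0 < dl & forall h : R, `|h| < dl ->
     `|f (h *: v + x) - f x - h * l| <= e * `|h|) -> 'D_v f x = l.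
Proof.
move=> hf; apply: cvg_lim; first exact: norm_hausdorff.
apply/cvgrPdist_le => e e0; have [dl dl0 H] := hf e e0.
apply/nbhs_ballP; exists dl => //= h; rewrite /ball /= sub0r normrN => hh h0.
have hn : 0 < `|h| by rewrite normr_gt0.
have -> : l - h^-1 *: (f (h *: v + x) - f x) = - (h^-1 * (f (h *: v + x) - f x - h * l)).
  by rewrite -[h^-1 *: _]/(h^-1 * _); field.
by rewrite normrN normrM normfV ler_pdivrMl// [leRHS]mulrC H.
Qed.

Variable d : nat.

Lemma psum_at0 (c : multi d -> R) : psum c (fun=> 0) = c 0.
Proof.
apply: usumE; have := hsum1 (0 : multi d) (c 0); apply: hsum_ext => I.
case: eqP => [->|/eqP I0]; first by rewrite mono0 mulr1.
suff -> : mono (fun=> 0 : R) I = 0 by rewrite mulr0.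
have [i Ii] : exists i, I i != 0%N.
  apply/existsP; rewrite -negb_forall; apply: contra I0 => /forallP h.
  by apply/eqP/ffunP => i; rewrite ffunE; apply/eqP; have := h i.
by rewrite /mono (bigD1 i)//= expr0n (negbTE Ii) mul0r.
Qed.

Lemma foldr_deriv_coef (b : multi d -> R) (s : seq 'I_d) :
  foldr (fun i c => deriv_coef c i) (egf b) s = egf (fun I => b (I + \sum_(i <- s) munit i)).
Proof.
elim: s => [|i s IH] /=; first by congr egf; apply/funext => I; rewrite big_nil addr0.
by rewrite IH deriv_coef_egf; congr egf; apply/funext => I; rewrite big_cons addrA.
Qed.

Lemma sum_mset (I : multi d) : \sum_(i <- Defs.mset I) munit i = I.
Proof.
rewrite /Defs.mset big_flatten /= big_map -[RHS]sum_munit; apply: eq_bigr => i _.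
by rewrite big_nseq; elim: (I i) => // n IH; rewrite iterS IH mulrS.
Qed.

Variable rho : 'I_d -> R.
Hypothesis rho0 : forall i, 0 < rho i.

Definition conv_inside (c : multi d -> R) := forall y, (forall i, 0 <= y i < rho i) -> abs_conv_at c y.

Lemma conv_inside_deriv c i : conv_inside c -> conv_inside (deriv_coef c i).
Proof.
move=> hc y hy; apply: (@deriv_coef_conv _ _ _ _ _ (fun k => (y k + rho k) / 2)).
  by apply: hc => k; have /andP[] := hy k; have := rho0 k; lra.
by move=> k; have /andP[] := hy k; have := rho0 k; lra.
Qed.

(** Differentiating a power series composed with a linear substitution: moving the k-th variable of l
    moves the js(k)-th variable of the series. The last variable is left at 0, since in the
    application the derivative in it has been taken before. *)
Lemma foldr_partial m (js : 'I_m -> 'I_d) (xi : 'rV[R]_m.+1 -> 'I_d -> R) (g : 'rV[R]_m.+1 -> R) c :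
  (forall (l : 'rV[R]_m.+1) (h : R) k, xi (h *: delta_mx 0 (widen_ord (leqnSn m) k) + l) =
     updr (xi l) (js k) (xi l (js k) + h)) ->
  conv_inside c ->
  (forall l : 'rV[R]_m.+1, l 0 ord_max = 0 -> (forall i, `|xi l i| < rho i) -> g l = psum c (xi l)) ->
  forall ks : seq 'I_m, conv_inside (foldr (fun i c => deriv_coef c i) c (map js ks)) /\
   forall l : 'rV[R]_m.+1, l 0 ord_max = 0 -> (forall i, `|xi l i| < rho i) ->
    foldr (@partial R m.+1) g (map (widen_ord (leqnSn m)) ks) l =
    psum (foldr (fun i c => deriv_coef c i) c (map js ks)) (xi l).
Proof.
move=> hxi hc hg; elim=> [|k ks [IH1 IH2]] /=; first by split.
split=> [|l l0 lr]; first exact: conv_inside_deriv.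
set c' := foldr _ c _ in IH1 IH2 *; set g' := foldr _ g _ in IH2 *.
pose y i := (`|xi l i| + rho i) / 2.
have ly i : `|xi l i| < y i < rho i by rewrite /y; have := lr i; lra.
have cy : abs_conv_at c' y.
  by apply: IH1 => i; have /andP[h1 ->] := ly i; rewrite andbT (le_trans _ (ltW h1)).
have lty i : `|xi l i| < y i by case/andP: (ly i).
have [A [dl [dl0 H]]] := psum_deriv (js k) cy lty.
pose r := rho (js k) - `|xi l (js k)|.
have r0 : 0 < r by rewrite subr_gt0.
rewrite /partial; apply: derive_o => e e0.
have A1 : 0 < `|A| + 1 by rewrite ltr_wpDl.
exists (Num.min (Num.min dl r) (e / (`|A| + 1))).
  by rewrite !lt_min dl0 r0 divr_gt0.
move=> h; rewrite !lt_min => /andP[/andP[h1 h2] h3].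
rewrite !IH2//; last 2 first.
- by rewrite !mxE eqxx /= l0 addr0; case: eqP => [/(congr1 val)/= E|_]; [have := ltn_ord k; rewrite -E ltnn|rewrite mulr0].
- move=> i; rewrite hxi /updr; case: eqP => [->|_]; last exact: lr.
  by apply: le_lt_trans (ler_normD _ _) _; rewrite /r in h2; lra.
rewrite hxi; apply: le_trans (H h h1) _.
have hh : h ^+ 2 = `|h| * `|h| by rewrite -expr2 real_normK ?num_real.
rewrite hh mulrA ler_wpM2r//; apply: (@le_trans _ _ ((`|A| + 1) * `|h|)).
  by rewrite ler_wpM2r// (le_trans (ler_norm A))// lerDl.
by rewrite mulrC -ler_pdivlMr// ltW.
Qed.

End CumulantDerivative.

Section JointCumulant.
Context {R : realType} {disp : measure_display} {Omega : measurableType disp}.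
Context (P : probability Omega R) {d : nat} (T : R) (X : R -> Omega -> 'rV[R]_d).
Local Notation C := R[i].
Variables (Rad : 'I_d -> \bar R).
Variables (K dK : R -> R -> 'rV[C]_d -> 'rV[C]_d -> C) (B : R).
Hypothesis HK : log_mgf P T X Rad K dK B.
Hypothesis T0 : 0 < T.
Variable rho : 'I_d -> R.
Hypotheses (rho0 : forall i, 0 < rho i) (rhoR : forall i, ((rho i)%:E < Rad i)%E).

Lemma K_bounded u v : 0 <= u <= T -> 0 <= v <= T ->
  exists M, forall z w, cpoly rho z -> cpoly rho w -> normc (K u v z w) <= M.
Proof.
move=> hu hv.
pose XX := ('rV[C]_d * 'rV[C]_d)%type.
pose F (y : XX) := K u v y.1 y.2.
have cA : compact (cpoly rho `*` cpoly rho : set XX) by apply: compact_setX; exact: compact_cpoly.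
have [|dl dl0 H] := @compact_uniform R XX _ (fun dl y => normc (F y) <= dl^-1) cA; last first.
  by exists dl^-1 => z w hz hw; exact: (H (z, w)).
move=> [y1 y2]; set y : XX := (y1, y2) => -[/= hz hw].
have N0 : 0 < normc (F y) + 1 by rewrite ltr_wpDl ?normc_ge0.
exists (normc (F y) + 1)^-1; first by rewrite invr_gt0.
have cF : F y' @[y' --> y] --> F y.
  by apply: differentiable_continuous; apply: (K_diff HK) => //; exact: cpolyD.
have e1 : 0 < 1%:C :> C by rewrite ltcR.
have := (@cvgrPdist_lt _ _ _ _ _ _ _).1 cF _ e1 => U.
exists [set y' | `|F y - F y'| < 1%:C]; first exact: U.
move=> y' /= hy' _ dl /andP[dl0 dl1]; rewrite normcE ltcR in hy'.
apply: (@le_trans _ _ (normc (F y) + 1)).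
  have -> : F y' = F y - (F y - F y') by ring.
  by apply: le_trans (normcB _ _) _; rewrite lerD2l ltW.
by rewrite -[leLHS]invrK lef_pV2 ?posrE ?invr_gt0// ltW.
Qed.

Lemma cgf_axis_coef j u v : 0 <= u <= T -> 0 <= v <= T ->
  exists2 c, coef1 rho (cgf_axis K u v j) c & exists M, forall I, normc (c I) <= M / mono rho I.
Proof.
move=> hu hv; have [M hM] := K_bounded hu hv.
have [c hc cb] := @coef1_exists _ _ (rho j) rho (cgf_axis K u v j) M (rho0 j) rho0 (cgf_axis_holo HK rho0 rhoR j hu hv)
  (fun t z ht hz => hM _ _ (cpoly_row hz) (cpoly_axis rho0 (ltW ht))).
exists c => //; exists (M / rho j) => I; by rewrite -mulrA -invfM.
Qed.

Definition jcn n (Y : seq (Omega -> R)) : R :=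
  foldr (@partial R n)
    (fun l : 'rV[R]_n => ln (fine ('E_P[fun w => expR (\sum_(k < n) l 0 k * nth (fun=> 0) Y k w)])%E))
    (enum 'I_n) 0.

(** The linear combination of the variables is xi(l).X_u + l_m X^j_v, where xi(l) collects the l_k
    according to the coordinate of the k-th variable. The derivative in the last variable gives the
    series with coefficients c, and each other derivative acts on it as [deriv_coef]. *)
Lemma joint_cumulantE u v j c (js : seq 'I_d) : 0 <= u <= T -> 0 <= v <= T ->
  coef1 rho (cgf_axis K u v j) c -> (exists M, forall I, normc (c I) <= M / mono rho I) ->
  joint_cumulant P (rcons [seq (fun w => X u w 0 i) | i <- js] (fun w => X v w 0 j)) =
  foldr (fun i c => deriv_coef c i) (fun I => complex.Re (c I)) js 0.
Proof.
move=> hu hv hc [M cb].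
set Y := rcons _ _; have sY : size Y = (size js).+1 by rewrite size_rcons size_map.
rewrite -[LHS]/(jcn (size Y) Y) sY; set m := size js.
pose cr I := complex.Re (c I).
have M0 : 0 <= M.
  by have := le_trans (normc_ge0 _) (cb 0); rewrite mono0 divr1.
have lc : conv_inside rho cr.
  move=> y hy; have hz : in_polydisc rho (fun i => (y i)%:C).
    by move=> i; have /andP[y0 yr] := hy i; rewrite normc_real ger0_norm.
  eexists; apply: absb_le (cabsb_Re (cabsb_mono rho0 M0 cb hz)) => I.
  by rewrite mono_real [c I * _]mulrC ReZ mulrC.
pose w (k : 'I_m) := widen_ord (leqnSn m) k.
pose jk (k : 'I_m) := nth j js k.
(* xi(l)_i is the sum of the l_k with k-th variable X^i_u *)
pose xi (l : 'rV[R]_m.+1) (i : 'I_d) : R := \sum_(k < m) if jk k == i then l 0 (w k) else 0.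
have wmax k : (w k == ord_max) = false.
  by apply/eqP => /(congr1 val)/= E; have := ltn_ord k; rewrite E ltnn.
have lin (l : 'rV[R]_m.+1) om : \sum_(k < m.+1) l 0 k * nth (fun=> 0) Y k om =
    \sum_i xi l i * X u om 0 i + l 0 ord_max * X v om 0 j.
  rewrite big_ord_recr /=; congr (_ + _ * _); last by rewrite /Y nth_rcons size_map ltnn eqxx.
  transitivity (\sum_i \sum_(k < m) (if jk k == i then l 0 (w k) * X u om 0 i else 0)); last first.
    apply: eq_bigr => i _; rewrite /xi mulr_suml; apply: eq_bigr => k _.
    by case: ifP => // _; rewrite mul0r.
  rewrite exchange_big /=; apply: eq_bigr => k _.
  rewrite (bigD1 (jk k))//= eqxx big1 ?addr0 => [|i ik]; last by rewrite eq_sym (negbTE ik).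
  by rewrite /Y nth_rcons size_map ltn_ord (nth_map j).
have xi_w (l : 'rV[R]_m.+1) (h : R) k : xi (h *: delta_mx 0 (w k) + l) = updr (xi l) (jk k) (xi l (jk k) + h).
  have E i : xi (h *: delta_mx 0 (w k) + l) i = xi l i + (if jk k == i then h else 0).
    rewrite /xi [\sum_(k0 < m) _](bigD1 k)//= [in RHS](bigD1 k)//=.
    rewrite !mxE eqxx /= eqxx mulr1.
    rewrite [X in _ + X](eq_bigr (fun k0 => if jk k0 == i then l 0 (w k0) else 0)).
      by case: ifP => _; ring.
    move=> k' k'k; rewrite !mxE eqxx /=.
    have -> : (w k' == w k) = false.
      by apply/negbTE; apply: contra k'k => /eqP/(congr1 val)/= /val_inj->.
    by rewrite mulr0 add0r.
  apply/funext => i; rewrite E /updr eq_sym; case: eqP => [->//|_]; by rewrite addr0.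
have xi_max (l : 'rV[R]_m.+1) (h : R) : xi (h *: delta_mx 0 ord_max + l) = xi l.
  apply/funext => i; apply: eq_bigr => k _; case: ifP => // _.
  by rewrite !mxE wmax andbF mulr0 add0r.
pose L (l : 'rV[R]_m.+1) : R := ln (fine ('E_P[fun om => expR (\sum_(k < m.+1) l 0 k * nth (fun=> 0) Y k om)])%E).
have LE (l : 'rV[R]_m.+1) : `|l 0 ord_max| < rho j -> (forall i, `|xi l i| < rho i) ->
    L l = complex.Re (cgf_axis K u v j (l 0 ord_max)%:C (fun i => (xi l i)%:C)).
  move=> h1 h2; rewrite /L.
  have hz : cpoly rho (\row_k (xi l k)%:C) by move=> i; rewrite mxE normc_real ltW.
  have hw : cpoly rho (axis j (l 0 ord_max)%:C) by apply: cpoly_axis => //; rewrite normc_real ltW.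
  have := K_cexp HK hu hv (cpolyD rhoR hz) (cpolyD rhoR hw).
  rewrite (cexpectation_real P (fun om => ex_real X u v _ _ _ om)).
  have -> : (fun om => expR (\sum_i xi l i * X u om 0 i + l 0 ord_max * X v om 0 j)) =
      (fun om => expR (\sum_(k < m.+1) l 0 k * nth (fun=> 0) Y k om)).
    by apply/funext => om; rewrite lin.
  rewrite /cgf_axis; set k0 := K _ _ _ _; set E := fine _ => cE.
  have : normc (cexp k0) = `|E| by rewrite cE normc_real.
  rewrite normc_cexp ger0_norm; first by move=> <-; rewrite expRK.
  by apply: fine_ge0; apply: expectation_ge0 => om; exact: expR_ge0.
(* the derivative in the last variable, at points where it is 0 *)
have Gmax (l : 'rV[R]_m.+1) : l 0 ord_max = 0 -> (forall i, `|xi l i| < rho i) -> partial ord_max L l = psum cr (xi l).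
  move=> l0 lr; have hz : in_polydisc rho (fun i => (xi l i)%:C) by move=> i; rewrite normc_real.
  have [phi c1 s1] := hc _ hz.
  have -> : psum cr (xi l) = complex.Re phi.
    by apply: usumE; apply: hsum_ext s1.1 => I; rewrite mono_real [c I * _]mulrC ReZ mulrC.
  apply: derive_o => e e0; have [dl dl0 H] := c1 e e0.
  exists (Num.min dl (rho j)); first by rewrite lt_min dl0 rho0.
  move=> h; rewrite lt_min => /andP[h1 h2].
  have hmax : (h *: delta_mx 0 ord_max + l : 'rV[R]_m.+1) 0 ord_max = h.
    by rewrite !mxE !eqxx mulr1 l0 addr0.
  rewrite LE ?hmax ?xi_max// LE ?l0 ?normr0 ?rho0//.
  have := H h%:C; rewrite normc_real => /(_ h1); rewrite add0r; apply: le_trans.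
  apply: le_trans (ler_Re _); rewrite !ReD !ReN ReM /= mulr0 subr0 [h * _]mulrC.
  by rewrite /cgf_axis.
rewrite /jcn enum_ordSr foldr_rcons -/L.
have [_ ->] := @foldr_partial R d rho rho0 m jk xi (partial ord_max L) cr xi_w lc Gmax (enum 'I_m).
- have -> : map jk (enum 'I_m) = js.
    by rewrite -[RHS](mkseq_nth j) /mkseq -val_enum_ord -map_comp.
  have -> : xi 0 = fun=> 0.
    by apply/funext => i; apply: big1 => k _; rewrite mxE; case: ifP.
  by rewrite psum_at0.
- by rewrite mxE.
- by move=> i; rewrite /xi big1 ?normr0// => k _; rewrite mxE; case: ifP.
Qed.

Lemma joint_cumulant_mset u v j c I : 0 <= u <= T -> 0 <= v <= T ->
  coef1 rho (cgf_axis K u v j) c -> (exists M, forall I, normc (c I) <= M / mono rho I) ->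
  joint_cumulant P (rcons [seq (fun w => X u w 0 i) | i <- Defs.mset I] (fun w => X v w 0 j)) =
  (mfact I)%:R * complex.Re (c I).
Proof.
move=> hu hv hc cb; rewrite (joint_cumulantE _ hu hv hc cb).
have -> : (fun I => complex.Re (c I)) = egf (fun I => (mfact I)%:R * complex.Re (c I)).
  apply/funext => J; rewrite /egf mulrAC mulfV ?mul1r// pnatr_eq0 -lt0n; exact: mfact_gt0.
by rewrite foldr_deriv_coef sum_mset /egf add0r mfact0 divr1.
Qed.

Lemma within_proper u : 0 <= u <= T -> ProperFilter (within `[0, T] u^').
Proof.
move=> hu; split; last exact: within_filter.
move=> /nbhs_ballP[r /= r0 hr]; have [N hN] := nearby_small T0 r0; have [a1 a2 a3] := nearbyP T0 N hu.
apply: (hr (nearby T u N)); rewrite /= ?in_itv//; last by rewrite eq_sym.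
by rewrite /ball /= distrC a3 hN.
Qed.

(** The joint cumulant of X^{i_1}_u, ..., X^{i_n}_u and X^j_v, minus its value at v = u, is
    I! k_I(u, v). *)
Lemma kappaE I j u : 0 <= u <= T -> kappa P T X I j u = (mfact I)%:R * cum_deriv T K rho j u I.
Proof.
move=> hu; rewrite /kappa /deriv_in.
have [c0 hc0 cb0] := cgf_axis_coef j hu hu.
pose g v := joint_cumulant P (rcons [seq (fun w => X u w 0 i) | i <- Defs.mset I] (fun w => X v w 0 j)).
change (lim ((g v - g u) / (v - u) @[v --> within `[0, T] u^']) = (mfact I)%:R * cum_deriv T K rho j u I).
have gE v : 0 <= v <= T -> g v - g u = (mfact I)%:R * cum_incr K rho j u v I.
  move=> hv; have [c hc cb] := cgf_axis_coef j hu hv.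
  rewrite /g (joint_cumulant_mset I hu hv hc cb) (joint_cumulant_mset I hu hu hc0 cb0).
  have := coef1_uniq rho0 (kcoefP HK rho0 rhoR j hu hv) (coef1_lin 1 (-1) hc hc0) I.
  by rewrite /cum_incr => ->; rewrite mul1r mulN1r ReD ReN mulrBr.
have pf := within_proper hu.
apply: cvg_lim; first exact: norm_hausdorff.
apply/cvgrPdist_le => e e0.
have m0 : 0 < mono rho I by exact: mono_gt0.
have f0 : 0 < (mfact I)%:R :> R by rewrite ltr0n mfact_gt0.
have [dl dl0 H] := cum_incr_deriv HK T0 rho0 rhoR j (divr_gt0 (mulr_gt0 e0 m0) f0).
apply/nbhs_ballP; exists dl => //= v; rewrite /ball /= distrC => vu nvu vT.
rewrite in_itv /= in vT; rewrite gE//.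
have n0 : v - u != 0 by rewrite subr_eq0.
have := H u v I hu vT vu.
have -> : (mfact I)%:R * cum_deriv T K rho j u I - (mfact I)%:R * cum_incr K rho j u v I / (v - u) =
   - ((mfact I)%:R / (v - u) * (cum_incr K rho j u v I - cum_deriv T K rho j u I * (v - u))) by field.
rewrite normrN normrM normrM normfV (gtr0_norm f0) => H1.
apply: le_trans (ler_wpM2l _ H1) _; first by rewrite mulr_ge0 ?invr_ge0// ltW.
have v0 : `|v - u| != 0 by rewrite normr_eq0.
rewrite le_eqVlt; apply/orP; left; apply/eqP; field.
by rewrite v0 !gt_eqF.
Qed.

End JointCumulant.

(** * Convolutions of coefficient families *)

Section Convolution.
Context {R : realType} {d : nat}.
Implicit Types (al mu ga b : multi d -> R).

Lemma absb_mul (J K : choiceType) (a : J -> R) (b : K -> R) M N : absb a M -> absb b N ->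
  absb (fun p : J * K => a p.1 * b p.2) (N * M).
Proof.
move=> ha hb; have N0 := absb_ge0 hb.
apply: (@absb_pair _ _ _ (fun p : J * K => a p.1 * b p.2) (fun j => `|a j| * N)) => [j|] /=.
  exact: absbZ.
have := absbZ N ha; rewrite ger0_norm//; apply: absb_le => j.
by rewrite normrM normr_id mulrC normrM.
Qed.

Lemma hsum_mul (J K : choiceType) (a : J -> R) (b : K -> R) M N s t : absb a M -> absb b N ->
  hsum a s -> hsum b t -> hsum (fun p : J * K => a p.1 * b p.2) (s * t).
Proof.
move=> ha hb sa sb; have [v hv] := absb_hsum (absb_mul ha hb).
have h1 := hsum_pair hv (fun j => hsumZ (a j) sb).
have h2 := hsumZ t sa.
suff <- : v = s * t by [].
apply: hsum_uniq h1 _; rewrite mulrC; apply: hsum_ext h2 => j; exact: mulrC.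
Qed.

(** Products of power series at the level of coefficients, without reference to their convergence. *)
Definition is_conv al mu ga := forall I : multi d,
  hsum (fun p : multi d * multi d => if p.1 + p.2 == I then al p.1 * mu p.2 else 0) (ga I).

(** A convolution identity is checked on generating functions near 0. *)
Lemma conv_uniq al mu ga (rho : R) : 0 < rho ->
  (forall x : 'I_d -> R, (forall i, 0 < x i < rho) -> exists s t,
     [/\ hsum (fun I => al I * mono x I) s, hsum (fun I => mu I * mono x I) t &
         hsum (fun I => ga I * mono x I) (s * t)]) -> is_conv al mu ga.
Proof.
move=> rho0 H.
pose x0 (i : 'I_d) := rho / 2.
have hx0 i : 0 < x0 i < rho by rewrite /x0; lra.
pose pf (x : 'I_d -> R) (p : multi d * multi d) := (al p.1 * mono x p.1) * (mu p.2 * mono x p.2).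
have pfE x p : pf x p = mono x (p.1 + p.2) * (al p.1 * mu p.2) by rewrite /pf monoD; ring.
have ex I : exists g, hsum (fun p : multi d * multi d => if p.1 + p.2 == I then al p.1 * mu p.2 else 0) g.
  have [s [t [h1 h2 _]]] := H _ hx0.
  have [M hM] := hsum_abs h1; have [N hN] := hsum_abs h2.
  have m0 : 0 < mono x0 I by apply: mono_gt0 => i; case/andP: (hx0 i).
  apply: (@absb_hsum _ _ _ (`|(mono x0 I)^-1| * (N * M))).
  apply: absb_le (absbZ _ (absb_mul hM hN)) => p; case: eqP => [e|_]; last by rewrite normr0.
  by rewrite -/(pf x0 p) pfE e mulrA mulVf ?gt_eqF// mul1r.
have [g hg] := choice ex.
suff -> : ga = g by [].
apply/funext => I; apply/eqP; rewrite -subr_eq0; apply/eqP.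
apply: (@mseries_uniq _ _ (fun I => ga I - g I) rho rho0 _ I) => x hx.
have [s [t [h1 h2 h3]]] := H _ hx.
have [M hM] := hsum_abs h1; have [N hN] := hsum_abs h2.
have h4 := @hsum_fiber _ _ _ (fun p : multi d * multi d => p.1 + p.2) (pf x) (N * M)
  (fun I => mono x I * g I) (s * t) (absb_mul hM hN) (hsum_mul hM hN h1 h2).
have {}h4 : hsum (fun I => mono x I * g I) (s * t).
  apply: h4 => J; apply: hsum_ext (hsumZ (mono x J) (hg J)) => p.
  by case: eqP => [e|_]; rewrite ?mulr0// pfE e.
have := hsumB h3 h4; rewrite subrr; apply: hsum_ext => J; ring.
Qed.

(** Summation by parts: pairing b with a convolution of al and mu means first pairing the shifts of b
    with al, then the result with mu. *)
Lemma conv_sum al mu ga b M (t : multi d -> R) : is_conv al mu ga ->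
  absb (fun p : multi d * multi d => b (p.1 + p.2) * (al p.1 * mu p.2)) M ->
  (forall J, hsum (fun L => b (L + J) * al L) (t J)) ->
  exists2 w, hsum (fun I => b I * ga I) w & hsum (fun J => mu J * t J) w.
Proof.
move=> hc hM ht; have [w hw] := absb_hsum hM; exists w.
  apply: (@hsum_fiber _ _ _ (fun p : multi d * multi d => p.1 + p.2) _ M _ w hM hw) => I.
  apply: hsum_ext (hsumZ (b I) (hc I)) => p; case: eqP => [->//|_]; exact: mulr0.
apply: (hsum_pair (hsum_swap hw)) => J /=.
by apply: hsum_ext (hsumZ (mu J) (ht J)) => L; ring.
Qed.

Lemma pair_series_uniq (D : multi d * nat -> R) (rho : R) : 0 < rho ->
  (forall (x : 'I_d -> R) (t : R), (forall i, 0 < x i < rho) -> 0 < t < rho ->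
     hsum (fun p => D p * (mono x p.1 * t ^+ p.2)) 0) -> forall p, D p = 0.
Proof.
move=> rho0 H [I n].
suff S m (x : 'I_d -> R) : (forall i, 0 < x i < rho) -> hsum (fun I => D (I, m) * mono x I) 0.
  by apply: (@mseries_uniq _ _ (fun I => D (I, n)) rho rho0); exact: S.
move=> hx; have ht0 : 0 < rho / 2 < rho by lra.
have ex k : exists s, hsum (fun I => D (I, k) * mono x I) s.
  have [M hM] := hsum_abs (H x _ hx ht0).
  have h := absb_row k (absb_swap hM); simpl in h.
  apply: (@absb_hsum _ _ _ (`|(rho / 2) ^- k| * M)).
  apply: absb_le (absbZ _ h) => J.
  have -> // : D (J, k) * mono x J = (rho / 2) ^- k * (D (J, k) * (mono x J * (rho / 2) ^+ k)).
  by field; rewrite expf_neq0// gt_eqF//; case/andP: ht0.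
have [s hs] := choice ex.
suff <- : s m = 0 by exact: hs.
apply: (@pseries_uniq1 _ s rho rho0) => t ht.
have h := hsum_swap (H x t hx ht).
apply: (hsum_pair h) => k /=.
by rewrite mulrC; apply: hsum_ext (hsumZ (t ^+ k) (hs k)) => J; ring.
Qed.

End Convolution.

(** * Expectations of real random variables *)

Section Expectation.
Context {R : realType} {disp : measure_display} {Omega : measurableType disp}.
Context (P : probability Omega R).
Implicit Types (f g : Omega -> R).

Definition intg f := P.-integrable setT (EFin \o f).
Definition Ex f : R := fine ('E_P[f])%E.

Lemma intg_meas f : intg f -> measurable_fun setT f.
Proof. by move=> /measurable_int/measurable_EFinP. Qed.

Lemma ExE f : intg f -> ('E_P[f] = (Ex f)%:E)%E.
Proof. by move=> h; rewrite /Ex fineK// unlock; exact: integrable_fin_num. Qed.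

Lemma intg_cst c : intg (fun=> c).
Proof. exact: finite_measure_integrable_cst. Qed.

Lemma intgD f g : intg f -> intg g -> intg (fun w => f w + g w).
Proof. by move=> hf hg; exact: (integrableD measurableT hf hg). Qed.

Lemma intgZ c f : intg f -> intg (fun w => c * f w).
Proof. by move=> hf; exact: (integrableZl measurableT c hf). Qed.

Lemma intgB f g : intg f -> intg g -> intg (fun w => f w - g w).
Proof.
move=> hf hg; have := intgD hf (intgZ (-1) hg); apply: eq_integrable => // w _ /=.
by rewrite mulN1r.
Qed.

Lemma intg_le f g : measurable_fun setT f -> (forall w, `|f w| <= g w) -> intg g -> intg f.
Proof.
move=> mf fg; apply: le_integrable => //; first exact/measurable_EFinP.
by move=> w _ /=; rewrite lee_fin (le_trans (fg w))// ler_norm.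
Qed.

Lemma intg_abs f : intg f -> intg (fun w => `|f w|).
Proof.
move=> hf; apply: (@le_integrable _ _ _ P setT measurableT _ (EFin \o f)) => //.
  by apply/measurable_EFinP; apply: measurableT_comp => //; exact: intg_meas.
by move=> w _ /=; rewrite normr_id.
Qed.

Lemma intg_sum (I : Type) (s : seq I) (f : I -> Omega -> R) : (forall i, intg (f i)) ->
  intg (fun w => \sum_(i <- s) f i w).
Proof.
move=> hf; elim: s => [|i s IH].
  by under eq_fun do rewrite big_nil; exact: intg_cst.
by under eq_fun do rewrite big_cons; exact: intgD.
Qed.

Lemma ExD f g : intg f -> intg g -> Ex (fun w => f w + g w) = Ex f + Ex g.
Proof.
move=> hf hg; apply: EFin_inj; rewrite EFinD -!ExE//; last exact: intgD.
by rewrite unlock -(integralD measurableT hf hg).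
Qed.

Lemma ExZ c f : intg f -> Ex (fun w => c * f w) = c * Ex f.
Proof.
move=> hf; apply: EFin_inj; rewrite EFinM -!ExE//; last exact: intgZ.
by rewrite unlock -(integralZl measurableT hf).
Qed.

Lemma ExB f g : intg f -> intg g -> Ex (fun w => f w - g w) = Ex f - Ex g.
Proof.
move=> hf hg; have := ExD hf (intgZ (-1) hg); rewrite ExZ// mulN1r => <-.
by congr Ex; apply/funext => w; rewrite mulN1r.
Qed.

Lemma Ex_cst c : Ex (fun=> c) = c.
Proof. by rewrite /Ex expectation_cst. Qed.

Lemma Ex_sum (I : Type) (s : seq I) (f : I -> Omega -> R) : (forall i, intg (f i)) ->
  Ex (fun w => \sum_(i <- s) f i w) = \sum_(i <- s) Ex (f i).
Proof.
move=> hf; elim: s => [|i s IH].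
  by rewrite big_nil -[RHS](Ex_cst 0); congr Ex; apply/funext => w; rewrite big_nil.
rewrite big_cons -IH -ExD//; last exact: intg_sum.
by congr Ex; apply/funext => w; rewrite big_cons.
Qed.

Lemma Ex_le f g : intg f -> intg g -> (forall w, f w <= g w) -> Ex f <= Ex g.
Proof.
move=> hf hg fg; rewrite -lee_fin -!ExE// unlock; apply: le_integral => //.
by move=> w _ /=; rewrite lee_fin.
Qed.

Lemma Ex_ge0 f : (forall w, 0 <= f w) -> 0 <= Ex f.
Proof. by move=> h; apply: fine_ge0; exact: expectation_ge0. Qed.

Lemma Ex_norm f : intg f -> `|Ex f| <= Ex (fun w => `|f w|).
Proof.
move=> hf; have ha := intg_abs hf; rewrite ler_norml; apply/andP; split.
  rewrite lerNl -mulN1r -ExZ//; apply: Ex_le => //; first exact: intgZ.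
  by move=> w; rewrite mulN1r lerNl; have := ler_norm (- f w); rewrite normrN; lra.
by apply: Ex_le => // w; exact: ler_norm.
Qed.

(** Dominated convergence for real random variables. *)
Lemma Ex_dct (f_ : nat -> Omega -> R) (F g : Omega -> R) : (forall n, measurable_fun setT (f_ n)) ->
  measurable_fun setT F -> {ae P, forall w, f_ n w @[n --> \oo] --> F w} ->
  {ae P, forall w, forall n, `|f_ n w| <= g w} -> intg g ->
  [/\ forall n, intg (f_ n), intg F, Ex (fun w => `|f_ n w - F w|) @[n --> \oo] --> 0 &
      Ex (f_ n) @[n --> \oo] --> Ex F].
Proof.
move=> mf mF cv bd ig.
have [] := @dominated_convergence _ _ _ P setT measurableT (fun n => EFin \o f_ n) (EFin \o F) (EFin \o g).
- by move=> n; exact/measurable_EFinP.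
- exact/measurable_EFinP.
- by apply: filterS cv => w h _; exact: cvg_EFin (nearW _ _) h.
- exact: ig.
- by apply: filterS bd => w h n _; rewrite /= lee_fin.
move=> iF c0 c1.
have i_ n : intg (f_ n).
  apply/integrableP; split; first exact/measurable_EFinP.
  have /integrableP[mg goo] := ig; apply: le_lt_trans goo.
  apply: ae_ge0_le_integral => //.
  - by apply/measurable_EFinP; apply: measurableT_comp.
  - exact: measurableT_comp.
  - by apply: filterS bd => w h _; rewrite /= lee_fin (le_trans (h n))// ler_norm.
split=> //.
- move/fine_cvgP: c0 => [_ c0]; apply: cvg_trans c0; apply: near_eq_cvg; apply: nearW => n /=.
  by rewrite /Ex unlock.
- have -> : Ex F = fine (\int[P]_w (F w)%:E)%E by rewrite /Ex unlock.
  have fF : (\int[P]_w (F w)%:E)%E \is a fin_num by exact: integrable_fin_num.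
  move: c1; rewrite -[X in _ --> X -> _](fineK fF) => /fine_cvgP[_ c1].
  by apply: cvg_trans c1; apply: near_eq_cvg; apply: nearW => n /=; rewrite /Ex unlock.
Qed.

Lemma hsum_box d (a : multi d -> R) v : hsum a v -> \sum_(I <- box n) a I @[n --> \oo] --> v.
Proof. exact: (hsum_exhaust (@box_exhaust d)). Qed.

Lemma hsum_measurable d (f : multi d -> Omega -> R) F : (forall I, measurable_fun setT (f I)) ->
  (forall w, hsum (f ^~ w) (F w)) -> measurable_fun setT F.
Proof.
move=> mf hF; apply: (@measurable_fun_cvg _ _ _ setT (fun n w => \sum_(I <- box n) f I w)).
  by move=> n; apply: measurable_sum.
by move=> w _; exact: hsum_box.
Qed.

(** Dominated convergence along boxes, the partial sums being dominated by g. *)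
Lemma Ex_hsum d (f : multi d -> Omega -> R) F g : (forall I, measurable_fun setT (f I)) ->
  (forall w, hsum (f ^~ w) (F w)) -> (forall w, absb (f ^~ w) (g w)) -> intg g ->
  [/\ forall I, intg (f I), intg F, absb (fun I => Ex (fun w => `|f I w|)) (Ex g) &
      hsum (fun I => Ex (f I)) (Ex F)].
Proof.
move=> mf hF hg ig.
have i_ I : intg (f I) by apply: intg_le ig => // w; exact: absb_le1 (hg w).
have mF := hsum_measurable mf hF.
have iF : intg F by apply: intg_le ig => // w; exact: hsum_norm_le (hg w) (hF w).
have ab : absb (fun I => Ex (fun w => `|f I w|)) (Ex g).
  move=> A; rewrite (eq_bigr (fun I => Ex (fun w => `|f I w|))); last first.
    by move=> I _; rewrite ger0_norm// Ex_ge0.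
  rewrite -(Ex_sum A (fun I => intg_abs (i_ I))); apply: Ex_le => //.
    by apply: intg_sum => I; exact: intg_abs.
  by move=> w; exact: hg.
split=> //; apply: (@exhaust_hsum _ _ _ (Ex g) _ (@box d) (@box_exhaust d)).
  apply: absb_le ab => I; rewrite [leRHS]ger0_norm ?Ex_ge0//; exact: Ex_norm.
have [|||||_ _ _] := @Ex_dct (fun n w => \sum_(I <- box n) f I w) F g.
- by move=> n; apply: measurable_sum.
- exact: mF.
- by apply: nearW => w; exact: hsum_box.
- apply: nearW => w n; apply: le_trans (hg w (box n)); exact: ler_norm_sum.
- exact: ig.
by under eq_fun do rewrite (Ex_sum _ i_).
Qed.

End Expectation.

(** * Exponential moments *)

Section Moments.
Context {R : realType} {disp : measure_display} {Omega : measurableType disp}.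
Context (P : probability Omega R) {d : nat} (T : R) (X : R -> Omega -> 'rV[R]_d).
Local Notation C := R[i].
Variables (Rad : 'I_d -> \bar R).
Variables (K dK : R -> R -> 'rV[C]_d -> 'rV[C]_d -> C) (B : R).
Hypothesis HX : process T X.
Hypothesis HK : log_mgf P T X Rad K dK B.
Hypothesis T0 : 0 < T.
Variable rho : 'I_d -> R.
Hypotheses (rho0 : forall i, 0 < rho i) (rhoR : forall i, ((rho i)%:E < Rad i)%E).
Local Notation intg := (intg P).
Local Notation Ex := (Ex P).

Definition dotabs (y : 'I_d -> R) (x : 'rV[R]_d) : R := \sum_i y i * `|x 0 i|.

Definition sgn (e : {ffun 'I_d -> bool}) (y : 'I_d -> R) (i : 'I_d) : R := if e i then y i else - y i.

(** The exponential of a weighted l^1 norm is at most the sum over all signs of the exponentials of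
    linear forms, to which the moment-generating function applies. *)
Lemma exp_dotabs_le (y : 'I_d -> R) (x : 'rV[R]_d) :
  exists e : {ffun 'I_d -> bool}, dotabs y x = \sum_i sgn e y i * x 0 i.
Proof.
exists [ffun i => 0 <= x 0 i]; apply: eq_bigr => i _; rewrite /sgn ffunE.
case: leP => h; first by rewrite ger0_norm.
by rewrite ltr0_norm// mulNr mulrN.
Qed.

Lemma meas_coord u i : 0 <= u <= T -> measurable_fun setT (fun w => X u w 0 i).
Proof. by move=> hu; exact: HX. Qed.

Lemma meas_dotabs u y : 0 <= u <= T -> measurable_fun setT (fun w => dotabs y (X u w)).
Proof.
move=> hu; apply: measurable_sum => i; apply: measurable_funM => //.
by apply: measurableT_comp => //; exact: meas_coord.
Qed.

Lemma meas_exp_dotabs u y : 0 <= u <= T -> measurable_fun setT (fun w => expR (dotabs y (X u w))).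
Proof. by move=> hu; apply: measurableT_comp => //; exact: meas_dotabs. Qed.

Lemma cpoly_sgn (y : 'I_d -> R) : (forall i, 0 <= y i <= rho i) -> forall e, cpoly rho (\row_k (sgn e y k)%:C).
Proof.
move=> hy e i; rewrite mxE normc_real /sgn; have /andP[y0 yr] := hy i.
by case: (e i); rewrite ?normrN ger0_norm.
Qed.

Lemma intg_exp2 u v (z w : 'I_d -> R) : 0 <= u <= T -> 0 <= v <= T ->
  cpoly rho (\row_k (z k)%:C) -> cpoly rho (\row_k (w k)%:C) ->
  intg (fun om => expR (\sum_i z i * X u om 0 i + \sum_i w i * X v om 0 i)).
Proof.
move=> hu hv hz hw; have [H _ _ _ _] := HK.1 u v hu hv.
have := H _ _ (cpolyD rhoR hz) (cpolyD rhoR hw); apply: eq_integrable => // om _ /=.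
by rewrite !cdot_real -rmorphD cexp_real normc_real ger0_norm ?expR_ge0.
Qed.

Lemma intg_exp_dotabs2 u v (y y' : 'I_d -> R) : 0 <= u <= T -> 0 <= v <= T ->
  (forall i, 0 <= y i <= rho i) -> (forall i, 0 <= y' i <= rho i) ->
  intg (fun w => expR (dotabs y (X u w) + dotabs y' (X v w))).
Proof.
move=> hu hv hy hy'.
pose E (p : {ffun 'I_d -> bool} * {ffun 'I_d -> bool}) w :=
  expR (\sum_i sgn p.1 y i * X u w 0 i + \sum_i sgn p.2 y' i * X v w 0 i).
have iE : intg (fun w => \sum_(p <- enum {: {ffun 'I_d -> bool} * {ffun 'I_d -> bool}}) E p w).
  by apply: intg_sum => p; apply: intg_exp2 => //; exact: cpoly_sgn.
apply: intg_le iE => [|w].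
  by apply: measurableT_comp => //; apply: measurable_funD; exact: meas_dotabs.
rewrite ger0_norm ?expR_ge0//.
have [e1 ->] := exp_dotabs_le y (X u w); have [e2 ->] := exp_dotabs_le y' (X v w).
rewrite big_enum /= (bigD1 (e1, e2))//= lerDl sumr_ge0// => p _; exact: expR_ge0.
Qed.

Lemma intg_exp_dotabs u (y : 'I_d -> R) : 0 <= u <= T ->
  (forall i, 0 <= y i <= rho i) -> intg (fun w => expR (dotabs y (X u w))).
Proof.
move=> hu hy; have r0 : forall i, 0 <= (0 : R) <= rho i by move=> i; rewrite lexx ltW.
have := intg_exp_dotabs2 hu hu hy r0; apply: eq_integrable => // w _ /=.
by rewrite [dotabs (fun=> 0) _]big1 ?addr0// => i _; rewrite mul0r.
Qed.

(** The moment-generating functions of X_u at the finitely many real points with coordinates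
    rho_i or - rho_i are exponentials of K_{0,u}(0, z), which differ from K_{0,0}(0, z) by at most
    B u. *)
Lemma exp_moment_bound : exists M, forall u, 0 <= u <= T ->
  Ex (fun w => expR (dotabs rho (X u w))) <= M.
Proof.
have h0 : 0 <= (0 : R) <= T by rewrite lexx ltW.
have [M hM] := K_bounded HK rhoR h0 h0.
pose S := enum {: {ffun 'I_d -> bool}}.
(* one summand for each choice of signs *)
exists (\sum_(e <- S) expR (M + B * T)) => u hu.
have ry i : 0 <= rho i <= rho i by rewrite lexx ltW.
pose E (e : {ffun 'I_d -> bool}) w := expR (\sum_i 0 * X 0 w 0 i + \sum_i sgn e rho i * X u w 0 i).
have z0 : \row_k ((fun=> 0 : R) k)%:C = 0 :> 'rV[C]_d by apply/rowP => k; rewrite !mxE.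
have iE e : intg (E e).
  by apply: intg_exp2 => //; [rewrite z0; exact: cpoly0|exact: cpoly_sgn].
apply: (@le_trans _ _ (Ex (fun w => \sum_(e <- S) E e w))).
  apply: Ex_le; [exact: intg_exp_dotabs|exact: intg_sum|].
  move=> w; have [e1 ->] := exp_dotabs_le rho (X u w).
  have -> : expR (\sum_i sgn e1 rho i * X u w 0 i) = E e1 w.
    by rewrite /E [X in X + _]big1 ?add0r// => i _; rewrite mul0r.
  by rewrite big_enum /= (bigD1 e1)//= lerDl sumr_ge0// => p _; exact: expR_ge0.
rewrite Ex_sum//; apply: ler_sum => e _.
have cz := cpoly_sgn ry e.
have c0 : cpoly rho 0 by exact: cpoly0.
have := K_cexp HK h0 hu (cpolyD rhoR c0) (cpolyD rhoR cz).
rewrite (cexpectation_real P (f := E e)); last first.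
  by move=> om; rewrite /E cdot_real -[X in cdot X]z0 cdot_real -rmorphD cexp_real.
move=> /(congr1 (@normc R)); rewrite normc_cexp normc_real ger0_norm; last first.
  by apply: Ex_ge0 => w; exact: expR_ge0.
rewrite -/(Ex _) => <-; rewrite ler_expR; apply: le_trans (ler_norm _) _; apply: le_trans (ler_Re _) _.
have -> : K 0 u 0 (\row_k (sgn e rho k)%:C) = K 0 0 0 (\row_k (sgn e rho k)%:C) +
   (K 0 u 0 (\row_k (sgn e rho k)%:C) - K 0 0 0 (\row_k (sgn e rho k)%:C)) by ring.
apply: le_trans (normcD _ _) _; apply: lerD; first exact: hM.
have /andP[u0 uT] := hu.
have := K_lip HK h0 hu (cpolyD rhoR c0) (cpolyD rhoR cz); rewrite subr0 ger0_norm// => h.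
apply: le_trans h _; rewrite ler_wpM2l//.
apply: le_trans (normc_ge0 _) (HK.2.2 0 0 0 0 h0 h0 _ _); exact: (cpolyD rhoR).
Qed.

End Moments.

Section MomentSeries.
Context {R : realType} {disp : measure_display} {Omega : measurableType disp}.
Context (P : probability Omega R) {d : nat}.
Local Notation intg := (intg P).
Local Notation Ex := (Ex P).
Variables (Z : Omega -> 'rV[R]_d) (Y : Omega -> R).
Hypothesis mZ : forall i, measurable_fun setT (fun w => Z w 0 i).
Hypothesis mY : measurable_fun setT Y.

Lemma meas_mono I : measurable_fun setT (fun w => mono (Z w 0) I).
Proof. by apply: measurable_prod => i _; exact: measurable_funX. Qed.

(** Moments weighted by a random variable Y; their exponential generating function is
    E[Y exp(x.Z)]. *)
Definition mom I := Ex (fun w => Y w * (mono (Z w 0) I / (mfact I)%:R)).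

Lemma mom_series (y : 'I_d -> R) : (forall i, 0 <= y i) ->
  intg (fun w => `|Y w| * expR (dotabs y (Z w))) ->
  absb (fun I => mom I * mono y I) (Ex (fun w => `|Y w| * expR (dotabs y (Z w)))) /\
  forall x : 'I_d -> R, (forall i, `|x i| <= y i) ->
    hsum (fun I => mom I * mono x I) (Ex (fun w => Y w * expR (\sum_i x i * Z w 0 i))).
Proof.
move=> y0 iY.
pose f (x : 'I_d -> R) (I : multi d) w := Y w * (mono (fun i => x i * Z w 0 i) I / (mfact I)%:R).
have mf x I : measurable_fun setT (f x I).
  apply: measurable_funM => //; apply: measurable_funM => //.
  by apply: measurable_prod => i _; apply: measurable_funX; exact: measurable_funM.
have fE x I : f x I = fun w => mono x I * (Y w * (mono (Z w 0) I / (mfact I)%:R)).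
  by apply/funext => w; rewrite /f monoM; ring.
have fs x w : hsum (f x ^~ w) (Y w * expR (\sum_i x i * Z w 0 i)) by exact/hsumZ/hsum_mexp.
have fa x w : (forall i, `|x i| <= y i) -> absb (f x ^~ w) (`|Y w| * expR (dotabs y (Z w))).
  move=> xy; apply: absb_weak (absbZ (Y w) (absb_mexp _)).
  rewrite ler_wpM2l// ler_expR; apply: ler_sum => i _; rewrite normrM.
  by rewrite ler_wpM2r.
have key x : (forall i, `|x i| <= y i) -> absb (fun I => mom I * mono x I) (Ex (fun w => `|Y w| * expR (dotabs y (Z w)))) /\
   hsum (fun I => mom I * mono x I) (Ex (fun w => Y w * expR (\sum_i x i * Z w 0 i))).
  move=> xy; have [i1 i2 i3 i4] := Ex_hsum (mf x) (fs x) (fun w => fa x w xy) iY.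
  have mE I : Ex (f x I) = mom I * mono x I.
    have [x0|x0] := eqVneq (mono x I) 0.
      by rewrite x0 mulr0 fE x0 -[RHS](Ex_cst P 0); congr Ex; apply/funext => w; rewrite mul0r.
    rewrite fE mulrC ExZ//; have := intgZ (mono x I)^-1 (i1 I); rewrite fE.
    by apply: eq_integrable => // w _ /=; rewrite mulKf.
  split; last by apply: hsum_ext i4 => I; rewrite mE.
  by apply: absb_le i3 => I; rewrite -mE [leRHS]ger0_norm ?Ex_ge0//; exact: Ex_norm.
split; last by move=> x xy; exact: (key x xy).2.
by apply: (key y _).1 => i; rewrite ger0_norm.
Qed.

End MomentSeries.

(** * Appell polynomials *)

Section Appell.
Context {R : realType} {disp : measure_display} {Omega : measurableType disp}.
Context (P : probability Omega R) {d : nat}.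
Local Notation C := R[i].

(** Two families of Appell coefficients have the same generating function near 0. *)
Lemma is_appell_uniq (Z : Omega -> 'rV[R]_d) (Y : Omega -> R) x y A A' :
  is_appell P Z Y x y A -> is_appell P Z Y x y A' -> A = A'.
Proof.
move=> [r1 r10 h1] [r2 r20 h2]; apply/funext => -[I n].
pose D (p : multi d * nat) := (A p - A' p) / ((mfact p.1 * p.2`!)%N)%:R.
have m0 : 0 < Num.min r1 r2 by rewrite lt_min r10.
have f0 : ((mfact I * n`!)%N)%:R != 0 :> R.
  by rewrite pnatr_eq0 -lt0n muln_gt0 mfact_gt0 fact_gt0.
suff /eqP : D (I, n) = 0.
  by rewrite /D mulf_eq0 invr_eq0 (negbTE f0) orbF subr_eq0 => /eqP.
apply: (pair_series_uniq m0) => z t hz ht.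
pose zc : 'rV[C]_d := \row_k (z k)%:C.
have nz i : normc (zc 0 i) < Num.min r1 r2.
  by rewrite mxE normc_real gtr0_norm; case/andP: (hz i).
have nt : normc t%:C < Num.min r1 r2 by rewrite normc_real gtr0_norm; case/andP: ht.
have k1 : forall i, normc (zc 0 i) < r1 by move=> i; have := nz i; rewrite lt_min => /andP[].
have k2 : forall i, normc (zc 0 i) < r2 by move=> i; have := nz i; rewrite lt_min => /andP[].
move: nt; rewrite lt_min => /andP[t1 t2].
have s1 := (chsum_is_sum _ _).1 (h1 zc t%:C k1 t1).
have s2 := (chsum_is_sum _ _).1 (h2 zc t%:C k2 t2).
have := (chsumB s1 s2).1; rewrite subrr; apply: hsum_ext => -[J k] /=.
have -> : mpow zc J = (mono z J)%:C.
  by rewrite mpowE -mono_real; congr mono; apply/funext => i; rewrite mxE.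
have nE (q : nat) : (q%:R : C) = (q%:R : R)%:C by rewrite rmorph_nat.
by rewrite nE -rmorphXn -!rmorphM -fmorphV -!rmorphM -rmorphB /D /=; ring.
Qed.

Lemma appellE (Z : Omega -> 'rV[R]_d) (Y : Omega -> R) x y A :
  is_appell P Z Y x y A -> forall I n, appell P Z Y x y I n = A (I, n).
Proof.
move=> hA I n; rewrite /appell; congr (_ (I, n)); apply: xget_unique => // A' hA'.
exact: is_appell_uniq hA' hA.
Qed.

End Appell.

Section AppellSeries.
Context {R : realType} {disp : measure_display} {Omega : measurableType disp}.
Context (P : probability Omega R) {d : nat} (T : R) (X : R -> Omega -> 'rV[R]_d).
Local Notation C := R[i].
Variables (Rad : 'I_d -> \bar R).
Variables (K dK : R -> R -> 'rV[C]_d -> 'rV[C]_d -> C) (B : R).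
Hypothesis HK : log_mgf P T X Rad K dK B.
Hypothesis T0 : 0 < T.
Variables rho rp : 'I_d -> R.
Hypotheses (rp0 : forall i, 0 < rp i) (rpr : forall i, rp i < rho i).
Hypotheses (rhoR : forall i, ((rho i)%:E < Rad i)%E).
Variables (u v : R) (j : 'I_d).
Hypotheses (hu : 0 <= u <= T) (hv : 0 <= v <= T).

Let rho0 i : 0 < rho i. Proof. exact: lt_trans (rpr i). Qed.
Let sg := rho j - rp j.
Let sg0 : 0 < sg. Proof. by rewrite /sg subr_gt0. Qed.

Lemma cdiff_affine (a b : C) z : cdiff (fun t => a + t * b) z b.
Proof.
move=> e e0; exists 1 => // h _.
have -> : a + (z + h) * b - (a + z * b) - b * h = 0 by ring.
by rewrite (normc_real (0 : R)) normr0 mulr_ge0 ?normc_ge0// ltW.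
Qed.

Lemma diff_affine (a b z : C) : differentiable (fun t : C => a + t * b) z.
Proof. by apply/cdiffP; exists b; exact: cdiff_affine. Qed.

Lemma cpoly_diag xi eta : in_polydisc rp xi -> normc eta <= sg -> cpoly rho (\row_k xi k - axis j eta).
Proof.
move=> hx he i; rewrite !mxE eqxx /=; have hi := hx i; have ri := rpr i.
case: eqP => [->|_]; last by rewrite mulr0 subr0 ltW// (lt_trans hi).
rewrite mulr1; apply: le_trans (normcB _ _) _; have := hx j; rewrite /sg in he; lra.
Qed.

Lemma cpoly_diag_axis eta : normc eta <= sg -> cpoly rho (axis j eta).
Proof.
move=> he; apply: cpoly_axis => //; apply: le_trans he _.
by rewrite /sg gerBl ltW.
Qed.

Variables (x : 'rV[R]_d) (y : R).

(** The exponent of the generating function of the Appell polynomials of (X_u, X^j_v - X^j_u): the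
    variables of K are arranged so that z.X_u + w.X_v = xi.X_u + eta (X^j_v - X^j_u). *)
Definition appell_log (eta : C) (xi : 'I_d -> C) : C :=
  cdot (\row_k xi k) x + eta * y%:C - K u v (\row_k xi k - axis j eta) (axis j eta).

Lemma appell_exp_holo : sepholo_param sg rp (fun eta xi => cexp (appell_log eta xi)).
Proof.
pose VV := ('rV[C]_d * 'rV[C]_d)%type.
split=> [t z ht hz|t ht z hz i].
  apply: (@differentiable_comp _ _ _ _ (fun t : C => appell_log t z) (@cexp R)); last exact: differentiable_cexp.
  apply: differentiableB; first exact: diff_affine.
  have -> : (fun t : C => K u v (\row_k z k - axis j t) (axis j t)) =
      (fun t : C => (fun zw : VV => K u v zw.1 zw.2) ((\row_k z k, 0) + t *: (- delta_mx 0 j, delta_mx 0 j))).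
    by apply/funext => a /=; rewrite /axis scalerN add0r.
  apply: (@diff_line R VV (fun zw => K u v zw.1 zw.2) (\row_k z k, 0) (- delta_mx 0 j, delta_mx 0 j) t).
  rewrite -[X in differentiable _ X]/(_ + _ *: _, _ + _ *: _) scalerN add0r.
  apply: (K_diff HK) => //; apply: (cpolyD rhoR).
    by apply: cpoly_diag => //; exact: ltW.
  by apply: cpoly_diag_axis; exact: ltW.
apply: (@differentiable_comp _ _ _ _ (fun a : C => appell_log t (upd z i a)) (@cexp R)); last exact: differentiable_cexp.
apply: differentiableB.
  have -> : (fun a : C => cdot (\row_k upd z i a k) x + t * y%:C) =
      (fun a : C => (cdot (\row_k upd z i 0 k) x + t * y%:C) + a * (x 0 i)%:C).
    apply/funext => a; rewrite row_upd_line cdotDl -[a *: _]/(axis i a) cdot_axis.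
    by rewrite -!addrA [t * _ + _]addrC.
  exact: diff_affine.
have -> : (fun a : C => K u v (\row_k upd z i a k - axis j t) (axis j t)) =
    (fun a : C => (fun zw : VV => K u v zw.1 zw.2) ((\row_k upd z i 0 k - axis j t, axis j t) + a *: (delta_mx 0 i, 0))).
  by apply/funext => a /=; rewrite scaler0 addr0 row_upd_line addrAC.
apply: (@diff_line R VV (fun zw => K u v zw.1 zw.2) (\row_k upd z i 0 k - axis j t, axis j t) (delta_mx 0 i, 0) (z i)).
rewrite -[X in differentiable _ X]/(_ + _ *: _, _ + _ *: _) scaler0 addr0 addrAC -row_upd_line upd_id.
apply: (K_diff HK) => //; apply: (cpolyD rhoR).
  by apply: cpoly_diag => //; exact: ltW.
by apply: cpoly_diag_axis; exact: ltW.
Qed.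

Lemma appell_log_bound : exists M, forall t z, normc t < sg -> in_polydisc rp z -> normc (cexp (appell_log t z)) <= M.
Proof.
have [M hM] := K_bounded HK rhoR hu hv.
exists (expR (\sum_i rp i * `|x 0 i| + sg * `|y| + M)) => t z ht hz.
rewrite normc_cexp ler_expR; apply: le_trans (ler_norm _) _; apply: le_trans (ler_Re _) _.
apply: le_trans (normcB _ _) _; apply: lerD; last first.
  by apply: hM; [apply: cpoly_diag => //; exact: ltW|apply: cpoly_diag_axis; exact: ltW].
apply: le_trans (normcD _ _) _; apply: lerD.
  apply: le_trans (normc_sum _ _ _) _; apply: ler_sum => i _.
  by rewrite normcM normc_real mxE ler_wpM2r// ltW.
by rewrite normcM normc_real ler_wpM2r// ltW.
Qed.

Lemma appell_logE t z : normc t < sg -> in_polydisc rp z -> cexp (appell_log t z) =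
  cexp (cdot (\row_k z k) x + t * y%:C) /
  cexpectation P (fun w => cexp (cdot (\row_k z k) (X u w) + t * (X v w 0 j - X u w 0 j)%:C)).
Proof.
move=> ht hz; rewrite /appell_log [LHS]cexpD cexpN (K_cexp HK hu hv); last 2 first.
- by apply: (cpolyD rhoR); apply: cpoly_diag => //; exact: ltW.
- by apply: (cpolyD rhoR); apply: cpoly_diag_axis; exact: ltW.
congr (_ / cexpectation P _); apply/funext => om; congr cexp.
rewrite cdotDl !cdot_axis.
have -> : cdot (- axis j t) (X u om) = - (t * (X u om 0 j)%:C).
  by rewrite -cdot_axis /cdot -sumrN; apply: eq_bigr => i _; rewrite !mxE mulNr.
by rewrite rmorphB /=; ring.
Qed.

Local Notation Ex := (Ex P).

Lemma appell_log_real (t : R) (z : 'I_d -> R) : `|t| < sg -> in_polydisc rp (fun k => (z k)%:C) ->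
  cexp (appell_log t%:C (fun k => (z k)%:C)) = (expR (\sum_i z i * x 0 i + t * y) /
    Ex (fun w => expR (\sum_i z i * X u w 0 i + t * (X v w 0 j - X u w 0 j))))%:C.
Proof.
move=> ht hz; rewrite appell_logE ?normc_real//.
rewrite cdot_real -rmorphM -rmorphD cexp_real.
rewrite (cexpectation_real P (f := fun w => expR (\sum_i z i * X u w 0 i + t * (X v w 0 j - X u w 0 j)))).
  by rewrite -fmorphV -rmorphM.
by move=> om; rewrite cdot_real -rmorphM -rmorphD cexp_real.
Qed.

(** The coefficients of order 0 and 1 in eta are those of e^{xi.x} / M(xi) and of
    (e^{xi.x} / M(xi)) (y - phi(xi)), M(xi) being E exp(xi.X_u). The second is the derivative in eta
    of the exponential of [appell_log], computed with [diag_deriv]. *)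
Lemma appell_spec : exists (al be : multi d -> R) (A : multi d * nat -> R) (M : R),
  [/\ is_appell P (X u) (fun w => X v w 0 j - X u w 0 j) x y A,
      forall I, A (I, 0%N) = (mfact I)%:R * al I,
      forall I, A (I, 1%N) = (mfact I)%:R * be I &
      [/\ forall I, `|al I| <= M / mono rp I, forall I, `|be I| <= M / mono rp I &
      forall z : 'I_d -> R, (forall i, 0 < z i < rp i) ->
        let s := expR (\sum_i z i * x 0 i) / Ex (fun w => expR (\sum_i z i * X u w 0 i)) in
        [/\ hsum (fun I => al I * mono z I) s &
           forall phi, hsum (fun I => cum_incr K rho j u v I * mono z I) phi ->
             hsum (fun I => be I * mono z I) (s * (y - phi))]]].
Proof.
have [M hM] := appell_log_bound; have [g1 g2] := appell_exp_holo.
pose H eta xi := cexp (appell_log eta xi).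
have [c [cb ch cs]] := expand_parameter sg0 rp0 g1 g2 hM.
have exn n := cauchy_polydisc rp0 (ch n) (cb n).
have [cc hcc] := choice exn.
have M0 : 0 <= M.
  have z0 : in_polydisc rp (fun=> 0) by move=> i; rewrite (normc_real (0 : R)) normr0.
  have t0 : normc (0 : C) < sg by rewrite (normc_real (0 : R)) normr0.
  exact: le_trans (normc_ge0 _) (hM _ _ t0 z0).
(* the coefficients of order 0 and 1 are the value and the derivative at eta = 0 *)
have c0E z : in_polydisc rp z -> c 0%N z = H 0 z.
  move=> hz; have t0 : normc (0 : C) < sg by rewrite (normc_real (0 : R)) normr0.
  have S := cs 0 z t0 hz.
  have S' : chsum (fun n => if n == 0%N then c 0%N z else 0) (c 0%N z).
    by split; [have := hsum1 0%N (complex.Re (c 0%N z))|have := hsum1 0%N (complex.Im (c 0%N z))];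
      apply: hsum_ext => n; case: eqP.
  apply: chsum_uniq S' _; apply: chsum_ext S => -[|n] /=; first by rewrite expr0 mulr1.
  by rewrite expr0n mulr0.
have c1E z : in_polydisc rp z -> cdiff (H ^~ z) 0 (c 1%N z).
  move=> hz; apply: (cdiff_series (c := c ^~ z) (M := M) sg0) => [n|a ha]; first exact: cb.
  exact: cs.
have small := @small_rho _ _ rp rp0.
(* the coefficients are real because the generating function is real at real points *)
have re n I : complex.Im (cc n I) = 0.
  have [m m0 mr] := small.
  apply: (@mseries_uniq _ _ (fun I => complex.Im (cc n I)) m m0 _ I) => z hz.
  have hzc : in_polydisc rp (fun i => (z i)%:C).
    by move=> i; have /andP[z0 zm] := hz i; rewrite normc_real gtr0_norm// (lt_le_trans zm).
  have imc : complex.Im (c n (fun i => (z i)%:C)) = 0.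
    apply: (@pseries_uniq1 _ (fun n => complex.Im (c n (fun i => (z i)%:C))) sg sg0) => t ht.
    have htc : `|t| < sg by rewrite gtr0_norm; case/andP: ht.
    have := (cs t%:C _ (_ : normc t%:C < sg) hzc).2; rewrite normc_real => /(_ htc).
    rewrite appell_log_real//=; apply: hsum_ext => k.
    by rewrite -rmorphXn mulrC ImZ mulrC.
  have := ((hcc n).2 _ hzc).2; rewrite imc; apply: hsum_ext => J.
  by rewrite mono_real [cc n J * _]mulrC ImZ mulrC.
have ccE n I : cc n I = (complex.Re (cc n I))%:C by apply: complex_ext => //=; exact: re.
pose A (p : multi d * nat) : R := complex.Re (cc p.2 p.1) * ((mfact p.1 * p.2`!)%N)%:R.
have bnd n I : `|complex.Re (cc n I)| <= (M / sg ^+ n) / mono rp I.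
  by apply: le_trans (ler_Re _) _; exact: (hcc n).1.
exists (fun I => complex.Re (cc 0%N I)), (fun I => complex.Re (cc 1%N I)), A, (M + M / sg).
have q0 : 0 <= M / sg by rewrite divr_ge0// ltW.
split.
- have [m m0 mr] := small; exists (Num.min m sg); first by rewrite lt_min m0.
  move=> xi eta hxi; rewrite lt_min => /andP[_ he].
  have hz : in_polydisc rp (fun k => xi 0 k).
    by move=> i; have := hxi i; rewrite lt_min => /andP[h _]; exact: lt_le_trans h (mr i).
  have xiE : \row_k xi 0 k = xi by apply/rowP => k; rewrite mxE.
  apply/chsum_is_sum.
  have := appell_logE he hz; rewrite xiE => <-.
  pose a (p : nat * multi d) := cc p.1 p.2 * (mono (fun k => xi 0 k) p.2 * eta ^+ p.1).
  have ca : cabsb a (M * ((\prod_i (1 - normc (xi 0 i) / rp i)^-1) * (1 - normc eta / sg)^-1)).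
    apply: (@cabsb_le _ _ _ (fun p => M * ((normc eta / sg) ^+ p.1 * mono (fun i => normc (xi 0 i) / rp i) p.2))).
      move=> [n I] /=; rewrite normcM normcM normcX normc_mono.
      have := le_trans (_ : normc (cc n I) <= _) (lexx (M / sg ^+ n / mono rp I)).
      move/(_ ((hcc n).1 I)) => h.
      have n0 : 0 <= mono (fun i => normc (xi 0 i)) I * normc eta ^+ n.
        by rewrite mulr_ge0 ?exprn_ge0 ?normc_ge0// mono_ge0// => i; exact: normc_ge0.
      apply: le_trans (ler_wpM2r n0 h) _.
      have -> : mono (fun i => normc (xi 0 i) / rp i) I = mono (fun i => normc (xi 0 i)) I / mono rp I.
        by rewrite -monoV -monoM.
      by rewrite expr_div_n le_eqVlt; apply/orP; left; apply/eqP; ring.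
    rewrite -{2}(ger0_norm M0); apply: absbZ; apply: absb_mul.
      by apply: nat_geom_absb; rewrite divr_ge0 ?normc_ge0 ?(ltW sg0)//= ltr_pdivrMr// mul1r.
    by apply: absb_geom => i; rewrite divr_ge0 ?normc_ge0 ?(ltW (rp0 i))//= ltr_pdivrMr// mul1r; exact: hz.
  have [w hw] := cabsb_chsum ca.
  have rows n : chsum (fun I => a (n, I)) (c n (fun k => xi 0 k) * eta ^+ n).
    rewrite mulrC; apply: chsum_ext (chsumZ (eta ^+ n) ((hcc n).2 _ hz)) => I; rewrite /a /=; ring.
  have wE : w = H eta (fun k => xi 0 k).
    apply: (@chsum_uniq _ _ (fun n => c n (fun k => xi 0 k) * eta ^+ n)); last exact: cs.
    by split; [apply: (hsum_pair hw.1) => n; exact: (rows n).1|apply: (hsum_pair hw.2) => n; exact: (rows n).2].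
  rewrite -/(H _ _) -wE.
  have sw : chsum (fun p : multi d * nat => a (p.2, p.1)) w.
    by split; [exact: (hsum_swap hw.1)|exact: (hsum_swap hw.2)].
  apply: chsum_ext sw => -[I n]; rewrite /a /A /= mpowE [in LHS]ccE.
  have nE (q : nat) : (q%:R : C) = (q%:R : R)%:C by rewrite rmorph_nat.
  have fn0 : ((mfact I * n`!)%N)%:R != 0 :> C.
    by rewrite pnatr_eq0 -lt0n muln_gt0 mfact_gt0 fact_gt0.
  by rewrite rmorphM /= -nE [X in _ = X / _]mulrAC mulfK.
- by move=> I; rewrite /A /= fact0 muln1 mulrC.
- by move=> I; rewrite /A /= factS fact0 !muln1 mulrC.
split=> [I|I|z hz].
- apply: le_trans (bnd 0%N I) _; rewrite expr0 divr1 ler_wpM2r ?invr_ge0 ?lerDl//.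
  by apply: mono_ge0 => i; exact: ltW.
- apply: le_trans (bnd 1%N I) _; rewrite expr1 ler_wpM2r ?invr_ge0 ?lerDr//.
  by apply: mono_ge0 => i; exact: ltW.
have hzc : in_polydisc rp (fun i => (z i)%:C).
  by move=> i; have /andP[z0 zm] := hz i; rewrite normc_real gtr0_norm.
set s := _ / _.
have HE : H 0 (fun i => (z i)%:C) = s%:C.
  rewrite /H (_ : (0 : C) = (0 : R)%:C)// appell_log_real ?normr0// mul0r addr0 /s.
  by congr ((_ / Ex _)%:C); apply/funext => w; rewrite mul0r addr0.
split.
  have := ((hcc 0%N).2 _ hzc).1; rewrite c0E// HE; apply: hsum_ext => I.
  by rewrite mono_real [cc 0%N I * _]mulrC ReZ mulrC.
move=> phi hphi.
have hzr : in_polydisc rho (fun i => (z i)%:C) by move=> i; exact: lt_trans (hzc i) (rpr i).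
have [ph s1 d1] := diag_deriv HK rho0 rhoR j hu hv hzr.
have phE : ph = phi%:C.
  apply: complex_ext => /=; last exact: (diag_real HK rho0 rhoR hu hv hzr d1).
  apply: hsum_uniq hphi; apply: hsum_ext s1.1 => I.
  by rewrite mono_real [kcoef _ _ _ _ _ I * _]mulrC ReZ mulrC.
have d2 : cdiff (appell_log ^~ (fun i => (z i)%:C)) 0 (y%:C + (-1) * ph).
  apply: cdiff_ext ltr01 _ (cdiffD (cdiff_affine (cdot (\row_k (z k)%:C) x) y%:C 0) (cdiffZ (-1) d1)) => h _.
  by rewrite /appell_log mulN1r.
have d3 := cdiff_comp d2 (cexp_diff _).
have E : c 1%N (fun i => (z i)%:C) = (s * (y - phi))%:C.
  rewrite (cdiff_unique (c1E _ hzc) d3) -/(H 0 _) HE phE.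
  by rewrite mulN1r -rmorphB -rmorphM.
have := ((hcc 1%N).2 _ hzc).1; rewrite E; apply: hsum_ext => I.
by rewrite mono_real [cc 1%N I * _]mulrC ReZ mulrC.
Qed.

End AppellSeries.

(** * The Wick product with an increment *)

Section WickFormula.
Context {R : realType} {disp : measure_display} {Omega : measurableType disp}.
Context (P : probability Omega R) {d : nat} (T : R) (X : R -> Omega -> 'rV[R]_d).
Local Notation C := R[i].
Variables (Rad : 'I_d -> \bar R).
Variables (K dK : R -> R -> 'rV[C]_d -> 'rV[C]_d -> C) (B : R).
Hypothesis HX : process T X.
Hypothesis HK : log_mgf P T X Rad K dK B.
Hypothesis T0 : 0 < T.
Variables rho rp r : 'I_d -> R.
Hypotheses (r0 : forall i, 0 < r i) (rrp : forall i, r i < rp i) (rpr : forall i, rp i < rho i).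
Hypotheses (rhoR : forall i, ((rho i)%:E < Rad i)%E).
Local Notation intg := (intg P).
Local Notation Ex := (Ex P).

(** h is entire of exponential type, with derivatives b at 0. *)
Definition exp_series (b : multi d -> R) (Ch : R) (h : 'rV[R]_d -> R) :=
  [/\ 0 <= Ch, forall I, `|b I| <= Ch * mono r I &
      forall (J : multi d) (x : 'rV[R]_d),
        hsum (fun I : multi d => b (I + J) * (mono (x 0) I / (mfact I)%:R)) (mpartial J h x)].

Variables (b : multi d -> R) (Ch : R) (h : 'rV[R]_d -> R).
Hypothesis hh : exp_series b Ch h.

Let rp0 i : 0 < rp i. Proof. exact: lt_trans (rrp i). Qed.
Let rho0 i : 0 < rho i. Proof. exact: lt_trans (rpr i). Qed.

Lemma mpartial0 (g : 'rV[R]_d -> R) : mpartial 0 g = g.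
Proof. by rewrite /mpartial; elim: (enum _) => //= i s ->; rewrite ffunE. Qed.

Lemma exp_series_absb (J : multi d) (x : 'rV[R]_d) :
  absb (fun I : multi d => b (I + J) * (mono (x 0) I / (mfact I)%:R)) (Ch * mono r J * expR (dotabs r x)).
Proof.
have [C0 hb _] := hh.
have A := absbZ (Ch * mono r J) (absb_mexp (fun i => r i * x 0 i)).
have mJ : 0 <= Ch * mono r J by rewrite mulr_ge0// mono_ge0// => i; exact: ltW.
rewrite (ger0_norm mJ) in A.
have E : \sum_i `|r i * x 0 i| = dotabs r x.
  by apply: eq_bigr => i _; rewrite normrM gtr0_norm.
rewrite E in A; apply: absb_le A => I.
have f0 : 0 <= (mfact I)%:R^-1 :> R by rewrite invr_ge0.
rewrite monoM !normrM (ger0_norm f0) mulrA [leRHS]mulrA ler_wpM2r// mulrA ler_wpM2r//.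
rewrite (ger0_norm C0) (ger0_norm (mono_ge0 _ (fun i => ltW (r0 i)))).
rewrite (ger0_norm (mono_ge0 _ (fun i => ltW (r0 i)))).
have -> : Ch * mono r J * mono r I = Ch * mono r (I + J) by rewrite monoD; ring.
exact: hb.
Qed.

Lemma mpartial_bound J (x : 'rV[R]_d) : `|mpartial J h x| <= Ch * mono r J * expR (dotabs r x).
Proof. by have [_ _ H] := hh; exact: hsum_norm_le (exp_series_absb J x) (H J x). Qed.

Lemma meas_mpartial J u : 0 <= u <= T -> measurable_fun setT (fun w => mpartial J h (X u w)).
Proof.
move=> hu; have [_ _ H] := hh.
apply: (hsum_measurable (f := fun I w => b (I + J) * (mono (X u w 0) I / (mfact I)%:R))) => [I|w]; last exact: H.
apply: measurable_funM => //; apply: measurable_funM => //.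
by apply: meas_mono => i; exact: HX.
Qed.

Let rle i : 0 <= r i <= rho i. Proof. by rewrite ltW//= ltW// (lt_trans (rrp i)). Qed.

Lemma intg_mpartial J u : 0 <= u <= T -> intg (fun w => mpartial J h (X u w)).
Proof.
move=> hu; apply: (@intg_le _ _ _ _ _ (fun w => Ch * mono r J * expR (dotabs r (X u w)))).
- exact: meas_mpartial.
- by move=> w; exact: mpartial_bound.
- by apply: intgZ; apply: (intg_exp_dotabs HX HK rho0 rhoR).
Qed.

Section Fixed.
Variables (u v : R) (j : 'I_d).
Hypotheses (hu : 0 <= u <= T) (hv : 0 <= v <= T).

Let mZ i : measurable_fun setT (fun w => X u w 0 i). Proof. exact: HX. Qed.
Definition incr w := X v w 0 j - X u w 0 j.
Lemma meas_incr : measurable_fun setT incr.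
Proof. by apply: measurable_funB; exact: HX. Qed.

Definition mom1 := mom P (X u) (fun=> 1).
Definition incr_mom := mom P (X u) incr.
(** The coefficients a_J of the expansion of h in Appell polynomials. *)
Definition mean_deriv J := Ex (fun w => mpartial J h (X u w)).

Lemma intg_one : intg (fun w => `|(fun=> 1 : R) w| * expR (dotabs rho (X u w))).
Proof.
have := intg_exp_dotabs HX HK rho0 rhoR hu (y := rho) (fun i => introT andP (conj (ltW (rho0 i)) (lexx _))).
by apply: eq_integrable => // w _ /=; rewrite normr1 mul1r.
Qed.

(** The gap between rp and rho leaves room for the linear factor: |Y| is at most a multiple of the
    exponential of (rho j - rp j) (|X^j_u| + |X^j_v|). *)
Lemma intg_incr : intg (fun w => `|incr w| * expR (dotabs rp (X u w))).
Proof.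
pose de := rho j - rp j; have de0 : 0 < de by rewrite subr_gt0.
pose y i := if i == j then rho j else rp i.
pose y' (i : 'I_d) := if i == j then de else 0.
have hy i : 0 <= y i <= rho i.
  by rewrite /y; case: eqP => [->|_]; rewrite ltW//= ltW.
have hy' i : 0 <= y' i <= rho i.
  rewrite /y'; case: eqP => [->|_]; rewrite ?lexx ltW//=; by rewrite /de gerBl ltW.
have := intgZ (2 / de) (intg_exp_dotabs2 HX HK rhoR hu hv hy hy').
apply: intg_le.
  apply: measurable_funM; first by apply: measurableT_comp => //; exact: meas_incr.
  exact: (meas_exp_dotabs HX).
move=> w; rewrite normrM normr_id [ `|expR _|]ger0_norm ?expR_ge0//.
have D1 : dotabs y (X u w) = de * `|X u w 0 j| + dotabs rp (X u w).
  rewrite /dotabs (bigD1 j)//= [in RHS](bigD1 j)//= /y eqxx addrA -mulrDl /de subrK.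
  by congr (_ + _); apply: eq_bigr => i /negbTE ->.
have D2 : dotabs y' (X v w) = de * `|X v w 0 j|.
  by rewrite /dotabs (bigD1 j)//= /y' eqxx big1 ?addr0// => i /negbTE ->; rewrite mul0r.
rewrite D1 D2; set a := `|X u w 0 j|; set c := `|X v w 0 j|; set D := dotabs rp _.
have a0 : 0 <= a by exact: normr_ge0.
have c0 : 0 <= c by exact: normr_ge0.
have Y1 : `|incr w| <= c + a by exact: ler_normB.
have E : de * a + D + de * c = de * (c + a) + D by ring.
rewrite E expRD mulrA ler_wpM2r ?expR_ge0//; apply: le_trans Y1 _.
have h1 : de * (c + a) <= expR (de * (c + a)) by apply: le_trans (expR_ge1Dx _); rewrite lerDr.
rewrite mulrAC ler_pdivlMr//; apply: le_trans (_ : expR (de * (c + a)) <= _); first by rewrite mulrC.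
by rewrite ler_peMl ?expR_ge0// ler1n.
Qed.

Lemma mom1_series : absb (fun I => mom1 I * mono rho I) (Ex (fun w => `|(fun=> 1 : R) w| * expR (dotabs rho (X u w)))) /\
  forall x : 'I_d -> R, (forall i, `|x i| <= rho i) ->
   hsum (fun I => mom1 I * mono x I) (Ex (fun w => expR (\sum_i x i * X u w 0 i))).
Proof.
have [h1 h2] := mom_series mZ (measurable_cst _) (fun i => ltW (rho0 i)) intg_one; split => // x hx.
have := h2 x hx; have -> // : (fun w => cst 1 w * expR (\sum_i x i * X u w 0 i)) = (fun w => expR (\sum_i x i * X u w 0 i)).
by apply/funext => w; rewrite mul1r.
Qed.

Lemma incr_mom_series : absb (fun I => incr_mom I * mono rp I) (Ex (fun w => `|incr w| * expR (dotabs rp (X u w)))) /\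
  forall x : 'I_d -> R, (forall i, `|x i| <= rp i) ->
   hsum (fun I => incr_mom I * mono x I) (Ex (fun w => incr w * expR (\sum_i x i * X u w 0 i))).
Proof. exact: (mom_series mZ meas_incr (fun i => ltW (rp0 i)) intg_incr). Qed.

Lemma mean_deriv_series J : hsum (fun I => b (I + J) * mom1 I) (mean_deriv J).
Proof.
have [_ _ H] := hh.
have := Ex_hsum (P := P) (f := fun I w => b (I + J) * (mono (X u w 0) I / (mfact I)%:R))
   (F := fun w => mpartial J h (X u w)) (g := fun w => Ch * mono r J * expR (dotabs r (X u w))).
case.
- move=> I; apply: measurable_funM => //; apply: measurable_funM => //; exact: meas_mono.
- by move=> w; exact: H.
- by move=> w; exact: exp_series_absb.
- by apply: intgZ; apply: (intg_exp_dotabs HX HK rho0 rhoR).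
move=> i1 _ _; apply: hsum_ext => I; rewrite /mom1 /mom.
have [b0|b0] := eqVneq (b (I + J)) 0.
  by rewrite b0 mul0r -[RHS](Ex_cst P 0); congr Ex; apply/funext => w; rewrite mul0r.
rewrite ExZ; first by congr (_ * Ex _); apply/funext => w; rewrite mul1r.
have := intgZ (b (I + J))^-1 (i1 I); apply: eq_integrable => // w _ /=.
by rewrite mulKf.
Qed.

Lemma mean_deriv_bound J : `|mean_deriv J| <= Ch * mono r J * Ex (fun w => expR (dotabs rho (X u w))).
Proof.
have [C0 _ _] := hh.
have rh i : 0 <= rho i <= rho i by rewrite ltW//=.
have i2 := intg_exp_dotabs HX HK rho0 rhoR hu rh.
have m0 : 0 <= Ch * mono r J by rewrite mulr_ge0// mono_ge0// => i; exact: ltW.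
apply: le_trans (Ex_norm (intg_mpartial J hu)) _; rewrite -ExZ//; apply: Ex_le.
- exact: intg_abs (intg_mpartial J hu).
- exact: intgZ.
move=> w; apply: le_trans (mpartial_bound J _) _; rewrite ler_wpM2l// ler_expR.
by apply: ler_sum => i _; rewrite ler_wpM2r//; case/andP: (rle i).
Qed.

Lemma geom_absb (c : multi d -> R) M (y : 'I_d -> R) : (forall I, `|c I| <= M / mono rp I) ->
  (forall i, 0 <= y i < rp i) -> exists N, absb (fun I => c I * mono y I) N.
Proof.
move=> hc hy; have M0 : 0 <= M by have := le_trans (normr_ge0 _) (hc 0); rewrite mono0 divr1.
have y0 i : 0 <= y i by case/andP: (hy i).
have G : forall i, 0 <= y i / rp i < 1.
  move=> i; rewrite divr_ge0 ?(ltW (rp0 i))//= ltr_pdivrMr// mul1r; by case/andP: (hy i).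
exists (`|M| * \prod_i (1 - y i / rp i)^-1); apply: absb_le (absbZ M (absb_geom G)) => I.
rewrite monoM (monoV rp I) [leRHS]ger0_norm; last first.
  by rewrite mulr_ge0// mulr_ge0 ?invr_ge0// mono_ge0// => i; exact: ltW.
rewrite normrM (ger0_norm (mono_ge0 _ y0)) [leRHS]mulrCA mulrC ler_wpM2l//; exact: mono_ge0.
Qed.

Lemma coef_absb (c : multi d -> R) M : (forall I, `|c I| <= M / mono rp I) ->
  exists N, absb (fun I => c I * mono r I) N.
Proof. by move=> hc; apply: geom_absb hc _ => i; rewrite ltW//=. Qed.

(** A family of growth r^(I + J) factors into r^I r^J, so that absolute sums at the point r suffice. *)
Lemma conv_absb (g c c' : multi d -> R) Cg N N' : (forall I, `|g I| <= Cg * mono r I) ->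
  absb (fun I => c I * mono r I) N -> absb (fun I => c' I * mono r I) N' ->
  exists M, absb (fun p : multi d * multi d => g (p.1 + p.2) * (c p.1 * c' p.2)) M.
Proof.
move=> hg h1 h2.
eexists; apply: absb_le (absbZ Cg (absb_mul h1 h2)) => p.
have -> : Cg * (c p.1 * mono r p.1 * (c' p.2 * mono r p.2)) =
   (Cg * mono r (p.1 + p.2)) * (c p.1 * c' p.2) by rewrite !monoD; ring.
rewrite [leLHS]normrM [leRHS]normrM ler_wpM2r//.
by apply: le_trans (hg _) _; exact: ler_norm.
Qed.

Lemma cum_incr_bound_rp : exists M, forall I, `|cum_incr K rho j u v I| <= M / mono rp I.
Proof.
exists (B * `|v - u| / rho j) => I.
apply: le_trans (cum_incr_bound HK rho0 rhoR j I hu hv) _.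
have B0 : 0 <= B * `|v - u| / rho j.
  have := cum_incr_bound HK rho0 rhoR j 0 hu hv; rewrite mono0 mulr1.
  exact: le_trans.
rewrite invfM mulrA ler_wpM2l// lef_pV2 ?posrE ?mono_gt0//.
by apply: mono_le => i; rewrite ltW//= ltW.
Qed.

Lemma mom1_absb : exists N, absb (fun I => mom1 I * mono r I) N.
Proof.
have [muabs _] := mom1_series.
eexists; apply: absb_le muabs => I; rewrite !normrM ler_wpM2l// !ger0_norm.
- by apply: mono_le.
- by apply: mono_ge0 => i; exact: ltW.
- by apply: mono_ge0 => i; exact: ltW.
Qed.

Lemma intg_lin (z : 'I_d -> R) t : (forall i, `|z i| < rp i) -> `|t| <= rho j - rp j ->
  intg (fun w => expR (\sum_i z i * X u w 0 i + t * incr w)).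
Proof.
move=> hz ht.
have c1 : cpoly rho (\row_k (z k - t *+ (k == j))%:C).
  move=> i; rewrite mxE normc_real; case: eqP => [->|_].
    by rewrite mulr1n; apply: le_trans (ler_normB _ _) _; have := hz j; lra.
  by rewrite mulr0n subr0 ltW// (lt_trans (hz i)).
have c2 : cpoly rho (\row_k ((t *+ (k == j)) : R)%:C).
  move=> i; rewrite mxE normc_real; case: eqP => [->|_]; last by rewrite mulr0n normr0 ltW.
  by rewrite mulr1n; have := rp0 j; lra.
have := intg_exp2 HK rhoR hu hv c1 c2; apply: eq_integrable => // w _ /=; congr ((expR _)%:E).
have -> : \sum_i t *+ (i == j) * X v w 0 i = t * X v w 0 j.
  by rewrite (bigD1 j)//= eqxx big1 ?addr0// => i /negbTE ->; rewrite mulr0n mul0r.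
have -> : \sum_i (z i - t *+ (i == j)) * X u w 0 i = \sum_i z i * X u w 0 i - t * X u w 0 j.
  under eq_bigr do rewrite mulrBl.
  rewrite sumrB; congr (_ - _).
  by rewrite (bigD1 j)//= eqxx big1 ?addr0// => i /negbTE ->; rewrite mulr0n mul0r.
by rewrite /incr; ring.
Qed.

Lemma intg_incr_exp (z : 'I_d -> R) : (forall i, `|z i| < rp i) ->
  intg (fun w => incr w * expR (\sum_i z i * X u w 0 i)).
Proof.
move=> hz; apply: intg_le intg_incr.
  apply: measurable_funM; first exact: meas_incr.
  by apply: measurableT_comp => //; apply: measurable_sum => i; exact: measurable_funM.
move=> w; rewrite normrM [ `|expR _|]ger0_norm ?expR_ge0// ler_wpM2l// ler_expR.
apply: ler_sum => i _; apply: le_trans (ler_norm _) _; rewrite normrM ler_wpM2r//; exact: ltW.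
Qed.

(** N(t) = E exp(z.X_u + t Y) has the derivative N(0) phi at 0. The inequality exp a >= 1 + a, used
    for positive and for negative t, bounds this derivative from both sides by E[Y exp(z.X_u)]. It
    replaces a differentiation under the expectation. *)
Lemma incr_mgf (z : 'I_d -> R) phi : (forall i, `|z i| < rp i) ->
  hsum (fun I => cum_incr K rho j u v I * mono z I) phi ->
  Ex (fun w => incr w * expR (\sum_i z i * X u w 0 i)) = Ex (fun w => expR (\sum_i z i * X u w 0 i)) * phi.
Proof.
move=> hz hphi.
have hzc : in_polydisc rp (fun i => (z i)%:C) by move=> i; rewrite normc_real.
have hzr : in_polydisc rho (fun i => (z i)%:C) by move=> i; exact: lt_trans (hzc i) (rpr i).
have [ph s1 d1] := diag_deriv HK rho0 rhoR j hu hv hzr.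
have phE : ph = phi%:C.
  apply: complex_ext => /=; last exact: (diag_real HK rho0 rhoR hu hv hzr d1).
  apply: hsum_uniq hphi; apply: hsum_ext s1.1 => I.
  by rewrite mono_real [kcoef _ _ _ _ _ I * _]mulrC ReZ mulrC.
pose N t := Ex (fun w => expR (\sum_i z i * X u w 0 i + t * incr w)).
pose sg := rho j - rp j; have sg0 : 0 < sg by rewrite subr_gt0.
have NE (t : R) : `|t| < sg -> cexp (K u v (\row_k (z k)%:C - axis j t%:C) (axis j t%:C)) = (N t)%:C.
  move=> ht; have := appell_log_real HK rp0 rpr rhoR hu hv 0 0 ht hzc.
  rewrite /appell_log; have -> : cdot (\row_k (z k)%:C) (0 : 'rV[R]_d) = 0.
    by rewrite cdot_real big1// => i _; rewrite mxE mulr0.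
  rewrite mulr0 !add0r cexpN; have -> : \sum_i z i * (0 : 'rV[R]_d) 0 i = 0.
    by rewrite big1// => i _; rewrite mxE mulr0.
  rewrite mulr0 add0r expR0 mul1r -/(N t) fmorphV => /invr_inj; exact.
have d2 := cdiff_comp d1 (cexp_diff _).
have N0 : N 0 = Ex (fun w => expR (\sum_i z i * X u w 0 i)).
  by congr Ex; apply/funext => w; rewrite mul0r addr0.
rewrite -N0; set E1 := Ex _.
(* the tangent line at 0 lies below N *)
have conv t : `|t| < sg -> N 0 + t * E1 <= N t.
  move=> ht; rewrite N0 -ExZ; last exact: intg_incr_exp.
  have i0 : intg (fun w => expR (\sum_i z i * X u w 0 i)).
    have := intg_lin (t := 0) hz; rewrite normr0 => /(_ (ltW sg0)).
    by apply: eq_integrable => // w _ /=; rewrite mul0r addr0.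
  have i1 := intgZ t (intg_incr_exp hz).
  rewrite -ExD//; apply: Ex_le.
  - exact: intgD.
  - exact: intg_lin (ltW ht).
  move=> w; rewrite expRD; set e := expR _.
  have -> : e + t * (incr w * e) = e * (1 + t * incr w) by ring.
  by rewrite ler_wpM2l ?expR_ge0// expR_ge1Dx.
have key e : 0 < e -> exists2 dl : R, 0 < dl & forall t : R, `|t| < dl -> `|N t - N 0 - N 0 * phi * t| <= e * `|t|.
  move=> e0; have [dl dl0 H] := d2 e e0; exists (Num.min dl sg); first by rewrite lt_min dl0.
  move=> t; rewrite lt_min => /andP[h1 h2]; have := H t%:C; rewrite normc_real => /(_ h1).
  rewrite add0r /= NE// (_ : (0 : C) = (0 : R)%:C)// NE ?normr0// phE.
  by rewrite -!rmorphM -!rmorphB normc_real.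
apply/eqP; rewrite eq_le; apply/andP; split; apply/ler_addgt0Pr => e e0.
  have [dl dl0 H] := key e e0; pose t := Num.min (dl / 2) (sg / 2).
  have t0 : 0 < t by rewrite lt_min !divr_gt0.
  have t1 : t < dl by apply: le_lt_trans (_ : dl / 2 < _); [rewrite ge_min lexx|lra].
  have t2 : t < sg by apply: le_lt_trans (_ : sg / 2 < _); [rewrite ge_min lexx orbT|lra].
  have := H t; have := conv t; rewrite (gtr0_norm t0) => /(_ t2) c1 /(_ t1) c2.
  have {c2} := le_trans (ler_norm _) c2 => c2.
  rewrite -(ler_pM2r t0) mulrDl [E1 * t]mulrC; lra.
have [dl dl0 H] := key e e0; pose t := Num.min (dl / 2) (sg / 2).
have t0 : 0 < t by rewrite lt_min !divr_gt0.
have t1 : t < dl by apply: le_lt_trans (_ : dl / 2 < _); [rewrite ge_min lexx|lra].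
have t2 : t < sg by apply: le_lt_trans (_ : sg / 2 < _); [rewrite ge_min lexx orbT|lra].
have := H (- t); have := conv (- t); rewrite normrN (gtr0_norm t0) => /(_ t2) c1 /(_ t1) c2.
have {c2} := le_trans (ler_norm _) c2 => c2.
rewrite -(ler_pM2r t0) mulrDl [E1 * t]mulrC; lra.
Qed.

Lemma cum_incr_series (z : 'I_d -> R) : (forall i, 0 <= z i < rp i) ->
  exists phi, hsum (fun I => cum_incr K rho j u v I * mono z I) phi.
Proof. by move=> hz; have [M hM] := cum_incr_bound_rp; have [N hN] := geom_absb hM hz; exact: absb_hsum hN. Qed.

Lemma Ex_incr : Ex incr = cum_incr K rho j u v 0.
Proof.
have z0 : forall i : 'I_d, 0 <= (0 : R) < rp i by move=> i; rewrite lexx rp0.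
have E : hsum (fun I => cum_incr K rho j u v I * mono (fun=> 0) I) (cum_incr K rho j u v 0).
  by rewrite -[X in hsum _ X]psum_at0; have [phi h1] := cum_incr_series z0; rewrite /psum (usumE h1).
have z1 : forall i : 'I_d, `|(0 : R)| < rp i by move=> i; rewrite normr0.
have := incr_mgf z1 E.
have -> : (fun w => incr w * expR (\sum_(i < d) 0 * X u w 0 i)) = incr.
  by apply/funext => w; rewrite big1 ?expR0 ?mulr1// => i _; rewrite mul0r.
have -> : (fun w => expR (\sum_(i < d) 0 * X u w 0 i)) = fun=> 1.
  by apply/funext => w; rewrite big1 ?expR0// => i _; rewrite mul0r.
by rewrite Ex_cst mul1r.
Qed.

(** [incr_mgf] at the level of coefficients. *)
Lemma incr_mom_conv : is_conv mom1 (cum_incr K rho j u v) incr_mom.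
Proof.
have [m m0 mr] := small_rho rp0.
apply: (conv_uniq m0) => z hz.
have z0 : forall i, 0 <= z i < rp i.
  by move=> i; have /andP[h1 h2] := hz i; rewrite ltW//= (lt_le_trans h2).
have z1 : forall i, `|z i| < rp i by move=> i; have /andP[h1 h2] := z0 i; rewrite ger0_norm.
have [phi hphi] := cum_incr_series z0.
exists (Ex (fun w => expR (\sum_i z i * X u w 0 i))), phi; split => //.
  by apply: mom1_series.2 => i; apply: ltW; exact: lt_trans (z1 i) _.
rewrite -(incr_mgf z1 hphi); apply: incr_mom_series.2 => i; exact: ltW.
Qed.

Lemma intg_incr_h : intg (fun w => incr w * h (X u w)).
Proof.
have [C0 _ _] := hh.
apply: (@intg_le _ _ _ _ _ (fun w => Ch * (`|incr w| * expR (dotabs rp (X u w))))).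
- apply: measurable_funM; first exact: meas_incr.
  by have := meas_mpartial 0 hu; rewrite mpartial0.
- move=> w; have := mpartial_bound 0 (X u w); rewrite mpartial0 mono0 mulr1 normrM => hb0.
  rewrite mulrCA ler_wpM2l//; apply: le_trans hb0 _; rewrite ler_wpM2l// ler_expR.
  by apply: ler_sum => i _; rewrite ler_wpM2r// ltW.
- exact: intgZ intg_incr.
Qed.

(** From [incr_mom_conv], by expanding h and taking means term by term. *)
Lemma Ex_incr_h : hsum (fun J => cum_incr K rho j u v J * mean_deriv J) (Ex (fun w => incr w * h (X u w))).
Proof.
have [C0 hb H] := hh.
have [Nm hNm] := mom1_absb; have [Mk hMk] := cum_incr_bound_rp; have [Nk hNk] := coef_absb hMk.
have [M hM] := conv_absb hb hNm hNk.
have [w3 h1 h2] := conv_sum incr_mom_conv hM mean_deriv_series.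
suff -> : Ex (fun w => incr w * h (X u w)) = w3 by [].
have := Ex_hsum (P := P) (f := fun I w => incr w * (b I * (mono (X u w 0) I / (mfact I)%:R)))
   (F := fun w => incr w * h (X u w)) (g := fun w => Ch * (`|incr w| * expR (dotabs rp (X u w)))).
case.
- move=> I; apply: measurable_funM; first exact: meas_incr.
  by apply: measurable_funM => //; apply: measurable_funM => //; exact: meas_mono.
- move=> w; have := H 0 (X u w); rewrite mpartial0 => H0; apply: hsumZ.
  by apply: hsum_ext H0 => I; rewrite addr0.
- move=> w; have := absbZ (incr w) (exp_series_absb 0 (X u w)); rewrite mono0 mulr1 => A.
  have {}A : absb (fun I => incr w * (b I * (mono (X u w 0) I / (mfact I)%:R))) (`|incr w| * (Ch * expR (dotabs r (X u w)))).
    by apply: absb_le A => I; rewrite addr0.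
  apply: absb_weak A; rewrite mulrCA ler_wpM2l// ler_wpM2l// ler_expR.
  by apply: ler_sum => i _; rewrite ler_wpM2r// ltW.
- exact: intgZ intg_incr.
move=> i1 _ _ h3; apply: hsum_uniq h3 _; apply: hsum_ext h1 => I.
rewrite /incr_mom /mom; have [b0|b0] := eqVneq (b I) 0.
  by rewrite b0 mul0r -[LHS](Ex_cst P 0); congr Ex; apply/funext => w; rewrite mul0r mulr0.
rewrite -ExZ; first by congr Ex; apply/funext => w; rewrite mulrCA.
have := intgZ (b I)^-1 (i1 I); apply: eq_integrable => // w _ /=.
by rewrite mulrCA mulKf.
Qed.

(** Let al and be be the Appell coefficients of order 0 and 1 in y at the point (X_u, Y), divided by
    factorials. The moments of X_u convolved with al give x^I / I!, so that the series of the
    means a_{L+N} against al is d_N h(x). Moreover Y al - be is the convolution of al with k. Pairing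
    it with the a_I gives the sum of k_J d_J h(x). Its term of index 0 cancels with the term E[Y] of
    the Wick product, since k_0 = E[Y]. *)
Theorem wick_formula w : hsum (fun J => if J == 0 then 0 else cum_incr K rho j u v J * mpartial J h (X u w))
  (h (X u w) * incr w - wick_product P h (X u) (fun w' => X v w' 0 j - X u w' 0 j) w).
Proof.
have [C0 hb H] := hh.
have [al [be [A [M [hA A0 A1 [bal bbe hs]]]]]] := appell_spec HK rp0 rpr rhoR j hu hv (X u w) (incr w).
have [Na hNa] := coef_absb bal; have [Nb hNb] := coef_absb bbe.
have [Mk hMk] := cum_incr_bound_rp; have [Nk hNk] := coef_absb hMk.
have [Nm hNm] := mom1_absb.
have [m m0 mr] := small_rho rp0.
set x := X u w; pose k := cum_incr K rho j u v.
have sz (z : 'I_d -> R) : (forall i, 0 < z i < m) -> forall i, 0 < z i < rp i.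
  by move=> hz i; have /andP[-> h2] := hz i; rewrite (lt_le_trans h2).
have Mn0 (z : 'I_d -> R) : (forall i, 0 < z i < rp i) -> Ex (fun w => expR (\sum_i z i * X u w 0 i)) != 0.
  move=> hz; have hzc : in_polydisc rp (fun i => (z i)%:C).
    by move=> i; have /andP[z0 z1] := hz i; rewrite normc_real gtr0_norm.
  have t0 : `|0 : R| < rho j - rp j by rewrite normr0 subr_gt0.
  have := appell_log_real HK rp0 rpr rhoR hu hv x (incr w) t0 hzc.
  apply: contra_eqN => /eqP E0.
  have -> : (fun w0 => expR (\sum_i z i * X u w0 0 i + 0 * (X v w0 0 j - X u w0 0 j))) = (fun w => expR (\sum_i z i * X u w 0 i)).
    by apply/funext => w0; rewrite mul0r addr0.
  by rewrite E0 invr0 mulr0 cexp_neq0.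
have cv1 : is_conv mom1 al (fun I => mono (x 0) I / (mfact I)%:R).
  apply: (conv_uniq m0) => z /sz hz; have [s1 _] := hs z hz.
  exists (Ex (fun w => expR (\sum_i z i * X u w 0 i))), (expR (\sum_i z i * x 0 i) / Ex (fun w => expR (\sum_i z i * X u w 0 i))).
  split => //.
    by apply: mom1_series.2 => i; have /andP[z0 z1] := hz i; rewrite gtr0_norm// ltW// (lt_trans z1).
  rewrite mulrC divfK ?Mn0//; apply: hsum_ext (hsum_mexp (fun i => z i * x 0 i)) => I.
  by rewrite monoM; ring.
(* derivatives of h from the means of its derivatives *)
have E1 N : hsum (fun L => mean_deriv (L + N) * al L) (mpartial N h x).
  have hbN : forall I, `|b (I + N)| <= Ch * mono r N * mono r I.
    move=> I; have -> : Ch * mono r N * mono r I = Ch * mono r (I + N) by rewrite monoD; ring.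
    exact: hb.
  have [M1 hM1] := conv_absb hbN hNm hNa.
  have ht L : hsum (fun J => b (J + L + N) * mom1 J) (mean_deriv (L + N)).
    by apply: hsum_ext (mean_deriv_series (L + N)) => J; rewrite addrA.
  have [w1 h1 h2] := conv_sum (b := fun I => b (I + N)) (t := fun L => mean_deriv (L + N)) cv1 hM1 ht.
  rewrite (hsum_uniq (H N x) h1); apply: hsum_ext h2 => J; exact: mulrC.
have cv2 : is_conv al k (fun I => incr w * al I - be I).
  apply: (conv_uniq m0) => z /sz hz; have [s1 s2] := hs z hz.
  have [phi hphi] : exists phi, hsum (fun I => k I * mono z I) phi.
    by apply: cum_incr_series => i; have /andP[h1 h2] := hz i; rewrite ltW.
  set s := _ / _ in s1 s2; exists s, phi; split => //.
  have := hsumB (hsumZ (incr w) s1) (s2 phi hphi).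
  have -> : incr w * s - s * (incr w - phi) = s * phi by ring.
  by apply: hsum_ext => I; ring.
pose Ee := Ex (fun w => expR (dotabs rho (X u w))).
have haE J : `|mean_deriv J| <= Ch * Ee * mono r J by rewrite mulrAC; exact: mean_deriv_bound.
have [M2 hM2] := conv_absb haE hNa hNk.
have [w2 g1 g2] := conv_sum cv2 hM2 E1.
have E10 : hsum (fun L => mean_deriv L * al L) (h x).
  by have := E1 0; rewrite mpartial0; apply: hsum_ext => L; rewrite addr0.
have -> : wick_product P h (X u) (fun w' => X v w' 0 j - X u w' 0 j) w = incr w * h x - w2 + k 0 * h x.
  apply: summability_sumE; apply: hsum_ext (hsumD (hsumB (hsumZ (incr w) E10) g1) (hsumZ (k 0) E10)) => I.
  have EY : fine ('E_P[fun w' => (X v w' 0%R j - X u w' 0%R j)%R])%E = k 0 := Ex_incr.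
  rewrite !(appellE hA) A0 A1 EY.
  have f0 : (mfact I)%:R != 0 :> R by rewrite pnatr_eq0 -lt0n mfact_gt0.
  rewrite -[fine _]/(mean_deriv I); field; exact: f0.
have -> : h x * incr w - (incr w * h x - w2 + k 0 * h x) = w2 - k 0 * h x by ring.
apply: hsum_ext (hsumB g2 (hsum1 (0 : multi d) (k 0 * h x))) => J.
by case: eqP => [->|_]; rewrite ?mpartial0 ?subrr// subr0.
Qed.

(** The expectation of h(X_u) Y - h(X_u) <> Y is the series of k_J E[d_J h(X_u)] over J <> 0. By
    [Ex_incr_h] this is E[h(X_u) Y] without its term of index 0, which is the product of the means. *)
Lemma Ex_wick : intg (wick_product P h (X u) (fun w' => X v w' 0 j - X u w' 0 j)) /\
  Ex (wick_product P h (X u) (fun w' => X v w' 0 j - X u w' 0 j)) = Ex incr * Ex (fun w => h (X u w)).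
Proof.
have [C0 hb H] := hh.
pose k := cum_incr K rho j u v; pose W := wick_product P h (X u) (fun w' => X v w' 0 j - X u w' 0 j).
have [Mk hMk] := cum_incr_bound_rp; have [Nk hNk] := coef_absb hMk.
pose f (J : multi d) w := if J == 0 then 0 else k J * mpartial J h (X u w).
pose S w := h (X u w) * incr w - W w.
have rh i : 0 <= r i <= rho i by exact: rle.
have i2 := intg_exp_dotabs HX HK rho0 rhoR hu rh.
have [||||i1 iS _ hS] := @Ex_hsum _ _ _ P d f S (fun w => Ch * Nk * expR (dotabs r (X u w))).
- move=> J; rewrite /f; case: eqP => _ //; apply: measurable_funM => //; exact: meas_mpartial.
- by move=> w; exact: wick_formula.
- move=> w; have A := absbZ (Ch * expR (dotabs r (X u w))) hNk.
  have p0 : 0 <= Ch * expR (dotabs r (X u w)) by rewrite mulr_ge0// expR_ge0.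
  rewrite (ger0_norm p0) mulrAC in A; apply: absb_le A => J; rewrite /f.
  case: eqP => _; first by rewrite normr0.
  have mJ : 0 <= mono r J by apply: mono_ge0 => i; exact: ltW.
  have -> : Ch * expR (dotabs r (X u w)) * (k J * mono r J) = k J * (Ch * mono r J * expR (dotabs r (X u w))) by ring.
  rewrite [leLHS]normrM [leRHS]normrM ler_wpM2l//.
  by apply: le_trans (mpartial_bound _ _) _; exact: ler_norm.
- exact: intgZ i2.
have ihY := intg_incr_h.
have WE : W = fun w => incr w * h (X u w) - S w.
  by apply/funext => w; rewrite /S mulrC; ring.
split; first by rewrite -/W WE; exact: intgB.
rewrite -/W WE ExB// (Ex_incr) -/k.
have E1 := hsumB Ex_incr_h (hsum1 (0 : multi d) (k 0 * mean_deriv 0)).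
have -> : Ex (fun w => h (X u w)) = mean_deriv 0 by rewrite /mean_deriv mpartial0.
suff -> : Ex S = Ex (fun w => incr w * h (X u w)) - k 0 * mean_deriv 0 by ring.
apply: hsum_uniq hS _; apply: hsum_ext E1 => J; rewrite /f.
case: eqP => [->|_]; first by rewrite subrr Ex_cst.
by rewrite subr0 ExZ//; exact: intg_mpartial.
Qed.

End Fixed.
End WickFormula.

(** * Sums of two-point functions along a partition *)

Section TwoPointSums.
Context {R : realType}.
Implicit Types (F G : R -> R -> R) (a b c : R) (s : seq R).

Fixpoint dsum F a s : R := if s is x :: s' then F a x + dsum F x s' else 0.

Lemma dsumE F a b s : \sum_(i < size s) F (ppoint a b s i) (ppoint a b s i.+1) = dsum F a s.
Proof.
elim: s a => [|x s IH] a /=; first by rewrite big_ord0.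
by rewrite big_ord_recl -IH.
Qed.

Lemma lsum_dsum (g h : R -> R) a s : lsum g h a s = dsum (fun u v => g u * (h v - h u)) a s.
Proof. by elim: s a => //= x s IH a; rewrite IH. Qed.

Lemma dsumB F G a s : dsum (fun u v => F u v - G u v) a s = dsum F a s - dsum G a s.
Proof. by elim: s a => [|x s IH] a /=; rewrite ?subrr// IH opprD addrACA. Qed.

Lemma dsum_norm F a s : `|dsum F a s| <= dsum (fun u v => `|F u v|) a s.
Proof.
elim: s a => [|x s IH] a /=; first by rewrite normr0.
by apply: le_trans (ler_normD _ _) _; rewrite lerD2l.
Qed.

Lemma path_finer_all a s : path <%R a s -> path (finer (last a s - a + 1)) a s.
Proof.
suff H b : path <%R b s -> a <= b -> path (finer (last b s - a + 1)) b s by move=> /H; apply.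
elim: s b => //= x s IH b /andP[bx px] ab.
have xl := path_le_last px.
by rewrite /finer bx IH ?(ltW (le_lt_trans ab bx))// andbT /=; lra.
Qed.

Lemma dsum_ext F G a0 b0 a s : (forall u v, a0 <= u <= b0 -> a0 <= v <= b0 -> F u v = G u v) ->
  a0 <= a -> path <%R a s -> last a s <= b0 -> dsum F a s = dsum G a s.
Proof.
move=> H; elim: s a => //= x s IH a a0a /andP[ax px] lb; have xl := path_le_last px.
by rewrite H ?IH//; lra.
Qed.

Lemma dsum_bound dl c F a0 b0 a s :
  (forall u v, a0 <= u <= b0 -> a0 <= v <= b0 -> u < v -> v - u < dl -> `|F u v| <= c * (v - u)) ->
  a0 <= a -> path (finer dl) a s -> last a s <= b0 -> `|dsum F a s| <= c * (last a s - a).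
Proof.
move=> H; elim: s a => [|x s IH] a a0a /=; first by rewrite normr0 subrr mulr0.
move=> /andP[/andP[ax xa] px] lb; have xl := path_le_last (finer_lt px).
apply: le_trans (ler_normD _ _) _.
have -> : c * (last x s - a) = c * (x - a) + c * (last x s - x) by ring.
by apply: lerD; [apply: H; lra|apply: IH => //; lra].
Qed.

Lemma dsum_hsum (J : choiceType) (F : J -> R -> R -> R) G a0 b0 a s :
  (forall u v, a0 <= u <= b0 -> a0 <= v <= b0 -> hsum (fun j => F j u v) (G u v)) ->
  a0 <= a -> path <%R a s -> last a s <= b0 -> hsum (fun j => dsum (F j) a s) (dsum G a s).
Proof.
move=> H; elim: s a => [|x s IH] a a0a /=; first by move=> *; exact: hsum0.
move=> /andP[ax px] lb; have xl := path_le_last px.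
by apply: hsumD; [apply: H; lra|apply: IH => //; lra].
Qed.

Lemma rs_sum_ext (g1 g2 h : R -> R) c a b s tag : (forall u, a <= u <= b -> g2 u = c * g1 u) ->
  itv_partition a b s ->
  (forall i, (i < size s)%N -> ppoint a b s i <= tag i <= ppoint a b s i.+1) ->
  rs_sum g2 h a b s tag = c * rs_sum g1 h a b s tag.
Proof.
move=> H hs ht; rewrite /rs_sum mulr_sumr; apply: eq_bigr => i _; rewrite mulrA H//.
have /andP[h1 h2] := ht i (ltn_ord i); apply/andP; split.
  by apply: le_trans h1; apply: (itv_partition_nth_ge _ hs); rewrite ltnS ltnW.
by apply: le_trans h2 _; apply: (itv_partition_nth_le _ hs); rewrite ltnS.
Qed.

Lemma is_rs_integralZ (g1 g2 h : R -> R) c a b v : (forall u, a <= u <= b -> g2 u = c * g1 u) ->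
  is_rs_integral g1 h a b v -> is_rs_integral g2 h a b (c * v).
Proof.
move=> H hg e e0; have d0 : 0 < `|c| + 1 by rewrite ltr_wpDl.
have [dl dl0 hd] := hg _ (divr_gt0 e0 d0); exists dl => // s tag hs hm ht.
rewrite (rs_sum_ext h H hs ht) -mulrBr normrM.
have := hd s tag hs hm ht; rewrite ltr_pdivlMr// mulrC => h1.
by apply: le_lt_trans h1; rewrite ler_wpM2r// lerDl.
Qed.

Lemma cvg_sum_seq (n : nat) (F : 'I_n -> nat -> R) (l : 'I_n -> R) :
  (forall j, F j @ \oo --> l j) -> \sum_j F j k @[k --> \oo] --> \sum_j l j.
Proof.
elim: n F l => [|n IH] F l H.
  by rewrite big_ord0; under eq_fun do rewrite big_ord0; exact: cvg_cst.
rewrite big_ord_recl; under eq_fun do rewrite big_ord_recl.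
by apply: cvgD; [exact: H|apply: IH => j; exact: H].
Qed.

End TwoPointSums.

(** * Convergence of the correction series *)

Section CorrectionSeries.
Context {R : realType} {disp : measure_display} {Omega : measurableType disp}.
Context (P : probability Omega R) {d : nat} (T : R) (X : R -> Omega -> 'rV[R]_d).
Local Notation C := R[i].
Variables (Rad : 'I_d -> \bar R).
Variables (K dK : R -> R -> 'rV[C]_d -> 'rV[C]_d -> C) (B : R).
Hypothesis HK : log_mgf P T X Rad K dK B.
Hypothesis T0 : 0 < T.
Variables rho r : 'I_d -> R.
Hypotheses (r0 : forall i, 0 < r i) (rrho : forall i, r i < rho i).
Hypotheses (rhoR : forall i, ((rho i)%:E < Rad i)%E).
Variables (s t : R).
Hypotheses (s0 : 0 <= s) (st : s < t) (tT : t <= T).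

Let rho0 i : 0 < rho i. Proof. exact: lt_trans (rrho i). Qed.

Lemma in_horizon u : s <= u <= t -> 0 <= u <= T.
Proof. by move=> /andP[h1 h2]; rewrite (le_trans s0 h1) (le_trans h2 tT). Qed.

Lemma B_ge0 : 0 <= B.
Proof.
have h0 : 0 <= (0 : R) <= T by rewrite lexx ltW.
have c0 := cpolyD rhoR (cpoly0 rho0).
by apply: le_trans (normc_ge0 _) (HK.2.2 0 0 0 0 h0 h0 c0 c0).
Qed.

(** Both the increments of the cumulants and their derivatives are of order B / rho ^ I, which beats
    the growth r ^ I of the derivatives of the integrand. *)
Definition ratio (J : multi d) : R := mono r J / mono rho J.

Definition cum_bound : R := \sum_j B / rho j.

Lemma cum_bound_ge0 : 0 <= cum_bound.
Proof. by apply: sumr_ge0 => j _; rewrite divr_ge0 ?B_ge0// ltW. Qed.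

Lemma ratio_ge0 J : 0 <= ratio J.
Proof. by rewrite divr_ge0// mono_ge0// => i; exact: ltW. Qed.

Lemma absb_ratio : absb ratio (\prod_i (1 - r i / rho i)^-1).
Proof.
have G : forall i, 0 <= r i / rho i < 1.
  by move=> i; rewrite divr_ge0 ?(ltW (r0 i)) ?(ltW (rho0 i))//= ltr_pdivrMr// mul1r.
by apply: absb_le (absb_geom G) => J; rewrite monoM (monoV rho J).
Qed.

Variables (g : multi d -> 'I_d -> R -> R) (A : R).
Hypothesis A0 : 0 <= A.
Hypothesis gc : forall J j, {within `[s, t], continuous (g J j)}.
Hypothesis gb : forall J j u, s <= u <= t -> `|g J j u| <= A * mono r J.

Local Notation q := (cum_deriv T K rho).

Definition corr_density J j u : R := g J j u * q j u J.

Lemma corr_density_integral J j : exists v, is_rs_integral (corr_density J j) id s t v.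
Proof.
apply: riemann_exists => //.
have sub : `[s, t]%classic `<=` `[0, T]%classic.
  by move=> u /=; rewrite !in_itv/=; exact: in_horizon.
have qc := continuous_subspaceW sub (cum_deriv_cont HK T0 rho0 rhoR (j := j) (I := J)).
by move=> u; apply: cvgM; [exact: gc|exact: qc].
Qed.

Definition correction_limit J : R := \sum_j rs_integral (corr_density J j) id s t.

Definition correction pi J : R := \sum_j dsum (fun u v => cum_incr K rho j u v J * g J j u) s pi.

Lemma correction_limit_cvg J pi : vanishing_partitions s t pi ->
  \sum_j lsum (corr_density J j) id s (pi n) @[n --> \oo] --> correction_limit J.
Proof.
move=> hpi; apply: cvg_sum_seq => j; have [v hv] := corr_density_integral J j.
by rewrite (rs_integralE st hv); exact: (rs_integral_cvg hv hpi).
Qed.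

Lemma itvP pi : itv_partition s t pi -> path <%R s pi /\ last s pi = t.
Proof. by move=> [p1 /eqP]. Qed.

Lemma bound_sum J : A * (t - s) * cum_bound * ratio J =
  \sum_j A * mono r J * (B / (rho j * mono rho J)) * (t - s).
Proof.
rewrite -mulr_suml -mulr_sumr /cum_bound /ratio.
have m0 : mono rho J != 0 by rewrite gt_eqF// mono_gt0.
have -> : \sum_j B / (rho j * mono rho J) = (\sum_j B / rho j) / mono rho J.
  by rewrite mulr_suml; apply: eq_bigr => j _; rewrite invfM mulrA.
by field.
Qed.

Lemma lsum_density_bound J pi : itv_partition s t pi ->
  `|\sum_j lsum (corr_density J j) id s pi| <= A * (t - s) * cum_bound * ratio J.
Proof.
move=> /itvP[p1 l1]; rewrite bound_sum; apply: le_trans (ler_norm_sum _ _ _) _.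
apply: ler_sum => j _; rewrite lsum_dsum.
have := @dsum_bound _ (last s pi - s + 1) (A * mono r J * (B / (rho j * mono rho J)))
  (fun u v => corr_density J j u * (id v - id u)) s t s pi.
rewrite l1; apply => //; last by rewrite -{1}l1; exact: path_finer_all.
move=> u v hu hv uv _ /=; rewrite normrM [X in _ * X <= _]gtr0_norm ?subr_gt0//.
rewrite ler_wpM2r ?subr_ge0 ?(ltW uv)// /corr_density normrM; apply: ler_pM => //; first exact: gb.
exact: (cum_deriv_bound HK T0 rho0 rhoR) (in_horizon hu).
Qed.

Lemma correction_bound J pi : itv_partition s t pi -> `|correction pi J| <= A * (t - s) * cum_bound * ratio J.
Proof.
move=> /itvP[p1 l1]; rewrite bound_sum; apply: le_trans (ler_norm_sum _ _ _) _.
apply: ler_sum => j _.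
have := @dsum_bound _ (last s pi - s + 1) (A * mono r J * (B / (rho j * mono rho J)))
  (fun u v => cum_incr K rho j u v J * g J j u) s t s pi.
rewrite l1; apply => //; last by rewrite -{1}l1; exact: path_finer_all.
move=> u v hu hv uv _ /=; rewrite mulrC normrM.
have := cum_incr_bound HK rho0 rhoR j J (in_horizon hu) (in_horizon hv).
rewrite (gtr0_norm (x := v - u)) ?subr_gt0// mulrAC => h.
by rewrite -mulrA ler_pM//; exact: gb.
Qed.

Lemma correction_limit_bound J : `|correction_limit J| <= A * (t - s) * cum_bound * ratio J.
Proof.
have pis := upart_vanishing st.
rewrite -[correction_limit J]subr0; apply: (cvg_dist_le (N := 0%N) (@correction_limit_cvg J _ pis)) => n _.
by rewrite subr0; apply: lsum_density_bound; exact: pis.1.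
Qed.

(** Replacing the increment k_J(u, v) by q_J(u) (v - u) turns the sum into a Riemann sum, up to
    errors which add up to a small multiple of t - s. *)
Lemma correction_term_cvg J pi : vanishing_partitions s t pi -> correction (pi n) J @[n --> \oo] --> correction_limit J.
Proof.
move=> hpi; have h1 := @correction_limit_cvg J _ hpi.
suff h2 : correction (pi n) J - \sum_j lsum (corr_density J j) id s (pi n) @[n --> \oo] --> 0.
  have -> : (fun n => correction (pi n) J) = (fun n => (correction (pi n) J - \sum_j lsum (corr_density J j) id s (pi n)) +
    \sum_j lsum (corr_density J j) id s (pi n)) by apply/funext => n; rewrite subrK.
  by rewrite -[X in _ --> X]add0r; exact: cvgD h2 h1.
rewrite /correction; have -> : (fun n => \sum_j dsum (fun u v => cum_incr K rho j u v J * g J j u) s (pi n) -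
    \sum_j lsum (corr_density J j) id s (pi n)) = fun n => \sum_j dsum (fun u v =>
      cum_incr K rho j u v J * g J j u - corr_density J j u * (v - u)) s (pi n).
  by apply/funext => n; rewrite -sumrB; apply: eq_bigr => j _; rewrite lsum_dsum dsumB.
have z0 : (0 : R) = \sum_(j < d) 0 by rewrite big1.
rewrite [X in _ --> X]z0; apply: cvg_sum_seq => j; apply/cvgrPdist_lt => e e0.
pose D := A * mono r J / mono rho J * (t - s).
have D0 : 0 <= D.
  rewrite mulr_ge0 ?subr_ge0 ?(ltW st)// divr_ge0 ?mulr_ge0 ?mono_ge0// => i; exact: ltW.
have D1 : 0 < D + 1 by rewrite ltr_wpDl.
(* D may be 0 *)
have [dl dl0 hdl] := cum_incr_deriv HK T0 rho0 rhoR j (divr_gt0 e0 D1).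
have [N _ hN] := (@cvgrPdist_lt _ _ _ _ _ _ _).1 hpi.2 _ dl0.
exists N => // n /hN /=; rewrite sub0r normrN ger0_norm ?mesh_ge0// => hm.
have [p1 l1] := itvP (hpi.1 n); rewrite sub0r normrN.
apply: (@le_lt_trans _ _ (e / (D + 1) * D)); last first.
  by rewrite -mulrA gtr_pMr// mulrC ltr_pdivrMr// mul1r ltrDl.
have -> : e / (D + 1) * D = e / (D + 1) * (A * mono r J) / mono rho J * (last s (pi n) - s).
  by rewrite l1 /D; ring.
apply: (@dsum_bound _ dl _ _ s t) => //; last 2 first.
- exact: mesh_finer p1 hm.
- by rewrite l1.
move=> u v hu hv uv vu; set e' := e / (D + 1).
have -> : cum_incr K rho j u v J * g J j u - corr_density J j u * (v - u) = g J j u * (cum_incr K rho j u v J - q j u J * (v - u)).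
  by rewrite /corr_density; ring.
have nuv : `|v - u| = v - u by rewrite gtr0_norm// subr_gt0.
have := hdl u v J (in_horizon hu) (in_horizon hv); rewrite nuv => /(_ vu) h.
have -> : e' * (A * mono r J) / mono rho J * (v - u) = A * mono r J * (e' * (v - u) / mono rho J) by ring.
by rewrite normrM ler_pM//; exact: gb.
Qed.

(** The family g is arbitrary with growth r^J: it will be the derivatives of the integrand along a
    path, and then the means of these derivatives. *)
Theorem correction_cvg : exists2 V, hsum (fun J => if J == 0 then 0 else correction_limit J) V &
  forall pi v, vanishing_partitions s t pi ->
    (forall n, hsum (fun J => if J == 0 then 0 else correction (pi n) J) (v n)) -> v @ \oo --> V.
Proof.
have D0 : 0 <= A * (t - s) * cum_bound.
  by rewrite !mulr_ge0 ?subr_ge0 ?cum_bound_ge0// ltW.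
have := absbZ (A * (t - s) * cum_bound) absb_ratio; rewrite (ger0_norm D0) => hM.
have [|V hV] := @absb_hsum _ _ (fun J => if J == 0 then 0 else correction_limit J) (A * (t - s) * cum_bound * \prod_i (1 - r i / rho i)^-1).
  apply: absb_le hM => J; case: eqP => _; first by rewrite normr0.
  by apply: le_trans (correction_limit_bound J) _; exact: ler_norm.
exists V => // pi v hpi hv; apply: hsum_tannery hM _ _ hv hV => [n J|J].
  case: eqP => _; first by rewrite normr0 mulr_ge0 ?ratio_ge0.
  by apply: correction_bound; exact: hpi.1.
by case: eqP => _; [exact: cvg_cst|exact: correction_term_cvg].
Qed.

(** This bound does not depend on the partition; it serves for dominated convergence. *)
Lemma correction_sum_bound pi v : itv_partition s t pi ->
  hsum (fun J => if J == 0 then 0 else correction pi J) v ->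
  `|v| <= A * (t - s) * cum_bound * \prod_i (1 - r i / rho i)^-1.
Proof.
move=> hpi hv; have D0 : 0 <= A * (t - s) * cum_bound.
  by rewrite !mulr_ge0 ?subr_ge0 ?cum_bound_ge0// ltW.
have := absbZ (A * (t - s) * cum_bound) absb_ratio; rewrite (ger0_norm D0) => hM.
apply: hsum_norm_le hv; apply: absb_le hM => J; case: eqP => _; first by rewrite normr0.
by apply: le_trans (correction_bound J hpi) _; exact: ler_norm.
Qed.

End CorrectionSeries.

(** * Local bounds on the derivatives of the integrand *)

Section LocalLipschitz.
Context {R : realType} {d : nat}.

Lemma coord_norm (x : 'rV[R]_d) i : `|x 0 i| <= `|x|.
Proof.
by rewrite [leRHS]/Num.norm /= mx_normrE; apply/bigmax_geP; right; exists (ord0, i).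
Qed.

Lemma expn_prod_lip (de a b m c A A' Mm Cc : R) : 0 <= de -> `|a| <= m -> `|b| <= m -> m <= c ->
  `|a - b| <= de * (c - m) -> `|A| <= Mm -> `|A'| <= Mm -> Mm <= Cc ->
  `|A - A'| <= de * (Cc - Mm) ->
  [/\ `|a * A| <= m * Mm, `|b * A'| <= m * Mm, m * Mm <= c * Cc &
      `|a * A - b * A'| <= de * (c * Cc - m * Mm)].
Proof.
move=> d0 ha hb mc hab hA hA' MC hAA.
have m0 : 0 <= m := le_trans (normr_ge0 _) ha.
have M0 : 0 <= Mm := le_trans (normr_ge0 _) hA.
rewrite !normrM; split; [exact: ler_pM|exact: ler_pM|by rewrite ler_pM|].
have -> : a * A - b * A' = (a - b) * A + b * (A - A') by ring.
apply: le_trans (ler_normD _ _) _; rewrite !normrM.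
have h1 : `|a - b| * `|A| <= de * (c - m) * Cc.
  by rewrite ler_pM// (le_trans hA).
have h2 : `|b| * `|A - A'| <= m * (de * (Cc - Mm)) by rewrite ler_pM.
apply: le_trans (lerD h1 h2) _; rewrite le_eqVlt; apply/orP; left; apply/eqP; ring.
Qed.

(** Comparing with the polynomial whose variables are enlarged by 1 absorbs the degree that a
    derivative would produce. *)
Lemma mono_lip (a b m : 'I_d -> R) de (I : multi d) : 0 <= de -> (forall i, `|a i| <= m i) ->
  (forall i, `|b i| <= m i) -> (forall i, `|a i - b i| <= de) ->
  `|mono a I - mono b I| <= de * mono (fun i => m i + 1) I.
Proof.
move=> d0 ha hb hab.
pose Q (a b m c : R) := [/\ `|a| <= m, `|b| <= m, m <= c & `|a - b| <= de * (c - m)].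
have Q1 : Q 1 1 1 1 by rewrite /Q normr1 !subrr normr0 mulr0 !lexx.
have QM a1 b1 m1 c1 a2 b2 m2 c2 : Q a1 b1 m1 c1 -> Q a2 b2 m2 c2 -> Q (a1 * a2) (b1 * b2) (m1 * m2) (c1 * c2).
  by move=> [h1 h2 h3 h4] [h5 h6 h7 h8]; exact: expn_prod_lip.
have Qi i : Q (a i ^+ I i) (b i ^+ I i) (m i ^+ I i) ((m i + 1) ^+ I i).
  elim: (I i) => [|n IH]; first by rewrite !expr0.
  rewrite !exprS; apply: QM IH; split => //; first by rewrite lerDl.
  by rewrite addrAC subrr add0r mulr1.
have : Q (mono a I) (mono b I) (mono m I) (mono (fun i => m i + 1) I).
  rewrite /mono; elim: (index_enum _) => [|i s IH]; first by rewrite !big_nil.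
  by rewrite !big_cons; exact: QM.
move=> [_ h2 _ h]; apply: le_trans h _; rewrite ler_wpM2l// gerBl.
exact: le_trans (normr_ge0 _) h2.
Qed.

Variables (r : 'I_d -> R) (b : multi d -> R) (Ch : R) (h : 'rV[R]_d -> R).
Hypothesis r0 : forall i, 0 < r i.
Hypothesis hh : exp_series r b Ch h.

(** The bound of an exponential series of type r on the box of half-sides m, enlarged by 1 for
    [mono_lip]. *)
Definition exp_box (m : 'I_d -> R) : R := expR (\sum_i r i * (m i + 1)).

Lemma mpartial_lip J (x y : 'rV[R]_d) m : (forall i, `|x 0 i| <= m i) -> (forall i, `|y 0 i| <= m i) ->
  `|mpartial J h x - mpartial J h y| <= Ch * mono r J * exp_box m * `|x - y|.
Proof.
move=> hx hy; have [C0 hb H] := hh.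
have ab i : `|x 0 i - y 0 i| <= `|x - y|.
  by have := coord_norm (x - y) i; rewrite !mxE.
pose c := `|x - y| * (Ch * mono r J).
have mJ : 0 <= mono r J by apply: mono_ge0 => i; exact: ltW.
have c0 : 0 <= c by rewrite mulr_ge0// mulr_ge0.
have m0 i : 0 <= m i + 1 by rewrite addr_ge0// (le_trans _ (hx i)).
have A := absbZ c (absb_mexp (fun i => r i * (m i + 1))).
have E : \sum_i `|r i * (m i + 1)| = \sum_i r i * (m i + 1).
  by apply: eq_bigr => i _; rewrite ger0_norm// mulr_ge0// ltW.
rewrite E (ger0_norm c0) in A.
have -> : Ch * mono r J * exp_box m * `|x - y| = c * exp_box m by rewrite /c; ring.
apply: hsum_norm_le (hsumB (H J x) (H J y)); apply: absb_le A => I.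
have f0 : 0 <= (mfact I)%:R^-1 :> R by rewrite invr_ge0.
have ml := mono_lip I (normr_ge0 (x - y)) hx hy ab.
have -> : b (I + J) * (mono (x 0) I / (mfact I)%:R) - b (I + J) * (mono (y 0) I / (mfact I)%:R) =
  b (I + J) * ((mono (x 0) I - mono (y 0) I) * (mfact I)%:R^-1) by ring.
rewrite monoM [leRHS]ger0_norm; last first.
  by rewrite mulr_ge0// mulr_ge0// mulr_ge0// mono_ge0// => i; exact: ltW.
rewrite !normrM (ger0_norm f0).
have -> : c * (mono r I * mono (fun i => m i + 1) I / (mfact I)%:R) =
   Ch * mono r (I + J) * (`|x - y| * mono (fun i => m i + 1) I * (mfact I)%:R^-1).
  by rewrite monoD /c; ring.
by apply: ler_pM => //; rewrite ?mulr_ge0// ler_wpM2r.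
Qed.

Lemma mpartial_box J (x : 'rV[R]_d) m : (forall i, `|x 0 i| <= m i) ->
  `|mpartial J h x| <= Ch * exp_box m * mono r J.
Proof.
move=> hx; have [C0 _ _] := hh; apply: le_trans (mpartial_bound r0 hh J x) _.
rewrite [leRHS]mulrAC ler_wpM2l ?mulr_ge0 ?mono_ge0//; first by move=> i; exact: ltW.
rewrite ler_expR; apply: ler_sum => i _; rewrite ler_wpM2l ?(ltW (r0 i))//.
by apply: le_trans (hx i) _; rewrite lerDl.
Qed.

End LocalLipschitz.

(** * Young integrals along a path *)

Section PathIntegrals.
Context {R : realType} {d : nat}.

Lemma unif_within (g : R -> R) a b : (forall e, 0 < e -> exists2 dl, 0 < dl &
    forall u v, a <= u <= b -> a <= v <= b -> `|v - u| < dl -> `|g v - g u| < e) ->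
  {within `[a, b], continuous g}.
Proof.
move=> H; apply/subspace_continuousP => u; rewrite /= in_itv /= => hu; apply/cvgrPdist_lt => e e0.
have [dl dl0 hd] := H e e0.
apply/nbhs_ballP; exists dl => // v; rewrite /ball /= distrC => vu; rewrite in_itv /= => hv.
by have := hd u v hu hv vu; rewrite distrC.
Qed.

Lemma path_bounded (x : R -> 'rV[R]_d) T : 0 <= T -> {within `[0, T], continuous x} ->
  exists M, forall u, 0 <= u <= T -> `|x u| <= M.
Proof.
move=> T0 cx; have [] := @EVT_max R (fun u => `|x u|) 0 T T0.
  apply: unif_within => e e0; have [dl dl0 H] := path_unif cx e0.
  exists dl => // u v hu hv vu; apply: le_lt_trans (H u v hu hv vu).
  exact: ler_dist_dist.
move=> c _ hc; exists `|x c| => u hu; apply: hc; by rewrite in_itv.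
Qed.

Variables (p T s t : R) (x : R -> 'rV[R]_d).
Hypothesis (p02 : 0 < p < 2) (fin : (pvar p 0 T x < +oo)%E).
Hypothesis (cont : {within `[0, T], continuous x}).
Hypothesis (s0 : 0 <= s) (st : s < t) (tT : t <= T).
Variables (r : 'I_d -> R) (b : 'I_d -> multi d -> R) (Ch : R) (f : 'rV[R]_d -> 'rV[R]_d).
Hypothesis r0 : forall i, 0 < r i.
Hypothesis hf : forall j, exp_series r (b j) Ch (fun y => f y 0 j).
Hypothesis Ch0 : 0 <= Ch.
Variable m : 'I_d -> R.
Hypothesis hm : forall u, 0 <= u <= T -> forall i, `|x u 0 i| <= m i.

Let inT u : s <= u -> u <= t -> 0 <= u <= T.
Proof. by move=> h1 h2; rewrite (le_trans s0 h1) (le_trans h2 tT). Qed.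

Lemma deriv_path_cont J j : {within `[s, t], continuous (fun u => mpartial J (fun y => f y 0 j) (x u))}.
Proof.
apply: unif_within => e e0; pose L := Ch * mono r J * exp_box r m.
have L0 : 0 <= L by rewrite !mulr_ge0 ?expR_ge0 ?mono_ge0// => i; exact: ltW.
have L1 : 0 < L + 1 by rewrite ltr_wpDl.
have [dl dl0 H] := path_unif cont (divr_gt0 e0 L1); exists dl => // u v /andP[su ut] /andP[sv vt] vu.
have hu := inT su ut; have hv := inT sv vt.
apply: le_lt_trans (mpartial_lip r0 (hf j) J (hm hv) (hm hu)) _.
have := H u v hu hv vu; rewrite ltr_pdivlMr// mulrC; apply: le_lt_trans.
by rewrite ler_wpM2r// lerDl.
Qed.

Lemma deriv_path_bound J j u : s <= u <= t ->
  `|mpartial J (fun y => f y 0 j) (x u)| <= Ch * exp_box r m * mono r J.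
Proof. by move=> /andP[su ut]; apply: (mpartial_box r0 (hf j)) => i; exact/hm/inT. Qed.

Let lip j u v : s <= u -> u <= v -> v <= t ->
  `|f (x v) 0 j - f (x u) 0 j| <= Ch * exp_box r m * `|x v - x u|.
Proof.
move=> su uv vt.
have := mpartial_lip r0 (hf j) 0 (hm (inT (le_trans su uv) vt)) (hm (inT su (le_trans uv vt))).
by rewrite mpartial0 mono0 mulr1.
Qed.

Let inc j u v : s <= u -> u <= v -> v <= t -> `|x v 0 j - x u 0 j| <= `|x v - x u|.
Proof. by move=> _ _ _; have := coord_norm (x v - x u) j; rewrite !mxE. Qed.

Let L0 : 0 <= Ch * exp_box r m. Proof. by rewrite mulr_ge0 ?expR_ge0. Qed.

Lemma young_path j : rs_integrable (fun u => f (x u) 0 j) (fun u => x u 0 j) s t.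
Proof. exact: (young_exists p02 fin cont s0 st tT L0 (lip j) (inc j)). Qed.

Lemma young_path_cvg pi : vanishing_partitions s t pi ->
  \sum_j lsum (fun u => f (x u) 0 j) (fun u => x u 0 j) s (pi n) @[n --> \oo] -->
  \sum_j rs_integral (fun u => f (x u) 0 j) (fun u => x u 0 j) s t.
Proof.
move=> hpi; apply: cvg_sum_seq => j; have [v hv] := young_path j.
by rewrite (rs_integralE st hv); exact: (rs_integral_cvg hv hpi).
Qed.

(** The constant of [young_bound], enlarged by 1 to cover the first term f(x_s) (x_t - x_s). *)
Definition young_const : R := 2 / (1 - 2 `^ (1 - 2 / p)) + 1.

Lemma young_const_ge1 : 1 <= young_const.
Proof.
rewrite /young_const lerDr divr_ge0// subr_ge0.
have /andP[p0 p2] := p02; rewrite -[leRHS](powRr0 2) ler_powR ?ler1n// subr_le0.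
by rewrite ler_pdivlMr// mul1r ltW.
Qed.

Lemma young_path_bound pi : itv_partition s t pi ->
  `|\sum_j lsum (fun u => f (x u) 0 j) (fun u => x u 0 j) s pi| <=
  d%:R * (Ch * exp_box r m * young_const * (1 + fine (pvar p 0 T x)) ^+ 2).
Proof.
move=> hpi; set V := fine _; have V0 : 0 <= V by apply: fine_ge0; exact: poweR_ge0.
apply: le_trans (ler_norm_sum _ _ _) _.
rewrite -[X in X%:R * _]card_ord mulr_natl -sumr_const; apply: ler_sum => j _.
have := young_bound p02 fin s0 st tT L0 (lip j) (inc j) hpi.
set A := lsum _ _ _ _; set G := f (x s) 0 j; set H := _ - x s 0 j => hA.
have hG : `|G| <= Ch * exp_box r m.
  by have := @deriv_path_bound 0 j s; rewrite mpartial0 mono0 mulr1; apply; rewrite lexx ltW.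
have /andP[p0 _] := p02.
have T0 : 0 < T by apply: lt_le_trans tT; exact: le_lt_trans st.
have hH : `|H| <= V.
  apply: le_trans (inc j (lexx s) (ltW st) (lexx t)) _.
  apply: le_trans (vcontrol_incr p0 fin (lexx 0) s0 (ltW st) tT (lexx T)) _.
  have hv := vcontrol_le p0 fin (lexx 0) (ltW T0) (lexx T).
  have h0 := vcontrol_ge0 p0 fin (lexx 0) (ltW T0) (lexx T).
  apply: le_trans (ge0_ler_powR _ _ _ hv) _; rewrite ?invr_ge0 ?(ltW p0) ?nnegrE ?powR_ge0//.
  by rewrite -powRrM mulfV ?gt_eqF// powRr1.
have -> : A = (A - G * H) + G * H by ring.
apply: le_trans (ler_normD _ _) _; rewrite normrM.
have h2 : `|G| * `|H| <= Ch * exp_box r m * V by rewrite ler_pM.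
apply: le_trans (lerD hA h2) _.
have y1 := young_const_ge1.
set c := 2 / _ * _ * _.
have -> : c = (young_const - 1) * (Ch * exp_box r m) * V ^+ 2 by rewrite /c /young_const addrK.
set L := Ch * exp_box r m; have : 0 <= L by exact: L0.
move: (young_const) y1 => y y1 l0.
have -> : L * y * (1 + V) ^+ 2 = (y - 1) * L * V ^+ 2 + L * V + (L * V ^+ 2 + L * V + L * y + L * (y-1) * V * 2) by ring.
have y0 : 0 <= y := le_trans ler01 y1; have y10 : 0 <= y - 1 by rewrite subr_ge0.
have V2 : 0 <= V ^+ 2 by rewrite exprn_ge0.
by rewrite lerDl; repeat first [done | apply: mulr_ge0 | apply: addr_ge0].
Qed.

End PathIntegrals.

(** * Sequential continuity and limits of random variables *)

Section SequentialContinuity.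
Context {R : realType}.

(** Sequential continuity suffices on an interval; dominated convergence provides it. *)
Lemma seq_within (g : R -> R) a b : (forall u (v : nat -> R), a <= u <= b -> (forall n, a <= v n <= b) ->
    v @ \oo --> u -> g (v n) @[n --> \oo] --> g u) -> {within `[a, b], continuous g}.
Proof.
move=> H; apply/subspace_continuousP => u; rewrite /= in_itv /= => hu; apply/cvgrPdist_lt => e e0.
apply: contrapT => N.
have E n : exists v : R, [/\ a <= v <= b, `|u - v| < n.+1%:R^-1 & e <= `|g u - g v|].
  apply: contrapT => N2; apply: N.
  apply/nbhs_ballP; exists n.+1%:R^-1 => /=; first by rewrite invr_gt0.
  move=> v; rewrite /ball /= => uv; rewrite in_itv /= => hv.
  by rewrite ltNge; apply/negP => ev; apply: N2; exists v.
have [v hv] := choice E.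
have vu : v @ \oo --> u.
  apply/cvgrPdist_lt => e1 e10; have [M _ hM] := (@cvgrPdist_lt _ _ _ _ _ _ _).1 (@cvg_harmonic R) e1 e10.
  exists M => // n /hM /=; rewrite sub0r normrN ger0_norm//.
  by apply: lt_trans; have [] := hv n.
have := H u v hu (fun n => let: And3 h _ _ := hv n in h) vu.
move=> /cvgrPdist_lt /(_ e e0) [M _ /(_ M (leqnn M))] /=; rewrite ltNge => /negP; apply.
by have [] := hv M.
Qed.

Lemma within_seq (g : R -> R) a b u (v : nat -> R) : {within `[a, b], continuous g} ->
  a <= u <= b -> (forall n, a <= v n <= b) -> v @ \oo --> u -> g (v n) @[n --> \oo] --> g u.
Proof.
move=> /subspace_continuousP cg hu hv vu.
have h1 : v @ \oo --> within `[a, b]%classic (nbhs u).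
  move=> U hU; have h : \forall n \near \oo, `[a, b]%classic (v n) -> U (v n) := vu _ hU.
  change (\forall n \near \oo, U (v n)).
  by apply: filterS h => n; apply; rewrite /= in_itv /=; exact: hv.
by apply: cvg_comp h1 _; apply: cg; rewrite /= in_itv.
Qed.

End SequentialContinuity.

Section LimitVariables.
Context {R : realType} {disp : measure_display} {Omega : measurableType disp}.
Context (P : probability Omega R).
Local Notation intg := (intg P).
Local Notation Ex := (Ex P).

(** A limit which exists almost surely, completed to a measurable function. *)
Definition lim_rv (F : nat -> Omega -> R) (w : Omega) : R := fine (limn_esup (fun n => (F n w)%:E)).

Lemma lim_rv_meas F : (forall n, measurable_fun setT (F n)) -> measurable_fun setT (lim_rv F).
Proof.
move=> mF; apply: measurableT_comp; first exact: fine_measurable.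
by apply: measurable_fun_limn_esup => n; apply/measurable_EFinP; exact: mF.
Qed.

Lemma lim_rv_cvg (F : nat -> Omega -> R) w l : F n w @[n --> \oo] --> l -> lim_rv F w = l.
Proof.
move=> h; have h' : (F n w)%:E @[n --> \oo] --> l%:E by apply: cvg_EFin => //; exact: nearW.
by rewrite /lim_rv (cvg_limn_einf_sup h').2.
Qed.

Lemma dsumZ c (F : R -> R -> R) a pi : dsum (fun u v => c * F u v) a pi = c * dsum F a pi.
Proof. by elim: pi a => [|x l IH] a /=; rewrite ?mulr0// mulrDr IH. Qed.

Lemma dsum0 a pi : dsum (fun _ _ => 0 : R) a pi = 0.
Proof. by elim: pi a => [|x l IH] a //=; rewrite IH addr0. Qed.

Lemma meas_dsum (F : R -> R -> Omega -> R) a0 b0 a pi :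
  (forall u v, a0 <= u <= b0 -> a0 <= v <= b0 -> measurable_fun setT (F u v)) ->
  a0 <= a -> path <%R a pi -> last a pi <= b0 ->
  measurable_fun setT (fun w => dsum (fun u v => F u v w) a pi).
Proof.
move=> H; elim: pi a => [|x pi IH] a a0a /=; first by move=> _ _; exact: measurable_cst.
move=> /andP[ax px] lb; have xl := path_le_last px.
by apply: measurable_funD; [apply: H; lra|apply: IH => //; lra].
Qed.

Lemma Ex_dsum (F : R -> R -> Omega -> R) a0 b0 a pi :
  (forall u v, a0 <= u <= b0 -> a0 <= v <= b0 -> intg (F u v)) ->
  a0 <= a -> path <%R a pi -> last a pi <= b0 ->
  intg (fun w => dsum (fun u v => F u v w) a pi) /\
  Ex (fun w => dsum (fun u v => F u v w) a pi) = dsum (fun u v => Ex (F u v)) a pi.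
Proof.
move=> H; elim: pi a => [|x pi IH] a a0a /=.
  by move=> _ _; split; [exact: intg_cst|exact: Ex_cst].
move=> /andP[ax px] lb; have xl := path_le_last px.
have i1 : intg (F a x) by apply: H; lra.
have [||//|i2 e2] := IH x; [lra|by []|].
by split; [exact: intgD|rewrite -e2 -ExD].
Qed.

(** Fatou's lemma for a sequence bounded in mean. *)
Lemma Ex_abs_limit (F : nat -> Omega -> R) (G : Omega -> R) c : (forall n, intg (F n)) ->
  measurable_fun setT G -> {ae P, forall w, F n w @[n --> \oo] --> G w} ->
  (forall n, Ex (fun w => `|F n w|) <= c) -> ('E_P[fun w => `|G w|%R] <= c%:E)%E.
Proof.
move=> iF mG hae hc.
have mF n : measurable_fun setT (F n) := intg_meas (iF n).
have mA n : measurable_fun setT (fun w => `|F n w|%:E).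
  by apply/measurable_EFinP; apply: measurableT_comp => //.
have mI : measurable_fun setT (fun w => limn_einf (fun n => `|F n w|%:E)).
  by apply: measurableT_comp => //; apply: measurable_fun_limn_esup => n; apply: measurableT_comp => //.
have le1 u : (forall n : nat, (u n <= c%:E)%E) -> (limn_einf u <= c%:E)%E.
  move=> hu; rewrite limn_einf_lim; apply: lime_le; first exact: is_cvg_einfs.
  apply: nearW => n; apply: le_trans (hu n); apply: ereal_inf_lbound; exists n => //=.
rewrite unlock (_ : (\int[P]_x _)%E = (\int[P]_w limn_einf (fun n => `|F n w|%:E))%E); last first.
  apply: ge0_ae_eq_integral => //.
  - by apply/measurable_EFinP; apply: measurableT_comp => //.
  - by move=> w _; rewrite limn_einf_lim; apply: lime_ge; [exact: is_cvg_einfs|apply: nearW => n; apply: le_ereal_inf_tmp => _ [k _ <-]; rewrite lee_fin].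
  move: hae; apply: filterS => w hw _; have h1 : `|F n w| @[n --> \oo] --> `|G w| by exact: cvg_norm.
  have h' : `|F n w|%:E @[n --> \oo] --> `|G w|%:E by apply: cvg_EFin => //; exact: nearW.
  by rewrite (cvg_limn_einf_sup h').1.
apply: le_trans (fatou P measurableT mA _) _; first by move=> n w _; rewrite lee_fin.
apply: le1 => n; have := ExE (intg_abs (iF n)); rewrite unlock => ->.
by rewrite lee_fin.
Qed.

End LimitVariables.

(** * The Wick integral *)

Section WickIntegral.
Context {R : realType} {disp : measure_display} {Omega : measurableType disp}.
Context (P : probability Omega R) {d : nat} (T p : R) (X : R -> Omega -> 'rV[R]_d).
Local Notation C := R[i].
Variables (f : 'rV[R]_d -> 'rV[R]_d) (s t : R).

Definition riemann_young pi w : R :=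
  \sum_j lsum (fun u => f (X u w) 0 j) (fun u => X u w 0 j) s pi.

(** The limits are taken along the uniform partitions, which makes them measurable and independent of
    the constants in the estimates. *)
Definition young_rv : Omega -> R := lim_rv (fun n => riemann_young (upart s t n)).

Definition wick_rv : Omega -> R := lim_rv (fun n => wick_sum P f X s t (upart s t n)).

Definition kappa_density I j w u : R := mpartial I (fun x => f x 0 j) (X u w) * kappa P T X I j u.

Definition term_rv I : Omega -> R := lim_rv (fun n w => (mfact I)%:R^-1 *
  \sum_j lsum (kappa_density I j w) id s (upart s t n)).

Variables (Rad : 'I_d -> \bar R).
Variables (K dK : R -> R -> 'rV[C]_d -> 'rV[C]_d -> C) (B : R).
Hypothesis HX : process T X.
Hypothesis HK : log_mgf P T X Rad K dK B.
Hypothesis p02 : 0 < p < 2.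
Hypothesis Hreg : regular_paths P T p X.
Hypotheses (s0 : 0 <= s) (st : s < t) (tT : t <= T).
Variables rho rp r : 'I_d -> R.
Hypotheses (r0 : forall i, 0 < r i) (rrp : forall i, r i < rp i) (rpr : forall i, rp i < rho i).
Hypotheses (rhoR : forall i, ((rho i)%:E < Rad i)%E).
Variables (b : 'I_d -> multi d -> R) (Ch : R).
Hypothesis hf : forall j, exp_series r (b j) Ch (fun y => f y 0 j).
Hypothesis Ch0 : 0 <= Ch.
Local Notation intg := (intg P).
Local Notation Ex := (Ex P).

Let T0 : 0 < T. Proof. by apply: lt_le_trans tT; exact: le_lt_trans st. Qed.
Let rp0 i : 0 < rp i. Proof. exact: lt_trans (rrp i). Qed.
Let rho0 i : 0 < rho i. Proof. exact: lt_trans (rpr i). Qed.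
Let rrho i : r i < rho i. Proof. exact: lt_trans (rpr i). Qed.
Let inT u : s <= u <= t -> 0 <= u <= T.
Proof. by move=> /andP[h1 h2]; rewrite (le_trans s0 h1) (le_trans h2 tT). Qed.

Local Notation fj j := (fun y : 'rV[R]_d => f y 0 j).
Definition dpath w (J : multi d) j u : R := mpartial J (fj j) (X u w).

Definition regular w := {within `[0, T], continuous (fun u => X u w)} /\
  (pvar p 0 T (fun u => X u w) < +oo)%E.

Lemma wick_sumE pi w : wick_sum P f X s t pi w =
  \sum_j dsum (fun u v => wick_product P (fj j) (X u) (fun w' => X v w' 0 j - X u w' 0 j) w) s pi.
Proof.
rewrite /wick_sum exchange_big; apply: eq_bigr => j _.
exact: (@dsumE _ (fun u v => wick_product P (fj j) (X u) (fun w' => X v w' 0 j - X u w' 0 j) w)).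
Qed.

(** The Wick formula summed over the intervals of a partition and over j. *)
Lemma wick_sum_series pi w : itv_partition s t pi ->
  hsum (fun J => if J == 0 then 0 else correction K rho s (dpath w) pi J)
    (riemann_young pi w - wick_sum P f X s t pi w).
Proof.
move=> /itvP[p1 l1]; rewrite wick_sumE /riemann_young -sumrB.
have H j : hsum (fun J => if J == 0 then 0 else dsum (fun u v => cum_incr K rho j u v J * dpath w J j u) s pi)
    (lsum (fun u => f (X u w) 0 j) (fun u => X u w 0 j) s pi -
    dsum (fun u v => wick_product P (fj j) (X u) (fun w' => X v w' 0 j - X u w' 0 j) w) s pi).
  rewrite lsum_dsum -dsumB.
  have := @dsum_hsum _ _ (fun J u v => if J == 0 then 0 else cum_incr K rho j u v J * dpath w J j u)
    (fun u v => f (X u w) 0 j * (X v w 0 j - X u w 0 j) -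
       wick_product P (fj j) (X u) (fun w' => X v w' 0 j - X u w' 0 j) w) s t s pi.
  have hpt u v : s <= u <= t -> s <= v <= t ->
    hsum (fun J => if J == 0 then 0 else cum_incr K rho j u v J * dpath w J j u)
      (f (X u w) 0 j * (X v w 0 j - X u w 0 j) -
       wick_product P (fj j) (X u) (fun w' => X v w' 0 j - X u w' 0 j) w).
    move=> /inT hu /inT hv; exact: (wick_formula HX HK r0 rrp rpr rhoR (hf j) j hu hv w).
  move=> /(_ hpt (lexx s) p1); rewrite l1 => /(_ (lexx t)); apply: hsum_ext => J.
  by case: eqP => // _; exact: dsum0.
apply: hsum_ext (hsum_sum (index_enum 'I_d) H) => J.
by case: eqP => _; [rewrite big1|].
Qed.

Lemma regular_bound w : regular w -> exists M, 0 <= M /\ forall u, 0 <= u <= T -> forall i, `|X u w 0 i| <= M.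
Proof.
move=> [cx _]; have [M hM] := path_bounded (ltW T0) cx; exists M; split.
  by apply: le_trans (hM 0 _) => //; rewrite lexx ltW.
by move=> u hu i; apply: le_trans (coord_norm _ i) (hM u hu).
Qed.

(** The Riemann sums converge to the Young integral and the correction series converges, hence so
    does their difference, the Wick sum, along every sequence of partitions to the same limit. *)
Lemma regular_limits w : regular w ->
  [/\ forall pi, vanishing_partitions s t pi -> riemann_young (pi n) w @[n --> \oo] --> young_rv w,
      young_rv w = \sum_j rs_integral (fun u => f (X u w) 0 j) (fun u => X u w 0 j) s t,
      hsum (fun J => if J == 0 then 0 else correction_limit T K rho s t (dpath w) J) (young_rv w - wick_rv w) &
      forall pi, vanishing_partitions s t pi -> wick_sum P f X s t (pi n) w @[n --> \oo] --> wick_rv w].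
Proof.
move=> hw; have [M [_ hM]] := regular_bound hw; have [cx fx] := hw.
have A0 : 0 <= Ch * exp_box r (fun=> M) by rewrite mulr_ge0 ?expR_ge0.
have gc := deriv_path_cont cx s0 tT r0 hf Ch0 hM.
have gb := deriv_path_bound s0 tT r0 hf hM.
have yc := young_path_cvg p02 fx cx s0 st tT r0 hf Ch0 hM.
set Yv := \sum_j _ in yc *.
have hY : young_rv w = Yv by apply: lim_rv_cvg; apply: yc; exact: upart_vanishing.
have [V hV cV] := correction_cvg HK T0 r0 rrho rhoR s0 st tT A0 gc gb.
have cW pi : vanishing_partitions s t pi -> wick_sum P f X s t (pi n) w @[n --> \oo] --> Yv - V.
  move=> hpi.
  have -> : (fun n => wick_sum P f X s t (pi n) w) = fun n => riemann_young (pi n) w -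
      (riemann_young (pi n) w - wick_sum P f X s t (pi n) w) by apply/funext => n; rewrite subKr.
  apply: cvgB; first exact: yc.
  by apply: (cV _ _ hpi) => n; apply: wick_sum_series; exact: hpi.1.
have hW : wick_rv w = Yv - V by apply: lim_rv_cvg; apply: cW; exact: upart_vanishing.
split; [by move=> pi /yc; rewrite hY| exact: hY | by rewrite hW hY subKr | by rewrite hW].
Qed.

Lemma kappa_corr_density (g : multi d -> 'I_d -> R -> R) I j u : s <= u <= t ->
  g I j u * kappa P T X I j u = (mfact I)%:R * corr_density T K rho g I j u.
Proof. by move=> hu; rewrite (kappaE HK T0 rho0 rhoR I j (inT hu)) /corr_density mulrCA. Qed.

(** The factor J! of [kappaE] cancels with the factor 1 / J! of the series. *)
Lemma kappa_integral (g : multi d -> 'I_d -> R -> R) I :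
  (forall J j, {within `[s, t], continuous (g J j)}) ->
  exists v : 'I_d -> R, [/\ forall j, is_rs_integral (fun u => g I j u * kappa P T X I j u) id s t (v j),
     forall j, rs_integral (fun u => g I j u * kappa P T X I j u) id s t = v j &
     (mfact I)%:R^-1 * \sum_j v j = correction_limit T K rho s t g I].
Proof.
move=> gc; pose v j := rs_integral (corr_density T K rho g I j) id s t.
have hv j : is_rs_integral (fun u => g I j u * kappa P T X I j u) id s t ((mfact I)%:R * v j).
  have [v1 hv1] := corr_density_integral HK T0 r0 rrho rhoR s0 st tT gc I j.
  rewrite /v (rs_integralE st hv1); apply: is_rs_integralZ hv1 => u hu; exact: kappa_corr_density.
exists (fun j => (mfact I)%:R * v j); split => // [j|]; first exact: rs_integralE.
by rewrite -mulr_sumr mulKf// pnatr_eq0 -lt0n mfact_gt0.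
Qed.

Lemma term_limit I w : regular w ->
  (forall j, rs_integrable (kappa_density I j w) id s t) /\
  [/\ term_rv I w = (mfact I)%:R^-1 * \sum_j rs_integral (kappa_density I j w) id s t,
     term_rv I w = correction_limit T K rho s t (dpath w) I &
     (mfact I)%:R^-1 * \sum_j lsum (kappa_density I j w) id s (upart s t n) @[n --> \oo] --> term_rv I w].
Proof.
move=> hw; have [M [_ hM]] := regular_bound hw; have [cx fx] := hw.
have [v [h1 h2 h3]] := kappa_integral I (deriv_path_cont cx s0 tT r0 hf Ch0 hM).
have cv : (mfact I)%:R^-1 * \sum_j lsum (kappa_density I j w) id s (upart s t n) @[n --> \oo] -->
    (mfact I)%:R^-1 * \sum_j v j.
  apply: cvgMr; apply: cvg_sum_seq => j; apply: (rs_integral_cvg (h1 j)); exact: upart_vanishing.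
have TE := lim_rv_cvg (F := fun n w => (mfact I)%:R^-1 *
  \sum_j lsum (kappa_density I j w) id s (upart s t n)) cv.
split; first by move=> j; exists (v j); exact: h1.
split; rewrite /term_rv TE//.
by congr (_ * _); apply: eq_bigr => j _; rewrite -h2.
Qed.

Lemma meas_dpath J j u : 0 <= u <= T -> measurable_fun setT (fun w => dpath w J j u).
Proof. by move=> hu; exact: (meas_mpartial HX (hf j) J hu). Qed.

Lemma meas_riemann_young pi : itv_partition s t pi -> measurable_fun setT (riemann_young pi).
Proof.
move=> /itvP[p1 l1]; apply: measurable_sum => j.
have -> : (fun w => lsum (fun u => f (X u w) 0 j) (fun u => X u w 0 j) s pi) =
    fun w => dsum (fun u v => f (X u w) 0 j * (X v w 0 j - X u w 0 j)) s pi.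
  by apply/funext => w; rewrite lsum_dsum.
apply: (@meas_dsum _ _ _ (fun u v w => f (X u w) 0 j * (X v w 0 j - X u w 0 j)) s t) => //; last by rewrite l1.
move=> u v /inT hu /inT hv; apply: measurable_funM; last by apply: measurable_funB; exact: HX.
by have := meas_dpath 0 j hu; rewrite /dpath mpartial0.
Qed.

Lemma Ex_riemann_young pi : itv_partition s t pi -> intg (riemann_young pi) /\
  Ex (riemann_young pi) =
  \sum_j dsum (fun u v => Ex (fun w => (X v w 0 j - X u w 0 j) * f (X u w) 0 j)) s pi.
Proof.
move=> /itvP[p1 l1].
have H j : intg (fun w => lsum (fun u => f (X u w) 0 j) (fun u => X u w 0 j) s pi) /\
    Ex (fun w => lsum (fun u => f (X u w) 0 j) (fun u => X u w 0 j) s pi) =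
    dsum (fun u v => Ex (fun w => (X v w 0 j - X u w 0 j) * f (X u w) 0 j)) s pi.
  have -> : (fun w => lsum (fun u => f (X u w) 0 j) (fun u => X u w 0 j) s pi) =
    fun w => dsum (fun u v => (X v w 0 j - X u w 0 j) * f (X u w) 0 j) s pi.
    by apply/funext => w; rewrite lsum_dsum; congr dsum; do 2 apply/funext => ?; exact: mulrC.
  apply: (Ex_dsum (F := fun u v w => (X v w 0 j - X u w 0 j) * f (X u w) 0 j) (a0 := s) (b0 := t)) => //; last by rewrite l1.
  move=> u v /inT hu /inT hv; exact: (intg_incr_h HX HK r0 rrp rpr rhoR (hf j) j hu hv).
split; first by apply: intg_sum => j; exact: (H j).1.
by rewrite /riemann_young Ex_sum; [apply: eq_bigr => j _; exact: (H j).2|move=> j; exact: (H j).1].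
Qed.

Lemma Ex_wick_sum pi : itv_partition s t pi -> intg (wick_sum P f X s t pi) /\
  Ex (wick_sum P f X s t pi) =
  \sum_j dsum (fun u v => Ex (fun w => X v w 0 j - X u w 0 j) * Ex (fun w => f (X u w) 0 j)) s pi.
Proof.
move=> /itvP[p1 l1].
have -> : wick_sum P f X s t pi = fun w => \sum_j dsum (fun u v => wick_product P (fj j) (X u)
    (fun w' => X v w' 0 j - X u w' 0 j) w) s pi by apply/funext => w; exact: wick_sumE.
have H j : intg (fun w => dsum (fun u v => wick_product P (fj j) (X u) (fun w' => X v w' 0 j - X u w' 0 j) w) s pi) /\
    Ex (fun w => dsum (fun u v => wick_product P (fj j) (X u) (fun w' => X v w' 0 j - X u w' 0 j) w) s pi) =
    dsum (fun u v => Ex (fun w => X v w 0 j - X u w 0 j) * Ex (fun w => f (X u w) 0 j)) s pi.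
  have hw u v (hu : s <= u <= t) (hv : s <= v <= t) :=
    Ex_wick HX HK r0 rrp rpr rhoR (hf j) j (inT hu) (inT hv).
  have i0 u v (hu : s <= u <= t) (hv : s <= v <= t) := (hw u v hu hv).1.
  have lt1 : last s pi <= t by rewrite l1.
  have [i1 ->] := Ex_dsum i0 (lexx s) p1 lt1.
  split => //; apply: (@dsum_ext _ _ _ s t) => //.
  by move=> u v hu hv; exact: (hw u v hu hv).2.
split; first by apply: intg_sum => j; exact: (H j).1.
by rewrite Ex_sum; [apply: eq_bigr => j _; exact: (H j).2|move=> j; exact: (H j).1].
Qed.

Lemma meas_young_rv : measurable_fun setT young_rv.
Proof. by apply: lim_rv_meas => n; apply: meas_riemann_young; exact: upart_itv. Qed.

Lemma meas_wick_rv : measurable_fun setT wick_rv.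
Proof. by apply: lim_rv_meas => n; apply: intg_meas; apply: (Ex_wick_sum _).1; exact: upart_itv. Qed.

Lemma intg_term I n : intg (fun w => (mfact I)%:R^-1 * \sum_j lsum (kappa_density I j w) id s (upart s t n)).
Proof.
have [p1 l1] := itvP (upart_itv n st).
apply: intgZ; apply: intg_sum => j.
have -> : (fun w => lsum (kappa_density I j w) id s (upart s t n)) =
    fun w => dsum (fun u v => kappa P T X I j u * (v - u) * dpath w I j u) s (upart s t n).
  apply/funext => w; rewrite lsum_dsum; congr dsum; do 2 apply/funext => ?.
  by rewrite /kappa_density /dpath /=; ring.
apply: (@Ex_dsum _ _ _ P (fun u v w => kappa P T X I j u * (v - u) * dpath w I j u) s t _ _ _ _ p1 _).1 => //.
  by move=> u v /inT hu _; apply: intgZ; exact: (intg_mpartial HX HK r0 rrp rpr rhoR (hf j) I hu).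
by rewrite l1.
Qed.

Lemma meas_term_rv I : measurable_fun setT (term_rv I).
Proof. by apply: lim_rv_meas => n; apply: intg_meas; exact: intg_term. Qed.

Lemma term_sumE I n w : (mfact I)%:R^-1 * \sum_j lsum (kappa_density I j w) id s (upart s t n) =
  \sum_j dsum (fun u v => cum_deriv T K rho j u I * (v - u) * dpath w I j u) s (upart s t n).
Proof.
have [p1 l1] := itvP (upart_itv n st).
have f0 : (mfact I)%:R != 0 :> R by rewrite pnatr_eq0 -lt0n mfact_gt0.
rewrite mulr_sumr; apply: eq_bigr => j _; rewrite lsum_dsum.
rewrite (@dsum_ext _ _ (fun u v => (mfact I)%:R * (cum_deriv T K rho j u I * (v - u) * dpath w I j u)) s t)//; last 2 first.
- by move=> u v hu _; rewrite /kappa_density (kappa_corr_density (dpath w))// /corr_density; ring.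
- by rewrite l1.
by rewrite (dsumZ _ (fun u v => cum_deriv T K rho j u I * (v - u) * dpath w I j u)) mulKf.
Qed.

(** Before the limit, the mean of each Riemann sum is bounded through the exponential moments of X_u;
    the bound passes to the limit by Fatou's lemma. *)
Lemma term_rv_L1 : exists c, forall I, ('E_P[fun w => `|term_rv I w|%R] <= (c * ratio rho r I)%:E)%E.
Proof.
have [M hM] := exp_moment_bound HX HK T0 rho0 rhoR.
have M0 : 0 <= M.
  by apply: le_trans (hM 0 _); [apply: Ex_ge0 => w; exact: expR_ge0|rewrite lexx ltW].
pose A := Ch * M; exists (A * (t - s) * cum_bound B rho) => I.
apply: (Ex_abs_limit (intg_term I)) => [||n].
- exact: meas_term_rv.
- by move: Hreg; apply: filterS => w hw; have [_ []] := term_limit I hw.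
have [p1 l1] := itvP (upart_itv n st).
pose F j u v w := `|cum_deriv T K rho j u I| * `|v - u| * `|dpath w I j u|.
have iF j u v : s <= u <= t -> s <= v <= t -> intg (F j u v).
  move=> /inT hu _; apply: intgZ; apply: intg_abs.
  exact: (intg_mpartial HX HK r0 rrp rpr rhoR (hf j) I hu).
have hF j : intg (fun w => dsum (fun u v => F j u v w) s (upart s t n)) /\
  Ex (fun w => dsum (fun u v => F j u v w) s (upart s t n)) = dsum (fun u v => Ex (F j u v)) s (upart s t n).
  by apply: (@Ex_dsum _ _ _ P (F j) s t) => //; rewrite ?l1//; exact: iF.
apply: (@le_trans _ _ (Ex (fun w => \sum_j dsum (fun u v => F j u v w) s (upart s t n)))).
  apply: Ex_le.
  - exact: intg_abs (intg_term I n).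
  - by apply: intg_sum => j; exact: (hF j).1.
  move=> w; rewrite term_sumE; apply: le_trans (ler_norm_sum _ _ _) _; apply: ler_sum => j _.
  apply: le_trans (dsum_norm _ _ _) _; rewrite le_eqVlt; apply/orP; left; apply/eqP.
  by congr dsum; do 2 apply/funext => ?; rewrite !normrM.
rewrite Ex_sum; last by move=> j; exact: (hF j).1.
rewrite (bound_sum _ r0 rrho); apply: ler_sum => j _; rewrite (hF j).2.
apply: le_trans (ler_norm _) _; rewrite -[X in _ * (X - s)]l1.
(* a mesh bound which every partition satisfies *)
apply: (@dsum_bound _ (last s (upart s t n) - s + 1) _ _ s t) => //; last 2 first.
- exact: path_finer_all.
- by rewrite l1.
move=> u v hu hv uv _; rewrite ger0_norm; last by apply: Ex_ge0 => w; rewrite !mulr_ge0.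
have im := intg_mpartial HX HK r0 rrp rpr rhoR (hf j) I (inT hu).
rewrite /F ExZ; last exact: intg_abs.
rewrite (gtr0_norm (x := v - u)) ?subr_gt0// mulrAC ler_wpM2r ?subr_ge0 ?(ltW uv)//.
rewrite mulrC; apply: ler_pM => //; first by apply: Ex_ge0.
  have rl i : 0 <= rho i <= rho i by rewrite lexx ltW.
  have ie := intg_exp_dotabs HX HK rho0 rhoR (inT hu) rl.
  apply: (@le_trans _ _ (Ex (fun w => Ch * mono r I * expR (dotabs rho (X u w))))).
    apply: Ex_le => [||w]; [exact: intg_abs|exact: intgZ|].
    apply: le_trans (mpartial_bound r0 (hf j) I (X u w)) _.
    rewrite ler_wpM2l ?mulr_ge0 ?mono_ge0//; first by move=> i; exact: ltW.
    by rewrite ler_expR; apply: ler_sum => i _; rewrite ler_wpM2r// ltW.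
  rewrite ExZ// /A mulrAC ler_wpM2r ?mono_ge0//; first by move=> i; exact: ltW.
  by rewrite ler_wpM2l//; exact: hM (inT hu).
exact: (cum_deriv_bound HK T0 rho0 rhoR j I (inT hu)).
Qed.

Lemma term_rv_summable : (\esum_(I in [set I | I != 0%R]) 'E_P[fun w => `|term_rv I w|%R] < +oo)%E.
Proof.
have [c hc] := term_rv_L1.
have := absbZ c (absb_ratio r0 rrho); set N := _ * _ => hN.
apply: (@le_lt_trans _ _ N%:E); last exact: ltry.
rewrite /esum; apply: ge_ereal_sup => _ [A [fA _] <-].
rewrite fsbig_finite//=.
apply: (@le_trans _ _ (\sum_(I <- fset_set A) `|c * ratio rho r I|)%:E); last by rewrite lee_fin; exact: hN.
rewrite -sumEFin; apply: lee_sum => I _; apply: le_trans (hc I) _.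
by rewrite lee_fin ler_norm.
Qed.

Lemma wick_integral_exists :
  [/\ forall pi, vanishing_partitions s t pi ->
        {ae P, forall w, wick_sum P f X s t (pi m) w @[m --> \oo] --> wick_rv w},
      {ae P, forall w,
       (forall j, rs_integrable (fun u => f (X u w) 0 j) (fun u => X u w 0 j) s t) /\
       young_rv w = \sum_j rs_integral (fun u => f (X u w) 0 j) (fun u => X u w 0 j) s t},
      forall I, {ae P, forall w, (forall j, rs_integrable (kappa_density I j w) id s t) /\
          term_rv I w = (mfact I)%:R^-1 * \sum_j rs_integral (kappa_density I j w) id s t} &
      {ae P, forall w,
       is_sum (V := R^o) (fun I => if I == 0 then 0 else term_rv I w) (young_rv w - wick_rv w)}].
Proof.
split.
- move=> pi hpi; move: Hreg; apply: filterS => w hw; have [_ _ _] := regular_limits hw; exact.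
- move: Hreg; apply: filterS => w hw; have [_ E _ _] := regular_limits hw; split => // j.
  have [M [_ hM]] := regular_bound hw; have [cx fx] := hw.
  exact: (young_path p02 fx cx s0 st tT r0 hf Ch0 hM).
- by move=> I; move: Hreg; apply: filterS => w hw; have [h1 [h2 _ _]] := term_limit I hw.
move: Hreg; apply: filterS => w hw; have [_ _ h _] := regular_limits hw.
apply/hsum_is_sum; apply: hsum_ext h => I; case: eqP => // _.
by have [_ [_ -> _]] := term_limit I hw.
Qed.

Section Dominated.

Definition sup_coord w i : R := sup [set `|X u w 0 i| | u in `[0, T]].

Variable G : Omega -> R.
Hypothesis iG : intg G.
Hypothesis HG : {ae P, forall w, regular w ->
  Ch * exp_box r (sup_coord w) * (1 + fine (pvar p 0 T (fun u => X u w))) ^+ 2 <= G w}.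

Lemma pvar_fine_ge0 w : 0 <= fine (pvar p 0 T (fun u => X u w)).
Proof. by apply: fine_ge0; exact: poweR_ge0. Qed.

Lemma sup_coord_ge w : regular w -> forall u, 0 <= u <= T -> forall i, `|X u w 0 i| <= sup_coord w i.
Proof.
move=> hw u hu i; have [M [_ hM]] := regular_bound hw.
apply: sup_upper_bound; last by exists u => //=; rewrite in_itv.
split; first by exists `|X u w 0 i|, u => //=; rewrite in_itv.
by exists M => _ [v hv <-]; apply: hM; rewrite /= in_itv in hv.
Qed.

Definition dom_const : R := d%:R * young_const p + (t - s) * cum_bound B rho * \prod_i (1 - r i / rho i)^-1.

Lemma young_dom : {ae P, forall w, forall pi, itv_partition s t pi ->
  `|riemann_young pi w| <= d%:R * young_const p * G w}.
Proof.
move: Hreg HG; apply: filterS2 => w hw /(_ hw) hG pi hpi; have [cx fx] := hw.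
have h := young_path_bound p02 fx s0 st tT r0 hf Ch0 (sup_coord_ge hw) hpi.
apply: le_trans h _; set E := Ch * _ in hG *; set V := _ ^+ 2 in hG *.
have -> : d%:R * (E * young_const p * V) = d%:R * young_const p * (E * V) by ring.
by rewrite ler_wpM2l// mulr_ge0// (le_trans ler01)// young_const_ge1.
Qed.

Lemma dpath_dom : {ae P, forall w, forall J j u, s <= u <= t -> `|dpath w J j u| <= mono r J * G w}.
Proof.
move: Hreg HG; apply: filterS2 => w hw /(_ hw) hG J j u hu.
rewrite /dpath; apply: le_trans (deriv_path_bound s0 tT r0 hf (sup_coord_ge hw) _ _ hu) _.
rewrite mulrC ler_wpM2l ?mono_ge0//; first by move=> i; exact: ltW.
apply: le_trans hG; rewrite ler_peMr ?mulr_ge0 ?expR_ge0// exprn_ege1// lerDl.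
exact: pvar_fine_ge0.
Qed.

(** The Wick sum is a Riemann sum minus a correction; both have bounds independent of the partition. *)
Lemma wick_dom : {ae P, forall w, forall pi, itv_partition s t pi ->
  `|wick_sum P f X s t pi w| <= dom_const * G w}.
Proof.
move: Hreg HG young_dom; apply: filterS3 => w hw /(_ hw) hG hY pi hpi; have [cx fx] := hw.
set E := Ch * exp_box r (sup_coord w) in hG.
have E0 : 0 <= E by rewrite mulr_ge0 ?expR_ge0.
have gb := deriv_path_bound s0 tT r0 hf (sup_coord_ge hw).
have h := correction_sum_bound HK T0 r0 rrho rhoR s0 st tT E0 gb hpi (wick_sum_series w hpi).
have -> : wick_sum P f X s t pi w = riemann_young pi w - (riemann_young pi w - wick_sum P f X s t pi w).
  by rewrite subKr.
apply: le_trans (ler_normB _ _) _; rewrite /dom_const mulrDl; apply: lerD; first exact: hY.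
apply: le_trans h _.
have EG : E <= G w.
  apply: le_trans hG; rewrite ler_peMr// exprn_ege1// lerDl; exact: pvar_fine_ge0.
have -> (x y z : R) : E * x * y * z = x * y * z * E by ring.
rewrite ler_wpM2l// !mulr_ge0 ?subr_ge0 ?(ltW st) ?(cum_bound_ge0 HK T0 r0 rrho rhoR)//.
apply: prodr_ge0 => i _; rewrite invr_ge0 subr_ge0 ler_pdivrMr// mul1r; exact: ltW.
Qed.

Lemma dominated_limit (F : nat -> Omega -> R) (L : Omega -> R) c : (forall n, measurable_fun setT (F n)) ->
  measurable_fun setT L -> {ae P, forall w, F n w @[n --> \oo] --> L w} ->
  {ae P, forall w, forall n, `|F n w| <= c * G w} ->
  [/\ intg L, Ex (fun w => `|F n w - L w|) @[n --> \oo] --> 0 & Ex (F n) @[n --> \oo] --> Ex L].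
Proof. by move=> mF mL hc hb; have [_ ? ? ?] := Ex_dct mF mL hc hb (intgZ c iG). Qed.

Lemma wick_L1 pi : vanishing_partitions s t pi ->
  [/\ intg wick_rv, Ex (fun w => `|wick_sum P f X s t (pi n) w - wick_rv w|) @[n --> \oo] --> 0 &
      Ex (wick_sum P f X s t (pi n)) @[n --> \oo] --> Ex wick_rv].
Proof.
move=> hpi; apply: (@dominated_limit (fun n => wick_sum P f X s t (pi n)) wick_rv dom_const).
- by move=> n; exact: intg_meas (Ex_wick_sum (hpi.1 n)).1.
- exact: meas_wick_rv.
- by have [h _ _ _] := wick_integral_exists; exact: h.
by move: wick_dom; apply: filterS => w hw n; apply: hw; exact: hpi.1.
Qed.

Lemma young_L1 pi : vanishing_partitions s t pi -> intg young_rv /\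
  Ex (riemann_young (pi n)) @[n --> \oo] --> Ex young_rv.
Proof.
move=> hpi; have [] // := @dominated_limit (fun n => riemann_young (pi n)) young_rv (d%:R * young_const p).
- by move=> n; apply: meas_riemann_young; exact: hpi.1.
- exact: meas_young_rv.
- by move: Hreg; apply: filterS => w hw; have [h _ _ _] := regular_limits hw; exact: h.
by move: young_dom; apply: filterS => w hw n; apply: hw; exact: hpi.1.
Qed.

Definition mean_dpath (J : multi d) j u : R := Ex (fun w => dpath w J j u).

Lemma mean_dpath_bound : exists A, 0 <= A /\
  forall J j u, s <= u <= t -> `|mean_dpath J j u| <= A * mono r J.
Proof.
have [M hM] := exp_moment_bound HX HK T0 rho0 rhoR.
have M0 : 0 <= M.
  by apply: le_trans (hM 0 _); [apply: Ex_ge0 => w; exact: expR_ge0|rewrite lexx ltW].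
exists (Ch * M); split; first exact: mulr_ge0.
move=> J j u /inT hu; have := mean_deriv_bound HX HK r0 rrp rpr rhoR (hf j) hu J.
move/le_trans; apply; rewrite mulrAC ler_wpM2r ?mono_ge0//; first by move=> i; exact: ltW.
by rewrite ler_wpM2l//; exact: hM.
Qed.

(** Continuity of the paths and domination by G. *)
Lemma mean_dpath_cont J j : {within `[s, t], continuous (mean_dpath J j)}.
Proof.
apply: seq_within => u v hu hv vu.
have [||||_ _] // := @dominated_limit (fun n w => dpath w J j (v n)) (fun w => dpath w J j u) (mono r J).
- by move=> n; exact: meas_dpath (inT (hv n)).
- exact: meas_dpath (inT hu).
- move: Hreg; apply: filterS => w hw; have [M [_ hM]] := regular_bound hw; have [cx _] := hw.
  have cD := deriv_path_cont cx s0 tT r0 hf Ch0 hM (J := J) (j := j).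
  by have := within_seq cD hu hv vu.
by move: dpath_dom; apply: filterS => w hw n; exact: hw.
Qed.

(** The Wick sums have mean zero since expectations factorize. The Riemann sums have as their means
    the correction sums with the means of the derivatives, whose limit is given by
    [correction_cvg]. *)
Lemma centered_means : (forall u, 0 <= u <= T -> forall i, Ex (fun w => X u w 0 i) = 0) ->
  Ex wick_rv = 0 /\
  hsum (fun J => if J == 0 then 0 else correction_limit T K rho s t mean_dpath J) (Ex young_rv).
Proof.
move=> hc; have pis := upart_vanishing st.
have iX u i : 0 <= u <= T -> intg (fun w => X u w 0 i).
  move=> hu; have rl k : 0 <= rho k <= rho k by rewrite lexx ltW.
  apply: (@intg_le _ _ _ _ _ (fun w => (rho i)^-1 * expR (dotabs rho (X u w)))); first exact: HX.
    move=> w; rewrite mulrC ler_pdivlMr// mulrC; have := expR_ge1Dx (dotabs rho (X u w)).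
    have : rho i * `|X u w 0 i| <= dotabs rho (X u w).
      by rewrite /dotabs (bigD1 i)//= lerDl sumr_ge0// => k _; rewrite mulr_ge0// ltW.
    by move=> h1 h2; apply: le_trans h1 (le_trans _ h2); rewrite lerDr.
  exact: intgZ (intg_exp_dotabs HX HK rho0 rhoR hu rl).
have Ei j u v : s <= u <= t -> s <= v <= t -> Ex (fun w => X v w 0 j - X u w 0 j) = 0.
  by move=> /inT hu /inT hv; rewrite ExB ?hc ?subrr//; exact: iX.
split.
  have [_ _ h] := wick_L1 pis.
  suff E n : Ex (wick_sum P f X s t (upart s t n)) = 0.
    apply: (cvg_unique _ h) => //.
    by rewrite (_ : (fun n => _) = fun=> 0); [exact: cvg_cst|apply/funext].
  rewrite (Ex_wick_sum (pis.1 n)).2 big1// => j _.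
  have [p1 l1] := itvP (pis.1 n).
  rewrite (@dsum_ext _ _ (fun _ _ => 0 * 0) s t) ?l1//.
    by rewrite mul0r dsum0.
  by move=> u v hu hv; rewrite Ei// !mul0r.
have [A [A0 hA]] := mean_dpath_bound.
have [V hV cV] := correction_cvg HK T0 r0 rrho rhoR s0 st tT A0 mean_dpath_cont hA.
have [_ hy] := young_L1 pis.
suff -> : Ex young_rv = V by [].
apply: (cvg_unique _ hy) => //; apply: (cV _ _ pis) => n.
have [p1 l1] := itvP (pis.1 n).
rewrite (Ex_riemann_young (pis.1 n)).2.
have H j : hsum (fun J => if J == 0 then 0 else dsum (fun u v => cum_incr K rho j u v J * mean_dpath J j u) s (upart s t n))
    (dsum (fun u v => Ex (fun w => (X v w 0 j - X u w 0 j) * f (X u w) 0 j)) s (upart s t n)).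
  have hpt u v : s <= u <= t -> s <= v <= t ->
    hsum (fun J => if J == 0 then 0 else cum_incr K rho j u v J * mean_dpath J j u)
      (Ex (fun w => (X v w 0 j - X u w 0 j) * f (X u w) 0 j)).
    move=> hu hv; have := Ex_incr_h HX HK r0 rrp rpr rhoR (hf j) j (inT hu) (inT hv).
    apply: hsum_ext => J; case: eqP => // ->.
    by rewrite -(Ex_incr HX HK r0 rrp rpr rhoR j (inT hu) (inT hv)) Ei// mul0r.
  have lt1 : last s (upart s t n) <= t by rewrite l1.
  have := dsum_hsum hpt (lexx s) p1 lt1; apply: hsum_ext => J.
  by case: eqP => // _; exact: dsum0.
apply: hsum_ext (hsum_sum (index_enum 'I_d) H) => J.
by case: eqP => _; [rewrite big1|].
Qed.

End Dominated.

End WickIntegral.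

(** * Choice of the radii and of a dominating variable *)

Section Radii.
Context {R : realType} {d : nat}.

Lemma between3 (lo : R) (hi : \bar R) : (lo%:E < hi)%E ->
  exists a : R * R * R, [/\ lo < a.1.1, a.1.1 < a.1.2, a.1.2 < a.2 & (a.2%:E < hi)%E].
Proof.
case: hi => [h| |] //; last by exists (lo + 1, lo + 2, lo + 3); split=> /=; rewrite ?ltry//; lra.
rewrite lte_fin => lh; pose e := (h - lo) / 4; have e0 : 0 < e by rewrite divr_gt0 ?subr_gt0.
have E : h = lo + 4 * e by rewrite /e; field.
by exists (lo + e, lo + 2 * e, lo + 3 * e); split => /=; rewrite ?lte_fin; lra.
Qed.

(** Three radii between r and hi are needed: the derivatives of f grow like a^J, the Appell
    coefficients decay like b^(-J), and the cumulants like c^(-J). The growth rates may be taken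
    positive. If one of the given rates is negative the function vanishes, whence the last claim. *)
Lemma radii_and_series (Cst : R) (r : 'I_d -> R) (f : 'rV[R]_d -> 'rV[R]_d) (hi : 'I_d -> \bar R) :
  (forall k, extends_exp_type Cst r (fun x => f x 0 k)) ->
  (forall i, ((Num.max (r i) 0)%:E < hi i)%E) ->
  exists a b c : 'I_d -> R, exists (bb : 'I_d -> multi d -> R) (Ch : R),
    [/\ [/\ forall i, 0 < a i, forall i, a i < b i, forall i, b i < c i & forall i, ((c i)%:E < hi i)%E],
        forall j, exp_series a (bb j) Ch (fun x => f x 0 j), 0 <= Ch & (exists i, r i < 0) -> Ch = 0].
Proof.
move=> hf hhi; have [A hA] := choice (fun i => between3 (hhi i)).
pose a i := (A i).1.1.
have a0 i : 0 < a i.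
  by have [h _ _ _] := hA i; apply: le_lt_trans h; rewrite le_max lexx orbT.
have ra i : r i < a i.
  by have [h _ _ _] := hA i; apply: le_lt_trans h; rewrite le_max lexx.
have E j : exists p : (multi d -> R) * R, [/\ 0 <= p.2, forall I, `|p.1 I| <= p.2 * mono a I,
        forall (J : multi d) (x : 'rV[R]_d), hsum (fun I : multi d => p.1 (I + J) * (mono (x 0) I / (mfact I)%:R))
          (mpartial J (fun x => f x 0 j) x) & (exists i, r i < 0) -> p.2 = 0].
  by have [b [C' h]] := exp_type_expansion (hf j) ra a0; exists (b, C').
have [p hp] := choice E.
exists a, (fun i => (A i).1.2), (fun i => (A i).2), (fun j => (p j).1), (\sum_j (p j).2).
have S0 : 0 <= \sum_j (p j).2 by apply: sumr_ge0 => j _; have [] := hp j.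
split => //.
- by split=> // i; have [] := hA i.
- move=> j; have [p0 hb hs _] := hp j; split => // I; apply: le_trans (hb I) _.
  rewrite ler_wpM2r//; first by apply: mono_ge0 => i; exact: ltW.
  by rewrite (bigD1 j)//= lerDl sumr_ge0// => k _; have [] := hp k.
by move=> neg; rewrite big1// => j _; have [_ _ _ h] := hp j; exact: h.
Qed.

(** A Young inequality with integer exponent: either V is at most exp(S / (N + 1)), or exp S is at
    most V^(N + 1). *)
Lemma exp_times_le (S Sg V : R) (N : nat) : 0 <= V -> S + S / N.+1%:R <= Sg ->
  expR S * V <= expR Sg + V ^+ N.+2.
Proof.
move=> V0 hS; have [h|h] := leP V (expR (S / N.+1%:R)).
  apply: (@le_trans _ _ (expR Sg)); last by rewrite lerDl exprn_ge0.
  apply: le_trans (ler_wpM2l (expR_ge0 _) h) _.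
  by rewrite -expRD ler_expR.
apply: (@le_trans _ _ (V ^+ N.+2)); last by rewrite lerDr expR_ge0.
rewrite [leRHS]exprSr ler_wpM2r//.
have -> : S = N.+1%:R * (S / N.+1%:R) by rewrite mulrC divfK// pnatr_eq0.
by rewrite expRM_natl lerXn2r// ?nnegrE ?expR_ge0// ltW.
Qed.

Lemma pow_1D_le (x : R) k : 0 <= x -> (1 + x) ^+ k <= 2 ^+ k * (1 + x ^+ k).
Proof.
move=> x0; have xk : 0 <= x ^+ k by rewrite exprn_ge0.
have [h|h] := leP x 1.
  apply: (@le_trans _ _ (2 ^+ k * 1)); last by rewrite ler_wpM2l ?exprn_ge0// lerDl.
  by rewrite mulr1 lerXn2r// ?nnegrE ?addr_ge0//; lra.
apply: (@le_trans _ _ (2 ^+ k * x ^+ k)); last by rewrite ler_wpM2l ?exprn_ge0// lerDr.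
by rewrite -exprMn lerXn2r// ?nnegrE ?addr_ge0 ?mulr_ge0//; lra.
Qed.

(** The integer N is larger than the finitely many ratios a_i / (sg_i - a_i). *)
Lemma exponent_gap (a sg : 'I_d -> R) : (forall i, 0 < a i) -> (forall i, a i < sg i) ->
  exists N : nat, forall i, a i + a i / N.+1%:R <= sg i.
Proof.
move=> a0 asg; pose x := \sum_i a i / (sg i - a i).
have g0 i : 0 < sg i - a i by rewrite subr_gt0.
have x0 i : a i / (sg i - a i) <= x.
  by rewrite /x (bigD1 i)//= lerDl sumr_ge0// => k _; rewrite divr_ge0 ?ltW.
exists (Num.bound x) => i; rewrite -lerBrDl ler_pdivrMr// mulrC -ler_pdivrMr//.
have xx : 0 <= x by apply: sumr_ge0 => k _; rewrite divr_ge0 ?ltW.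
apply: le_trans (x0 i) _; apply: le_trans (ltW (archi_boundP xx)) _.
by rewrite ler_nat.
Qed.
End Radii.

Section Main.
Context {R : realType} {disp : measure_display} {Omega : measurableType disp}.
Context (P : probability Omega R).

Lemma as_rv (F : Omega -> R) : measurable_fun setT F -> exists Z : {RV P >-> R}, (Z : Omega -> R) = F.
Proof.
move=> mF; pose Z : {RV P >-> R} := HB.pack F (isMeasurableFun.Build _ _ _ _ F mF).
by exists Z.
Qed.

Context {d : nat} (T p : R) (X : R -> Omega -> 'rV[R]_d).

(** [exp_times_le] separates the supremum from the variation: the first factor becomes an exponential
    of type sg, the second a power, and both have finite means. *)
Lemma dominating_rv (a sg : 'I_d -> R) (Ch : R) : 0 < T -> 0 < p -> 0 <= Ch ->
  (forall i, 0 < a i) -> (forall i, a i < sg i) ->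
  in_L1 P (exp_sup_norm T X sg) ->
  (forall q : nat, in_L1 P (fun w => fine (pvar p 0 T (fun u => X u w)) ^+ q)) ->
  exists2 G, intg P G & {ae P, forall w, regular T p X w ->
    Ch * exp_box a (sup_coord T X w) * (1 + fine (pvar p 0 T (fun u => X u w))) ^+ 2 <= G w}.
Proof.
move=> T0 p0 Ch0 a0 asg [Zs iZs hZs] hpv; have [N hN] := exponent_gap a0 asg.
(* the exponent N + 2 of the inequality, applied to (1 + V)^2 *)
pose k := (2 * N.+2)%N; have [Zk iZk hZk] := hpv k.
pose c := Ch * expR (\sum_i a i).
exists (fun w => c * (Zs w + 2 ^+ k * (1 + Zk w))).
  by apply: intgZ; apply: intgD => //; apply: intgZ; apply: intgD => //; exact: intg_cst.
move: hZs hZk; apply: filterS2 => w <- <- hw.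
set V := fine _; have V0 : 0 <= V by exact: pvar_fine_ge0.
pose S := \sum_i a i * sup_coord T X w i.
have -> : exp_box a (sup_coord T X w) = expR S * expR (\sum_i a i).
  by rewrite -expRD /exp_box /S -big_split; congr expR; apply: eq_bigr => i _ /=; ring.
have -> : Ch * (expR S * expR (\sum_i a i)) * (1 + V) ^+ 2 = c * (expR S * (1 + V) ^+ 2) by rewrite /c; ring.
have c0 : 0 <= c by rewrite mulr_ge0 ?expR_ge0.
rewrite ler_wpM2l//.
have s0 i : 0 <= sup_coord T X w i.
  have h0 : 0 <= (0 : R) <= T by rewrite lexx ltW.
  exact: le_trans (normr_ge0 _) (sup_coord_ge (lexx 0) T0 (lexx T) hw h0 i).
apply: le_trans (exp_times_le (Sg := \sum_i sg i * sup_coord T X w i) (N := N) _ _) _.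
- by rewrite exprn_ge0// addr_ge0.
- rewrite /S mulr_suml -big_split; apply: ler_sum => i _ /=.
  by rewrite mulrAC -mulrDl ler_wpM2r.
by rewrite lerD2l -exprM; exact: pow_1D_le.
Qed.

End Main.

(** * The Wick integral of a function of exponential type *)

Theorem theorem3p5 (R : realType) (disp : measure_display)
    (Omega : measurableType disp) (P : probability Omega R)
    (d : nat) (T p : R) (X : R -> Omega -> 'rV[R]_d) (Rad : 'I_d -> \bar R)
    (f : 'rV[R]_d -> 'rV[R]_d) (C : R) (r : 'I_d -> R)
    (hX : process T X)
    (hp : 0 < p < 2)
    (hRad : forall i, (0 < Rad i)%E)
    (hi : regular_paths P T p X)
    (hii : cumulant_condition P T Rad X)
    (hiii : density_condition P T X)
    (hC : 0 < C)
    (hr : forall i, ((r i)%:E < Rad i)%E)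
    (hf : forall k, extends_exp_type C r (fun x => f x 0 k))
    (s t : R) (hs : 0 <= s) (hst : s < t) (ht : t <= T) :
  exists (W Y : {RV P >-> R}) (S : multi d -> {RV P >-> R}),
    (* existence of the Wick integral W *)
    (forall pi, vanishing_partitions s t pi ->
       {ae P, forall w, wick_sum P f X s t (pi m) w @[m --> \oo] --> W w}) /\
    (* Y is the Young integral *)
    {ae P, forall w,
       (forall j, rs_integrable (fun u => f (X u w) 0 j) (fun u => X u w 0 j) s t) /\
       Y w = \sum_j rs_integral (fun u => f (X u w) 0 j) (fun u => X u w 0 j) s t} /\
    (* S I is the term of index I of the series *)
    (forall I, I != 0 ->
       {ae P, forall w,
          (forall j, rs_integrable
             (fun u => mpartial I (fun x => f x 0 j) (X u w) * kappa P T X I j u)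
             id s t) /\
          S I w = (mfact I)%:R^-1 * \sum_j rs_integral
             (fun u => mpartial I (fun x => f x 0 j) (X u w) * kappa P T X I j u)
             id s t}) /\
    (\esum_(I in [set I | I != 0%R]) 'E_P[fun w => `|S I w|%R] < +oo)%E /\
    {ae P, forall w,
       is_sum (V := R^o) (fun I => if I == 0 then 0 else S I w) (Y w - W w)} /\
    ((exists2 sigma : 'I_d -> R, (forall i, r i < sigma i) &
        in_L1 P (exp_sup_norm T X sigma)) ->
     (forall q : nat,
        in_L1 P (fun w => fine (pvar p 0 T (fun u => X u w)) ^+ q)) ->
     [/\ P.-integrable setT (EFin \o W),
         forall pi, vanishing_partitions s t pi ->
           (forall m, P.-integrable setT (EFin \o wick_sum P f X s t (pi m))) /\
           ('E_P[fun w => `|wick_sum P f X s t (pi m) w - W w|%R]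
              @[m --> \oo] --> 0)%E &
         (forall u, 0 <= u <= T -> forall i, ('E_P[fun w => X u w 0%R i] = 0)%E) ->
         [/\ ('E_P[W] = 0)%E,
             P.-integrable setT (EFin \o Y),
             forall I, I != 0 -> forall j,
               rs_integrable
                 (fun u => fine 'E_P[fun w => mpartial I (fun x => f x 0%R j) (X u w)]%E
                           * kappa P T X I j u)
                 id s t &
             is_sum (V := R^o)
               (fun I => if I == 0 then 0 else
                  (mfact I)%:R^-1 * \sum_j rs_integral
                    (fun u => fine 'E_P[fun w => mpartial I (fun x => f x 0%R j) (X u w)]%E
                              * kappa P T X I j u)
                    id s t)
               (fine 'E_P[Y]%E)]]).
Proof.
have s_T := lt_le_trans hst ht; have T0 : 0 < T := le_lt_trans hs s_T.
have [K [dK [hK1 [hK2 [B hB]]]]] := hii.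
have HK : log_mgf P T X Rad K dK B by split.
have hRad' i : ((Num.max (r i) 0)%:E < Rad i)%E.
  by rewrite /Num.max; case: ifP => _; [exact: hRad|exact: hr].
have [a [b [c [bb [Ch [[a0 ab bc cR] hser Ch0 _]]]]]] := radii_and_series hf hRad'.
have [W EW] := as_rv P (meas_wick_rv hX HK hs hst ht a0 ab bc cR hser).
have [Y EY] := as_rv P (meas_young_rv hX hs hst ht hser).
have [S ES] := choice (fun I => as_rv P (meas_term_rv hX HK hs hst ht a0 ab bc cR hser I)).
exists W, Y, S; rewrite EW EY.
have [w1 w2 w3 w4] := wick_integral_exists hX HK hp hi hs hst ht a0 ab bc cR hser Ch0.
split; first exact: w1.
split; first exact: w2.
split; first by move=> I _; rewrite ES; exact: w3.
split.
  have := term_rv_summable hX HK hi hs hst ht a0 ab bc cR hser Ch0.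
  by congr (_ < _)%E; apply: eq_esum => I _; rewrite ES.
split.
  move: w4; apply: filterS => w; set u := (X in is_sum X _); set v := (X in _ -> is_sum X _).
  by have -> : u = v by apply/funext => I; rewrite /u /v ES.
move=> [sg rsg hsg] hpv.
(* the limits W, Y and S do not depend on the radii, which may therefore be chosen again, this time
   also below the exponent of the additional moment condition *)
clear a b c bb Ch a0 ab bc cR hser Ch0 w1 w2 w3 w4.
have [a [b [c [bb [Ch [[a0 ab bc cR] hser Ch0 [G iG HG]]]]]]] :
    exists a b c : 'I_d -> R, exists (bb : 'I_d -> multi d -> R) (Ch : R),
    [/\ [/\ forall i, 0 < a i, forall i, a i < b i, forall i, b i < c i & forall i, ((c i)%:E < Rad i)%E],
        forall j, exp_series a (bb j) Ch (fun x => f x 0 j), 0 <= Ch &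
        exists2 G, intg P G & {ae P, forall w, regular T p X w -> Ch * exp_box a (sup_coord T X w) *
          (1 + fine (pvar p 0 T (fun u => X u w))) ^+ 2 <= G w}].
  (* a negative rate makes f vanish, and nothing has to be dominated *)
  have [neg|nneg] := pselect (exists i, r i < 0).
    have [a [b [c [bb [Ch [h hser Ch0 /(_ neg) C0]]]]]] := radii_and_series hf hRad'.
    exists a, b, c, bb, Ch; split => //; exists (fun=> 0); first exact: intg_cst.
    by apply: aeW => w _; rewrite C0 !mul0r.
  have r0 i : 0 <= r i by rewrite leNgt; apply/negP => ri; apply: nneg; exists i.
  have hmin i : ((Num.max (r i) 0)%:E < Order.min (Rad i) (sg i)%:E)%E.
    by rewrite lt_min hRad' max_l// lte_fin rsg.
  have [a [b [c [bb [Ch [[a0 ab bc cR] hser Ch0 _]]]]]] := radii_and_series hf hmin.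
  exists a, b, c, bb, Ch; split => //.
    by split => // i; have := cR i; rewrite lt_min => /andP[].
  have asg i : a i < sg i.
    have := cR i; rewrite lt_min => /andP[_]; rewrite lte_fin; apply: lt_trans.
    exact: lt_trans (bc i).
  by have /andP[p0 _] := hp; exact: dominating_rv T0 p0 Ch0 a0 asg hsg hpv.
have wL := wick_L1 hX HK hp hi hs hst ht a0 ab bc cR hser Ch0 iG HG.
have pis := upart_vanishing hst.
have [iW _ _] := wL _ pis.
have iS pi (hpi : itv_partition s t pi) := (Ex_wick_sum hX HK hs ht a0 ab bc cR hser hpi).1.
split => //.
  move=> pi hpi; split; first by move=> m; apply: iS; exact: hpi.1.
  have [_ h _] := wL _ hpi.
  have -> : (fun m => 'E_P[fun w => `|wick_sum P f X s t (pi m) w - wick_rv P X f s t w|%R])%E =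
      fun m => (Ex P (fun w => `|wick_sum P f X s t (pi m) w - wick_rv P X f s t w|))%:E.
    by apply/funext => m; rewrite ExE//; apply: intg_abs; apply: intgB => //; apply: iS; exact: hpi.1.
  by apply: cvg_EFin => //; exact: nearW.
move=> hcen.
have hc u : 0 <= u <= T -> forall i, Ex P (fun w => X u w 0 i) = 0.
  by move=> hu i; rewrite /Ex (hcen u hu i).
have [E0 hY] := centered_means hX HK hp hi hs hst ht a0 ab bc cR hser Ch0 iG HG hc.
have [iY _] := young_L1 hX HK hp hi hs hst ht a0 ab bc cR hser Ch0 iG HG pis.
have mc := mean_dpath_cont hX hi hs hst ht a0 hser Ch0 iG HG.
have kI I := kappa_integral HK hs hst ht a0 ab bc cR I mc.
split => //.
- by rewrite ExE// E0.
- by move=> I _ j; have [v [h _ _]] := kI I; exists (v j); exact: h.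
apply/hsum_is_sum; apply: hsum_ext hY => I; case: eqP => // _.
have [v [_ h2 <-]] := kI I; congr (_ * _); apply: eq_bigr => j _; exact/esym/h2.
Qed.
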